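(* Consider a slow-fast system $$x' = y-F(x,z,\epsilon,\delta),\qquad y'=\epsilon g_1(x,y,z,\epsilon,\delta),\qquad z'=\epsilon g_2(x,y,z,\epsilon,\delta)$$ that satisfies Assumptions 1 through 5 stated in the context, and let $\tilde\Pi_0$ be the rescaled singular return map defined in the context. For each $Z\neq0$, $\tilde\Pi_0(Z)$ is well-defined for $\delta>0$ sufficiently small; moreover, the limit $\tilde\Pi_{00}(Z)=\lim_{\delta\to0}\tilde\Pi_0(Z)$ exists and is equal to the piecewise affine map $$M(Z_{\rm init})=\begin{cases}Z\big(x_4,\hat x_1,Z(x_1,\hat x_4,Z_{\rm init})\big)&\text{if }Z_{\rm init}<0,\\ Z\big(x_4,\hat x_3,Z(x_3,x_2,Z_{\rm init})\big)&\text{if }Z_{\rm init}>0,\end{cases}$$ i.e., $\tilde\Pi_{00}(Z_{\rm init})=M(Z_{\rm init})$ for all $Z_{\rm init}\ne0$, where $$Z(x,x_{\rm init},Z_{\rm init})=\Big(e^{\int_{x_{\rm init}}^{x}p(s)\,ds}\Big)Z_{\rm init}+\int_{x_{\rm init}}^{x}q(u)\,e^{\int_u^x p(s)\,ds}\,du$$ and $p,q,x_1,x_2,x_3,x_4,\hat x_1,\hat x_3,\hat x_4$ are as defined in the context.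
   Context: **Setting.** $F,g_1,g_2$ are $C^\infty$-smooth in their arguments; $x\in\mathbb{R}$ is the fast variable and $(y,z)\in\mathbb{R}^2$ are the slow variables; $\epsilon\ge 0$ is a small singular perturbation parameter and $\delta$ is an additional small parameter. Put $f(x,y,z,\epsilon,\delta):=y-F(x,z,\epsilon,\delta)$. The layer problem is $x'=y-F(x,z,0,\delta)$, $y'=0$, $z'=0$; the reduced problem is $0=y-F(x,z,0,\delta)$, $\dot y=g_1(x,y,z,0,\delta)$, $\dot z=g_2(x,y,z,0,\delta)$ (with slow time $\tau=\epsilon t$). The critical manifold is $\mathcal S=\{f(x,y,z,0,\delta)=0\}$. **Assumption 1.** Possibly restricting to $z\in(z_{\min},z_{\max})$, one has $\mathcal S=\mathcal S_{a_1}\cup L_1\cup\mathcal S_{r_1}\cup L_2\cup\mathcal S_{a_2}\cup L_3\cup\mathcal S_{r_2}\cup L_4\cup\mathcal S_{a_3}$, where $\mathcal S_{a_1}\cup\mathcal S_{a_2}\cup\mathcal S_{a_3}=\mathcal S\cap\{\partial f/\partial x<0\}$ (normally attracting) and $\mathcal S_{r_1}\cup\mathcal S_{r_2}=\mathcal S\cap\{\partial f/\partial x>0\}$ (normally repelling) at $\epsilon=0$. The fold curves $L_i$ ($i=1,2,3,4$) are graphs over $z$: $L_i=\{(x,y,z)\in\mathcal S: x=\nu_i(z,\delta)\}$ with $\nu_1<\nu_2<\nu_3<\nu_4$, along which $\partial f/\partial x=0$ and $\partial^2 f/\partial x^2\ne 0$ at $\epsilon=0$. On $\mathcal S$: $\mathcal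 S_{a_1}=\{x<\nu_1\}$, $\mathcal S_{r_1}=\{\nu_1<x<\nu_2\}$, $\mathcal S_{a_2}=\{\nu_2<x<\nu_3\}$, $\mathcal S_{r_2}=\{\nu_3<x<\nu_4\}$, $\mathcal S_{a_3}=\{x>\nu_4\}$. **Assumption 2 (normal switching condition).** $f_yg_1+f_zg_2\neq0$ at every $p\in L_i$, $i=1,2,3,4$ (every fold point is a jump point), and the reduced flow on both sides of $L_i$ ($i=1,3,4$) is transverse to, and directed towards, $L_i$. **Assumption 3 (transversality).** Let $\omega(L_2)$ be the projection (along the layer flow) of $L_2$ onto $\mathcal S_{a_1}$, $\omega(L_1)$ and $\omega(L_3)$ the projections of $L_1$ and $L_3$ onto $\mathcal S_{a_3}$, and $\omega(L_4)$ the projection of $L_4$ onto both $\mathcal S_{a_1}$ and $\mathcal S_{a_2}$. For $\delta=0$, the reduced flow is transverse to $\omega(L_1)$ and $\omega(L_3)$ on $\mathcal S_{a_3}$, to $\omega(L_2)$ on $\mathcal S_{a_1}$, and to $\omega(L_4)$ on both $\mathcal S_{a_1}$ and $\mathcal S_{a_2}$. **Section $\Delta$.** $\Delta$ is a section between $L_2$ and $L_4$, transverse to the layer flow and with coordinates $(y,z)$; it is crossed by the fast orbits leaving $L_4$. $P(L_2),P(L_4)$ denote the projections (along the layer flow) of $L_2,L_4$ onto $\Delta$; they are smooth $\delta$-families of graphs $y=\phi_{L_2}(z,\delta)$ and $y=\phi_{L_4}(z,\delta)$. **Assumption 4 (breaking mechanism).** For $\epsilon=0$ and $\delta>0$ sufficiently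 small, the $z$-parametrized curves $P(L_2)$ and $P(L_4)$ intersect transversely at a $z$-value $z_0(\delta)$, with $z_0(0)=z_0$ and $z_0'(0)=0$; the ($\delta$-dependent) intersection point is $P_c$. For $z<z_0(\delta)$, the forward evolution of $P(L_4)$ remains below $\mathcal S_{r_1}$ and $\mathcal S_{a_2}$ and lands directly on $\mathcal S_{a_1}$; for $z>z_0(\delta)$, it lands on $\mathcal S_{a_2}$, away from $L_2$. **Assumption 5 (ambiguous singular orbit).** (For $\delta=0$) there is a singular closed orbit $\Gamma_0^L$ obtained by concatenating the reduced flow on $\mathcal S_{a_1}$ and $\mathcal S_{a_3}$ with the layer flow from $L_1$ to $\mathcal S_{a_3}$ and from $L_4$ to $\mathcal S_{a_1}$; and a singular closed orbit $\Gamma_0^S$ obtained by concatenating the reduced flow on $\mathcal S_{a_2}$ and $\mathcal S_{a_3}$ with the layer flow from $L_3$ to $\mathcal S_{a_3}$ and from $L_4$ to $\mathcal S_{a_2}$. Both contain $P_c$. **Standing convention.** $\Gamma_0^L$ and $\Gamma_0^S$ lie in the plane $z=z_0$, and $g_2(x,y,z,\epsilon,\delta)=\delta\,G(x,y,z,\epsilon,\delta)+(z-z_0)H(x,y,z,\epsilon,\delta)$. **The maps.** Let $B_r(P(L_2))=\{(y,z)\in\Delta:|y-\phi_{L_2}(z,\delta)|<r\}$. For $\delta,r>0$ small and $\epsilon>0$ small enough (depending on $\delta,r$), let $\Pi:(y,z)\mapsto(\mathcal Y(y,z,\epsilon,\delta),\mathcal Z(y,z,\epsilon,\delta))$ be the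 first return map of the flow from $\mathcal U\setminus B_r(P(L_2))\subset\Delta$ to $\Delta$, where $\mathcal U$ is a suitable open neighbourhood of $P_c$ in $\Delta$. Let $\mathcal Z(y,z,0,\delta)$ denote the singular limit of $\mathcal Z$ as $\epsilon\to0$; since $r>0$ is arbitrary, it is considered at all points of $\mathcal U$ off $P(L_2)$. Put $\mathcal Z_1(z,\delta):=\mathcal Z(\phi_{L_4}(z,\delta),z,0,\delta)$ for $z\neq z_0(\delta)$, with the convention $\mathcal Z_1(z_0,0)=z_0$, and $$\tilde\Pi_0(Z):=\frac{\mathcal Z_1(z_0+\delta Z,\delta)-z_0}{\delta}\qquad\text{for } z_0+\delta Z\neq z_0(\delta).$$ **Data in the formula for $M$.** Write $F(x,z_0):=F(x,z_0,0,0)$ and $$p(x)=\frac{H(x,F(x,z_0),z_0,0,0)}{g_1(x,F(x,z_0),z_0,0,0)}F_x(x,z_0),\qquad q(x)=\frac{G(x,F(x,z_0),z_0,0,0)}{g_1(x,F(x,z_0),z_0,0,0)}F_x(x,z_0).$$ Let $x_1<x_2<x_3<x_4$ be the four local extrema of $x\mapsto F(x,z_0)$ (the $x$-coordinates of $L_1,\dots,L_4$ at $z=z_0$, $\delta=0$). Then $F(x_2,z_0)=F(x_4,z_0)$; $\hat x_4<x_1$ is the point with $F(\hat x_4,z_0)=F(x_4,z_0)$; $\hat x_3,\hat x_1>x_4$ are the points with $F(\hat x_3,z_0)=F(x_3,z_0)$ and $F(\hat x_1,z_0)=F(x_1,z_0)$. *)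

(* Defs.v *)
From Stdlib Require Import Reals List Relations.
From Coquelicot Require Import Coquelicot.
Open Scope R_scope.

(** C^k and C^infinity on an open set [O] of a finite product of copies of R:
    all iterated directional derivatives exist and are continuous. *)
Fixpoint Ck_on {E : NormedModule R_AbsRing} (O : E -> Prop) (k : nat)
    (h : E -> R) : Prop :=
  (forall p, O p -> continuous h p) /\
  match k with
  | 0%nat => True
  | S k' => forall v : E,
      (forall p, O p -> ex_derive (fun t : R => h (plus p (scal t v))) 0) /\
      Ck_on O k' (fun p => Derive (fun t : R => h (plus p (scal t v))) 0)
  end.

Definition smooth_on {E : NormedModule R_AbsRing} (O : E -> Prop)
    (h : E -> R) : Prop := forall k, Ck_on O k h.

Inductive fold := L1 | L2 | L3 | L4.
Inductive branch := Sa1 | Sr1 | Sa2 | Sr2 | Sa3.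

(** Functions of the phase point and the parameters take their arguments in the
    order x, y, z, epsilon, delta; [F] does not depend on y. *)
Record setting := Setting {
  F : R -> R -> R -> R -> R;
  g1 : R -> R -> R -> R -> R -> R;
  g2 : R -> R -> R -> R -> R -> R;
  Gz : R -> R -> R -> R -> R -> R;
  Hz : R -> R -> R -> R -> R -> R;
  eps0 : R;
  delta0 : R;
  zmin : R;
  zmax : R;
  nu : fold -> R -> R -> R;    (* L_i is x = nu_i (z, delta) on S *)
  (* Delta is the graph x = xi (y, z) over [ylo, yhi] x [zlo, zhi] *)
  ylo : R;
  yhi : R;
  zlo : R;
  zhi : R;
  xi : R -> R -> R;
  phi2 : R -> R -> R;          (* P(L2) is y = phi2 (z, delta) *)
  phi4 : R -> R -> R;          (* P(L4) is y = phi4 (z, delta) *)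
  z0 : R;
  zc : R -> R                  (* z0(delta) *)
}.

Section Setting.

Variable s : setting.

Definition f (x y z e d : R) : R := y - F s x z e d.
Definition f_x (x y z e d : R) : R := Derive (fun x' => f x' y z e d) x.
Definition f_xx (x y z e d : R) : R := Derive_n (fun x' => f x' y z e d) 2 x.
Definition f_y (x y z e d : R) : R := Derive (fun y' => f x y' z e d) y.
Definition f_z (x y z e d : R) : R := Derive (fun z' => f x y z' e d) z.

Definition small_delta (d : R) : Prop := 0 <= d < delta0 s.

(** Smoothness up to epsilon = 0 and delta = 0 means smoothness on an open
    neighbourhood of these values. *)
Definition smooth5 (h : R -> R -> R -> R -> R -> R) : Prop :=
  smooth_on
    (fun p : R * R * R * R * R => let '(x, y, z, e, d) := p in
       - eps0 s < e < eps0 s /\ - delta0 s < d < delta0 s)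
    (fun p : R * R * R * R * R => let '(x, y, z, e, d) := p in h x y z e d).

Definition smooth_system : Prop :=
  0 < eps0 s /\ 0 < delta0 s /\
  smooth5 (fun x _ z e d => F s x z e d) /\ smooth5 (g1 s) /\ smooth5 (g2 s).

(** ** The critical manifold, at epsilon = 0 *)

Definition on_S (x y z d : R) : Prop := f x y z 0 d = 0.

Definition on_branch (b : branch) (x z d : R) : Prop :=
  match b with
  | Sa1 => x < nu s L1 z d
  | Sr1 => nu s L1 z d < x < nu s L2 z d
  | Sa2 => nu s L2 z d < x < nu s L3 z d
  | Sr2 => nu s L3 z d < x < nu s L4 z d
  | Sa3 => nu s L4 z d < x
  end.

Definition fold_y (i : fold) (z d : R) : R := F s (nu s i z d) z 0 d.

Definition assumption1 : Prop :=
  zmin s < zmax s /\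
  forall z d, zmin s < z < zmax s -> small_delta d ->
    nu s L1 z d < nu s L2 z d < nu s L3 z d /\ nu s L3 z d < nu s L4 z d /\
    (forall x y, on_S x y z d ->
       (f_x x y z 0 d < 0 <->
          on_branch Sa1 x z d \/ on_branch Sa2 x z d \/ on_branch Sa3 x z d) /\
       (f_x x y z 0 d > 0 <-> on_branch Sr1 x z d \/ on_branch Sr2 x z d)) /\
    (forall i, f_x (nu s i z d) (fold_y i z d) z 0 d = 0 /\
               f_xx (nu s i z d) (fold_y i z d) z 0 d <> 0).

(** ** Reduced flow *)

(** x-component of the reduced vector field off the folds, obtained by
    differentiating f = 0 along the reduced flow. *)
Definition reduced_vx (x y z d : R) : R :=
  - (f_y x y z 0 d * g1 s x y z 0 d + f_z x y z 0 d * g2 s x y z 0 d)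
  / f_x x y z 0 d.

(** Rate of change of x - nu_i (z, delta) along the reduced flow at the point
    of S with coordinates (x, z). *)
Definition fold_rate (i : fold) (x z d : R) : R :=
  let y := F s x z 0 d in
  reduced_vx x y z d - Derive (fun z' => nu s i z' d) z * g2 s x y z 0 d.

Definition assumption2 : Prop :=
  forall z d, zmin s < z < zmax s -> small_delta d ->
    (forall i, let x := nu s i z d in let y := fold_y i z d in
       f_y x y z 0 d * g1 s x y z 0 d + f_z x y z 0 d * g2 s x y z 0 d <> 0) /\
    (forall i, In i (L1 :: L3 :: L4 :: nil) ->
       at_left (nu s i z d) (fun x => fold_rate i x z d > 0) /\
       at_right (nu s i z d) (fun x => fold_rate i x z d < 0)).

(** Orbit segment of the reduced problem in the open branch [b]; the endpoints,
    at which the reduced problem may be singular, are only attained as limits. *)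
Definition reduced_segment (b : branch) (d : R) (X Y Z : R -> R) (T : R) : Prop :=
  0 < T /\
  (forall t, 0 <= t <= T -> continuous X t /\ continuous Y t /\ continuous Z t) /\
  (forall t, 0 <= t <= T -> on_S (X t) (Y t) (Z t) d) /\
  (forall t, 0 < t < T ->
     on_branch b (X t) (Z t) d /\
     is_derive Y t (g1 s (X t) (Y t) (Z t) 0 d) /\
     is_derive Z t (g2 s (X t) (Y t) (Z t) 0 d)).

(** ** Layer flow *)

Definition layer_orbit (I : R -> Prop) (d y z : R) (u : R -> R) : Prop :=
  forall t, I t -> is_derive u t (f (u t) y z 0 d).

Definition layer_connection (d y z a b : R) : Prop :=
  exists u, layer_orbit (fun _ => True) d y z u /\
    is_lim u m_infty a /\ is_lim u p_infty b.

(** Concatenations of layer orbits on one fibre are allowed, since the fibre of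
    L4 may pass through L2 before reaching S_a1. *)
Definition layer_path (d y z : R) : R -> R -> Prop :=
  clos_trans R (layer_connection d y z).

(** (x, fold_y i z d, z) lies on the projection of L_i onto the branch [b]. *)
Definition omega (i : fold) (b : branch) (d x z : R) : Prop :=
  on_branch b x z d /\ layer_path d (fold_y i z d) z (nu s i z d) x.

(** The branches S_a are graphs over (y, z), so transversality to the curve
    y = fold_y i z 0 on S_a is tested on the (y, z)-components. *)
Definition reduced_transverse (i : fold) (x z : R) : Prop :=
  let y := fold_y i z 0 in
  g1 s x y z 0 0 <> Derive (fun z' => fold_y i z' 0) z * g2 s x y z 0 0.

Definition assumption3 : Prop :=
  forall z, zmin s < z < zmax s ->
    (forall i b, In (i, b) ((L1, Sa3) :: (L3, Sa3) :: (L2, Sa1) :: nil) ->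
       exists x, on_branch b x z 0 /\
         layer_connection 0 (fold_y i z 0) z (nu s i z 0) x) /\
    (forall i b x,
       In (i, b) ((L1, Sa3) :: (L3, Sa3) :: (L2, Sa1) :: (L4, Sa1) :: (L4, Sa2)
                  :: nil) ->
       omega i b 0 x z -> reduced_transverse i x z).

(** ** The section Delta and the curves P(L2), P(L4) *)

Definition in_section (y z : R) : Prop :=
  ylo s <= y <= yhi s /\ zlo s <= z <= zhi s.

Definition PL2 (d y z : R) : Prop :=
  in_section y z /\
  exists u, layer_orbit (fun t => 0 <= t) d y z u /\
    u 0 = xi s y z /\ is_lim u p_infty (nu s L2 z d).

Definition PL4 (d y z : R) : Prop :=
  in_section y z /\
  exists u, layer_orbit (fun t => t <= 0) d y z u /\
    is_lim u m_infty (nu s L4 z d) /\ u 0 = xi s y z.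

Definition smooth_curve (phi : R -> R -> R) : Prop :=
  smooth_on
    (fun p : R * R => let '(z, d) := p in
       zlo s < z < zhi s /\ - delta0 s < d < delta0 s)
    (fun p : R * R => let '(z, d) := p in phi z d).

Definition section_setup : Prop :=
  zmin s < zlo s < z0 s /\ z0 s < zhi s < zmax s /\
  ylo s < phi4 s (z0 s) 0 < yhi s /\
  smooth_on (fun _ : R * R => True)
    (fun p : R * R => let '(y, z) := p in xi s y z) /\
  (forall y z d, in_section y z -> small_delta d ->
     nu s L2 z d < xi s y z < nu s L4 z d /\
     (* the graph of xi is transverse to the direction of x *)
     f (xi s y z) y z 0 d <> 0) /\
  smooth_curve (phi2 s) /\ smooth_curve (phi4 s) /\
  (forall y z d, zlo s < z < zhi s -> small_delta d ->
     (PL2 d y z <-> y = phi2 s z d) /\ (PL4 d y z <-> y = phi4 s z d)).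

(** z0(delta) is only defined for delta >= 0, so z0'(0) is a right derivative. *)
Definition assumption4 : Prop :=
  zc s 0 = z0 s /\
  filterlim (fun d => (zc s d - zc s 0) / d) (at_right 0) (locally 0) /\
  forall d, 0 < d < delta0 s ->
    zlo s < zc s d < zhi s /\
    phi2 s (zc s d) d = phi4 s (zc s d) d /\
    Derive (fun z => phi2 s z d) (zc s d) <> Derive (fun z => phi4 s z d) (zc s d) /\
    (forall z, zlo s < z < zc s d ->
       let y := phi4 s z d in
       exists (u : R -> R) (x : R),
         layer_orbit (fun t => 0 <= t) d y z u /\ u 0 = xi s y z /\
         (forall t, 0 <= t ->
            on_branch Sr1 (u t) z d \/ on_branch Sa2 (u t) z d ->
            y < F s (u t) z 0 d) /\
         is_lim u p_infty x /\ on_branch Sa1 x z d) /\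
    (forall z, zc s d < z < zhi s ->
       let y := phi4 s z d in
       exists (u : R -> R) (x : R),
         layer_orbit (fun t => 0 <= t) d y z u /\ u 0 = xi s y z /\
         is_lim u p_infty x /\ on_branch Sa2 x z d).

(** Singular closed orbit in the plane z = z0 at delta = 0 through P_c: reduced
    flow on [b] from a landing point [xl] to L_i, layer flow from L_i to a point
    [xr] of S_a3, reduced flow on S_a3 from [xr] to L4, and layer flow from L4,
    through P_c, to [xl]. *)
Definition singular_closed_orbit (i : fold) (b : branch) (landing : R -> Prop)
    : Prop :=
  exists (xl xr : R) (X Y X' Y' : R -> R) (T T' : R),
    let zz := z0 s in
    let yc := phi4 s zz 0 in
    landing xl /\
    reduced_segment b 0 X Y (fun _ => zz) T /\
    X 0 = xl /\ X T = nu s i zz 0 /\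
    on_branch Sa3 xr zz 0 /\
    layer_connection 0 (fold_y i zz 0) zz (nu s i zz 0) xr /\
    reduced_segment Sa3 0 X' Y' (fun _ => zz) T' /\
    X' 0 = xr /\ X' T' = nu s L4 zz 0 /\
    layer_path 0 (fold_y L4 zz 0) zz (nu s L4 zz 0) xl /\
    yc = fold_y L4 zz 0 /\ xl < xi s yc zz < nu s L4 zz 0.

(** At delta = 0 and z = z0 the fast orbit from L4 meets S at the boundary L2 of
    S_a2; hence the landing point of the second orbit may lie on L2. *)
Definition assumption5 : Prop :=
  singular_closed_orbit L1 Sa1 (fun x => x < nu s L1 (z0 s) 0) /\
  singular_closed_orbit L3 Sa2
    (fun x => nu s L2 (z0 s) 0 <= x < nu s L3 (z0 s) 0).

Definition standing_convention : Prop :=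
  smooth5 (Gz s) /\ smooth5 (Hz s) /\
  forall x y z e d, 0 <= e < eps0 s -> small_delta d ->
    g2 s x y z e d = d * Gz s x y z e d + (z - z0 s) * Hz s x y z e d.

(** ** The return map *)

Definition solution (e d T : R) (X Y Z : R -> R) : Prop :=
  forall t, 0 <= t <= T ->
    is_derive X t (Y t - F s (X t) (Z t) e d) /\
    is_derive Y t (e * g1 s (X t) (Y t) (Z t) e d) /\
    is_derive Z t (e * g2 s (X t) (Y t) (Z t) e d).

Definition on_Delta (x y z : R) : Prop := in_section y z /\ x = xi s y z.

Definition first_return (e d y z y' z' : R) : Prop :=
  exists (T : R) (X Y Z : R -> R),
    0 < T /\ solution e d T X Y Z /\
    on_Delta (X 0) (Y 0) (Z 0) /\ Y 0 = y /\ Z 0 = z /\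
    on_Delta (X T) (Y T) (Z T) /\ Y T = y' /\ Z T = z' /\
    (forall t, 0 < t < T -> ~ on_Delta (X t) (Y t) (Z t)).

Definition B (r d y z : R) : Prop :=
  in_section y z /\ Rabs (y - phi2 s z d) < r.

(** [Ymap], [Zmap] (arguments y, z, epsilon, delta) are the components of the
    first return map on U \ B_r(P(L2)). *)
Definition return_map (U : R * R -> Prop) (Ymap Zmap : R -> R -> R -> R -> R)
    : Prop :=
  open U /\ U (phi4 s (z0 s) 0, z0 s) /\
  (forall y z, U (y, z) -> in_section y z) /\
  exists d1 r1, 0 < d1 /\ 0 < r1 /\
    forall d r, 0 < d < d1 -> 0 < r < r1 ->
      exists e1, 0 < e1 /\
        forall e y z, 0 < e < e1 -> U (y, z) -> ~ B r d y z ->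
          first_return e d y z (Ymap y z e d) (Zmap y z e d).

(** The value of [lim] is meaningful only where the limit exists. *)
Definition Zsing (Zmap : R -> R -> R -> R -> R) (y z d : R) : R :=
  lim (filtermap (fun e => Zmap y z e d) (at_right 0)).

Definition Z1 (Zmap : R -> R -> R -> R -> R) (z d : R) : R :=
  match Req_EM_T z (z0 s), Req_EM_T d 0 with
  | left _, left _ => z0 s
  | _, _ => Zsing Zmap (phi4 s z d) z d
  end.

Definition Pi0 (Zmap : R -> R -> R -> R -> R) (d Z : R) : R :=
  (Z1 Zmap (z0 s + d * Z) d - z0 s) / d.

(** [Pi0 Zmap d Z] is well-defined: the evaluation point is off z = z0(delta),
    lies in U off P(L2) and in the domain of the return map for all small
    epsilon > 0, and the singular limit exists there. *)
Definition Pi0_defined (U : R * R -> Prop) (Ymap Zmap : R -> R -> R -> R -> R)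
    (d Z : R) : Prop :=
  let z := z0 s + d * Z in
  let y := phi4 s z d in
  z <> zc s d /\ U (y, z) /\ ~ PL2 d y z /\
  at_right 0 (fun e => first_return e d y z (Ymap y z e d) (Zmap y z e d)) /\
  filterlim (fun e => Zmap y z e d) (at_right 0) (locally (Zsing Zmap y z d)).

(** ** The map M *)

Definition F0 (x : R) : R := F s x (z0 s) 0 0.
Definition p (x : R) : R :=
  Hz s x (F0 x) (z0 s) 0 0 / g1 s x (F0 x) (z0 s) 0 0 * Derive F0 x.
Definition q (x : R) : R :=
  Gz s x (F0 x) (z0 s) 0 0 / g1 s x (F0 x) (z0 s) 0 0 * Derive F0 x.

Definition Zsol (x xinit Zinit : R) : R :=
  exp (RInt p xinit x) * Zinit +
  RInt (fun u => q u * exp (RInt p u x)) xinit x.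

(** Relevant for Z <> 0 only. *)
Definition M (xh1 xh3 xh4 Z : R) : R :=
  let x1 := nu s L1 (z0 s) 0 in
  let x2 := nu s L2 (z0 s) 0 in
  let x3 := nu s L3 (z0 s) 0 in
  let x4 := nu s L4 (z0 s) 0 in
  if Rlt_dec Z 0 then Zsol x4 xh1 (Zsol x1 xh4 Z)
  else Zsol x4 xh3 (Zsol x3 x2 Z).

End Setting.

(* Main.v *)
From Stdlib Require Import Reals Lra Psatz Classical ClassicalEpsilon PSeries_reg.
From Stdlib Require Import FunctionalExtensionality PropExtensionality List Relations.
From Coquelicot Require Import Coquelicot.
Require Import Defs.
Open Scope R_scope.

(** The statement rests on the blow-up z = z0 + delta zeta. By the standing
    convention, g2 is of order delta in this scale, so z is a slow variable even for
    the reduced flow: on the critical manifold, with x as independent variable,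
    zeta solves an equation whose limit as delta tends to 0 is the linear one
    zeta' = p zeta + q. Variation of constants gives the map Z(x, x_init, Z_init) of
    the statement.

    For fixed delta, the return map as epsilon tends to 0 is a composition of slow
    and fast passages. From the section an orbit falls along a fibre of the layer flow
    onto S_a1 or S_a2, follows the reduced flow up to the fold L1 or L3, jumps to S_a3,
    follows the reduced flow to L4, and falls back through the section. One half of this
    cycle, from a point of a fibre to a point beyond the next fold, is treated
    in [half_passage] for a fixed delta and in [half_cycle] uniformly in delta; the
    second half is the image of the first under (x, y) -> (-x, -y)
    ([slow_fast_reflect], [left_leg], [right_leg]). Transit times are never estimated.
    Each phase has its own clock instead: x during the fall ([layer_descent]), the offset
    y - F on arrival ([arrival]), x again along the branch ([slow_estimates]), and a square
    root that bounds the offset from below beyond the fold ([jump_passage]). The slope dz/dx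
    of the reduced flow, cut off where F_x < 0, is Lipschitz across the fold, so the orbit can be
    compared with one solution of an ordinary differential equation throughout.

    The side of the breaking point decides the branch. As z0(delta) = z0 + o(delta), the
    point z0 + delta Z lies before z0(delta) if Z < 0 and after it if Z > 0, once delta is
    small. In the first case the orbit lands on S_a1, near the abscissa at which F has the
    level of L4 ([landing_before]); in the second it lands on S_a2 close to L2
    ([landing_after]), and the singular passage starts at the fold L2 itself, where the reduced
    flow is singular but the slope dz/dx is not. The signs of g1 needed for the two slow passages
    are not part of the assumptions: they follow from the existence of the singular closed
    orbits, since a zero of g1 cannot be passed in finite time ([branch_speed_pos]).

    Finally, [cycle_return] gives, for each small delta, a number zeta close to the asserted
    value M(Z) such that the return point tends to z0 + delta zeta as epsilon tends to 0;
    so the singular limit exists and the rescaled map equals zeta ([cycle_limit]). *)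

(** * Clocks, comparison and continuity in one variable *)

Ltac min_le := first [apply Rmin_l | apply Rmin_r |
  eapply Rle_trans; [apply Rmin_l|min_le] | eapply Rle_trans; [apply Rmin_r|min_le]].

Lemma first_exit (phi : R -> R) (a b : R) :
  a <= b -> (forall t, a <= t <= b -> continuous phi t) -> 0 < phi a ->
  (forall t, a <= t <= b -> 0 < phi t) \/
  (exists t1, a < t1 <= b /\ phi t1 = 0 /\ forall t, a <= t < t1 -> 0 < phi t).
Proof.
intros Hab Hc Ha.
destruct (classic (forall t, a <= t <= b -> 0 < phi t)) as [H|H]; [now left|right].
apply not_all_ex_not in H as [w Hw].
apply imply_to_and in Hw as [Hw Hw'].
set (E := fun t => a <= t <= b /\ forall u, a <= u <= t -> 0 < phi u).
assert (HE : E a).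
{ split; [lra|]. intros u Hu. replace u with a by lra. exact Ha. }
destruct (completeness E) as [m [Hub Hlub]].
{ exists b. intros t [Ht _]. lra. }
{ now exists a. }
assert (Ham : a <= m) by now apply Hub.
assert (Hmb : m <= b) by (apply Hlub; intros t [Ht _]; lra).
assert (Hbelow : forall t, a <= t < m -> 0 < phi t).
{ intros t Ht. destruct (classic (exists u, E u /\ t < u)) as [[u [[_ Hu] Htu]]|N].
  - apply Hu; lra.
  - exfalso. assert (m <= t); [|lra]. apply Hlub. intros u Hu.
    destruct (Rle_lt_dec u t); auto. exfalso; apply N; eauto. }
assert (Hcm := Hc m (conj Ham Hmb)).
assert (Hm0 : ~ phi m < 0).
{ intros Hn.
  assert (Hl : locally m (fun t => phi t < 0)).
  { apply (Hcm (fun v => v < 0)). apply open_lt. exact Hn. }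
  destruct Hl as [eps Hl].
  destruct (Req_dec m a) as [->|Hne]; [lra|].
  set (t := Rmax a (m - eps / 2)). pose proof (cond_pos eps).
  assert (a <= t < m).
  { unfold t. split; [apply Rmax_l|]. apply Rmax_lub_lt; lra. }
  assert (phi t < 0).
  { apply Hl. unfold ball; simpl; unfold AbsRing_ball, abs, minus, plus, opp; simpl.
    assert (m - eps / 2 <= t) by apply Rmax_r.
    apply Rabs_def1; lra. }
  specialize (Hbelow t H0). lra. }
assert (Hm1 : ~ 0 < phi m).
{ intros Hp.
  assert (Hl : locally m (fun t => 0 < phi t)).
  { apply (Hcm (fun v => 0 < v)). apply open_gt. exact Hp. }
  destruct Hl as [eps Hl]. pose proof (cond_pos eps).
  assert (Hall : forall t, a <= t < m + eps -> 0 < phi t).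
  { intros t Ht. destruct (Rlt_le_dec t m); [apply Hbelow; lra|].
    apply Hl. unfold ball; simpl; unfold AbsRing_ball, abs, minus, plus, opp; simpl.
    apply Rabs_def1; lra. }
  destruct (Rle_lt_dec b m).
  - apply Hw'. apply Hall. lra.
  - assert (Rmin b (m + eps / 2) <= m).
    { apply Hub. split.
      - split; [apply Rmin_glb; lra|apply Rmin_l].
      - intros u Hu. apply Hall. split; [lra|].
        assert (Rmin b (m + eps/2) <= m + eps / 2) by min_le. lra. }
    assert (m < Rmin b (m + eps / 2)) by (apply Rmin_glb_lt; lra). lra. }
exists m. split; [|split]; [|lra|exact Hbelow].
split; [|lra]. destruct (Req_dec m a) as [->|]; lra.
Qed.

Lemma MVT_on (u u' : R -> R) (a b : R) :
  a < b -> (forall t, a <= t <= b -> is_derive u t (u' t)) ->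
  exists c, a <= c <= b /\ u b - u a = u' c * (b - a).
Proof.
intros Hab Hu. destruct (MVT_gen u a b u') as [c [Hc Heq]].
- intros x Hx. rewrite Rmin_left, Rmax_right in Hx by lra. apply Hu; lra.
- intros x Hx. rewrite Rmin_left, Rmax_right in Hx by lra.
  apply continuity_pt_filterlim. apply (ex_derive_continuous u).
  exists (u' x). apply Hu; lra.
- rewrite Rmin_left, Rmax_right in Hc by lra. now exists c.
Qed.

Lemma deriv_nonneg_le (u u' : R -> R) (a b : R) :
  a <= b -> (forall t, a <= t <= b -> is_derive u t (u' t)) ->
  (forall t, a <= t <= b -> 0 <= u' t) -> u a <= u b.
Proof.
intros Hab Hu Hp. destruct (Req_dec a b) as [->|]; [lra|].
destruct (MVT_on u u' a b) as [c [Hc Heq]]; [lra|auto|].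
specialize (Hp c Hc). nra.
Qed.

Lemma deriv_pos_lt (u u' : R -> R) (a b : R) :
  a < b -> (forall t, a <= t <= b -> is_derive u t (u' t)) ->
  (forall t, a <= t <= b -> 0 < u' t) -> u a < u b.
Proof.
intros Hab Hu Hp. destruct (MVT_on u u' a b) as [c [Hc Heq]]; [lra|auto|].
specialize (Hp c Hc). nra.
Qed.

Lemma deriv_pos_open_lt (u u' : R -> R) (a b : R) :
  a < b -> (forall t, a <= t <= b -> is_derive u t (u' t)) ->
  (forall t, a < t < b -> 0 < u' t) -> u a < u b.
Proof.
intros Hab Hu Hp. destruct (MVT_cor2 u u' a b Hab) as [c [Heq Hc]].
- intros c Hc. apply is_derive_Reals. now apply Hu.
- specialize (Hp c Hc). nra.
Qed.

(** The function [w] acts as a clock. Measuring displacements against a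
    monotone function of the state dispenses with any estimate of transit times,
    which are unbounded as epsilon tends to 0. *)
Lemma clock_bound (u u' w w' : R -> R) (a b : R) :
  a <= b -> (forall t, a <= t <= b -> is_derive u t (u' t)) ->
  (forall t, a <= t <= b -> is_derive w t (w' t)) ->
  (forall t, a <= t <= b -> Rabs (u' t) <= w' t) ->
  Rabs (u b - u a) <= w b - w a.
Proof.
intros Hab Hu Hw Hle.
assert (H1 : w a - u a <= w b - u b).
{ apply (deriv_nonneg_le (fun t => w t - u t) (fun t => w' t - u' t) a b Hab).
  - intros t Ht. apply (is_derive_minus w u t (w' t) (u' t)); auto.
  - intros t Ht. specialize (Hle t Ht). pose proof (Rle_abs (u' t)). lra. }
assert (H2 : w a + u a <= w b + u b).
{ apply (deriv_nonneg_le (fun t => w t + u t) (fun t => w' t + u' t) a b Hab).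
  - intros t Ht. apply (is_derive_plus w u t (w' t) (u' t)); auto.
  - intros t Ht. specialize (Hle t Ht). pose proof (Rle_abs (- u' t)).
    rewrite Rabs_Ropp in H. lra. }
apply Rabs_le. lra.
Qed.

Lemma is_derive_first_zero (phi : R -> R) (a t1 l : R) :
  a < t1 -> is_derive phi t1 l -> phi t1 <= 0 ->
  (forall t, a <= t < t1 -> 0 < phi t) -> l <= 0.
Proof.
intros Ha Hd Hz Hp. apply Rnot_lt_le. intros Hl.
apply is_derive_Reals in Hd.
destruct (Hd l Hl) as [del Hdel]. pose proof (cond_pos del).
set (h := Rmin (del / 2) (t1 - a)).
assert (0 < h) by (apply Rmin_glb_lt; lra).
assert (h <= del / 2) by min_le.
assert (h <= t1 - a) by min_le.
assert (Hh : Rabs ((phi (t1 + - h) - phi t1) / (- h) - l) < l).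
{ apply Hdel; [lra|]. rewrite Rabs_Ropp, Rabs_pos_eq; lra. }
specialize (Hp (t1 + - h)). assert (0 < phi (t1 + - h)) by (apply Hp; lra).
apply Rabs_def2 in Hh.
assert ((phi (t1 + - h) - phi t1) / - h < 0); [|lra].
replace ((phi (t1 + - h) - phi t1) / - h) with (- ((phi (t1 + - h) - phi t1) / h))
  by (field; lra).
assert (0 < (phi (t1 + - h) - phi t1) / h) by (apply Rdiv_lt_0_compat; lra). lra.
Qed.

(** Gronwall's inequality with [X] in place of time. The proof differentiates
    [sqrt (D^2 + eta^2)] because the absolute value of [D] need not be differentiable. *)
Lemma gronwall_clock (D D' X X' : R -> R) (L K a b : R) :
  a <= b -> 0 <= L -> 0 <= K ->
  (forall t, a <= t <= b -> is_derive D t (D' t)) ->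
  (forall t, a <= t <= b -> is_derive X t (X' t)) ->
  (forall t, a <= t <= b -> 0 <= X' t) ->
  (forall t, a <= t <= b -> Rabs (D' t) <= X' t * (L * Rabs (D t) + K)) ->
  Rabs (D b) <= exp (L * (X b - X a)) * (Rabs (D a) + K * (X b - X a)).
Proof.
intros Hab HL HK HD HX HX' Hle.
assert (Hmono : forall t, a <= t <= b -> X a <= X t).
{ intros t Ht. apply (deriv_nonneg_le X X'); [lra| |]; intros; [apply HX|apply HX']; lra. }
apply le_epsilon. intros eps Heps.
set (E := exp (L * (X b - X a))). assert (HE : 0 < E) by apply exp_pos.
set (eta := eps / E). assert (Heta : 0 < eta) by now apply Rdiv_lt_0_compat.
set (w := fun t => sqrt (D t * D t + eta * eta)).
assert (Hpos : forall t, 0 < D t * D t + eta * eta) by (intros; nra).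
assert (Hw : forall t, Rabs (D t) <= w t).
{ intros t. unfold w. rewrite <- sqrt_Rsqr_abs. apply sqrt_le_1_alt. unfold Rsqr. nra. }
assert (Hwpos : forall t, 0 < w t) by (intros; apply sqrt_lt_R0; auto).
set (g := fun t => exp (- (L * (X t - X a))) * w t - K * (X t - X a)).
assert (Hg : g b <= g a).
{ assert (H : (fun t => - g t) a <= (fun t => - g t) b); [|lra].
  apply (deriv_nonneg_le (fun t => - g t) (fun t => - ((- (L * X' t)) * exp (- (L * (X t - X a))) * w t +
      exp (- (L * (X t - X a))) * ((2 * D t * D' t) / (2 * w t)) - K * X' t)) a b Hab).
  - intros t Ht. specialize (HD t Ht). specialize (HX t Ht). unfold g, w.
    auto_derive.
    + repeat split; auto; try (now exists (D' t)); now exists (X' t).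
    + replace (Derive (fun x : R => D x) t) with (D' t) by now symmetry; apply is_derive_unique.
      replace (Derive (fun x : R => X x) t) with (X' t) by now symmetry; apply is_derive_unique.
      unfold Rminus.
      field. apply Rgt_not_eq. apply sqrt_lt_R0; auto.
  - intros t Ht. specialize (Hle t Ht). specialize (HX' t Ht).
    specialize (Hmono t Ht).
    set (e := exp (- (L * (X t - X a)))).
    assert (0 < e <= 1).
    { split; [apply exp_pos|]. unfold e. rewrite <- exp_0.
      destruct (Req_dec (- (L * (X t - X a))) 0) as [->|]; [lra|].
      apply Rlt_le, exp_increasing. nra. }
    assert (Hq : Rabs (2 * D t * D' t / (2 * w t)) <= Rabs (D' t)).
    { replace (2 * D t * D' t / (2 * w t)) with (D' t * (D t / w t))
        by (field; apply Rgt_not_eq, Hwpos).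
      rewrite Rabs_mult. rewrite <- (Rmult_1_r (Rabs (D' t))) at 2.
      apply Rmult_le_compat_l; [apply Rabs_pos|].
      unfold Rdiv. rewrite Rabs_mult, Rabs_inv, (Rabs_pos_eq (w t)) by (left; auto).
      apply (Rmult_le_reg_r (w t)); auto. rewrite Rmult_assoc, Rinv_l, Rmult_1_r, Rmult_1_l; auto.
      apply Rgt_not_eq, Hwpos. }
    assert (Hq2 := Rle_trans _ _ _ (Rle_abs _) Hq).
    specialize (Hw t).
    assert (Rabs (D' t) <= X' t * (L * w t + K)).
    { eapply Rle_trans; [exact Hle|]. apply Rmult_le_compat_l; auto.
      apply Rplus_le_compat_r. apply Rmult_le_compat_l; auto. }
    assert (e * (2 * D t * D' t / (2 * w t)) <= e * (X' t * (L * w t + K))).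
    { apply Rmult_le_compat_l; lra. }
    assert (e * (X' t * K) <= X' t * K).
    { assert (0 <= X' t * K) by nra. nra. }
    nra. }
unfold g in Hg. rewrite Rminus_diag, Rmult_0_r, Ropp_0, exp_0, Rmult_1_l, Rmult_0_r, Rminus_0_r in Hg.
assert (Hwa : w a <= Rabs (D a) + eta).
{ unfold w. rewrite <- (sqrt_Rsqr (Rabs (D a) + eta)).
  - apply sqrt_le_1_alt. unfold Rsqr. pose proof (Rabs_pos (D a)).
    assert (D a * D a = Rabs (D a) * Rabs (D a)) by (rewrite <- Rabs_mult; rewrite Rabs_pos_eq; nra).
    nra.
  - pose proof (Rabs_pos (D a)). lra. }
assert (Hexp : E * exp (- (L * (X b - X a))) = 1).
{ unfold E. rewrite <- exp_plus, Rplus_opp_r. apply exp_0. }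
eapply Rle_trans; [apply Hw|].
replace (w b) with (E * (exp (- (L * (X b - X a))) * w b)) by (rewrite <- Rmult_assoc, Hexp; ring).
assert (E * (exp (- (L * (X b - X a))) * w b) <= E * (Rabs (D a) + eta + K * (X b - X a))).
{ apply Rmult_le_compat_l; lra. }
assert (E * eta = eps) by (unfold eta; field; lra).
lra.
Qed.

(** Every local estimate below holds with a radius that may be decreased, so by
    Heine-Borel one radius serves a whole compact interval. *)
Lemma compact_unif (a b : R) (N : R -> R -> Prop) :
  (forall x r r', N x r -> 0 < r' <= r -> N x r') ->
  (forall x, a <= x <= b -> exists r, 0 < r /\
     forall x', a <= x' <= b -> Rabs (x' - x) < r -> N x' r) ->
  exists r, 0 < r /\ forall x, a <= x <= b -> N x r.
Proof.
intros Hmono Hloc.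
assert (Hch : forall x, exists r : posreal, a <= x <= b ->
   forall x', a <= x' <= b -> Rabs (x' - x) < r -> N x' r).
{ intros x. destruct (classic (a <= x <= b)) as [Hx|Hx].
  - destruct (Hloc x Hx) as [r [Hr H]]. now exists (mkposreal r Hr).
  - exists (mkposreal 1 Rlt_0_1). tauto. }
destruct (constructive_indefinite_description
  (fun del : R -> posreal => forall x, a <= x <= b ->
   forall x', a <= x' <= b -> Rabs (x' - x) < del x -> N x' (del x))) as [del Hdel].
{ exists (fun x => proj1_sig (constructive_indefinite_description _ (Hch x))).
  intros x. exact (proj2_sig (constructive_indefinite_description _ (Hch x))). }
destruct (compactness_value_1d a b del) as [d Hd].
exists d. split; [apply cond_pos|].
intros x Hx. specialize (Hd x Hx). apply NNPP in Hd.
destruct Hd as [t [Ht [Hxt Hle]]].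
apply (Hmono x (del t)); [|split; [apply cond_pos|exact Hle]].
now apply Hdel.
Qed.

Lemma continuous_bounded (u : R -> R) (a b : R) :
  (forall t, a <= t <= b -> continuous u t) ->
  exists B, 0 < B /\ forall t, a <= t <= b -> Rabs (u t) <= B.
Proof.
intros Hc. destruct (compact_unif a b (fun t r => Rabs (u t) <= / r)) as [r [Hr H]].
- intros t r r' H Hr. eapply Rle_trans; [exact H|]. apply Rinv_le_contravar; lra.
- intros t Ht. destruct (proj1 (filterlim_locally _ _) (Hc t Ht) (mkposreal 1 Rlt_0_1)) as [eta He].
  pose proof (cond_pos eta). set (m := Rabs (u t) + 1).
  assert (Hm : 0 < / m) by (apply Rinv_0_lt_compat; unfold m; pose proof (Rabs_pos (u t)); lra).
  assert (Hl : Rmin eta (/ m) <= eta) by min_le.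
  exists (Rmin eta (/ m)). split; [apply Rmin_glb_lt; auto|]. intros t' _ Htt.
  apply Rle_trans with (/ / m); [rewrite Rinv_inv|apply Rinv_le_contravar; [apply Rmin_glb_lt; auto|min_le]].
  assert (Hd : Rabs (u t' - u t) < 1) by (apply (He t'); change (Rabs (t' - t) < eta); lra).
  replace (u t') with ((u t' - u t) + u t) by ring. eapply Rle_trans; [apply Rabs_triang|]. unfold m. lra.
- exists (/ r). split; auto. now apply Rinv_0_lt_compat.
Qed.

Lemma continuous_Rmin (u v : R -> R) (t : R) :
  continuous u t -> continuous v t -> continuous (fun t => Rmin (u t) (v t)) t.
Proof.
intros Hu Hv. apply filterlim_locally. intros eps.
generalize (filter_and _ _ (proj1 (filterlim_locally _ _) Hu eps) (proj1 (filterlim_locally _ _) Hv eps)).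
apply filter_imp. intros s [H1 H2].
change (Rabs (u s - u t) < eps) in H1. change (Rabs (v s - v t) < eps) in H2.
change (Rabs (Rmin (u s) (v s) - Rmin (u t) (v t)) < eps).
apply Rabs_def2 in H1, H2. apply Rabs_def1; unfold Rmin; repeat destruct Rle_dec; lra.
Qed.

Lemma Rmin_pos_inv (a b : R) : 0 < Rmin a b -> 0 < a /\ 0 < b.
Proof. unfold Rmin; destruct Rle_dec; lra. Qed.

Lemma Rmin_zero_inv (a b : R) : Rmin a b = 0 -> 0 <= a /\ 0 <= b /\ (a = 0 \/ b = 0).
Proof. unfold Rmin; destruct Rle_dec; lra. Qed.

Lemma Rmin_nonneg_inv (a b : R) : 0 <= Rmin a b -> 0 <= a /\ 0 <= b.
Proof. unfold Rmin; destruct Rle_dec; lra. Qed.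

Lemma continuous_minus_const (u : R -> R) (c t : R) :
  continuous u t -> continuous (fun t => u t - c) t.
Proof. intros H. apply (continuous_minus u (fun _ => c)); auto. apply continuous_const. Qed.

Lemma continuous_const_minus (u : R -> R) (c t : R) :
  continuous u t -> continuous (fun t => c - u t) t.
Proof. intros H. apply (continuous_minus (fun _ => c) u); auto. apply continuous_const. Qed.

Lemma continuous_Rabs_dist (u : R -> R) (c t : R) :
  continuous u t -> continuous (fun t => Rabs (u t - c)) t.
Proof.
intros H. apply (continuous_comp (fun t => u t - c) Rabs).
- now apply continuous_minus_const.
- apply continuous_Rabs.
Qed.

(** * Picard iteration and the linear equation *)

Lemma is_derive_continuity_pt (u : R -> R) (x l : R) : is_derive u x l -> continuity_pt u x.
Proof.
intros H. apply continuity_pt_filterlim. apply (ex_derive_continuous u). now exists l.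
Qed.

Lemma picard_contraction (u u' : R -> R) (M L x0 : R) :
  0 <= M -> 0 < L -> u x0 = 0 -> (forall x, is_derive u x (u' x)) ->
  (forall x, Rabs (u' x) <= L * (2 * M * exp (2 * L * Rabs (x - x0)))) ->
  forall x, Rabs (u x) <= M * exp (2 * L * Rabs (x - x0)).
Proof.
intros HM HL H0 Hu Hb x.
destruct (Rle_lt_dec x0 x) as [Hx|Hx].
- assert (H := clock_bound u u' (fun s => M * exp (2 * L * (s - x0)))
    (fun s => M * (2 * L * exp (2 * L * (s - x0)))) x0 x Hx (fun t _ => Hu t)).
  cbv beta in H. rewrite Rminus_diag, Rmult_0_r, exp_0, H0, Rminus_0_r in H.
  rewrite (Rabs_pos_eq (x - x0)) by lra.
  assert (Rabs (u x) <= M * exp (2 * L * (x - x0)) - M * 1); [|lra].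
  apply H.
  + intros t _. auto_derive; auto. unfold Rminus. ring.
  + intros t Ht. specialize (Hb t). rewrite (Rabs_pos_eq (t - x0)) in Hb by lra. lra.
- assert (H := clock_bound u u' (fun s => - (M * exp (2 * L * (x0 - s))))
    (fun s => M * (2 * L * exp (2 * L * (x0 - s)))) x x0 ltac:(lra) (fun t _ => Hu t)).
  cbv beta in H. rewrite Rminus_diag, Rmult_0_r, exp_0, H0 in H.
  rewrite (Rabs_left (x - x0)) by lra.
  replace (- (x - x0)) with (x0 - x) by ring.
  rewrite <- (Rabs_Ropp (u x)). replace (- u x) with (0 - u x) by ring.
  assert (Rabs (0 - u x) <= - (M * 1) - - (M * exp (2 * L * (x0 - x)))); [|lra].
  apply H.
  + intros t _. auto_derive; auto. unfold Rminus. ring.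
  + intros t Ht. specialize (Hb t). rewrite (Rabs_left1 (t - x0)) in Hb by lra.
    replace (- (t - x0)) with (x0 - t) in Hb by ring. lra.
Qed.

(** In the norm weighted by [exp (2 L |x - x0|)] the iteration contracts by the
    factor 1/2 on the whole line, so no interval of existence has to be tracked. *)
Theorem picard (K : R -> R -> R) (B L x0 u0 : R) :
  0 < L -> (forall x u, Rabs (K x u) <= B) ->
  (forall x u v, Rabs (K x u - K x v) <= L * Rabs (u - v)) ->
  (forall u x, continuous (fun x => K x u) x) ->
  exists phi : R -> R, phi x0 = u0 /\ forall x, is_derive phi x (K x (phi x)).
Proof.
intros HL HB HLip HK.
assert (HKc : forall phi x, continuous phi x -> continuous (fun s => K s (phi s)) x).
{ intros phi x Hphi. apply filterlim_locally. intros eps. pose proof (cond_pos eps).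
  assert (H1 := proj1 (filterlim_locally _ _) (HK (phi x) x) (pos_div_2 eps)).
  assert (He : 0 < eps / 2 / (L + 1)) by (apply Rdiv_lt_0_compat; lra).
  assert (H2 := proj1 (filterlim_locally _ _) Hphi (mkposreal _ He)).
  generalize (filter_and _ _ H1 H2). apply filter_imp. intros s [Hs1 Hs2].
  change (Rabs (K s (phi x) - K x (phi x)) < eps / 2) in Hs1.
  change (Rabs (phi s - phi x) < eps / 2 / (L + 1)) in Hs2.
  change (Rabs (K s (phi s) - K x (phi x)) < eps).
  replace (K s (phi s) - K x (phi x)) with ((K s (phi s) - K s (phi x)) + (K s (phi x) - K x (phi x))) by ring.
  eapply Rle_lt_trans; [apply Rabs_triang|].
  assert (L * Rabs (phi s - phi x) <= eps / 2).
  { apply Rle_trans with ((L + 1) * (eps / 2 / (L + 1))); [|right; field; lra].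
    pose proof (Rabs_pos (phi s - phi x)). nra. }
  specialize (HLip s (phi s) (phi x)). lra. }
set (T := fun (phi : R -> R) x => u0 + RInt (fun s => K s (phi s)) x0 x).
set (it := fix it n := match n with O => fun _ => u0 | S n => T (it n) end).
assert (HT : forall phi, (forall x, continuous phi x) -> forall x, is_derive (T phi) x (K x (phi x))).
{ intros phi Hphi x. unfold T. rewrite <- (Rplus_0_l (K x (phi x))).
  apply (is_derive_plus (fun _ => u0) (RInt (fun s => K s (phi s)) x0) x 0 (K x (phi x))).
  - apply (is_derive_const u0).
  - apply (is_derive_RInt (fun s => K s (phi s)) _ x0).
    + apply filter_forall. intros b. apply (RInt_correct (fun s => K s (phi s))).
      apply (ex_RInt_continuous (fun s => K s (phi s))). auto.
    + auto. }
assert (Hit : forall n x, continuous (it n) x).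
{ induction n as [|n IH]; intros x.
  - apply continuous_const.
  - apply (ex_derive_continuous (it (S n))). exists (K x (it n x)). now apply HT. }
assert (Hd : forall n x, is_derive (it (S n)) x (K x (it n x))) by (intros; now apply HT).
assert (H0 : forall n, it n x0 = u0).
{ intros [|n]; [reflexivity|]. simpl. unfold T. rewrite RInt_point.
  unfold zero; simpl. ring. }
assert (HB0 : 0 <= B) by (eapply Rle_trans; [apply Rabs_pos|apply (HB 0 0)]).
set (M := B / L). assert (HM : 0 <= M) by (apply Rdiv_le_0_compat; lra).
assert (Hgeo : forall n x, Rabs (it (S n) x - it n x) <= M * (/ 2) ^ n * exp (2 * L * Rabs (x - x0))).
{ induction n as [|n IH].
  - intros x. apply (picard_contraction (fun x => it 1%nat x - it 0%nat x)
      (fun x => K x (it 0%nat x))); auto.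
    + simpl. lra.
    + rewrite !H0. ring.
    + intros y. rewrite <- (Rminus_0_r (K y _)).
      apply (is_derive_minus (it 1%nat) (it 0%nat) y (K y (it 0%nat y)) 0); auto.
      apply (is_derive_const u0).
    + intros y. eapply Rle_trans; [apply HB|]. simpl.
      replace (L * (2 * (M * 1) * exp (2 * L * Rabs (y - x0)))) with (B * (2 * exp (2 * L * Rabs (y - x0))))
        by (unfold M; field; lra).
      assert (1 <= exp (2 * L * Rabs (y - x0))).
      { rewrite <- exp_0. pose proof (Rabs_pos (y - x0)).
        destruct (Req_dec (2 * L * Rabs (y - x0)) 0) as [->|]; [lra|].
        left; apply exp_increasing. nra. }
      nra.
  - intros x. apply (picard_contraction (fun x => it (S (S n)) x - it (S n) x)
      (fun x => K x (it (S n) x) - K x (it n x))); auto.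
    + apply Rmult_le_pos; auto. apply pow_le. lra.
    + rewrite !H0. ring.
    + intros y. apply (is_derive_minus (it (S (S n))) (it (S n)) y); apply Hd.
    + intros y. eapply Rle_trans; [apply HLip|].
      apply Rmult_le_compat_l; [lra|]. eapply Rle_trans; [apply IH|].
      right. simpl. field. }
assert (Htail : forall n k x, Rabs (it (n + k)%nat x - it n x) <=
   2 * M * (/ 2) ^ n * (1 - (/ 2) ^ k) * exp (2 * L * Rabs (x - x0))).
{ intros n k x. induction k as [|k IH].
  - rewrite Nat.add_0_r, Rminus_diag, Rabs_R0. simpl. lra.
  - rewrite Nat.add_succ_r.
    replace (it (S (n + k)) x - it n x) with ((it (S (n + k)) x - it (n + k)%nat x) + (it (n + k)%nat x - it n x)) by ring.
    eapply Rle_trans; [apply Rabs_triang|].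
    specialize (Hgeo (n + k)%nat x). rewrite pow_add in Hgeo.
    replace (2 * M * (/ 2) ^ n * (1 - (/ 2) ^ S k) * exp (2 * L * Rabs (x - x0))) with
      (M * ((/ 2) ^ n * (/ 2) ^ k) * exp (2 * L * Rabs (x - x0)) +
       2 * M * (/ 2) ^ n * (1 - (/ 2) ^ k) * exp (2 * L * Rabs (x - x0))) by (simpl; field).
    lra. }
assert (Hcauchy : forall x, ex_finite_lim_seq (fun n => it n x)).
{ intros x. apply ex_lim_seq_cauchy_corr. intros eps.
  set (A := 2 * M * exp (2 * L * Rabs (x - x0))).
  assert (HA : 0 <= A). { unfold A. pose proof (exp_pos (2 * L * Rabs (x - x0))). nra. }
  destruct (pow_lt_1_zero (/ 2)) with (y := eps / 2 / (A + 1)) as [n0 Hn0].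
  { rewrite Rabs_pos_eq; lra. }
  { apply Rdiv_lt_0_compat; [|lra]. pose proof (cond_pos eps). lra. }
  exists n0.
  assert (Hone : forall n, (n0 <= n)%nat -> Rabs (it n x - it n0 x) < eps / 2).
  { intros n Hn. replace n with (n0 + (n - n0))%nat by (apply Nat.sub_add in Hn; rewrite Nat.add_comm; exact Hn).
    eapply Rle_lt_trans; [apply Htail|].
    specialize (Hn0 n0 (Nat.le_refl _)).
    assert (0 < (/ 2) ^ n0) by (apply pow_lt; lra).
    assert (0 < (/ 2) ^ (n - n0)) by (apply pow_lt; lra).
    rewrite Rabs_pos_eq in Hn0 by lra.
    assert (A * (/ 2) ^ n0 < eps / 2).
    { apply Rle_lt_trans with ((A + 1) * (/ 2) ^ n0); [nra|].
      apply Rlt_le_trans with ((A + 1) * (eps / 2 / (A + 1))); [|right; field; lra].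
      apply Rmult_lt_compat_l; lra. }
    replace (2 * M * (/ 2) ^ n0 * (1 - (/ 2) ^ (n - n0)) * exp (2 * L * Rabs (x - x0)))
      with (A * (/ 2) ^ n0 * (1 - (/ 2) ^ (n - n0))) by (unfold A; ring).
    assert (0 <= A * (/ 2) ^ n0) by nra. nra. }
  intros n m Hn Hm.
  replace (it n x - it m x) with ((it n x - it n0 x) - (it m x - it n0 x)) by ring.
  eapply Rle_lt_trans; [apply Rabs_triang|]. rewrite Rabs_Ropp.
  specialize (Hone n Hn) as H1. specialize (Hone m Hm) as H2. lra. }
set (phi := fun x => real (Lim_seq (fun n => it n x))).
assert (Hphi : forall x, is_lim_seq (fun n => it n x) (phi x)).
{ intros x. apply Lim_seq_correct'. apply Hcauchy. }
assert (Hunif : forall n x, Rabs (phi x - it n x) <= 2 * M * (/ 2) ^ n * exp (2 * L * Rabs (x - x0))).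
{ intros n x.
  assert (Hl : is_lim_seq (fun k => Rabs (it (k + n)%nat x - it n x)) (Rabs (phi x - it n x))).
  { apply (is_lim_seq_abs _ (phi x - it n x)).
    apply (is_lim_seq_minus' (fun k => it (k + n)%nat x) (fun _ => it n x)).
    - apply (is_lim_seq_incr_n (fun k => it k x)). apply Hphi.
    - apply is_lim_seq_const. }
  apply (is_lim_seq_le (fun k => Rabs (it (k + n)%nat x - it n x)) (fun _ => 2 * M * (/ 2) ^ n * exp (2 * L * Rabs (x - x0))) (Rabs (phi x - it n x)) (2 * M * (/ 2) ^ n * exp (2 * L * Rabs (x - x0)))); auto.
  - intros k. rewrite Nat.add_comm. eapply Rle_trans; [apply Htail|].
    assert (0 < (/ 2) ^ k) by (apply pow_lt; lra).
    assert (0 < (/ 2) ^ n) by (apply pow_lt; lra).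
    pose proof (exp_pos (2 * L * Rabs (x - x0))).
    assert (0 <= 2 * M * (/ 2) ^ n * exp (2 * L * Rabs (x - x0))).
    { apply Rmult_le_pos; [|lra]. apply Rmult_le_pos; lra. }
    replace (2 * M * (/ 2) ^ n * (1 - (/ 2) ^ k) * exp (2 * L * Rabs (x - x0))) with
     (2 * M * (/ 2) ^ n * exp (2 * L * Rabs (x - x0)) * (1 - (/ 2) ^ k)) by ring. nra.
  - apply is_lim_seq_const. }
exists phi. split.
{ apply (f_equal real (x := Lim_seq _) (y := Finite u0)). rewrite (Lim_seq_ext _ (fun _ => u0)) by apply H0.
  apply Lim_seq_const. }
intros x. apply is_derive_Reals.
apply (CVU_derivable (fun n => it (S n)) (fun n s => K s (it n s)) phi (fun s => K s (phi s)) x (mkposreal 1 Rlt_0_1)).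
- intros eps Heps.
  set (A := 2 * M * exp (2 * L * (Rabs (x - x0) + 1))).
  assert (HA : 0 <= A). { unfold A. pose proof (exp_pos (2 * L * (Rabs (x - x0) + 1))). nra. }
  destruct (pow_lt_1_zero (/ 2)) with (y := eps / (L * A + 1)) as [n0 Hn0].
  { rewrite Rabs_pos_eq; lra. }
  { apply Rdiv_lt_0_compat; [lra|nra]. }
  exists n0. intros n y Hn Hy. unfold Boule in Hy; simpl in Hy.
  eapply Rle_lt_trans; [apply HLip|].
  specialize (Hn0 n Hn). assert (0 < (/ 2) ^ n) by (apply pow_lt; lra).
  rewrite Rabs_pos_eq in Hn0 by lra.
  assert (Hyx : Rabs (y - x0) <= Rabs (x - x0) + 1).
  { replace (y - x0) with ((y - x) + (x - x0)) by ring.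
    eapply Rle_trans; [apply Rabs_triang|]. lra. }
  assert (exp (2 * L * Rabs (y - x0)) <= exp (2 * L * (Rabs (x - x0) + 1))).
  { destruct (Req_dec (Rabs (y - x0)) (Rabs (x - x0) + 1)) as [->|]; [lra|].
    left. apply exp_increasing. nra. }
  assert (Rabs (phi y - it n y) <= A * (/ 2) ^ n).
  { eapply Rle_trans; [apply Hunif|]. unfold A.
    replace (2 * M * exp (2 * L * (Rabs (x - x0) + 1)) * (/ 2) ^ n) with
      (2 * M * (/ 2) ^ n * exp (2 * L * (Rabs (x - x0) + 1))) by ring.
    apply Rmult_le_compat_l; auto. apply Rmult_le_pos; lra. }
  apply Rle_lt_trans with ((L * A + 1) * (/ 2) ^ n).
  { nra. }
  apply Rlt_le_trans with ((L * A + 1) * (eps / (L * A + 1))); [|right; field; nra].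
  apply Rmult_lt_compat_l; [nra|lra].
- intros y _. apply is_lim_seq_Reals. apply (is_lim_seq_incr_1 (fun n => it n y)). apply Hphi.
- intros n y _. apply is_derive_Reals. apply Hd.
- unfold Boule; simpl. rewrite Rminus_diag, Rabs_R0. lra.
Qed.

Lemma variation_of_constants_continuous (p q zeta : R -> R) (a b : R) :
  a <= b -> (forall x, continuous p x) -> (forall x, continuous q x) ->
  (forall x, a <= x <= b -> is_derive zeta x (p x * zeta x + q x)) ->
  zeta b = exp (RInt p a b) * zeta a + RInt (fun u => q u * exp (RInt p u b)) a b.
Proof.
intros Hab Hp Hq Hz.
set (A := fun u => RInt p u b).
assert (HA : forall u, is_derive A u (- p u)).
{ intros u. apply (is_derive_RInt' p A u b); [|apply Hp].
  apply filter_forall. intros v. apply (RInt_correct p).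
  apply (ex_RInt_continuous p). auto. }
assert (HI : is_RInt (fun u => q u * exp (A u)) a b (zeta b * exp (A b) - zeta a * exp (A a))).
{ apply (is_RInt_derive (fun u => zeta u * exp (A u)) (fun u => q u * exp (A u))).
  - intros x Hx. rewrite Rmin_left, Rmax_right in Hx by lra.
    replace (q x * exp (A x)) with ((p x * zeta x + q x) * exp (A x) + zeta x * (- p x * exp (A x))) by ring.
    apply (is_derive_mult zeta (fun u => exp (A u)) x _ (- p x * exp (A x))).
    + now apply Hz.
    + apply (is_derive_comp exp A x (exp (A x)) (- p x)); [apply is_derive_exp|apply HA].
    + intros; apply Rmult_comm.
  - intros x _. apply (continuous_mult q (fun u => exp (A u))); [apply Hq|].
    apply (continuous_comp A exp).
    + apply (ex_derive_continuous A). eexists; apply HA.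
    + apply (ex_derive_continuous exp). eexists; apply is_derive_exp. }
assert (HI' := is_RInt_unique (fun u => q u * exp (A u)) a b _ HI). clear HI. rename HI' into HI. fold A. change (RInt (fun u => q u * exp (RInt p u b)) a b) with (RInt (fun u => q u * exp (A u)) a b).
rewrite HI. change (RInt p a b) with (A a).
assert (A b = 0) as -> by (unfold A; rewrite RInt_point; reflexivity).
rewrite exp_0. ring.
Qed.

Definition clamp (a b x : R) : R := Rmax a (Rmin b x).

Lemma clamp_in (a b x : R) : a <= b -> a <= clamp a b x <= b.
Proof.
intros H. unfold clamp, Rmax, Rmin. repeat destruct Rle_dec; lra.
Qed.

Lemma clamp_id (a b x : R) : a <= x <= b -> clamp a b x = x.
Proof.
intros H. unfold clamp, Rmax, Rmin. repeat destruct Rle_dec; lra.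
Qed.

Lemma clamp_lip (a b x y : R) : Rabs (clamp a b x - clamp a b y) <= Rabs (x - y).
Proof.
unfold clamp, Rmax, Rmin, Rabs. repeat destruct Rle_dec; repeat destruct Rcase_abs; lra.
Qed.

(** Precomposition with [clamp] extends a function continuous on an interval to
    the line without changing it there. *)
Lemma continuous_clamp (f : R -> R) (a b x : R) :
  a <= b -> (forall y, a <= y <= b -> continuous f y) -> continuous (fun x => f (clamp a b x)) x.
Proof.
intros Hab Hf. apply (continuous_comp (clamp a b) f).
- apply filterlim_locally. intros eps. exists eps. intros y Hy.
  eapply Rle_lt_trans; [apply clamp_lip|exact Hy].
- apply Hf. now apply clamp_in.
Qed.

Lemma variation_of_constants (p q zeta : R -> R) (a b : R) :
  a <= b -> (forall x, a <= x <= b -> continuous p x /\ continuous q x) ->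
  (forall x, a <= x <= b -> is_derive zeta x (p x * zeta x + q x)) ->
  zeta b = exp (RInt p a b) * zeta a + RInt (fun u => q u * exp (RInt p u b)) a b.
Proof.
intros Hab Hpq Hz.
set (p1 := fun x => p (clamp a b x)). set (q1 := fun x => q (clamp a b x)).
assert (Hp1 : forall u, a <= u <= b -> RInt p u b = RInt p1 u b).
{ intros u Hu. apply RInt_ext. intros x. rewrite Rmin_left, Rmax_right by lra.
  intros Hx. unfold p1. rewrite clamp_id; auto; lra. }
rewrite (variation_of_constants_continuous p1 q1 zeta a b Hab).
- rewrite Hp1 by lra. f_equal. apply RInt_ext.
  intros x. rewrite Rmin_left, Rmax_right by lra. intros Hx.
  rewrite Hp1 by lra. unfold q1. rewrite clamp_id; auto; lra.
- intros x. apply (continuous_clamp p); auto. intros; apply Hpq; auto.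
- intros x. apply (continuous_clamp q); auto. intros; apply Hpq; auto.
- intros x Hx. unfold p1, q1. rewrite clamp_id; auto.
Qed.

(** * Smooth functions of the phase point and the parameters *)

Lemma Ck_on_ext {E : NormedModule R_AbsRing} (O : E -> Prop) (k : nat) (g h : E -> R) :
  (forall p, g p = h p) -> Ck_on O k g -> Ck_on O k h.
Proof. intros H. now replace h with g by now apply functional_extensionality. Qed.

Lemma Ck_on_opp {E : NormedModule R_AbsRing} (O : E -> Prop) (k : nat) (h : E -> R) :
  Ck_on O k h -> Ck_on O k (fun p => - h p).
Proof.
revert h. induction k as [|k IH]; intros h [Hc Hk]; (split; [intros p Hp; apply (continuous_opp h); auto|]).
- exact I.
- intros v. destruct (Hk v) as [He Hd]. split.
  + intros p Hp. apply (ex_derive_opp (fun t : R => h (plus p (scal t v)))). auto.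
  + apply (Ck_on_ext O k (fun p => - Derive (fun t : R => h (plus p (scal t v))) 0)).
    * intros p. now rewrite Derive_opp.
    * apply IH. exact Hd.
Qed.

(** Directional derivatives are transported by a linear change of variables:
    the derivative of [h o A] along [v] is that of [h] along [A v]. *)
Lemma Ck_on_comp_linear {E E' : NormedModule R_AbsRing} (O : E -> Prop) (O' : E' -> Prop) (A : E -> E') :
  (forall p v t, A (plus p (scal t v)) = plus (A p) (scal t (A v))) ->
  (forall p, continuous A p) -> (forall p, O p -> O' (A p)) ->
  forall (k : nat) (h : E' -> R), Ck_on O' k h -> Ck_on O k (fun p => h (A p)).
Proof.
intros HA HAc HO. induction k as [|k IH]; intros h [Hc Hk];
  (split; [intros p Hp; apply (continuous_comp A h); auto|]).
- exact I.
- intros v. destruct (Hk (A v)) as [He Hd]. split.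
  + intros p Hp. apply (ex_derive_ext (fun t : R => h (plus (A p) (scal t (A v))))).
    * intros t. now rewrite HA.
    * auto.
  + apply (Ck_on_ext O k (fun p => (fun p => Derive (fun t : R => h (plus p (scal t (A v)))) 0) (A p))).
    * intros p. apply Derive_ext. intros t. now rewrite HA.
    * apply (IH _ Hd).
Qed.

Notation E5 := (R * R * R * R * R)%type.
Notation fun5 := (R -> R -> R -> R -> R -> R).

Definition dom5 (e0 d0 : R) (p : E5) : Prop :=
  let '(x, y, z, e, d) := p in - e0 < e < e0 /\ - d0 < d < d0.

Definition unc (h : fun5) (p : E5) : R := let '(x, y, z, e, d) := p in h x y z e d.

Definition smooth (e0 d0 : R) (h : fun5) : Prop := smooth_on (dom5 e0 d0) (unc h).

Definition Dx (h : fun5) : fun5 := fun x y z e d => Derive (fun u => h u y z e d) x.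
Definition Dy (h : fun5) : fun5 := fun x y z e d => Derive (fun u => h x u z e d) y.
Definition Dz (h : fun5) : fun5 := fun x y z e d => Derive (fun u => h x y u e d) z.
Definition De (h : fun5) : fun5 := fun x y z e d => Derive (fun u => h x y z u d) e.
Definition Dd (h : fun5) : fun5 := fun x y z e d => Derive (fun u => h x y z e u) d.

Definition cont5 (h : fun5) (x y z e d : R) : Prop :=
  forall eps, 0 < eps -> exists r, 0 < r /\ forall x' y' z' e' d',
    Rabs (x' - x) < r -> Rabs (y' - y) < r -> Rabs (z' - z) < r ->
    Rabs (e' - e) < r -> Rabs (d' - d) < r ->
    Rabs (h x' y' z' e' d' - h x y z e d) < eps.

Definition diff5 (h : fun5) (x y z e d : R) : Prop :=
  ex_derive (fun u => h u y z e d) x /\ ex_derive (fun u => h x u z e d) y /\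
  ex_derive (fun u => h x y u e d) z /\ ex_derive (fun u => h x y z u d) e /\
  ex_derive (fun u => h x y z e u) d.

Lemma continuous_cont5 (h : fun5) (x y z e d : R) :
  continuous (unc h : E5 -> R) (x, y, z, e, d) -> cont5 h x y z e d.
Proof.
intros Hc eps Heps.
assert (H := proj1 (filterlim_locally _ _) Hc (mkposreal eps Heps)).
destruct H as [r Hr]. exists r. split; [apply cond_pos|].
intros x' y' z' e' d' Hx Hy Hz He Hd.
exact (Hr (x', y', z', e', d') (conj (conj (conj (conj Hx Hy) Hz) He) Hd)).
Qed.

Lemma smooth_cont5 (e0 d0 : R) (h : fun5) (x y z e d : R) :
  smooth e0 d0 h -> - e0 < e < e0 -> - d0 < d < d0 -> cont5 h x y z e d.
Proof.
intros H He Hd. apply continuous_cont5. apply (proj1 (H O)). split; auto.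
Qed.

Lemma Derive_shift (g : R -> R) (x : R) : Derive (fun t => g (x + t)) 0 = Derive g x.
Proof.
unfold Derive. f_equal. apply Lim_ext. intros t. rewrite !Rplus_0_r, Rplus_0_l. reflexivity.
Qed.

Lemma ex_derive_shift (g : R -> R) (x : R) : ex_derive (fun t => g (x + t)) 0 -> ex_derive g x.
Proof.
intros H. apply (ex_derive_ext (fun u => (fun t => g (x + t)) (u - x))).
- intros t. f_equal. ring.
- apply (ex_derive_comp (fun t => g (x + t)) (fun u => u - x)).
  + now rewrite Rminus_diag.
  + auto_derive. auto.
Qed.

Lemma plus_scal_5 (x y z e d a1 a2 a3 a4 a5 t : R) :
  plus ((x, y, z, e, d) : E5) (scal t ((a1, a2, a3, a4, a5) : E5)) =
  (x + t * a1, y + t * a2, z + t * a3, e + t * a4, d + t * a5).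
Proof. reflexivity. Qed.

Ltac dir5 :=
  let t := fresh "t" in intros t; cbv beta; rewrite plus_scal_5; unfold unc; repeat rewrite Rmult_0_r; repeat rewrite Rplus_0_r; repeat rewrite Rmult_1_r; reflexivity.

Lemma smooth_dir (e0 d0 : R) (h : fun5) (v : E5) :
  smooth e0 d0 h -> smooth_on (dom5 e0 d0) (fun p => Derive (fun t : R => unc h (plus p (scal t v))) 0).
Proof. intros H k. apply (H (S k)). Qed.

Lemma smooth_Dx (e0 d0 : R) (h : fun5) : smooth e0 d0 h -> smooth e0 d0 (Dx h).
Proof.
intros H k. refine (Ck_on_ext _ _ _ _ _ (smooth_dir _ _ _ (1, 0, 0, 0, 0) H k)).
intros [[[[x y] z] e] d]. unfold unc at 2, Dx.
rewrite <- (Derive_shift (fun u => h u y z e d) x). apply Derive_ext. dir5.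
Qed.

Lemma smooth_Dy (e0 d0 : R) (h : fun5) : smooth e0 d0 h -> smooth e0 d0 (Dy h).
Proof.
intros H k. refine (Ck_on_ext _ _ _ _ _ (smooth_dir _ _ _ (0, 1, 0, 0, 0) H k)).
intros [[[[x y] z] e] d]. unfold unc at 2, Dy.
rewrite <- (Derive_shift (fun u => h x u z e d) y). apply Derive_ext. dir5.
Qed.

Lemma smooth_Dz (e0 d0 : R) (h : fun5) : smooth e0 d0 h -> smooth e0 d0 (Dz h).
Proof.
intros H k. refine (Ck_on_ext _ _ _ _ _ (smooth_dir _ _ _ (0, 0, 1, 0, 0) H k)).
intros [[[[x y] z] e] d]. unfold unc at 2, Dz.
rewrite <- (Derive_shift (fun u => h x y u e d) z). apply Derive_ext. dir5.
Qed.

Lemma smooth_De (e0 d0 : R) (h : fun5) : smooth e0 d0 h -> smooth e0 d0 (De h).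
Proof.
intros H k. refine (Ck_on_ext _ _ _ _ _ (smooth_dir _ _ _ (0, 0, 0, 1, 0) H k)).
intros [[[[x y] z] e] d]. unfold unc at 2, De.
rewrite <- (Derive_shift (fun u => h x y z u d) e). apply Derive_ext. dir5.
Qed.

Lemma smooth_Dd (e0 d0 : R) (h : fun5) : smooth e0 d0 h -> smooth e0 d0 (Dd h).
Proof.
intros H k. refine (Ck_on_ext _ _ _ _ _ (smooth_dir _ _ _ (0, 0, 0, 0, 1) H k)).
intros [[[[x y] z] e] d]. unfold unc at 2, Dd.
rewrite <- (Derive_shift (fun u => h x y z e u) d). apply Derive_ext. dir5.
Qed.

Lemma smooth_diff5 (e0 d0 : R) (h : fun5) (x y z e d : R) :
  smooth e0 d0 h -> - e0 < e < e0 -> - d0 < d < d0 -> diff5 h x y z e d.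
Proof.
intros H He Hd. assert (Hp : dom5 e0 d0 (x, y, z, e, d)) by now split.
repeat split; apply ex_derive_shift.
- eapply ex_derive_ext; [|exact (proj1 (proj2 (H 1%nat) (1, 0, 0, 0, 0)) _ Hp)]. dir5.
- eapply ex_derive_ext; [|exact (proj1 (proj2 (H 1%nat) (0, 1, 0, 0, 0)) _ Hp)]. dir5.
- eapply ex_derive_ext; [|exact (proj1 (proj2 (H 1%nat) (0, 0, 1, 0, 0)) _ Hp)]. dir5.
- eapply ex_derive_ext; [|exact (proj1 (proj2 (H 1%nat) (0, 0, 0, 1, 0)) _ Hp)]. dir5.
- eapply ex_derive_ext; [|exact (proj1 (proj2 (H 1%nat) (0, 0, 0, 0, 1)) _ Hp)]. dir5.
Qed.

(** Reflecting the fast variable and the first slow variable exchanges the two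
    kinds of fold, so that only slow motion towards larger [x] and [y] has to be
    studied. *)
Definition reflect (h : fun5) : fun5 := fun x y z e d => h (- x) (- y) z e d.
Definition oreflect (h : fun5) : fun5 := fun x y z e d => - h (- x) (- y) z e d.

Lemma smooth_reflect (e0 d0 : R) (h : fun5) : smooth e0 d0 h -> smooth e0 d0 (reflect h).
Proof.
intros H k.
set (A := fun p : E5 => let '(x, y, z, e, d) := p in ((- x, - y, z, e, d) : E5)).
replace (unc (reflect h)) with (fun p => unc h (A p)).
2:{ apply functional_extensionality. now intros [[[[x y] z] e] d]. }
apply (Ck_on_comp_linear (dom5 e0 d0) (dom5 e0 d0) A).
- intros [[[[x y] z] e] d] [[[[a1 a2] a3] a4] a5] t. unfold A. rewrite !plus_scal_5.
  repeat f_equal; ring.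
- intros [[[[x y] z] e] d]. apply filterlim_locally. intros eps. exists eps.
  intros [[[[x' y'] z'] e'] d'] [[[[Hx Hy] Hz] He] Hd].
  repeat split; auto; simpl in *.
  + change (Rabs (- x' - - x) < eps). change (Rabs (x' - x) < eps) in Hx.
    rewrite <- Rabs_Ropp. now replace (- (- x' - - x)) with (x' - x) by ring.
  + change (Rabs (- y' - - y) < eps). change (Rabs (y' - y) < eps) in Hy.
    rewrite <- Rabs_Ropp. now replace (- (- y' - - y)) with (y' - y) by ring.
- now intros [[[[x y] z] e] d].
- apply H.
Qed.

Lemma smooth_oreflect (e0 d0 : R) (h : fun5) : smooth e0 d0 h -> smooth e0 d0 (oreflect h).
Proof.
intros H k.
replace (unc (oreflect h)) with (fun p => - unc (reflect h) p).
2:{ apply functional_extensionality. now intros [[[[x y] z] e] d]. }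
apply Ck_on_opp. now apply smooth_reflect.
Qed.

Lemma cont5_imp (h : fun5) (x y z e d : R) (P : R -> Prop) :
  cont5 h x y z e d -> open P -> P (h x y z e d) ->
  exists r, 0 < r /\ forall x' y' z' e' d',
    Rabs (x' - x) < r -> Rabs (y' - y) < r -> Rabs (z' - z) < r ->
    Rabs (e' - e) < r -> Rabs (d' - d) < r -> P (h x' y' z' e' d').
Proof.
intros Hc HP Hh. destruct (HP _ Hh) as [eps Heps].
destruct (Hc eps (cond_pos eps)) as [r [Hr H]]. exists r. split; auto.
intros. apply Heps. apply H; auto.
Qed.

Lemma mvt_lin (g : R -> R) (m eta a b : R) :
  (forall u, Rmin a b <= u <= Rmax a b -> ex_derive g u /\ Rabs (Derive g u - m) <= eta) ->
  Rabs (g b - g a - m * (b - a)) <= eta * Rabs (b - a).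
Proof.
intros H. destruct (MVT_gen g a b (Derive g)) as [c [Hc Heq]].
- intros x Hx. apply Derive_correct. apply H. lra.
- intros x Hx. apply continuity_pt_filterlim. apply (ex_derive_continuous g). apply H; auto.
- rewrite Heq. replace (Derive g c * (b - a) - m * (b - a)) with ((Derive g c - m) * (b - a)) by ring.
  rewrite Rabs_mult. apply Rmult_le_compat_r; [apply Rabs_pos|]. now apply H.
Qed.

Lemma between_abs (a b u c r : R) :
  Rmin a b <= u <= Rmax a b -> Rabs (a - c) < r -> Rabs (b - c) < r -> Rabs (u - c) < r.
Proof.
intros Hu Ha Hb. apply Rabs_def2 in Ha, Hb. apply Rabs_def1; unfold Rmin, Rmax in Hu; destruct Rle_dec; lra.
Qed.

(** Smoothness only provides derivatives along lines. The increment of [h]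
    is therefore split along the axes; the mean value theorem on each segment and the
    continuity of the partial derivatives give the chain rule. *)
Lemma chain5 (e0 d0 : R) (h : fun5) (X Y Z : R -> R) (t X' Y' Z' e d : R) :
  smooth e0 d0 h -> - e0 < e < e0 -> - d0 < d < d0 ->
  is_derive X t X' -> is_derive Y t Y' -> is_derive Z t Z' ->
  is_derive (fun s => h (X s) (Y s) (Z s) e d) t
    (Dx h (X t) (Y t) (Z t) e d * X' + Dy h (X t) (Y t) (Z t) e d * Y'
     + Dz h (X t) (Y t) (Z t) e d * Z').
Proof.
intros Hh He Hd HX HY HZ.
set (mx := Dx h (X t) (Y t) (Z t) e d). set (my := Dy h (X t) (Y t) (Z t) e d).
set (mz := Dz h (X t) (Y t) (Z t) e d).
assert (Hcx := smooth_cont5 e0 d0 _ (X t) (Y t) (Z t) e d (smooth_Dx _ _ _ Hh) He Hd).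
assert (Hcy := smooth_cont5 e0 d0 _ (X t) (Y t) (Z t) e d (smooth_Dy _ _ _ Hh) He Hd).
assert (Hcz := smooth_cont5 e0 d0 _ (X t) (Y t) (Z t) e d (smooth_Dz _ _ _ Hh) He Hd).
split; [apply (is_linear_scal_l (K := R_AbsRing))|].
intros t' Ht'. assert (t = t') as <- by exact (is_filter_lim_locally_unique (V := R_NormedModule) t t' Ht').
intros eps. pose proof (cond_pos eps) as Hpos.
set (B := Rabs mx + Rabs my + Rabs mz + Rabs X' + Rabs Y' + Rabs Z' + 3).
assert (HB : 3 <= B).
{ unfold B. pose proof (Rabs_pos mx). pose proof (Rabs_pos my). pose proof (Rabs_pos mz).
  pose proof (Rabs_pos X'). pose proof (Rabs_pos Y'). pose proof (Rabs_pos Z'). lra. }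
set (eta := Rmin 1 (eps / (2 * B))).
assert (Heta : 0 < eta).
{ apply Rmin_glb_lt; [lra|]. apply Rdiv_lt_0_compat; lra. }
assert (Heta1 : eta <= 1) by min_le.
assert (HetaB : eta * (2 * B) <= eps).
{ apply Rle_trans with (eps / (2 * B) * (2 * B)); [|right; field; lra].
  apply Rmult_le_compat_r; [lra|apply Rmin_r]. }
destruct (Hcx eta Heta) as [rx [Hrx Lx]]. destruct (Hcy eta Heta) as [ry [Hry Ly]].
destruct (Hcz eta Heta) as [rz [Hrz Lz]].
set (r := Rmin rx (Rmin ry rz)).
assert (Hr : 0 < r) by (repeat apply Rmin_glb_lt; auto).
assert (r <= rx /\ r <= ry /\ r <= rz) as [Hr1 [Hr2 Hr3]].
{ unfold r. repeat split; [apply Rmin_l|eapply Rle_trans; [apply Rmin_r|apply Rmin_l]|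
   eapply Rle_trans; [apply Rmin_r|apply Rmin_r]]. }
assert (Hlin : forall (W : R -> R) W', is_derive W t W' -> locally t (fun s =>
  Rabs (W s - W t - (s - t) * W') <= eta * Rabs (s - t) /\ Rabs (W s - W t) < r)).
{ intros W W' HW. apply filter_and.
  - destruct HW as [_ HW]. exact (HW t (fun P HP => HP) (mkposreal eta Heta)).
  - exact (proj1 (filterlim_locally _ _) (ex_derive_continuous W t (ex_intro _ W' HW)) (mkposreal r Hr)). }
generalize (filter_and _ _ (Hlin X X' HX) (filter_and _ _ (Hlin Y Y' HY) (Hlin Z Z' HZ))).
apply filter_imp. intros s [[HX1 HX2] [[HY1 HY2] [HZ1 HZ2]]].
assert (Hz0 : forall u : R, Rabs (u - u) < r) by (intros u; rewrite Rminus_diag, Rabs_R0; exact Hr).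
assert (I1 : Rabs (h (X s) (Y s) (Z s) e d - h (X t) (Y s) (Z s) e d - mx * (X s - X t)) <= eta * Rabs (X s - X t)).
{ apply (mvt_lin (fun u => h u (Y s) (Z s) e d)). intros u Hu.
  destruct (smooth_diff5 e0 d0 h u (Y s) (Z s) e d Hh He Hd) as [H1 _].
  split; [exact H1|]. left. apply Lx; try (apply Rlt_le_trans with r; auto; fail).
  apply Rlt_le_trans with r; auto. eapply between_abs; eauto. }
assert (I2 : Rabs (h (X t) (Y s) (Z s) e d - h (X t) (Y t) (Z s) e d - my * (Y s - Y t)) <= eta * Rabs (Y s - Y t)).
{ apply (mvt_lin (fun u => h (X t) u (Z s) e d)). intros u Hu.
  destruct (smooth_diff5 e0 d0 h (X t) u (Z s) e d Hh He Hd) as [_ [H1 _]].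
  split; [exact H1|]. left. apply Ly; try (apply Rlt_le_trans with r; auto; fail).
  apply Rlt_le_trans with r; auto. eapply between_abs; eauto. }
assert (I3 : Rabs (h (X t) (Y t) (Z s) e d - h (X t) (Y t) (Z t) e d - mz * (Z s - Z t)) <= eta * Rabs (Z s - Z t)).
{ apply (mvt_lin (fun u => h (X t) (Y t) u e d)). intros u Hu.
  destruct (smooth_diff5 e0 d0 h (X t) (Y t) u e d Hh He Hd) as [_ [_ [H1 _]]].
  split; [exact H1|]. left. apply Lz; try (apply Rlt_le_trans with r; auto; fail).
  apply Rlt_le_trans with r; auto. eapply between_abs; eauto. }
change (Rabs (h (X s) (Y s) (Z s) e d - h (X t) (Y t) (Z t) e d - (s - t) * (mx * X' + my * Y' + mz * Z'))
  <= eps * Rabs (s - t)).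
replace (h (X s) (Y s) (Z s) e d - h (X t) (Y t) (Z t) e d - (s - t) * (mx * X' + my * Y' + mz * Z')) with
 ((h (X s) (Y s) (Z s) e d - h (X t) (Y s) (Z s) e d - mx * (X s - X t)) +
  (h (X t) (Y s) (Z s) e d - h (X t) (Y t) (Z s) e d - my * (Y s - Y t)) +
  (h (X t) (Y t) (Z s) e d - h (X t) (Y t) (Z t) e d - mz * (Z s - Z t)) +
  mx * (X s - X t - (s - t) * X') + my * (Y s - Y t - (s - t) * Y') + mz * (Z s - Z t - (s - t) * Z')) by ring.
set (i1 := h (X s) (Y s) (Z s) e d - h (X t) (Y s) (Z s) e d - mx * (X s - X t)) in *.
set (i2 := h (X t) (Y s) (Z s) e d - h (X t) (Y t) (Z s) e d - my * (Y s - Y t)) in *.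
set (i3 := h (X t) (Y t) (Z s) e d - h (X t) (Y t) (Z t) e d - mz * (Z s - Z t)) in *.
set (T := Rabs (s - t)) in *. assert (HT : 0 <= T) by apply Rabs_pos.
assert (Hinc : forall W W' : R, Rabs (W - (s - t) * W') <= eta * T -> Rabs W <= (Rabs W' + 1) * T).
{ intros W W' HW. replace W with ((W - (s - t) * W') + (s - t) * W') by ring.
  eapply Rle_trans; [apply Rabs_triang|]. rewrite (Rabs_mult (s - t)). fold T. nra. }
assert (Hx := Hinc _ _ HX1). assert (Hy := Hinc _ _ HY1). assert (Hz := Hinc _ _ HZ1).
assert (Hm : forall m w, Rabs w <= eta * T -> Rabs (m * w) <= Rabs m * (eta * T)).
{ intros m w Hw. rewrite Rabs_mult. apply Rmult_le_compat_l; auto. apply Rabs_pos. }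
assert (Hmx := Hm mx _ HX1). assert (Hmy := Hm my _ HY1). assert (Hmz := Hm mz _ HZ1).
apply Rle_trans with (eta * B * T).
- eapply Rle_trans; [apply Rabs_triang|]. eapply Rle_trans; [apply Rplus_le_compat_r, Rabs_triang|].
  eapply Rle_trans; [apply Rplus_le_compat_r, Rplus_le_compat_r, Rabs_triang|].
  eapply Rle_trans; [apply Rplus_le_compat_r, Rplus_le_compat_r, Rplus_le_compat_r, Rabs_triang|].
  eapply Rle_trans; [apply Rplus_le_compat_r, Rplus_le_compat_r, Rplus_le_compat_r, Rplus_le_compat_r, Rabs_triang|].
  assert (eta * Rabs (X s - X t) <= eta * ((Rabs X' + 1) * T)) by (apply Rmult_le_compat_l; lra).
  assert (eta * Rabs (Y s - Y t) <= eta * ((Rabs Y' + 1) * T)) by (apply Rmult_le_compat_l; lra).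
  assert (eta * Rabs (Z s - Z t) <= eta * ((Rabs Z' + 1) * T)) by (apply Rmult_le_compat_l; lra).
  unfold B.
  replace (eta * (Rabs mx + Rabs my + Rabs mz + Rabs X' + Rabs Y' + Rabs Z' + 3) * T) with
   (eta * ((Rabs X' + 1) * T) + eta * ((Rabs Y' + 1) * T) + eta * ((Rabs Z' + 1) * T) +
    Rabs mx * (eta * T) + Rabs my * (eta * T) + Rabs mz * (eta * T)) by ring.
  lra.
- apply Rmult_le_compat_r; auto. nra.
Qed.

(** * Uniform bounds near a curve *)

(** A box-shaped neighbourhood of a curve over [a, b] at epsilon = 0. Branches of
    the critical manifold and fibres of the layer flow are both such curves. *)
Definition inbox (gam : R -> R) (zs ds a b r x y z e d : R) : Prop :=
  a <= x <= b /\ Rabs (y - gam x) <= r /\ Rabs (z - zs) <= r /\ Rabs e <= r /\ Rabs (d - ds) <= r.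

Lemma inbox_mono gam zs ds a b r a' b' r' x y z e d :
  inbox gam zs ds a' b' r' x y z e d -> a <= a' -> b' <= b -> r' <= r ->
  inbox gam zs ds a b r x y z e d.
Proof. unfold inbox. intros. lra. Qed.

(** Compactness in the form behind all uniform bounds. The radius is an argument of
    [Q] so that one statement yields both a neighbourhood and a bound on it. *)
Lemma tube (gam : R -> R) (zs ds a b : R) (Q : R -> R -> R -> R -> R -> R -> Prop) :
  (forall x, a <= x <= b -> continuous gam x) ->
  (forall x y z e d r r', Q x y z e d r -> 0 < r' <= r -> Q x y z e d r') ->
  (forall x, a <= x <= b -> exists r, 0 < r /\ forall x' y z e d, Rabs (x' - x) < r ->
     Rabs (y - gam x) < r -> Rabs (z - zs) < r -> Rabs (e - 0) < r -> Rabs (d - ds) < r ->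
     Q x' y z e d r) ->
  exists r, 0 < r /\ forall x y z e d, inbox gam zs ds a b r x y z e d -> Q x y z e d r.
Proof.
intros Hg Hmono Hloc.
destruct (compact_unif a b (fun x r => forall y z e d, inbox gam zs ds a b r x y z e d -> Q x y z e d r)) as [r [Hr H]].
- intros x r r' H Hr y z e d Hin. apply (Hmono x y z e d r r'); auto. apply H.
  eapply inbox_mono; eauto; lra.
- intros x Hx. destruct (Hloc x Hx) as [r [Hr H]].
  destruct (proj1 (filterlim_locally _ _) (Hg x Hx) (mkposreal (r / 2) ltac:(lra))) as [eta Heta].
  pose proof (cond_pos eta).
  assert (Hm : 0 < Rmin (r / 3) eta) by (apply Rmin_glb_lt; lra).
  assert (Hm1 : Rmin (r / 3) eta <= r / 3) by min_le.
  assert (Hm2 : Rmin (r / 3) eta <= eta) by min_le.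
  exists (Rmin (r / 3) eta). split; auto.
  intros x' Hx' Hxx y z e d [_ [H1 [H2 [H3 H4]]]].
  apply (Hmono x' y z e d r); [|lra]. apply H; try lra.
  + replace (y - gam x) with ((y - gam x') + (gam x' - gam x)) by ring.
    eapply Rle_lt_trans; [apply Rabs_triang|].
    assert (Rabs (gam x' - gam x) < r / 2).
    { apply (Heta x'). change (Rabs (x' - x) < eta). lra. }
    lra.
  + rewrite Rminus_0_r. lra.
- exists r. split; auto. intros x y z e d Hin. apply (H x); auto. apply Hin.
Qed.

Lemma tube_pos (gam : R -> R) (zs ds a b : R) (h : fun5) :
  (forall x, a <= x <= b -> continuous gam x) ->
  (forall x, a <= x <= b -> cont5 h x (gam x) zs 0 ds /\ 0 < h x (gam x) zs 0 ds) ->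
  exists r, 0 < r /\ forall x y z e d, inbox gam zs ds a b r x y z e d -> r <= h x y z e d.
Proof.
intros Hg Hh.
apply (tube gam zs ds a b (fun x y z e d r => r <= h x y z e d) Hg).
- intros; lra.
- intros x Hx. destruct (Hh x Hx) as [Hc Hp].
  destruct (Hc (h x (gam x) zs 0 ds / 2) ltac:(lra)) as [r [Hr H]].
  exists (Rmin r (h x (gam x) zs 0 ds / 2)).
  assert (Rmin r (h x (gam x) zs 0 ds / 2) <= r) by min_le.
  assert (Rmin r (h x (gam x) zs 0 ds / 2) <= h x (gam x) zs 0 ds / 2) by min_le.
  split; [apply Rmin_glb_lt; lra|].
  intros x' y z e d K1 K2 K3 K4 K5.
  assert (H6 := H x' y z e d ltac:(lra) ltac:(lra) ltac:(lra) ltac:(lra) ltac:(lra)).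
  apply Rabs_def2 in H6. lra.
Qed.

Lemma tube_bound (gam : R -> R) (zs ds a b : R) (h : fun5) :
  (forall x, a <= x <= b -> continuous gam x) ->
  (forall x, a <= x <= b -> cont5 h x (gam x) zs 0 ds) ->
  exists r, 0 < r /\ forall x y z e d, inbox gam zs ds a b r x y z e d -> Rabs (h x y z e d) <= / r.
Proof.
intros Hg Hh.
apply (tube gam zs ds a b (fun x y z e d r => Rabs (h x y z e d) <= / r) Hg).
- intros x y z e d r r' H Hr. eapply Rle_trans; [exact H|]. apply Rinv_le_contravar; lra.
- intros x Hx. destruct (Hh x Hx 1 Rlt_0_1) as [r [Hr H]].
  set (M := Rabs (h x (gam x) zs 0 ds) + 1).
  assert (HM : 1 <= M) by (unfold M; pose proof (Rabs_pos (h x (gam x) zs 0 ds)); lra).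
  assert (HiM : 0 < / M) by (apply Rinv_0_lt_compat; lra).
  exists (Rmin r (/ M)). assert (Rmin r (/ M) <= r) by min_le.
  assert (Rmin r (/ M) <= / M) by min_le. assert (0 < Rmin r (/ M)) by (apply Rmin_glb_lt; auto).
  split; auto. intros x' y z e d K2 K3 K4 K5 K6.
  assert (H7 := H x' y z e d ltac:(lra) ltac:(lra) ltac:(lra) ltac:(lra) ltac:(lra)).
  apply Rle_trans with M.
  + replace (h x' y z e d) with ((h x' y z e d - h x (gam x) zs 0 ds) + h x (gam x) zs 0 ds) by ring.
    eapply Rle_trans; [apply Rabs_triang|]. unfold M. lra.
  + apply Rle_trans with (/ / M); [rewrite Rinv_inv; lra|apply Rinv_le_contravar; auto].
Qed.

(** The comparison is made at equal [x] only: [x] is the independent variable along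
    the branches, and orbits are compared with solutions over the same [x]. *)
Definition tame (gam : R -> R) (zs ds a b r C : R) (h : fun5) : Prop :=
  forall x y z e d, inbox gam zs ds a b r x y z e d ->
    Rabs (h x y z e d) <= C /\ Rabs (Dx h x y z e d) <= C /\ Rabs (Dy h x y z e d) <= C /\
    Rabs (Dz h x y z e d) <= C /\
    forall y' z' e' d', inbox gam zs ds a b r x y' z' e' d' ->
      Rabs (h x y z e d - h x y' z' e' d') <=
        C * (Rabs (y - y') + Rabs (z - z') + Rabs (e - e') + Rabs (d - d')).

Lemma tame_mono gam zs ds a b r C a' b' r' C' h :
  tame gam zs ds a b r C h -> a <= a' -> b' <= b -> r' <= r -> C <= C' ->
  tame gam zs ds a' b' r' C' h.
Proof.
intros H Ha Hb Hr HC x y z e d Hin.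
destruct (H x y z e d) as [H1 [H2 [H3 [H4 H5]]]]; [eapply inbox_mono; eauto|].
repeat split; try lra. intros y' z' e' d' Hin'.
eapply Rle_trans; [apply H5; eapply inbox_mono; eauto|].
apply Rmult_le_compat_r; auto.
pose proof (Rabs_pos (y - y')). pose proof (Rabs_pos (z - z')).
pose proof (Rabs_pos (e - e')). pose proof (Rabs_pos (d - d')). lra.
Qed.

Lemma mvt_bound (g : R -> R) (C a b : R) :
  (forall u, Rmin a b <= u <= Rmax a b -> ex_derive g u /\ Rabs (Derive g u) <= C) ->
  Rabs (g a - g b) <= C * Rabs (a - b).
Proof.
intros H. assert (H' := mvt_lin g 0 C a b). rewrite Rmult_0_l, Rminus_0_r in H'.
rewrite (Rabs_minus_sym (g a)), (Rabs_minus_sym a). apply H'.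
intros u Hu. rewrite Rminus_0_r. now apply H.
Qed.

Lemma between_abs_le (a b u c r : R) :
  Rmin a b <= u <= Rmax a b -> Rabs (a - c) <= r -> Rabs (b - c) <= r -> Rabs (u - c) <= r.
Proof.
intros Hu Ha Hb. apply Rabs_le_between in Ha, Hb. apply Rabs_le; unfold Rmin, Rmax in Hu; destruct Rle_dec; lra.
Qed.

Lemma smooth_tame (e0 d0 : R) (gam : R -> R) (zs ds a b : R) (h : fun5) :
  0 < e0 -> - d0 < ds < d0 -> smooth e0 d0 h -> (forall x, a <= x <= b -> continuous gam x) ->
  exists r C, 0 < r /\ 0 < C /\ tame gam zs ds a b r C h.
Proof.
intros He0 Hd0 Hs Hg.
assert (Hc : forall k, smooth e0 d0 k -> forall x, a <= x <= b -> cont5 k x (gam x) zs 0 ds).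
{ intros k Hk x Hx. apply (smooth_cont5 e0 d0); auto; lra. }
destruct (tube_bound gam zs ds a b h Hg (Hc _ Hs)) as [r0 [Hr0 H0]].
destruct (tube_bound gam zs ds a b _ Hg (Hc _ (smooth_Dx _ _ _ Hs))) as [r1 [Hr1 H1]].
destruct (tube_bound gam zs ds a b _ Hg (Hc _ (smooth_Dy _ _ _ Hs))) as [r2 [Hr2 H2]].
destruct (tube_bound gam zs ds a b _ Hg (Hc _ (smooth_Dz _ _ _ Hs))) as [r3 [Hr3 H3]].
destruct (tube_bound gam zs ds a b _ Hg (Hc _ (smooth_De _ _ _ Hs))) as [r4 [Hr4 H4]].
destruct (tube_bound gam zs ds a b _ Hg (Hc _ (smooth_Dd _ _ _ Hs))) as [r5 [Hr5 H5]].
set (r6 := Rmin (e0 / 2) (Rmin ((d0 - ds) / 2) ((d0 + ds) / 2))).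
assert (Hr6 : 0 < r6) by (repeat apply Rmin_glb_lt; lra).
set (r := Rmin r0 (Rmin r1 (Rmin r2 (Rmin r3 (Rmin r4 (Rmin r5 r6)))))).
assert (Hr : 0 < r) by (repeat apply Rmin_glb_lt; lra).
assert (r <= r0 /\ r <= r1 /\ r <= r2 /\ r <= r3 /\ r <= r4 /\ r <= r5 /\ r <= r6) as [L0 [L1 [L2 [L3 [L4 [L5 L6]]]]]].
{ unfold r. repeat split; repeat (first [apply Rle_refl | apply Rmin_l | eapply Rle_trans; [apply Rmin_r|]]). }
assert (r6 <= e0 / 2) by min_le.
assert (r6 <= (d0 - ds) / 2) by min_le.
assert (r6 <= (d0 + ds) / 2) by min_le.
assert (Hi : forall k, 0 < k -> r <= k -> / k <= / r) by (intros; apply Rinv_le_contravar; auto).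
assert (Hdom : forall x y z e d, inbox gam zs ds a b r x y z e d -> - e0 < e < e0 /\ - d0 < d < d0).
{ intros x y z e d [_ [_ [_ [Hi1 Hi2]]]]. apply Rabs_le_between in Hi1, Hi2. lra. }
assert (HB : forall x y z e d, inbox gam zs ds a b r x y z e d ->
  diff5 h x y z e d /\
  Rabs (h x y z e d) <= / r /\ Rabs (Dx h x y z e d) <= / r /\ Rabs (Dy h x y z e d) <= / r /\
    Rabs (Dz h x y z e d) <= / r /\ Rabs (De h x y z e d) <= / r /\ Rabs (Dd h x y z e d) <= / r).
{ intros x y z e d Hin. split.
  { destruct (Hdom _ _ _ _ _ Hin). now apply (smooth_diff5 e0 d0). }
  repeat split; (eapply Rle_trans; [first [apply H0|apply H1|apply H2|apply H3|apply H4|apply H5]; eapply inbox_mono; eauto; lra|apply Hi; auto]). }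
exists r, (/ r). split; auto. split; [now apply Rinv_0_lt_compat|].
intros x y z e d Hin. destruct (HB _ _ _ _ _ Hin) as [_ [B0 [B1 [B2 [B3 _]]]]].
repeat split; auto. intros y' z' e' d' Hin'.
destruct Hin as [I1 [I2 [I3 [I4 I5]]]]. destruct Hin' as [J1 [J2 [J3 [J4 J5]]]].
assert (K1 : Rabs (h x y z e d - h x y' z e d) <= / r * Rabs (y - y')).
{ apply (mvt_bound (fun u => h x u z e d)). intros u Hu.
  assert (Hin : inbox gam zs ds a b r x u z e d) by (repeat split; auto; try apply I1; eapply between_abs_le; eauto).
  destruct (HB _ _ _ _ _ Hin) as [D B]. split; [apply D|]. apply B. }
assert (K2 : Rabs (h x y' z e d - h x y' z' e d) <= / r * Rabs (z - z')).
{ apply (mvt_bound (fun u => h x y' u e d)). intros u Hu.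
  assert (Hin : inbox gam zs ds a b r x y' u e d) by (repeat split; auto; try apply I1; eapply between_abs_le; eauto).
  destruct (HB _ _ _ _ _ Hin) as [D B]. split; [apply D|]. apply B. }
assert (K3 : Rabs (h x y' z' e d - h x y' z' e' d) <= / r * Rabs (e - e')).
{ apply (mvt_bound (fun u => h x y' z' u d)). intros u Hu.
  assert (Hin : inbox gam zs ds a b r x y' z' u d).
  { repeat split; auto; try apply I1. rewrite <- (Rminus_0_r u). rewrite <- (Rminus_0_r e) in I4.
    rewrite <- (Rminus_0_r e') in J4. eapply between_abs_le; eauto. }
  destruct (HB _ _ _ _ _ Hin) as [D B]. split; [apply D|]. apply B. }
assert (K4 : Rabs (h x y' z' e' d - h x y' z' e' d') <= / r * Rabs (d - d')).
{ apply (mvt_bound (fun u => h x y' z' e' u)). intros u Hu.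
  assert (Hin : inbox gam zs ds a b r x y' z' e' u) by (repeat split; auto; try apply I1; eapply between_abs_le; eauto).
  destruct (HB _ _ _ _ _ Hin) as [D B]. split; [apply D|]. apply B. }
replace (h x y z e d - h x y' z' e' d') with ((h x y z e d - h x y' z e d) + (h x y' z e d - h x y' z' e d) +
  (h x y' z' e d - h x y' z' e' d) + (h x y' z' e' d - h x y' z' e' d')) by ring.
eapply Rle_trans; [apply Rabs_triang|].
eapply Rle_trans; [apply Rplus_le_compat_r, Rabs_triang|].
eapply Rle_trans; [apply Rplus_le_compat_r, Rplus_le_compat_r, Rabs_triang|]. lra.
Qed.

Lemma quot_lip (n n' a a' c M d1 d2 : R) :
  0 < c -> c <= a -> c <= a' -> Rabs n' <= M -> Rabs (n - n') <= d1 -> Rabs (a - a') <= d2 ->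
  Rabs (n / a - n' / a') <= d1 / c + M * d2 / (c * c).
Proof.
intros Hc Ha Ha' HM H1 H2.
replace (n / a - n' / a') with ((n - n') * / a + - (n' * (a - a') * / (a * a'))) by (field; lra).
eapply Rle_trans; [apply Rabs_triang|]. rewrite Rabs_Ropp, !Rabs_mult.
rewrite (Rabs_pos_eq (/ a)) by (left; apply Rinv_0_lt_compat; lra).
rewrite (Rabs_pos_eq (/ (a * a'))) by (left; apply Rinv_0_lt_compat; nra).
assert (/ a <= / c) by (apply Rinv_le_contravar; lra).
assert (/ (a * a') <= / (c * c)) by (apply Rinv_le_contravar; nra).
apply Rplus_le_compat.
- apply Rmult_le_compat; auto; [apply Rabs_pos|left; apply Rinv_0_lt_compat; lra].
- apply Rmult_le_compat; auto.
  + apply Rmult_le_pos; apply Rabs_pos.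
  + left; apply Rinv_0_lt_compat; nra.
  + apply Rmult_le_compat; auto; apply Rabs_pos.
Qed.

Lemma prod_lip (u u' v v' M1 M2 d1 d2 : R) :
  Rabs u <= M1 -> Rabs v' <= M2 -> Rabs (u - u') <= d1 -> Rabs (v - v') <= d2 ->
  Rabs (u * v - u' * v') <= M2 * d1 + M1 * d2.
Proof.
intros H1 H2 H3 H4.
replace (u * v - u' * v') with ((u - u') * v' + u * (v - v')) by ring.
eapply Rle_trans; [apply Rabs_triang|]. rewrite !Rabs_mult.
apply Rplus_le_compat.
- rewrite Rmult_comm. apply Rmult_le_compat; auto; apply Rabs_pos.
- apply Rmult_le_compat; auto; apply Rabs_pos.
Qed.

Lemma Rmax0_lip (u v : R) : Rabs (Rmax u 0 - Rmax v 0) <= Rabs (u - v).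
Proof. unfold Rmax, Rabs. repeat destruct Rle_dec; repeat destruct Rcase_abs; lra. Qed.

(** * Passage along an attracting branch and past its fold *)

Section FoldPassage.

Variables (F Fx Fz Fxx Fxz : R -> R -> R -> R) (g1 g2 S : R -> R -> R -> R -> R)
  (R0 : R -> R -> R) (xA xM xE z0 r rho c c2 C L : R).

Definition orbit (e a b : R) (X Y Z : R -> R) : Prop :=
  forall t, a <= t <= b ->
    is_derive X t (Y t - F (X t) (Z t) e) /\
    is_derive Y t (e * g1 (X t) (Y t) (Z t) e) /\
    is_derive Z t (e * g2 (X t) (Y t) (Z t) e).

Definition near_S (x y z e : R) : Prop :=
  xA <= x <= xE /\ Rabs (z - z0) <= r /\ Rabs (y - F x z e) <= rho /\ 0 < e <= r.

(** Since [|F_x| <= C], the offset [y - F] increases at a rate of at least [c * e / 2] as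
    long as it lies between 0 and [mu * e]. *)
Definition mu : R := c / (2 * C).

(** The setting of a passage for a fixed delta. [S] is [g2 / (g1 - F_z g2)], the
    rate of z with respect to the offset [y - F] gained from the slow motion, and
    [R0 x z] is the slope [dz/dx] of the reduced flow, cut off beyond the fold. On
    [xA <= x <= xM] the derivative [F_x] may vanish only where it increases, which
    covers a passage that starts at a fold of the other kind; on [xM <= x <= xE] the
    graph is concave and contains the fold to be passed. *)
Record fold_passage : Prop := {
  fp_order : xA < xM < xE;
  fp_r : 0 < r; fp_rho : 0 < rho; fp_c : 0 < c; fp_c2 : 0 < c2; fp_C : 1 <= C; fp_L : 0 <= L;
  fp_chain_F : forall e a b X Y Z t, orbit e a b X Y Z -> 0 < e <= r -> a <= t <= b ->
    is_derive (fun t => F (X t) (Z t) e) t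
      (Fx (X t) (Z t) e * (Y t - F (X t) (Z t) e) + Fz (X t) (Z t) e * (e * g2 (X t) (Y t) (Z t) e));
  fp_chain_Fx : forall e a b X Y Z t, orbit e a b X Y Z -> 0 < e <= r -> a <= t <= b ->
    is_derive (fun t => Fx (X t) (Z t) e) t
      (Fxx (X t) (Z t) e * (Y t - F (X t) (Z t) e) + Fxz (X t) (Z t) e * (e * g2 (X t) (Y t) (Z t) e));
  fp_chain_S : forall e a b X Y Z t, orbit e a b X Y Z -> 0 < e <= r -> a <= t <= b ->
    near_S (X t) (Y t) (Z t) e ->
    exists l : R, is_derive (fun t => S (X t) (Y t) (Z t) e) t l /\
      Rabs l <= C * (Rabs (Y t - F (X t) (Z t) e) + e);
  fp_bounds : forall x y z e, near_S x y z e ->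
    Rabs (g1 x y z e) <= C /\ Rabs (g2 x y z e) <= C /\ Rabs (Fx x z e) <= C /\
    Rabs (S x y z e) <= C /\ c <= g1 x y z e - Fz x z e * g2 x y z e <= C /\
    S x y z e * (g1 x y z e - Fz x z e * g2 x y z e) = g2 x y z e /\
    Rabs (Fxz x z e * g2 x y z e) <= c2 * mu / 4 /\
    Rabs (S x y z e * Rmax (Fx x z e) 0 - R0 x z) <= C * (Rabs (y - F x z e) + e);
  fp_R0_lip : forall x z z', xA <= x <= xE -> Rabs (z - z0) <= r -> Rabs (z' - z0) <= r ->
    Rabs (R0 x z - R0 x z') <= L * Rabs (z - z');
  fp_F_lip : forall x z z' e e', xA <= x <= xE -> Rabs (z - z0) <= r -> Rabs (z' - z0) <= r ->
    0 <= e <= r -> 0 <= e' <= r ->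
    Rabs (F x z e - F x z' e') <= C * (Rabs (z - z') + Rabs (e - e'));
  fp_lower : forall x z e, xA <= x <= xM -> Rabs (z - z0) <= r -> 0 < e <= r ->
    0 < Fx x z e \/ c2 <= Fxx x z e;
  fp_fold : forall x z e, xM <= x <= xE -> Rabs (z - z0) <= r -> 0 < e <= r ->
    Fxx x z e <= - c2;
  fp_exit : forall z e, Rabs (z - z0) <= r -> 0 < e <= r -> Fx xE z e < 0;
  fp_osc : forall x x' z e, xM <= x <= xE -> xM <= x' <= xE -> Rabs (z - z0) <= r -> 0 < e <= r ->
    Rabs (F x z e - F x' z e) <= rho / 4;
  fp_max : forall x x' z e, xM <= x <= xE -> xM <= x' <= xE -> Rabs (z - z0) <= r -> 0 <= e <= r ->
    Fx x z e = 0 -> F x' z e <= F x z e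
}.

Hypothesis HP : fold_passage.

Lemma mu_pos : 0 < mu.
Proof. destruct HP. unfold mu. apply Rdiv_lt_0_compat; lra. Qed.

Lemma C_mu : C * mu = c / 2.
Proof. destruct HP. unfold mu. field. lra. Qed.

Lemma is_derive_offset e a b X Y Z t :
  orbit e a b X Y Z -> 0 < e <= r -> a <= t <= b ->
  is_derive (fun t => Y t - F (X t) (Z t) e) t
   (e * (g1 (X t) (Y t) (Z t) e - Fz (X t) (Z t) e * g2 (X t) (Y t) (Z t) e)
     - Fx (X t) (Z t) e * (Y t - F (X t) (Z t) e)).
Proof.
intros Ho He Ht.
replace (e * (g1 (X t) (Y t) (Z t) e - Fz (X t) (Z t) e * g2 (X t) (Y t) (Z t) e)
     - Fx (X t) (Z t) e * (Y t - F (X t) (Z t) e)) with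
  (e * g1 (X t) (Y t) (Z t) e - (Fx (X t) (Z t) e * (Y t - F (X t) (Z t) e) + Fz (X t) (Z t) e * (e * g2 (X t) (Y t) (Z t) e))) by ring.
apply (is_derive_minus Y (fun t => F (X t) (Z t) e) t).
- now apply Ho.
- now apply (fp_chain_F HP e a b X Y Z t).
Qed.

Lemma orbit_sub e a b a' b' X Y Z : orbit e a b X Y Z -> a <= a' -> b' <= b -> orbit e a' b' X Y Z.
Proof. intros H Ha Hb t Ht. apply H. lra. Qed.

Lemma orbit_cont e a b X Y Z t : orbit e a b X Y Z -> a <= t <= b ->
  continuous X t /\ continuous Y t /\ continuous Z t.
Proof.
intros H Ht. destruct (H t Ht) as [HX [HY HZ]].
repeat split; [apply (ex_derive_continuous X)|apply (ex_derive_continuous Y)|apply (ex_derive_continuous Z)];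
 eexists; eauto.
Qed.

(** Where the layer flow runs to the left with a speed bounded from below, [x]
    is a clock for which the slow variables move at a rate of order epsilon. *)
Lemma layer_descent (xb xs ys zs c1 rho2 C1 kappa : R) :
  xb < xs -> 0 < c1 -> 0 < rho2 -> 0 <= C1 -> 0 < kappa ->
  (forall x y z e, xb <= x <= xs + rho2 -> Rabs (y - ys) <= rho2 -> Rabs (z - zs) <= rho2 -> 0 < e <= rho2 ->
    y - F x z e <= - c1 /\ Rabs (g1 x y z e) <= C1 /\ Rabs (g2 x y z e) <= C1) ->
  exists eps1 rho1, 0 < eps1 /\ 0 < rho1 /\
  forall e a T X Y Z, 0 < e < eps1 -> a <= T -> orbit e a T X Y Z ->
    X a = xs -> Rabs (Y a - ys) < rho1 -> Rabs (Z a - zs) < rho1 ->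
    exists t1, a <= t1 <= T /\
      (forall t, a <= t <= t1 -> Y t - F (X t) (Z t) e < 0 /\
         Rabs (Y t - Y a) + Rabs (Z t - Z a) <= kappa * (xs - X t) /\ (a < t -> X t < xs) /\ xb <= X t) /\
      (t1 = T \/ X t1 = xb).
Proof.
intros Hb Hc1 Hr2 HC1 Hk Hreg.
set (k := Rmin (kappa / 2) (rho2 / (2 * (xs - xb)))).
assert (Hk0 : 0 < k) by (apply Rmin_glb_lt; [lra|apply Rdiv_lt_0_compat; lra]).
assert (Hk1 : k <= kappa / 2) by min_le.
assert (Hk2 : k * (xs - xb) <= rho2 / 2).
{ apply Rle_trans with (rho2 / (2 * (xs - xb)) * (xs - xb)); [|right; field; lra].
  apply Rmult_le_compat_r; [lra|apply Rmin_r]. }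
exists (Rmin rho2 (k * c1 / (C1 + 1))), (rho2 / 2). split.
{ apply Rmin_glb_lt; auto. apply Rdiv_lt_0_compat; nra. }
split; [lra|].
intros e a T X Y Z [He0 He] HaT Ho HXa HYa HZa.
assert (He1 : e < rho2) by (eapply Rlt_le_trans; [exact He|apply Rmin_l]).
assert (He2 : e < k * c1 / (C1 + 1)) by (eapply Rlt_le_trans; [exact He|apply Rmin_r]).
assert (HeC : e * C1 <= k * c1).
{ apply Rle_trans with (k * c1 / (C1 + 1) * (C1 + 1)); [|right; field; lra]. nra. }
set (phi := fun t => Rmin (X t - xb) (Rmin (xs + rho2 - X t) (Rmin (rho2 - Rabs (Y t - ys)) (rho2 - Rabs (Z t - zs))))).
assert (Hphic : forall t, a <= t <= T -> continuous phi t).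
{ intros t Ht. destruct (orbit_cont _ _ _ _ _ _ t Ho Ht) as [cX [cY cZ]].
  apply continuous_Rmin; [|apply continuous_Rmin; [|apply continuous_Rmin]].
  - now apply continuous_minus_const.
  - now apply continuous_const_minus.
  - apply continuous_const_minus. now apply continuous_Rabs_dist.
  - apply continuous_const_minus. now apply continuous_Rabs_dist. }
assert (Hest : forall t, a <= t <= T -> (forall u, a <= u <= t -> 0 <= phi u) ->
   Y t - F (X t) (Z t) e < 0 /\ Rabs (Y t - Y a) <= k * (xs - X t) /\
   Rabs (Z t - Z a) <= k * (xs - X t) /\ (a < t -> X t < xs) /\ xb <= X t <= xs).
{ intros t Ht Hu.
  assert (Hphi : forall s, a <= s <= t -> xb <= X s /\ (Y s - F (X s) (Z s) e <= - c1 /\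
    Rabs (g1 (X s) (Y s) (Z s) e) <= C1 /\ Rabs (g2 (X s) (Y s) (Z s) e) <= C1)).
  { intros s Hs. specialize (Hu s Hs). unfold phi in Hu.
    apply Rmin_nonneg_inv in Hu. destruct Hu as [U1 Hu]. apply Rmin_nonneg_inv in Hu. destruct Hu as [U2 Hu].
    apply Rmin_nonneg_inv in Hu. split; [lra|]. apply Hreg; lra. }
  assert (Hdisp : forall (u u' : R -> R), (forall s, a <= s <= t -> is_derive u s (u' s)) ->
    (forall s, a <= s <= t -> Rabs (u' s) <= e * C1) -> Rabs (u t - u a) <= k * (xs - X t)).
  { intros u u' Hd Hu'.
    replace (k * (xs - X t)) with (- (k * X t) - - (k * X a)) by (rewrite HXa; ring).
    apply (clock_bound u u' (fun s => - (k * X s)) (fun s => - (k * (Y s - F (X s) (Z s) e)))); [lra| | |]; auto.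
    - intros q Hq. apply (is_derive_opp (fun s => k * X s)). apply (is_derive_scal X q k). apply Ho; lra.
    - intros q Hq. eapply Rle_trans; [apply Hu'; auto|]. destruct (Hphi q Hq) as [_ [H _]]. nra. }
  destruct (Hphi t ltac:(lra)) as [H1 [H2 _]].
  split; [lra|]. split; [|split].
  - apply (Hdisp Y (fun s => e * g1 (X s) (Y s) (Z s) e)).
    + intros s Hs. apply Ho; lra.
    + intros s Hs. rewrite Rabs_mult, (Rabs_pos_eq e) by lra. apply Rmult_le_compat_l; [lra|]. now apply Hphi.
  - apply (Hdisp Z (fun s => e * g2 (X s) (Y s) (Z s) e)).
    + intros s Hs. apply Ho; lra.
    + intros s Hs. rewrite Rabs_mult, (Rabs_pos_eq e) by lra. apply Rmult_le_compat_l; [lra|]. now apply Hphi.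
  - assert (a < t -> X t < xs).
    { intros Hat. rewrite <- HXa. apply Ropp_lt_cancel.
      apply (deriv_pos_lt (fun s => - X s) (fun s => - (Y s - F (X s) (Z s) e))); auto.
      - intros s Hs. apply (is_derive_opp X). apply Ho; lra.
      - intros s Hs. destruct (Hphi s Hs) as [_ [H _]]. lra. }
    split; auto. split; auto. destruct (Req_dec a t) as [<-|]; [lra|]. left. apply H. lra. }
assert (Hgood : forall t, a <= t <= T -> (forall u, a <= u <= t -> 0 <= phi u) ->
  Y t - F (X t) (Z t) e < 0 /\ Rabs (Y t - Y a) + Rabs (Z t - Z a) <= kappa * (xs - X t) /\ (a < t -> X t < xs) /\ xb <= X t).
{ intros t Ht Hu. destruct (Hest t Ht Hu) as [H1 [H2 [H3 [H4 H5]]]].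
  split; auto. split; [|split; [auto|lra]].
  assert (k * (xs - X t) <= kappa / 2 * (xs - X t)) by (apply Rmult_le_compat_r; lra). lra. }
destruct (first_exit phi a T HaT Hphic) as [Hall|[t1 [Ht1 [Hz Hbef]]]].
{ unfold phi. rewrite HXa. repeat apply Rmin_glb_lt; lra. }
- exists T. split; [lra|]. split; [|now left].
  intros t Ht. apply Hgood; auto. intros u Hu. left. apply Hall. lra.
- assert (Hweak : forall u, a <= u <= t1 -> 0 <= phi u).
  { intros u Hu. destruct (Req_dec u t1) as [->|]; [lra|]. left; apply Hbef; lra. }
  exists t1. split; [lra|]. split.
  { intros t Ht. apply Hgood; [lra|]. intros u Hu. apply Hweak; lra. }
  right. destruct (Hest t1 ltac:(lra) Hweak) as [_ [H2 [H3 [H4 H5]]]].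
  assert (k * (xs - X t1) <= k * (xs - xb)) by (apply Rmult_le_compat_l; lra).
  unfold phi in Hz. apply Rmin_zero_inv in Hz. destruct Hz as [_ [_ [Hz|Hz]]]; [lra|].
  exfalso. apply Rmin_zero_inv in Hz. destruct Hz as [_ [_ [Hz|Hz]]]; [lra|].
  apply Rabs_le_between in H2, H3. apply Rabs_def2 in HYa, HZa.
  assert (Rabs (Y t1 - ys) < rho2) by (apply Rabs_def1; lra).
  assert (Rabs (Z t1 - zs) < rho2) by (apply Rabs_def1; lra).
  apply Rmin_zero_inv in Hz. destruct Hz as [_ [_ [Hz|Hz]]]; lra.
Qed.

Section SlowPhase.
Variable zp : R -> R.
Hypothesis Hzp : forall x, xA <= x <= xE -> is_derive zp x (R0 x (zp x)) /\ Rabs (zp x - z0) <= r / 2.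

Let K1 := mu * mu + 2 * C * (xE - xA).
Let K3 := (L * C + 2 * C) * sqrt K1 + 2 * C.

(** As long as the orbit has not crossed the fold the offset stays of order
    [sqrt epsilon], and with the offset as correction the slow variable shadows
    the reduced solution; both estimates are integrated along [x], whose speed is
    the offset. *)
Lemma slow_estimates e a b X Y Z :
  a <= b -> 0 < e <= r -> e <= 1 -> orbit e a b X Y Z ->
  (forall t, a <= t <= b -> near_S (X t) (Y t) (Z t) e /\ 0 <= Fx (X t) (Z t) e /\
     0 <= Y t - F (X t) (Z t) e) ->
  Y a - F (X a) (Z a) e <= mu * e ->
  Y b - F (X b) (Z b) e <= sqrt K1 * sqrt e /\
  Rabs (Z b - zp (X b)) <= exp (L * (xE - xA)) *
    (Rabs (Z a - zp (X a)) + C * (mu * e) + K3 * sqrt e * (xE - xA)) + C * (sqrt K1 * sqrt e).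
Proof.
intros Hab He He1 Ho Hreg Ha.
assert (Hmu := mu_pos). destruct HP as [Hord Hr Hrho Hc Hc2 HC HL _ _ HS Hb HR0 _ _ _ _ _ _].
assert (HK1 : 0 < K1) by (unfold K1; nra).
set (V := fun t => Y t - F (X t) (Z t) e).
set (A := fun t => g1 (X t) (Y t) (Z t) e - Fz (X t) (Z t) e * g2 (X t) (Y t) (Z t) e).
set (P := fun t => Fx (X t) (Z t) e).
assert (HV : forall t, a <= t <= b -> is_derive V t (e * A t - P t * V t)).
{ intros t Ht. now apply (is_derive_offset e a b). }
assert (HX : forall t, a <= t <= b -> is_derive X t (V t)) by (intros t Ht; apply Ho; auto).
assert (HVs : forall t, a <= t <= b -> V t <= sqrt K1 * sqrt e).
{ intros t Ht.
  assert (H := deriv_nonneg_le (fun t => 2 * e * C * X t - V t * V t)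
    (fun t => 2 * e * C * V t - ((e * A t - P t * V t) * V t + V t * (e * A t - P t * V t))) a t ltac:(lra)).
  assert (2 * e * C * X a - V a * V a <= 2 * e * C * X t - V t * V t).
  { apply H.
    - intros u Hu. apply (is_derive_minus (fun t => 2 * e * C * X t) (fun t => V t * V t)).
      + apply (is_derive_scal X u (2 * e * C) (V u)). apply HX; lra.
      + apply (is_derive_mult V V u); [apply HV; lra|apply HV; lra|intros; apply Rmult_comm].
    - intros u Hu. destruct (Hreg u ltac:(lra)) as [Hn [HPu HVu]].
      destruct (Hb _ _ _ _ Hn) as [_ [_ [_ [_ [[_ HA] _]]]]]. fold (A u) in HA.
      fold (P u) in HPu. fold (V u) in HVu.
      assert (0 <= e * V u) by nra. assert (0 <= P u * (V u * V u)) by (apply Rmult_le_pos; nra). nra. }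
  destruct (Hreg t Ht) as [[HXt _] [_ HVt]]. destruct (Hreg a ltac:(lra)) as [[HXa _] [_ HVa]].
  fold (V t) in HVt. fold (V a) in HVa, Ha.
  assert (V t * V t <= K1 * e).
  { assert (V a * V a <= (mu * e) * (mu * e)) by nra.
    assert ((mu * e) * (mu * e) <= mu * mu * e).
    { assert (0 <= mu * mu) by nra. assert (e * e <= e) by nra. nra. }
    assert (2 * e * C * (X t - X a) <= 2 * e * C * (xE - xA)) by (apply Rmult_le_compat_l; nra).
    unfold K1. nra. }
  rewrite <- sqrt_mult by lra. rewrite <- (sqrt_Rsqr (V t)) by auto.
  apply sqrt_le_1_alt. exact H1. }
split; [apply HVs; lra|].
set (Sg := fun t => S (X t) (Y t) (Z t) e).
assert (HSex : forall t, exists l, a <= t <= b -> is_derive Sg t l /\ Rabs l <= C * (V t + e)).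
{ intros t. destruct (classic (a <= t <= b)) as [Ht|Ht]; [|exists 0; tauto].
  destruct (Hreg t Ht) as [Hn [_ HVt]]. destruct (HS e a b X Y Z t Ho He Ht Hn) as [l [Hl1 Hl2]].
  exists l. intros _. split; auto. rewrite (Rabs_pos_eq (_ - _)) in Hl2 by exact HVt. exact Hl2. }
destruct (ClassicalEpsilon.constructive_indefinite_description
  (fun l : R -> R => forall t, a <= t <= b -> is_derive Sg t (l t) /\ Rabs (l t) <= C * (V t + e))) as [l Hl].
{ exists (fun t => proj1_sig (ClassicalEpsilon.constructive_indefinite_description _ (HSex t))).
  intros t. exact (proj2_sig (ClassicalEpsilon.constructive_indefinite_description _ (HSex t))). }
set (D := fun t => Z t - Sg t * V t - zp (X t)).
set (D' := fun t => V t * (Sg t * P t - l t - R0 (X t) (zp (X t)))).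
assert (HD : forall t, a <= t <= b -> is_derive D t (D' t)).
{ intros t Ht. destruct (Hl t Ht) as [Hl1 _]. destruct (Hreg t Ht) as [Hn _].
  destruct (Hb _ _ _ _ Hn) as [_ [_ [_ [_ [_ [HSA _]]]]]]. fold (A t) (Sg t) in HSA.
  replace (D' t) with (e * g2 (X t) (Y t) (Z t) e - (l t * V t + Sg t * (e * A t - P t * V t))
     - V t * R0 (X t) (zp (X t))) by (unfold D'; rewrite <- HSA; ring).
  apply (is_derive_minus (fun t => Z t - Sg t * V t) (fun t => zp (X t))).
  - apply (is_derive_minus Z (fun t => Sg t * V t)); [now apply Ho|].
    apply (is_derive_mult Sg V t); auto. intros; apply Rmult_comm.
  - apply (is_derive_comp zp X t (R0 (X t) (zp (X t))) (V t)); auto. apply Hzp. apply Hn. }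
assert (HsK : 0 <= sqrt K1 * sqrt e) by (apply Rmult_le_pos; apply sqrt_pos).
assert (Hse : e <= sqrt e).
{ rewrite <- (sqrt_Rsqr e) at 1 by lra. apply sqrt_le_1_alt. unfold Rsqr. nra. }
assert (HSV : forall t, a <= t <= b -> Rabs (Sg t * V t) <= C * V t).
{ intros t Ht. destruct (Hreg t Ht) as [Hn [_ HVt]]. fold (V t) in HVt.
  destruct (Hb _ _ _ _ Hn) as [_ [_ [_ [HSb _]]]]. fold (Sg t) in HSb.
  rewrite Rabs_mult, (Rabs_pos_eq (V t)) by auto. now apply Rmult_le_compat_r. }
assert (HK3 : 0 <= K3).
{ unfold K3. pose proof (sqrt_pos K1). assert (0 <= (L * C + 2 * C) * sqrt K1) by (apply Rmult_le_pos; nra). lra. }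
assert (HG := gronwall_clock D D' X V L (K3 * sqrt e) a b Hab HL).
assert (HXm : X a <= X b).
{ apply (deriv_nonneg_le X V); auto. intros t Ht. now apply Hreg. }
destruct (Hreg a ltac:(lra)) as [[HXa _] [_ HVa]]. destruct (Hreg b ltac:(lra)) as [[HXb _] [_ HVb]].
fold (V a) in HVa, Ha. fold (V b) in HVb.
assert (HDb : Rabs (D b) <= exp (L * (xE - xA)) * (Rabs (D a) + K3 * sqrt e * (xE - xA))).
{ eapply Rle_trans.
  - apply HG; auto.
    + apply Rmult_le_pos; [auto|apply sqrt_pos].
    + intros t Ht. now apply Hreg.
    + intros t Ht. destruct (Hreg t Ht) as [Hn [HPt HVt]]. fold (V t) in HVt. fold (P t) in HPt.
      destruct (Hb _ _ _ _ Hn) as [_ [_ [_ [_ [_ [_ [_ HSP]]]]]]].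
      fold (P t) (Sg t) (V t) in HSP. rewrite Rmax_left in HSP by auto.
      rewrite (Rabs_pos_eq (V t)) in HSP by auto.
      destruct (Hl t Ht) as [_ Hlt]. destruct Hn as [HXt [HZt _]].
      destruct (Hzp (X t) HXt) as [_ Hzpt].
      assert (HR := HR0 (X t) (Z t) (zp (X t)) HXt HZt ltac:(lra)).
      assert (HZD : Rabs (Z t - zp (X t)) <= Rabs (D t) + C * V t).
      { replace (Z t - zp (X t)) with (D t + Sg t * V t) by (unfold D; ring).
        eapply Rle_trans; [apply Rabs_triang|]. specialize (HSV t Ht). lra. }
      unfold D'. rewrite Rabs_mult, (Rabs_pos_eq (V t)) by auto.
      apply Rmult_le_compat_l; auto.
      replace (Sg t * P t - l t - R0 (X t) (zp (X t))) with
       ((Sg t * P t - R0 (X t) (Z t)) + (R0 (X t) (Z t) - R0 (X t) (zp (X t))) + - l t) by ring.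
      eapply Rle_trans; [apply Rabs_triang|]. rewrite Rabs_Ropp.
      eapply Rle_trans; [apply Rplus_le_compat_r, Rabs_triang|].
      assert (L * Rabs (Z t - zp (X t)) <= L * (Rabs (D t) + C * V t)) by (apply Rmult_le_compat_l; auto).
      assert (HVst := HVs t Ht).
      assert ((L * C + 2 * C) * V t <= (L * C + 2 * C) * (sqrt K1 * sqrt e)).
      { apply Rmult_le_compat_l; nra. }
      assert (2 * C * e <= 2 * C * sqrt e) by (apply Rmult_le_compat_l; lra).
      unfold K3. lra.
  - assert (exp (L * (X b - X a)) <= exp (L * (xE - xA))).
    { destruct (Req_dec (L * (X b - X a)) (L * (xE - xA))) as [->|]; [lra|].
      left. apply exp_increasing. nra. }
    assert (0 <= K3 * sqrt e) by (apply Rmult_le_pos; [auto|apply sqrt_pos]).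
    apply Rmult_le_compat; auto.
    + left; apply exp_pos.
    + pose proof (Rabs_pos (D a)). nra.
    + assert (K3 * sqrt e * (X b - X a) <= K3 * sqrt e * (xE - xA)) by (apply Rmult_le_compat_l; lra). lra. }
assert (HDa : Rabs (D a) <= Rabs (Z a - zp (X a)) + C * (mu * e)).
{ unfold D. replace (Z a - Sg a * V a - zp (X a)) with ((Z a - zp (X a)) + - (Sg a * V a)) by ring.
  eapply Rle_trans; [apply Rabs_triang|]. rewrite Rabs_Ropp.
  assert (HSVa := HSV a ltac:(lra)).
  assert (C * V a <= C * (mu * e)) by (apply Rmult_le_compat_l; lra). lra. }
replace (Z b - zp (X b)) with (D b + Sg b * V b) by (unfold D; ring).
eapply Rle_trans; [apply Rabs_triang|].
assert (HSVb := HSV b ltac:(lra)). assert (HVsb := HVs b ltac:(lra)).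
assert (C * V b <= C * (sqrt K1 * sqrt e)) by (apply Rmult_le_compat_l; lra).
assert (exp (L * (xE - xA)) * (Rabs (D a) + K3 * sqrt e * (xE - xA)) <=
  exp (L * (xE - xA)) * (Rabs (Z a - zp (X a)) + C * (mu * e) + K3 * sqrt e * (xE - xA))).
{ apply Rmult_le_compat_l; [left; apply exp_pos|lra]. }
lra.
Qed.

Definition offset (e : R) (X Y Z : R -> R) (t : R) : R := Y t - F (X t) (Z t) e.

Definition slow_at (e : R) (X Y Z : R -> R) (t : R) : Prop :=
  0 <= offset e X Y Z t /\ xA <= X t <= xE /\ Rabs (Z t - z0) <= r.

Lemma offset_cont e a b X Y Z t : orbit e a b X Y Z -> 0 < e <= r -> a <= t <= b ->
  continuous (offset e X Y Z) t.
Proof.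
intros Ho He Ht. apply (ex_derive_continuous (offset e X Y Z)).
eexists. now apply (is_derive_offset e a b).
Qed.

Lemma Fx_cont e a b X Y Z t : orbit e a b X Y Z -> 0 < e <= r -> a <= t <= b ->
  continuous (fun t => Fx (X t) (Z t) e) t.
Proof.
intros Ho He Ht. apply (ex_derive_continuous (fun t => Fx (X t) (Z t) e)).
eexists. now apply (fp_chain_Fx HP e a b X Y Z).
Qed.

(** Starting with offset [mu * e], the orbit can only stop following the attracting
    branch by crossing the fold: the offset cannot return to [mu * e / 2], where
    it increases, and the fold curve cannot be reached at its other end, since
    there [F_x] increases along the orbit. *)
Lemma slow_passage (kappa : R) : 0 < kappa -> exists eps1 kappa1, 0 < eps1 /\ 0 < kappa1 /\
  forall e a T X Y Z, 0 < e < eps1 -> a <= T -> orbit e a T X Y Z ->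
    xA <= X a < xE -> offset e X Y Z a = mu * e -> 0 < Fx (X a) (Z a) e ->
    Rabs (Z a - zp (X a)) < kappa1 ->
    exists tau, a <= tau <= T /\ (forall t, a <= t <= tau -> slow_at e X Y Z t) /\
      (tau = T \/
       (Fx (X tau) (Z tau) e = 0 /\ xM <= X tau < xE /\ mu * e / 2 <= offset e X Y Z tau <= kappa /\
        Rabs (Z tau - zp (X tau)) < kappa)).
Proof.
intros Hk. assert (Hmu := mu_pos). assert (HCmu := C_mu).
destruct (HP) as [Hord Hr Hrho Hc Hc2 HC HL _ _ _ Hb _ _ Hlow Hfold Hexit _ _].
assert (HK1 : 0 < K1) by (unfold K1; nra).
set (E := exp (L * (xE - xA))). assert (HE : 1 <= E).
{ unfold E. rewrite <- exp_0. destruct (Req_dec (L * (xE - xA)) 0) as [->|]; [lra|].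
  left; apply exp_increasing. nra. }
set (B := Rmin kappa (Rmin (r / 4) (rho / 4))).
assert (HB : 0 < B) by (repeat apply Rmin_glb_lt; lra).
assert (HB1 : B <= kappa) by min_le.
assert (HB2 : B <= r / 4) by min_le.
assert (HB3 : B <= rho / 4) by min_le.
assert (HK3 : 0 <= K3).
{ unfold K3. pose proof (sqrt_pos K1). assert (0 <= (L * C + 2 * C) * sqrt K1) by (apply Rmult_le_pos; nra). lra. }
set (Q := E * (C * mu + K3 * (xE - xA)) + C * sqrt K1 + sqrt K1 + 1).
assert (HQ : 1 <= Q).
{ unfold Q. pose proof (sqrt_pos K1). assert (0 <= C * mu + K3 * (xE - xA)) by nra.
  assert (0 <= E * (C * mu + K3 * (xE - xA))) by (apply Rmult_le_pos; lra). nra. }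
set (s1 := B / (4 * Q)). assert (Hs1 : 0 < s1) by (apply Rdiv_lt_0_compat; lra).
exists (Rmin (s1 * s1) (Rmin 1 (Rmin r (rho / (mu + 1))))), (B / (4 * E)).
split. { repeat apply Rmin_glb_lt; try nra. apply Rdiv_lt_0_compat; lra. }
split. { apply Rdiv_lt_0_compat; lra. }
intros e a T X Y Z [He0 He] HaT Ho HXa HVa HPa HZa.
assert (He1 : e < s1 * s1 /\ e < 1 /\ e < r /\ e < rho / (mu + 1)).
{ repeat split; eapply Rlt_le_trans; try exact He; [apply Rmin_l|
   eapply Rle_trans; [apply Rmin_r|apply Rmin_l]|
   eapply Rle_trans; [apply Rmin_r|]; eapply Rle_trans; [apply Rmin_r|apply Rmin_l]|
   eapply Rle_trans; [apply Rmin_r|]; eapply Rle_trans; [apply Rmin_r|apply Rmin_r]]. }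
destruct He1 as [He1 [He2 [He3 He4]]].
assert (Hse : sqrt e <= s1).
{ rewrite <- (sqrt_Rsqr s1) by lra. apply sqrt_le_1_alt. unfold Rsqr. lra. }
assert (Hee : e <= sqrt e).
{ rewrite <- (sqrt_Rsqr e) at 1 by lra. apply sqrt_le_1_alt. unfold Rsqr. nra. }
assert (HQs : Q * sqrt e <= B / 4).
{ apply Rle_trans with (Q * s1); [apply Rmult_le_compat_l; lra|]. unfold s1. right; field; lra. }
assert (Her : 0 < e <= r) by lra.
assert (Hmue : mu * e < rho).
{ apply Rle_lt_trans with ((mu + 1) * e); [nra|].
  apply Rlt_le_trans with ((mu + 1) * (rho / (mu + 1))); [apply Rmult_lt_compat_l; lra|right; field; lra]. }
assert (Hmue0 : 0 < mu * e) by nra.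
set (V := offset e X Y Z) in *.
set (P := fun t => Fx (X t) (Z t) e).
set (phi := fun t => Rmin (P t) (Rmin (r - Rabs (Z t - z0)) (Rmin (rho - V t) (Rmin (xE - X t) (V t - mu * e / 2))))).
assert (Hphic : forall t, a <= t <= T -> continuous phi t).
{ intros t Ht. destruct (orbit_cont _ _ _ _ _ _ t Ho Ht) as [cX [cY cZ]].
  assert (cV := offset_cont _ _ _ _ _ _ t Ho Her Ht).
  assert (cP := Fx_cont _ _ _ _ _ _ t Ho Her Ht).
  apply continuous_Rmin; [exact cP|apply continuous_Rmin; [|apply continuous_Rmin; [|apply continuous_Rmin]]].
  - apply continuous_const_minus. now apply continuous_Rabs_dist.
  - now apply continuous_const_minus.
  - now apply continuous_const_minus.
  - now apply continuous_minus_const. }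
assert (HE4 : E * (B / (4 * E)) = B / 4) by (field; lra).
assert (HzZa : Rabs (Z a - z0) < r).
{ replace (Z a - z0) with ((Z a - zp (X a)) + (zp (X a) - z0)) by ring.
  eapply Rle_lt_trans; [apply Rabs_triang|].
  destruct (Hzp (X a) ltac:(lra)) as [_ H].
  assert (B / (4 * E) <= B / 4).
  { apply Rmult_le_compat_l; [lra|]. apply Rinv_le_contravar; lra. }
  lra. }
(* the estimates available up to a time at which all constraints hold weakly *)
assert (Hest : forall t, a <= t <= T -> (forall u, a <= u <= t -> 0 <= phi u) ->
  V t <= B / 4 /\ Rabs (Z t - zp (X t)) <= B / 2).
{ intros t Ht Hu.
  assert (HXm : forall u, a <= u <= t -> X a <= X u).
  { intros u Hut. apply (deriv_nonneg_le X V); [lra| |].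
    - intros v Hv. apply Ho. lra.
    - intros v Hv. specialize (Hu v ltac:(lra)). unfold phi in Hu.
      repeat (apply Rmin_nonneg_inv in Hu; destruct Hu as [? Hu]). lra. }
  destruct (slow_estimates e a t X Y Z) as [H1 H2]; auto; try lra.
  - apply (orbit_sub e a T); auto; lra.
  - intros u Hut. specialize (HXm u Hut). specialize (Hu u Hut). unfold phi in Hu.
    apply Rmin_nonneg_inv in Hu; destruct Hu as [H1 Hu].
    apply Rmin_nonneg_inv in Hu; destruct Hu as [H2 Hu].
    apply Rmin_nonneg_inv in Hu; destruct Hu as [H3 Hu].
    apply Rmin_nonneg_inv in Hu; destruct Hu as [H4 H5].
    assert (0 <= V u) by lra.
    split; [|split]; auto. unfold near_S. fold (offset e X Y Z u). fold V.
    rewrite (Rabs_pos_eq (V u)) by auto. lra.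
  - right. exact HVa.
  - fold (offset e X Y Z t) in H1. fold V in H1. fold E in H2.
    pose proof (sqrt_pos K1). pose proof (sqrt_pos e).
    assert (0 <= C * mu + K3 * (xE - xA)) by nra.
    assert (0 <= E * (C * mu + K3 * (xE - xA))) by (apply Rmult_le_pos; lra).
    assert (sqrt K1 * sqrt e <= Q * sqrt e).
    { apply Rmult_le_compat_r; auto. unfold Q. nra. }
    split; [lra|].
    assert (E * Rabs (Z a - zp (X a)) <= B / 4).
    { rewrite <- HE4. apply Rmult_le_compat_l; lra. }
    assert (E * (C * (mu * e)) <= E * (C * mu * sqrt e)).
    { apply Rmult_le_compat_l; [lra|]. rewrite Rmult_assoc. apply Rmult_le_compat_l; [lra|].
      apply Rmult_le_compat_l; lra. }
    assert (E * (C * mu * sqrt e) + E * (K3 * sqrt e * (xE - xA)) + C * (sqrt K1 * sqrt e) <= Q * sqrt e).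
    { replace (E * (C * mu * sqrt e) + E * (K3 * sqrt e * (xE - xA)) + C * (sqrt K1 * sqrt e)) with
       ((E * (C * mu + K3 * (xE - xA)) + C * sqrt K1) * sqrt e) by ring.
      apply Rmult_le_compat_r; auto. unfold Q. lra. }
    lra. }
assert (Hgood : forall t, a <= t <= T -> (forall u, a <= u <= t -> 0 <= phi u) -> slow_at e X Y Z t).
{ intros t Ht Hu. unfold slow_at. fold V.
  assert (HXm : X a <= X t).
  { apply (deriv_nonneg_le X V); [lra| |].
    - intros v Hv. apply Ho. lra.
    - intros v Hv. specialize (Hu v ltac:(lra)). unfold phi in Hu.
      repeat (apply Rmin_nonneg_inv in Hu; destruct Hu as [? Hu]). lra. }
  specialize (Hu t ltac:(lra)). unfold phi in Hu.
  repeat (apply Rmin_nonneg_inv in Hu; destruct Hu as [? Hu]). repeat split; lra. }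
destruct (first_exit phi a T HaT Hphic) as [Hall|[tau [Htau [Hz Hbef]]]].
{ unfold phi. repeat apply Rmin_glb_lt; auto; try lra; unfold P; auto; fold V; rewrite HVa; lra. }
- exists T. split; [lra|]. split; [|now left].
  intros t Ht. apply Hgood; auto. intros u Hu. left. apply Hall. lra.
- assert (Hweak : forall u, a <= u <= tau -> 0 <= phi u).
  { intros u Hu. destruct (Req_dec u tau) as [->|]; [lra|]. left; apply Hbef; lra. }
  exists tau. split; [lra|]. split.
  { intros t Ht. apply Hgood; [lra|]. intros u Hu. apply Hweak; lra. }
  right. assert (Hslow := Hgood tau ltac:(lra) Hweak).
  destruct (Hest tau ltac:(lra) Hweak) as [HVt HZt]. destruct Hslow as [HVp [HXt HZr]]. fold V in HVp.
  assert (Hn : near_S (X tau) (Y tau) (Z tau) e).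
  { unfold near_S. fold (offset e X Y Z tau). fold V. rewrite (Rabs_pos_eq (V tau)) by lra. lra. }
  destruct (Hb _ _ _ _ Hn) as [_ [_ [HFxC [_ [[HAc _] [_ [HFxz _]]]]]]].
  assert (HVd := is_derive_offset e a T X Y Z tau Ho Her ltac:(lra)).
  fold (offset e X Y Z tau) in HVd.
  unfold phi in Hz. apply Rmin_zero_inv in Hz. destruct Hz as [HP0 [Hz' Hz]].
  apply Rmin_nonneg_inv in Hz' as Hz2. destruct Hz2 as [_ Hz2].
  apply Rmin_nonneg_inv in Hz2. destruct Hz2 as [_ Hz2].
  apply Rmin_nonneg_inv in Hz2. destruct Hz2 as [_ HVm].
  assert (HPz : P tau = 0).
  { destruct Hz as [Hz|Hz]; auto. exfalso.
    apply Rmin_zero_inv in Hz. destruct Hz as [_ [_ [Hz|Hz]]].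
    { destruct (Hzp (X tau) HXt) as [_ H].
      assert (Rabs (Z tau - z0) <= Rabs (Z tau - zp (X tau)) + Rabs (zp (X tau) - z0)).
      { replace (Z tau - z0) with ((Z tau - zp (X tau)) + (zp (X tau) - z0)) by ring. apply Rabs_triang. }
      lra. }
    apply Rmin_zero_inv in Hz. destruct Hz as [_ [_ [Hz|Hz]]]; [lra|].
    apply Rmin_zero_inv in Hz. destruct Hz as [_ [_ [Hz|Hz]]].
    { assert (Hx := Hexit (Z tau) e HZr Her). replace xE with (X tau) in Hx by lra. unfold P in HP0. lra. }
    assert (Hle := is_derive_first_zero (fun t => V t - mu * e / 2) a tau
      (e * (g1 (X tau) (Y tau) (Z tau) e - Fz (X tau) (Z tau) e * g2 (X tau) (Y tau) (Z tau) e)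
      - Fx (X tau) (Z tau) e * offset e X Y Z tau)).
    assert (e * (g1 (X tau) (Y tau) (Z tau) e - Fz (X tau) (Z tau) e * g2 (X tau) (Y tau) (Z tau) e)
      - Fx (X tau) (Z tau) e * offset e X Y Z tau <= 0).
    { apply Hle; try lra.
      - rewrite <- (Rminus_0_r (_ - _)). apply (is_derive_minus V (fun _ => mu * e / 2)); [exact HVd|].
        apply (is_derive_const (mu * e / 2)).
      - intros t Ht. specialize (Hbef t Ht). unfold phi in Hbef.
        repeat (apply Rmin_pos_inv in Hbef; destruct Hbef as [? Hbef]). exact Hbef. }
    fold V in H. replace (V tau) with (mu * e / 2) in H by lra.
    assert (Fx (X tau) (Z tau) e <= C) by (eapply Rle_trans; [apply Rle_abs|exact HFxC]).
    assert (Fx (X tau) (Z tau) e * (mu * e / 2) <= C * (mu * e / 2)) by (apply Rmult_le_compat_r; lra).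
    replace (C * (mu * e / 2)) with (c / 2 * e / 2) in H1 by (rewrite <- HCmu; field).
    nra. }
  split; [exact HPz|]. fold V.
  assert (HXE : X tau < xE).
  { destruct (Rle_lt_or_eq_dec (X tau) xE ltac:(lra)) as [|Heq]; auto. exfalso.
    assert (Hx := Hexit (Z tau) e HZr Her). rewrite <- Heq in Hx. unfold P in HPz. lra. }
  split; [|split; lra]. split; [|exact HXE].
  apply Rnot_lt_le. intros HXM.
  assert (HFxx : c2 <= Fxx (X tau) (Z tau) e).
  { destruct (Hlow (X tau) (Z tau) e ltac:(lra) HZr Her) as [H|H]; auto. unfold P in HPz. lra. }
  assert (Hle := is_derive_first_zero P a tau _ (proj1 Htau) (fp_chain_Fx HP e a T X Y Z tau Ho Her ltac:(lra)) ltac:(lra)).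
  assert (Hle' : Fxx (X tau) (Z tau) e * (Y tau - F (X tau) (Z tau) e) + Fxz (X tau) (Z tau) e * (e * g2 (X tau) (Y tau) (Z tau) e) <= 0).
  { apply Hle. intros t Ht. specialize (Hbef t Ht). unfold phi in Hbef. apply Rmin_pos_inv in Hbef. apply Hbef. }
  fold (offset e X Y Z tau) in Hle'. fold V in Hle'.
  apply Rabs_le_between in HFxz.
  assert (c2 * (mu * e / 2) <= Fxx (X tau) (Z tau) e * V tau) by (apply Rmult_le_compat; nra).
  assert (e * - (c2 * mu / 4) <= e * (Fxz (X tau) (Z tau) e * g2 (X tau) (Y tau) (Z tau) e)) by (apply Rmult_le_compat_l; lra).
  nra.
Qed.

(** Past the fold [F_x] decreases along the orbit, hence is negative, so that
    the offset grows at least like [sqrt (V0^2 + 2 c epsilon (x - x0))]. That square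
    root serves as a clock whose total increment is small, which freezes the slow
    variables until the orbit is at a fixed distance from the fold. *)
Lemma jump_passage (xc kappa : R) : xM <= xc <= xE -> Fx xc (zp xE) 0 = 0 -> 0 < kappa ->
  exists eps1 kappa1, 0 < eps1 /\ 0 < kappa1 /\
  forall e a T X Y Z, 0 < e < eps1 -> a <= T -> orbit e a T X Y Z ->
    Fx (X a) (Z a) e = 0 -> xM <= X a < xE -> mu * e / 2 <= offset e X Y Z a <= kappa1 ->
    Rabs (Z a - zp (X a)) < kappa1 ->
    exists tb, a <= tb <= T /\ (forall t, a <= t <= tb -> slow_at e X Y Z t) /\
      (tb = T \/
       (X tb = xE /\ Rabs (Z tb - zp xE) < kappa /\ Rabs (Y tb - F xc (zp xE) 0) < kappa)).
Proof.
intros Hxc Hcrit Hk. assert (Hmu := mu_pos).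
destruct (HP) as [Hord Hr Hrho Hc Hc2 HC HL _ _ _ Hb HR0 HFl _ Hfold Hexit Hosc Hmax].
set (E := exp (L * (xE - xA))). assert (HE : 1 <= E).
{ unfold E. rewrite <- exp_0. destruct (Req_dec (L * (xE - xA)) 0) as [->|]; [lra|].
  left; apply exp_increasing. nra. }
set (len := xE - xA). assert (Hlen : 0 < len) by (unfold len; lra).
(* w bounds the displacement of the slow variables *)
set (Q := 1 + E * (1 + (C + L) * len)). assert (HQ : 1 <= Q).
{ unfold Q. assert (0 <= (C + L) * len) by nra. nra. }
set (B := Rmin (kappa / 2) (Rmin (r / 4) (rho / 4))).
assert (HB : 0 < B) by (repeat apply Rmin_glb_lt; lra).
assert (HB1 : B <= kappa / 2) by min_le.
assert (HB2 : B <= r / 4) by min_le.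
assert (HB3 : B <= rho / 4) by min_le.
set (w := B / (8 * (C + 1) * Q)).
assert (Hw0 : 0 < w). { apply Rdiv_lt_0_compat; auto. apply Rmult_lt_0_compat; nra. }
assert (HwQ : (C + 1) * (Q * w) = B / 8) by (unfold w; field; lra).
assert (Hww : (C + 1) * w <= B / 8).
{ rewrite <- HwQ. apply Rmult_le_compat_l; [lra|]. nra. }
set (v := w * c / C). assert (Hv : 0 < v). { apply Rdiv_lt_0_compat; nra. }
assert (HvC : C / c * v = w) by (unfold v; field; lra).
set (k1 := Rmin (v / 2) w).
assert (Hk1 : 0 < k1) by (apply Rmin_glb_lt; lra).
assert (Hk1v : k1 <= v / 2) by min_le. assert (Hk1w : k1 <= w) by min_le.
exists (Rmin (v * v / (8 * c * len)) (Rmin r w)), k1.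
split. { repeat apply Rmin_glb_lt; auto. apply Rdiv_lt_0_compat; nra. }
split; auto.
intros e a T X Y Z [He0 He] HaT Ho HPa HXa HVa HZa.
assert (He1 : e < v * v / (8 * c * len) /\ e < r /\ e < w).
{ repeat split; eapply Rlt_le_trans; try exact He; [apply Rmin_l|
   eapply Rle_trans; [apply Rmin_r|apply Rmin_l]|
   eapply Rle_trans; [apply Rmin_r|apply Rmin_r]]. }
destruct He1 as [He1 [He2 He3]].
assert (Hev : 2 * e * c * len <= v * v / 4).
{ apply Rle_trans with (2 * (v * v / (8 * c * len)) * c * len); [|right; field; lra].
  repeat apply Rmult_le_compat_r; lra. }
assert (Her : 0 < e <= r) by lra.
set (V := offset e X Y Z) in *.
set (P := fun t => Fx (X t) (Z t) e).
set (phi := fun t => Rmin (r - Rabs (Z t - z0)) (Rmin (rho - V t) (Rmin (xE - X t) (V t - mu * e / 4)))).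
assert (Hme : 0 < mu * e) by nra.
assert (Hphic : forall t, a <= t <= T -> continuous phi t).
{ intros t Ht. destruct (orbit_cont _ _ _ _ _ _ t Ho Ht) as [cX [cY cZ]].
  assert (cV := offset_cont _ _ _ _ _ _ t Ho Her Ht).
  apply continuous_Rmin; [|apply continuous_Rmin; [|apply continuous_Rmin]].
  - apply continuous_const_minus. now apply continuous_Rabs_dist.
  - now apply continuous_const_minus.
  - now apply continuous_const_minus.
  - now apply continuous_minus_const. }
assert (Hsetup : forall t, a <= t <= T -> (forall u, a <= u <= t -> 0 <= phi u) ->
  (forall u, a <= u <= t -> X a <= X u /\ near_S (X u) (Y u) (Z u) e /\ P u <= 0 /\ 0 < V u)).
{ intros t Ht Hu.
  assert (Hdec : forall u, a <= u <= t -> X a <= X u /\ near_S (X u) (Y u) (Z u) e /\ 0 < V u /\ mu * e / 4 <= V u).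
  { intros u Hut.
    assert (X a <= X u).
    { apply (deriv_nonneg_le X V); [lra| |].
      - intros s Hs. apply Ho. lra.
      - intros s Hs. specialize (Hu s ltac:(lra)). unfold phi in Hu.
        repeat (apply Rmin_nonneg_inv in Hu; destruct Hu as [? Hu]). lra. }
    specialize (Hu u Hut). unfold phi in Hu.
    repeat (apply Rmin_nonneg_inv in Hu; destruct Hu as [? Hu]).
    split; auto. split; [|split; lra].
    unfold near_S. fold (offset e X Y Z u). fold V. rewrite (Rabs_pos_eq (V u)) by lra. lra. }
  intros u Hut. destruct (Hdec u Hut) as [H1 [H2 [H3 H4]]]. repeat split; auto; try apply H2.
  assert (P u <= P a); [|unfold P in *; lra].
  assert (- P a <= - P u); [|lra].
  apply (deriv_nonneg_le (fun s => - P s) (fun s => - (Fxx (X s) (Z s) e * V s + Fxz (X s) (Z s) e * (e * g2 (X s) (Y s) (Z s) e)))); [lra| |].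
  - intros s Hs. apply (is_derive_opp P). apply (fp_chain_Fx HP e a T X Y Z s); auto. lra.
  - intros s Hs. destruct (Hdec s ltac:(lra)) as [K4 [K5 [K6 K7]]].
    destruct (Hb _ _ _ _ K5) as [_ [_ [_ [_ [_ [_ [HFxz _]]]]]]].
    destruct K5 as [K51 [K52 _]].
    assert (Hf := Hfold (X s) (Z s) e ltac:(lra) K52 Her).
    apply Rabs_le_between in HFxz.
    assert (Fxx (X s) (Z s) e * V s <= - c2 * V s) by (apply Rmult_le_compat_r; lra).
    assert (c2 * (mu * e / 4) <= c2 * V s) by (apply Rmult_le_compat_l; lra).
    assert (e * (Fxz (X s) (Z s) e * g2 (X s) (Y s) (Z s) e) <= e * (c2 * mu / 4)) by (apply Rmult_le_compat_l; lra).
    nra. }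
assert (Hest : forall t, a <= t <= T -> (forall u, a <= u <= t -> 0 <= phi u) ->
  V a <= V t /\ Rabs (Z t - Z a) <= w /\ Rabs (Y t - Y a) <= w /\ Rabs (Z t - zp (X t)) <= Q * w + w).
{ intros t Ht Hu. assert (Hs := Hsetup t Ht Hu).
  set (A := fun s => g1 (X s) (Y s) (Z s) e - Fz (X s) (Z s) e * g2 (X s) (Y s) (Z s) e).
  assert (HVd : forall s, a <= s <= t -> is_derive V s (e * A s - P s * V s)).
  { intros s Hst. apply (is_derive_offset e a T); auto. lra. }
  assert (HA : forall s, a <= s <= t -> c <= A s).
  { intros s Hst. destruct (Hs s Hst) as [_ [Hn _]]. apply (Hb _ _ _ _ Hn). }
  assert (HVinc : forall s, a <= s <= t -> 0 <= e * A s - P s * V s /\ e * c <= e * A s - P s * V s).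
  { intros s Hst. destruct (Hs s Hst) as [_ [_ [H1 H2]]]. specialize (HA s Hst).
    assert (e * c <= e * A s) by (apply Rmult_le_compat_l; lra). assert (0 < e * c) by nra. nra. }
  set (W := fun s => sqrt (V a * V a + 2 * e * c * (X s - X a))).
  assert (HWp : forall s, a <= s <= t -> 0 < V a * V a + 2 * e * c * (X s - X a)).
  { intros s Hst. destruct (Hs s Hst) as [H1 _]. destruct (Hs a ltac:(lra)) as [_ [_ [_ H2]]].
    assert (0 < e * c) by nra. nra. }
  assert (HWV : forall s, a <= s <= t -> W s <= V s).
  { intros s Hst. unfold W. destruct (Hs s Hst) as [_ [_ [_ H2]]].
    rewrite <- (sqrt_Rsqr (V s)) by lra. apply sqrt_le_1_alt. unfold Rsqr.
    assert (H := deriv_nonneg_le (fun s => V s * V s - 2 * e * c * X s)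
      (fun s => ((e * A s - P s * V s) * V s + V s * (e * A s - P s * V s)) - 2 * e * c * V s) a s ltac:(lra)).
    cut (V a * V a - 2 * e * c * X a <= V s * V s - 2 * e * c * X s); [lra|]. apply H.
    - intros u Hus. apply (is_derive_minus (fun t => V t * V t) (fun t => 2 * e * c * X t)).
      + apply (is_derive_mult V V u); [apply HVd; lra|apply HVd; lra|intros; apply Rmult_comm].
      + apply (is_derive_scal X u (2 * e * c) (V u)). apply Ho; lra.
    - intros u Hus. destruct (Hs u ltac:(lra)) as [_ [_ [_ H3]]]. destruct (HVinc u ltac:(lra)) as [_ H4].
      assert (e * c * V u <= (e * A u - P u * V u) * V u) by (apply Rmult_le_compat_r; lra). lra. }
  assert (HWd : forall s, a <= s <= t -> is_derive W s (e * c * V s / W s)).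
  { intros s Hst. specialize (HWp s Hst).
    replace (e * c * V s / W s) with ((2 * e * c * V s) / (2 * sqrt (V a * V a + 2 * e * c * (X s - X a)))).
    2:{ unfold W. field. apply Rgt_not_eq, sqrt_lt_R0; auto. }
    assert (HXs : is_derive X s (V s)) by (apply Ho; lra).
    unfold W. auto_derive.
    - repeat split; auto. now exists (V s).
    - replace (Derive (fun x : R => X x) s) with (V s) by now symmetry; apply is_derive_unique.
      unfold Rminus in *. field. apply Rgt_not_eq, sqrt_lt_R0. exact HWp. }
  assert (HWe : forall s, a <= s <= t -> e * c <= e * c * V s / W s).
  { intros s Hst. assert (0 < W s) by (apply sqrt_lt_R0; auto). specialize (HWV s Hst).
    apply Rmult_le_reg_r with (W s); auto. unfold Rdiv. rewrite (Rmult_assoc _ (/ W s)), Rinv_l, Rmult_1_r by lra.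
    apply Rmult_le_compat_l; auto. nra. }
  assert (HWt : forall s, a <= s <= t -> W s <= v).
  { intros s Hst. unfold W. rewrite <- (sqrt_Rsqr v) by lra. apply sqrt_le_1_alt. unfold Rsqr.
    destruct (Hs a ltac:(lra)) as [_ [_ [_ H2]]].
    destruct (Hs s Hst) as [H1 [[H3 _] _]].
    assert (V a * V a <= v / 2 * (v / 2)) by (apply Rmult_le_compat; lra).
    assert (2 * e * c * (X s - X a) <= 2 * e * c * len).
    { apply Rmult_le_compat_l; [nra|unfold len; lra]. }
    assert (0 < v * v) by nra. lra. }
  assert (Hdisp : forall (u u' : R -> R), (forall s, a <= s <= t -> is_derive u s (u' s)) ->
    (forall s, a <= s <= t -> Rabs (u' s) <= e * C) -> forall s, a <= s <= t -> Rabs (u s - u a) <= w).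
  { intros u u' Hd Hu' s Hst.
    apply Rle_trans with (C / c * W s - C / c * W a).
    - apply (clock_bound u u' (fun s => C / c * W s) (fun s => C / c * (e * c * V s / W s))); [lra| | |].
      + intros q Hq; apply Hd; lra.
      + intros q Hq. apply (is_derive_scal W q (C / c)). apply HWd. lra.
      + intros q Hq. eapply Rle_trans; [apply Hu'; lra|].
        specialize (HWe q ltac:(lra)).
        replace (e * C) with (C / c * (e * c)) by (field; lra).
        apply Rmult_le_compat_l; auto. apply Rdiv_le_0_compat; lra.
    - assert (0 <= C / c * W a). { apply Rmult_le_pos; [apply Rdiv_le_0_compat; lra|apply sqrt_pos]. }
      assert (C / c * W s <= C / c * v); [|lra].
      apply Rmult_le_compat_l; [apply Rdiv_le_0_compat; lra|auto]. }
  assert (HZd : forall s, a <= s <= t -> Rabs (Z s - Z a) <= w).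
  { apply (Hdisp Z (fun s => e * g2 (X s) (Y s) (Z s) e)).
    - intros s Hst. apply Ho. lra.
    - intros s Hst. destruct (Hs s Hst) as [_ [Hn _]]. rewrite Rabs_mult, (Rabs_pos_eq e) by lra.
      apply Rmult_le_compat_l; [lra|]. apply (Hb _ _ _ _ Hn). }
  assert (HYd : forall s, a <= s <= t -> Rabs (Y s - Y a) <= w).
  { apply (Hdisp Y (fun s => e * g1 (X s) (Y s) (Z s) e)).
    - intros s Hst. apply Ho. lra.
    - intros s Hst. destruct (Hs s Hst) as [_ [Hn _]]. rewrite Rabs_mult, (Rabs_pos_eq e) by lra.
      apply Rmult_le_compat_l; [lra|]. apply (Hb _ _ _ _ Hn). }
  split.
  { apply (deriv_nonneg_le V (fun s => e * A s - P s * V s)); [lra|auto|]. intros s Hst. apply HVinc; auto. }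
  split; [apply HZd; lra|]. split; [apply HYd; lra|].
  assert (HG := gronwall_clock (fun s => Z a - zp (X s)) (fun s => - (V s * R0 (X s) (zp (X s)))) X V
     L ((C + L) * w) a t ltac:(lra) HL).
  cbv beta in HG.
  assert (HG' : Rabs (Z a - zp (X t)) <= exp (L * (X t - X a)) * (Rabs (Z a - zp (X a)) + (C + L) * w * (X t - X a))).
  { apply HG.
    - nra.
    - intros s Hst. destruct (Hs s Hst) as [_ [[HXs _] _]].
      rewrite <- (Rminus_0_l (V s * _)).
      apply (is_derive_minus (fun _ => Z a) (fun s => zp (X s))); [apply (is_derive_const (Z a))|].
      apply (is_derive_comp zp X s (R0 (X s) (zp (X s))) (V s)); [now apply Hzp|]. apply Ho; lra.
    - intros s Hst. apply Ho; lra.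
    - intros s Hst. left. now apply Hs.
    - intros s Hst. destruct (Hs s Hst) as [_ [[HXs [HZs Hn3]] [HPs HVs]]].
      rewrite Rabs_Ropp, Rabs_mult, (Rabs_pos_eq (V s)) by lra.
      apply Rmult_le_compat_l; [lra|].
      destruct (Hzp (X s) HXs) as [_ Hzps].
      assert (HR := HR0 (X s) (zp (X s)) (Z s) HXs ltac:(lra) HZs).
      assert (HRz : Rabs (R0 (X s) (Z s)) <= C * e).
      { assert (Hnz : near_S (X s) (F (X s) (Z s) e) (Z s) e).
        { unfold near_S. rewrite Rminus_diag, Rabs_R0. lra. }
        destruct (Hb _ _ _ _ Hnz) as [_ [_ [_ [_ [_ [_ [_ H]]]]]]].
        rewrite Rmax_right in H by exact HPs. rewrite Rminus_diag, Rabs_R0, Rmult_0_r, Rplus_0_l in H.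
        rewrite <- Rabs_Ropp. replace (- R0 (X s) (Z s)) with (0 - R0 (X s) (Z s)) by ring. exact H. }
      replace (R0 (X s) (zp (X s))) with ((R0 (X s) (zp (X s)) - R0 (X s) (Z s)) + R0 (X s) (Z s)) by ring.
      eapply Rle_trans; [apply Rabs_triang|].
      assert (Rabs (zp (X s) - Z s) <= Rabs (Z a - zp (X s)) + w).
      { replace (zp (X s) - Z s) with (- ((Z a - zp (X s)) + (Z s - Z a))) by ring.
        rewrite Rabs_Ropp. eapply Rle_trans; [apply Rabs_triang|]. specialize (HZd s Hst). lra. }
      assert (L * Rabs (zp (X s) - Z s) <= L * (Rabs (Z a - zp (X s)) + w)) by (apply Rmult_le_compat_l; auto).
      assert (C * e <= C * w) by (apply Rmult_le_compat_l; lra). lra. }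
  destruct (Hs t ltac:(lra)) as [HXat [[HXt _] _]].
  assert (exp (L * (X t - X a)) <= E).
  { unfold E. destruct (Req_dec (L * (X t - X a)) (L * (xE - xA))) as [->|]; [lra|].
    left. apply exp_increasing. assert (L * (X t - X a) <= L * (xE - xA)) by (apply Rmult_le_compat_l; lra). lra. }
  assert (Hlast : exp (L * (X t - X a)) * (Rabs (Z a - zp (X a)) + (C + L) * w * (X t - X a)) <= E * (w + (C + L) * w * len)).
  { apply Rmult_le_compat; auto.
    - left; apply exp_pos.
    - pose proof (Rabs_pos (Z a - zp (X a))). assert (0 <= (C + L) * w * (X t - X a)) by (apply Rmult_le_pos; nra). lra.
    - assert ((C + L) * w * (X t - X a) <= (C + L) * w * len); [|lra].
      apply Rmult_le_compat_l; [nra|]. unfold len; lra. }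
  replace (Z t - zp (X t)) with ((Z a - zp (X t)) + (Z t - Z a)) by ring.
  eapply Rle_trans; [apply Rabs_triang|]. specialize (HZd t ltac:(lra)).
  assert (E * (w + (C + L) * w * len) <= Q * w) by (unfold Q; nra). lra. }
assert (Hgood : forall t, a <= t <= T -> (forall u, a <= u <= t -> 0 <= phi u) -> slow_at e X Y Z t).
{ intros t Ht Hu. destruct (Hsetup t Ht Hu t ltac:(lra)) as [H1 [[H2 [H3 _]] [_ H4]]].
  unfold slow_at. fold V. repeat split; lra. }
assert (HX00 : Rabs (Z a - z0) < r).
{ replace (Z a - z0) with ((Z a - zp (X a)) + (zp (X a) - z0)) by ring.
  eapply Rle_lt_trans; [apply Rabs_triang|]. destruct (Hzp (X a) ltac:(lra)) as [_ H].
  assert (w <= B / 8) by nra. lra. }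
assert (HwB : w <= B / 8) by nra.
assert (HQwB : Q * w <= B / 8). { rewrite <- HwQ. assert (0 < Q * w) by nra. nra. }
destruct (first_exit phi a T HaT Hphic) as [Hall|[tb [Htb [Hz Hbef]]]].
{ unfold phi. repeat apply Rmin_glb_lt; auto; lra. }
- exists T. split; [lra|]. split; [|now left].
  intros t Ht. apply Hgood; auto. intros u Hu. left. apply Hall. lra.
- assert (Hweak : forall u, a <= u <= tb -> 0 <= phi u).
  { intros u Hu. destruct (Req_dec u tb) as [->|]; [lra|]. left; apply Hbef; lra. }
  exists tb. split; [lra|]. split.
  { intros t Ht. apply Hgood; [lra|]. intros u Hu. apply Hweak; lra. }
  right. destruct (Hest tb ltac:(lra) Hweak) as [HVt [HZt [HYt HZp]]].
  destruct (Hsetup tb ltac:(lra) Hweak tb ltac:(lra)) as [HXat [[HXt [HZr _]] [_ HVpos]]].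
  assert (HZa0 : Rabs (Z a - z0) <= r) by lra.
  assert (HXE : X tb = xE).
  { unfold phi in Hz. apply Rmin_zero_inv in Hz. destruct Hz as [_ [_ [Hz|Hz]]].
    { destruct (Hzp (X tb) HXt) as [_ H].
      assert (Rabs (Z tb - z0) <= Rabs (Z tb - zp (X tb)) + Rabs (zp (X tb) - z0)).
      { replace (Z tb - z0) with ((Z tb - zp (X tb)) + (zp (X tb) - z0)) by ring. apply Rabs_triang. }
      lra. }
    apply Rmin_zero_inv in Hz. destruct Hz as [_ [_ [Hz|Hz]]].
    { exfalso.
      assert (H1 := Hosc (X a) (X tb) (Z a) e ltac:(lra) ltac:(lra) HZa0 Her).
      assert (H2 := HFl (X tb) (Z a) (Z tb) e e HXt HZa0 HZr ltac:(lra) ltac:(lra)).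
      rewrite Rminus_diag, Rabs_R0, Rplus_0_r in H2.
      assert (C * Rabs (Z a - Z tb) <= C * w) by (apply Rmult_le_compat_l; [lra|rewrite Rabs_minus_sym; auto]).
      unfold V, offset in Hz, HVa. apply Rabs_le_between in HYt, H1, H2. nra. }
    apply Rmin_zero_inv in Hz. destruct Hz as [_ [_ [Hz|Hz]]]; lra. }
  split; auto. rewrite <- HXE at 1. split; [lra|].
  assert (Hze : Rabs (zp xE - z0) <= r) by (destruct (Hzp xE ltac:(lra)); lra).
  (* at the crossing of the fold both points maximise F in x, and the maximum is Lipschitz in z *)
  set (ze := zp xE) in *.
  assert (HZze : Rabs (Z a - ze) <= 2 * w + Q * w).
  { replace (Z a - ze) with (- (Z tb - Z a) + (Z tb - ze)) by ring.
    eapply Rle_trans; [apply Rabs_triang|]. rewrite Rabs_Ropp. unfold ze in *. rewrite HXE in HZp. lra. }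
  assert (M1 := Hmax (X a) xc (Z a) e ltac:(lra) Hxc HZa0 ltac:(lra) HPa).
  assert (M2 := Hmax xc (X a) ze 0 Hxc ltac:(lra) Hze ltac:(lra) Hcrit).
  assert (L1 := HFl xc (Z a) ze e 0 ltac:(lra) HZa0 Hze ltac:(lra) ltac:(lra)).
  assert (L2 := HFl (X a) (Z a) ze e 0 ltac:(lra) HZa0 Hze ltac:(lra) ltac:(lra)).
  rewrite Rminus_0_r, (Rabs_pos_eq e) in L1, L2 by lra.
  assert (C * (Rabs (Z a - ze) + e) <= C * (3 * w + Q * w)) by (apply Rmult_le_compat_l; lra).
  assert (C * (3 * w + Q * w) <= 4 * (B / 8)).
  { assert (w <= Q * w) by nra. replace (4 * (B / 8)) with (4 * ((C + 1) * (Q * w))) by (rewrite HwQ; ring). nra. }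
  unfold V, offset in HVa. apply Rabs_le_between in HYt, L1, L2.
  apply Rabs_def1; lra.
Qed.

Section Arrival.
Variables (xl zs ys xs k0 : R).
Hypothesis Hxl : xA < xl < xM.
Hypothesis Hzs : zp xl = zs.
Hypothesis Hys : F xl zs 0 = ys.
Hypothesis Hk0 : 0 < k0.
Hypothesis HFx0 : forall x z e, Rabs (x - xl) <= k0 -> Rabs (z - zs) <= k0 -> 0 <= e <= k0 -> 0 < Fx x z e.
Hypothesis HFder : forall x, Rabs (x - xl) <= k0 -> is_derive (fun x => F x zs 0) x (Fx x zs 0).

(** Near the landing point the offset is negative and increases at least at the
    rate [c * epsilon / 2] until it reaches [mu * epsilon]. It serves as the clock:
    the slow variables move by at most a multiple of its increment. *)
Lemma arrival (kappa : R) : 0 < kappa -> exists kappa1 eps1 rho1,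
  0 < kappa1 < kappa /\ 0 < eps1 /\ 0 < rho1 /\
  forall e a T X Y Z, 0 < e < eps1 -> a <= T -> orbit e a T X Y Z ->
    X a = xl + kappa1 -> Rabs (Y a - ys) < rho1 -> Rabs (Z a - zs) < rho1 ->
    offset e X Y Z a < mu * e ->
    exists t2, a <= t2 <= T /\
      (forall t, a <= t <= t2 -> Rabs (X t - xl) <= kappa /\ Rabs (Y t - ys) <= kappa /\
         Rabs (Z t - zs) <= kappa /\ Rabs (Z t - z0) <= r /\ xA <= X t < xE) /\
      (t2 = T \/ (offset e X Y Z t2 = mu * e /\ 0 < Fx (X t2) (Z t2) e)).
Proof.
intros Hk. assert (Hmu := mu_pos). assert (HCmu := C_mu).
destruct (HP) as [Hord Hr Hrho Hc Hc2 HC HL _ _ _ Hb _ HFl _ _ _ _ _].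
set (k := Rmin (kappa / 2) (Rmin k0 (Rmin (r / 4) (Rmin ((xl - xA) / 2) ((xE - xl) / 2))))).
assert (Hkk : 0 < k) by (repeat apply Rmin_glb_lt; lra).
assert (Hk1 : k <= kappa / 2) by min_le.
assert (Hk2 : k <= k0) by min_le.
assert (Hk3 : k <= r / 4) by (eapply Rle_trans; [apply Rmin_r|]; eapply Rle_trans; [apply Rmin_r|apply Rmin_l]).
assert (Hk4 : k <= (xl - xA) / 2) by min_le.
assert (Hk5 : k <= (xE - xl) / 2) by (do 4 (eapply Rle_trans; [apply Rmin_r|]); lra).
assert (Hzsr : Rabs (zs - z0) <= r / 2) by (rewrite <- Hzs; apply Hzp; lra).
assert (Hup : ys < F (xl + k) zs 0).
{ rewrite <- Hys. apply (deriv_pos_lt (fun x => F x zs 0) (fun x => Fx x zs 0)); [lra| |].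
  - intros x Hx. apply HFder. apply Rabs_le; lra.
  - intros x Hx. apply HFx0; [apply Rabs_le; lra| |lra]. rewrite Rminus_diag, Rabs_R0; lra. }
assert (Hdn : F (xl - k) zs 0 < ys).
{ rewrite <- Hys. apply (deriv_pos_lt (fun x => F x zs 0) (fun x => Fx x zs 0)); [lra| |].
  - intros x Hx. apply HFder. apply Rabs_le; lra.
  - intros x Hx. apply HFx0; [apply Rabs_le; lra| |lra]. rewrite Rminus_diag, Rabs_R0; lra. }
set (m2 := Rmin (F (xl + k) zs 0 - ys) (ys - F (xl - k) zs 0)).
assert (Hm2 : 0 < m2) by (apply Rmin_glb_lt; lra).
assert (Hm2a : m2 <= F (xl + k) zs 0 - ys) by min_le.
assert (Hm2b : m2 <= ys - F (xl - k) zs 0) by min_le.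
set (del := Rmin (k / 4) (Rmin (rho / 2) (m2 / (8 * (C + 1))))).
assert (Hdel : 0 < del). { repeat apply Rmin_glb_lt; try lra. apply Rdiv_lt_0_compat; lra. }
assert (Hd1 : del <= k / 4) by min_le.
assert (Hd2 : del <= rho / 2) by min_le.
assert (Hd3 : 8 * (C + 1) * del <= m2).
{ apply Rle_trans with (8 * (C + 1) * (m2 / (8 * (C + 1)))); [|right; field; lra].
  apply Rmult_le_compat_l; [lra|]. eapply Rle_trans; [apply Rmin_r|apply Rmin_r]. }
set (v0 := Rmin del (c * del / (4 * C))).
assert (Hv0 : 0 < v0). { apply Rmin_glb_lt; auto. apply Rdiv_lt_0_compat; nra. }
assert (Hv1 : v0 <= del) by min_le.
assert (Hv2 : 2 * C / c * v0 <= del / 2).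
{ apply Rle_trans with (2 * C / c * (c * del / (4 * C))); [|right; field; lra].
  apply Rmult_le_compat_l; [|apply Rmin_r]. apply Rdiv_le_0_compat; lra. }
assert (Hcont : continuous (fun x => F x zs 0) xl).
{ apply (ex_derive_continuous (fun x => F x zs 0)). exists (Fx xl zs 0). apply HFder.
  rewrite Rminus_diag, Rabs_R0; lra. }
destruct (proj1 (filterlim_locally _ _) Hcont (mkposreal (v0 / 4) ltac:(lra))) as [eta Heta].
set (kappa1 := Rmin (k / 2) (eta / 2)). pose proof (cond_pos eta) as Hetap.
assert (Hkp : 0 < kappa1) by (apply Rmin_glb_lt; lra).
assert (Hkp1 : kappa1 <= k / 2) by min_le. assert (Hkp2 : kappa1 <= eta / 2) by min_le.
assert (HFk : Rabs (F (xl + kappa1) zs 0 - ys) < v0 / 4).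
{ rewrite <- Hys. apply (Heta (xl + kappa1)). change (Rabs (xl + kappa1 - xl) < eta).
  replace (xl + kappa1 - xl) with kappa1 by ring. rewrite Rabs_pos_eq; lra. }
clear Heta Hcont.
set (eps1 := Rmin (v0 / (4 * (C + 1))) (Rmin (v0 / (mu + 1)) (Rmin r k0))).
set (rho1 := v0 / (4 * (C + 1))).
assert (Hrho1 : 0 < rho1) by (apply Rdiv_lt_0_compat; lra).
assert (Hrho1C : (C + 1) * rho1 = v0 / 4) by (unfold rho1; field; lra).
exists kappa1, eps1, rho1. split; [lra|]. split.
{ repeat apply Rmin_glb_lt; auto. apply Rdiv_lt_0_compat; lra. }
split; auto.
intros e a T X Y Z [He0 He] HaT Ho HXa HYa HZa HVa.
assert (He1 : e < rho1) by (eapply Rlt_le_trans; [exact He|apply Rmin_l]).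
assert (He2 : e < v0 / (mu + 1)) by (eapply Rlt_le_trans; [exact He|]; eapply Rle_trans; [apply Rmin_r|apply Rmin_l]).
assert (He3 : e < r) by (eapply Rlt_le_trans; [exact He|]; do 2 (eapply Rle_trans; [apply Rmin_r|]); apply Rmin_l).
assert (He4 : e < k0) by (eapply Rlt_le_trans; [exact He|]; do 2 (eapply Rle_trans; [apply Rmin_r|]); apply Rmin_r).
assert (Hmue : 0 < mu * e <= v0).
{ split; [nra|]. apply Rle_trans with ((mu + 1) * (v0 / (mu + 1))); [|right; field; lra].
  apply Rle_trans with ((mu + 1) * e); [nra|]. apply Rmult_le_compat_l; lra. }
assert (Her : 0 < e <= r) by lra.
assert (Hrv : rho1 <= v0 / 4) by nra.
assert (HZa0 : Rabs (Z a - z0) <= r).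
{ replace (Z a - z0) with ((Z a - zs) + (zs - z0)) by ring. eapply Rle_trans; [apply Rabs_triang|]. lra. }
set (V := offset e X Y Z) in *.
assert (HVab : - v0 <= V a).
{ assert (H1 := HFl (xl + kappa1) (Z a) zs e 0 ltac:(lra) HZa0 ltac:(lra) ltac:(lra) ltac:(lra)).
  rewrite Rminus_0_r, (Rabs_pos_eq e) in H1 by lra.
  assert (C * (Rabs (Z a - zs) + e) <= C * (2 * rho1)) by (apply Rmult_le_compat_l; lra).
  unfold V, offset. rewrite HXa. apply Rabs_le_between in H1. apply Rabs_def2 in HYa, HFk. nra. }
set (phi := fun t => Rmin (k - Rabs (X t - xl)) (Rmin (k - Rabs (Z t - zs)) (Rmin (V t + 2 * del) (mu * e - V t)))).
assert (Hphic : forall t, a <= t <= T -> continuous phi t).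
{ intros t Ht. destruct (orbit_cont _ _ _ _ _ _ t Ho Ht) as [cX [cY cZ]].
  assert (cV := offset_cont _ _ _ _ _ _ t Ho Her Ht).
  apply continuous_Rmin; [|apply continuous_Rmin; [|apply continuous_Rmin]].
  - apply continuous_const_minus. now apply continuous_Rabs_dist.
  - apply continuous_const_minus. now apply continuous_Rabs_dist.
  - apply (continuous_plus V (fun _ => 2 * del)); auto. apply continuous_const.
  - now apply continuous_const_minus. }
assert (Hest : forall t, a <= t <= T -> (forall u, a <= u <= t -> 0 <= phi u) ->
  Rabs (V t) <= del /\ Rabs (Y t - ys) <= 2 * del /\ Rabs (Z t - zs) <= 2 * del /\
  Rabs (X t - xl) <= k /\ 0 < Fx (X t) (Z t) e).
{ intros t Ht Hu.
  set (A := fun s => g1 (X s) (Y s) (Z s) e - Fz (X s) (Z s) e * g2 (X s) (Y s) (Z s) e).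
  set (V' := fun s => e * A s - Fx (X s) (Z s) e * V s).
  assert (HVd : forall s, a <= s <= t -> is_derive V s (V' s)).
  { intros s Hs. apply (is_derive_offset e a T); auto; lra. }
  assert (Hbox : forall s, a <= s <= t -> Rabs (X s - xl) <= k /\ Rabs (Z s - zs) <= k /\ V s <= mu * e /\
     0 < Fx (X s) (Z s) e /\ near_S (X s) (Y s) (Z s) e).
  { intros s Hs. specialize (Hu s Hs). unfold phi in Hu.
    apply Rmin_nonneg_inv in Hu. destruct Hu as [U1 Hu]. apply Rmin_nonneg_inv in Hu. destruct Hu as [U2 Hu].
    apply Rmin_nonneg_inv in Hu. destruct Hu as [U3 U4].
    assert (HX : Rabs (X s - xl) <= k) by lra. assert (HX' := proj1 (Rabs_le_between _ _) HX).
    split; [lra|]. split; [lra|]. split; [lra|]. split; [apply HFx0; lra|].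
    unfold near_S. fold (offset e X Y Z s). fold V. split; [lra|]. split; [|split; [|lra]].
    - replace (Z s - z0) with ((Z s - zs) + (zs - z0)) by ring. eapply Rle_trans; [apply Rabs_triang|]. lra.
    - apply Rabs_le. lra. }
  assert (HVinc : forall s, a <= s <= t -> e * c / 2 <= V' s).
  { intros s Hs. destruct (Hbox s Hs) as [_ [_ [B1 [B2 Hn]]]].
    destruct (Hb _ _ _ _ Hn) as [_ [_ [B3 [_ [[B4 _] _]]]]]. fold (A s) in B4.
    rewrite Rabs_pos_eq in B3 by lra.
    assert (e * c <= e * A s) by (apply Rmult_le_compat_l; lra).
    assert (Fx (X s) (Z s) e * V s <= C * (mu * e)).
    { destruct (Rle_lt_dec (V s) 0).
      - assert (0 <= C * (mu * e)) by nra. nra.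
      - apply Rmult_le_compat; lra. }
    replace (C * (mu * e)) with (c / 2 * e) in H0 by (rewrite <- HCmu; ring). unfold V'. lra. }
  assert (Hec : 0 < e * c) by nra.
  assert (HVmono : forall s, a <= s <= t -> V a <= V s).
  { intros s Hs. apply (deriv_nonneg_le V V'); [lra| |].
    - intros u Hus. apply HVd; lra.
    - intros u Hus. specialize (HVinc u ltac:(lra)). lra. }
  assert (Hdisp : forall (u u' : R -> R), (forall s, a <= s <= t -> is_derive u s (u' s)) ->
    (forall s, a <= s <= t -> Rabs (u' s) <= e * C) -> Rabs (u t - u a) <= del).
  { intros u u' Hd Hu'.
    apply Rle_trans with (2 * C / c * V t - 2 * C / c * V a).
    - apply (clock_bound u u' (fun s => 2 * C / c * V s) (fun s => 2 * C / c * V' s)); [lra| | |]; auto.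
      + intros q Hq. apply (is_derive_scal V q (2 * C / c)). auto.
      + intros q Hq. eapply Rle_trans; [apply Hu'; auto|]. specialize (HVinc q Hq).
        replace (e * C) with (2 * C / c * (e * c / 2)) by (field; lra).
        apply Rmult_le_compat_l; auto. apply Rdiv_le_0_compat; lra.
    - destruct (Hbox t ltac:(lra)) as [_ [_ [HVt _]]].
      assert (2 * C / c * (V t - V a) <= 2 * C / c * (2 * v0)).
      { apply Rmult_le_compat_l; [apply Rdiv_le_0_compat; lra|lra]. }
      lra. }
  assert (HZt : Rabs (Z t - Z a) <= del).
  { apply (Hdisp Z (fun s => e * g2 (X s) (Y s) (Z s) e)).
    - intros s Hs. apply Ho; lra.
    - intros s Hs. destruct (Hbox s Hs) as [_ [_ [_ [_ Hn]]]]. rewrite Rabs_mult, (Rabs_pos_eq e) by lra.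
      apply Rmult_le_compat_l; [lra|]. apply (Hb _ _ _ _ Hn). }
  assert (HYt : Rabs (Y t - Y a) <= del).
  { apply (Hdisp Y (fun s => e * g1 (X s) (Y s) (Z s) e)).
    - intros s Hs. apply Ho; lra.
    - intros s Hs. destruct (Hbox s Hs) as [_ [_ [_ [_ Hn]]]]. rewrite Rabs_mult, (Rabs_pos_eq e) by lra.
      apply Rmult_le_compat_l; [lra|]. apply (Hb _ _ _ _ Hn). }
  destruct (Hbox t ltac:(lra)) as [B1 [B2 [B3 [B4 _]]]].
  specialize (HVmono t ltac:(lra)).
  split; [apply Rabs_le; lra|].
  apply Rabs_le_between in HYt, HZt. apply Rabs_def2 in HYa, HZa.
  split; [apply Rabs_le; lra|]. split; [apply Rabs_le; lra|]. split; auto. }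
assert (Hgood : forall t, a <= t <= T -> (forall u, a <= u <= t -> 0 <= phi u) ->
  Rabs (X t - xl) <= kappa /\ Rabs (Y t - ys) <= kappa /\ Rabs (Z t - zs) <= kappa /\
  Rabs (Z t - z0) <= r /\ xA <= X t < xE).
{ intros t Ht Hu. destruct (Hest t Ht Hu) as [H1 [H2 [H3 [H4 _]]]].
  assert (H4' := proj1 (Rabs_le_between _ _) H4).
  split; [lra|]. split; [lra|]. split; [lra|]. split; [|lra].
  replace (Z t - z0) with ((Z t - zs) + (zs - z0)) by ring. eapply Rle_trans; [apply Rabs_triang|]. lra. }
destruct (first_exit phi a T HaT Hphic) as [Hall|[t2 [Ht2 [Hz Hbef]]]].
{ unfold phi. rewrite HXa. replace (xl + kappa1 - xl) with kappa1 by ring.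
  rewrite Rabs_pos_eq by lra. repeat apply Rmin_glb_lt; lra. }
- exists T. split; [lra|]. split; [|now left].
  intros t Ht. apply Hgood; auto. intros u Hu. left. apply Hall. lra.
- assert (Hweak : forall u, a <= u <= t2 -> 0 <= phi u).
  { intros u Hu. destruct (Req_dec u t2) as [->|]; [lra|]. left; apply Hbef; lra. }
  exists t2. split; [lra|]. split.
  { intros t Ht. apply Hgood; [lra|]. intros u Hu. apply Hweak; lra. }
  right. destruct (Hest t2 ltac:(lra) Hweak) as [H1 [H2 [H3 [H4 H5]]]].
  destruct (Hgood t2 ltac:(lra) Hweak) as [_ [_ [_ [HZr HXr]]]].
  split; auto. apply Rabs_le_between in H1.
  unfold phi in Hz. apply Rmin_zero_inv in Hz. destruct Hz as [_ [_ [Hz|Hz]]].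
  { exfalso.
    assert (H6 := HFl (X t2) (Z t2) zs e 0 ltac:(lra) HZr ltac:(lra) ltac:(lra) ltac:(lra)).
    rewrite Rminus_0_r, (Rabs_pos_eq e) in H6 by lra.
    assert (C * (Rabs (Z t2 - zs) + e) <= C * (3 * del)) by (apply Rmult_le_compat_l; lra).
    apply Rabs_le_between in H2, H6. unfold V, offset in H1.
    assert (Rabs (X t2 - xl) = k) by lra.
    assert (X t2 = xl + k \/ X t2 = xl - k) as [E|E].
    { revert H0. unfold Rabs. destruct Rcase_abs; lra. }
    - rewrite E in *. nra.
    - rewrite E in *. nra. }
  apply Rmin_zero_inv in Hz. destruct Hz as [_ [_ [Hz|Hz]]]; [lra|].
  apply Rmin_zero_inv in Hz. destruct Hz as [_ [_ [Hz|Hz]]]; fold V; lra.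
Qed.

(** The four phases follow one another. Each tolerance is fixed by the phase that comes
    after it, and epsilon is chosen last. *)
Theorem half_passage (xc kappa : R) :
  xM <= xc <= xE -> Fx xc (zp xE) 0 = 0 -> xl < xs -> 0 < kappa ->
  (forall xb, xl < xb < xs -> exists c1 rho2 C1, 0 < c1 /\ 0 < rho2 /\ 0 <= C1 /\
    forall x y z e, xb <= x <= xs + rho2 -> Rabs (y - ys) <= rho2 -> Rabs (z - zs) <= rho2 ->
      0 < e <= rho2 ->
      y - F x z e <= - c1 /\ Rabs (g1 x y z e) <= C1 /\ Rabs (g2 x y z e) <= C1) ->
  exists eps1 rho1, 0 < eps1 /\ 0 < rho1 /\
  forall e a T X Y Z, 0 < e < eps1 -> a <= T -> orbit e a T X Y Z ->
    X a = xs -> Rabs (Y a - ys) < rho1 -> Rabs (Z a - zs) < rho1 ->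
    exists tb, a <= tb <= T /\
      (forall t, a <= t <= tb ->
         (offset e X Y Z t < 0 /\ Rabs (Y t - Y a) + Rabs (Z t - Z a) <= kappa * (xs - X t) /\
          (a < t -> X t < xs) /\ xA <= X t) \/
         slow_at e X Y Z t) /\
      (tb = T \/
       (X tb = xE /\ Rabs (Z tb - zp xE) < kappa /\ Rabs (Y tb - F xc (zp xE) 0) < kappa)).
Proof.
intros Hxc Hcrit Hxs Hk Hlay.
assert (Hmu := mu_pos). destruct (HP) as [Hord Hr _ _ _ HC _ _ _ _ _ _ _ _ _ _ _ _].
destruct (jump_passage xc kappa Hxc Hcrit Hk) as [e4 [k4 [He4 [Hk4 Hjump]]]].
destruct (slow_passage k4 Hk4) as [e3 [k3 [He3 [Hk3 Hslow]]]].
(* modulus of continuity of the reduced solution at the landing point *)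
assert (Hzc : continuous zp xl).
{ apply (ex_derive_continuous zp). eexists. apply Hzp. lra. }
destruct (proj1 (filterlim_locally _ _) Hzc (mkposreal (k3 / 2) ltac:(lra))) as [eta Heta].
pose proof (cond_pos eta) as Hetap.
set (k2 := Rmin (kappa * (xs - xl) / 16) (Rmin ((xs - xl) / 4) (Rmin (k3 / 4) (eta / 2)))).
assert (Hk20 : 0 < k2). { repeat apply Rmin_glb_lt; try lra. apply Rdiv_lt_0_compat; nra. }
assert (Hk2a : k2 <= kappa * (xs - xl) / 16) by min_le.
assert (Hk2b : k2 <= (xs - xl) / 4) by min_le.
assert (Hk2c : k2 <= k3 / 4) by min_le.
assert (Hk2d : k2 <= eta / 2) by min_le.
destruct (arrival k2 Hk20) as [k1 [e2 [r2 [Hk1 [He2 [Hr2 Harr]]]]]].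
destruct (Hlay (xl + k1) ltac:(lra)) as [c1 [rho2 [C1 [Hc1 [Hrho2 [HC1 Hlay']]]]]].
set (kl := Rmin (kappa / 2) (r2 / (4 * (xs - xl)))).
assert (Hkl : 0 < kl) by (apply Rmin_glb_lt; [lra|apply Rdiv_lt_0_compat; lra]).
assert (Hkl1 : kl <= kappa / 2) by min_le.
assert (Hkl2 : kl * (xs - xl) <= r2 / 4).
{ apply Rle_trans with (r2 / (4 * (xs - xl)) * (xs - xl)); [|right; field; lra].
  apply Rmult_le_compat_r; [lra|apply Rmin_r]. }
destruct (layer_descent (xl + k1) xs ys zs c1 rho2 C1 kl ltac:(lra) Hc1 Hrho2 HC1 Hkl Hlay') as [e1 [r1 [He1 [Hr1 Hdesc]]]].
exists (Rmin (Rmin e1 e2) (Rmin (Rmin e3 e4) r)), (Rmin r1 (Rmin (r2 / 4) k2)).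
split. { repeat apply Rmin_glb_lt; auto. }
split. { repeat apply Rmin_glb_lt; lra. }
intros e a T X Y Z [He0 He] HaT Ho HXa HYa HZa.
assert (Hea : e < e1) by (eapply Rlt_le_trans; [exact He|]; eapply Rle_trans; [apply Rmin_l|apply Rmin_l]).
assert (Heb : e < e2) by (eapply Rlt_le_trans; [exact He|]; eapply Rle_trans; [apply Rmin_l|apply Rmin_r]).
assert (Hec : e < e3) by (eapply Rlt_le_trans; [exact He|]; eapply Rle_trans; [apply Rmin_r|]; eapply Rle_trans; [apply Rmin_l|apply Rmin_l]).
assert (Hed : e < e4) by (eapply Rlt_le_trans; [exact He|]; eapply Rle_trans; [apply Rmin_r|]; eapply Rle_trans; [apply Rmin_l|apply Rmin_r]).
assert (Hee : e < r) by (eapply Rlt_le_trans; [exact He|]; eapply Rle_trans; [apply Rmin_r|apply Rmin_r]).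
assert (Hrr : Rmin r1 (Rmin (r2 / 4) k2) <= r1 /\ Rmin r1 (Rmin (r2 / 4) k2) <= r2 / 4 /\ Rmin r1 (Rmin (r2 / 4) k2) <= k2).
{ repeat split; [apply Rmin_l|eapply Rle_trans; [apply Rmin_r|apply Rmin_l]|eapply Rle_trans; [apply Rmin_r|apply Rmin_r]]. }
destruct (Hdesc e a T X Y Z (conj He0 Hea) HaT Ho HXa ltac:(lra) ltac:(lra)) as [t1 [Ht1 [Hg1 Hend1]]].
assert (G1 : forall t, a <= t <= t1 -> offset e X Y Z t < 0 /\ Rabs (Y t - Y a) + Rabs (Z t - Z a) <= kappa * (xs - X t) /\ (a < t -> X t < xs) /\ xA <= X t).
{ intros t Ht. destruct (Hg1 t Ht) as [A1 [A2 [A3 A4]]]. split; auto. split; [|split; [auto|lra]].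
  assert (X t <= xs). { destruct (Req_dec a t) as [<-|]; [lra|]. left; apply A3; lra. }
  assert (kl * (xs - X t) <= kappa * (xs - X t)) by (apply Rmult_le_compat_r; lra). lra. }
destruct Hend1 as [Hend1|Hend1].
{ exists T. split; [lra|]. split; [|now left]. intros t Ht. left. apply G1. lra. }
destruct (Hg1 t1 ltac:(lra)) as [Hoff1 [Hdis1 _]]. rewrite Hend1 in Hdis1.
assert (kl * (xs - (xl + k1)) <= kl * (xs - xl)) by (apply Rmult_le_compat_l; lra).
assert (HYt1 : Rabs (Y t1 - ys) < r2).
{ replace (Y t1 - ys) with ((Y t1 - Y a) + (Y a - ys)) by ring. eapply Rle_lt_trans; [apply Rabs_triang|].
  pose proof (Rabs_pos (Z t1 - Z a)). lra. }
assert (HZt1 : Rabs (Z t1 - zs) < r2).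
{ replace (Z t1 - zs) with ((Z t1 - Z a) + (Z a - zs)) by ring. eapply Rle_lt_trans; [apply Rabs_triang|].
  pose proof (Rabs_pos (Y t1 - Y a)). lra. }
assert (Hoff1' : offset e X Y Z t1 < mu * e) by (unfold offset; nra).
destruct (Harr e t1 T X Y Z (conj He0 Heb) ltac:(lra) (orbit_sub e a T t1 T X Y Z Ho ltac:(lra) ltac:(lra)) Hend1 HYt1 HZt1 Hoff1')
  as [t2 [Ht2 [Hg2 Hend2]]].
assert (G2 : forall t, t1 <= t <= t2 ->
  (offset e X Y Z t < 0 /\ Rabs (Y t - Y a) + Rabs (Z t - Z a) <= kappa * (xs - X t) /\ (a < t -> X t < xs) /\ xA <= X t) \/
  slow_at e X Y Z t).
{ intros t Ht. destruct (Hg2 t Ht) as [A1 [A2 [A3 [A4 A5]]]].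
  destruct (Rlt_le_dec (offset e X Y Z t) 0) as [Hneg|Hpos].
  - left. split; auto. apply Rabs_le_between in A1. split; [|split; lra].
    replace (Y t - Y a) with ((Y t - ys) - (Y a - ys)) by ring.
    replace (Z t - Z a) with ((Z t - zs) - (Z a - zs)) by ring.
    assert (T1 := Rabs_triang (Y t - ys) (- (Y a - ys))). assert (T2 := Rabs_triang (Z t - zs) (- (Z a - zs))).
    rewrite Rabs_Ropp in T1, T2.
    assert (kappa * ((xs - xl) / 2) <= kappa * (xs - X t)) by (apply Rmult_le_compat_l; lra).
    unfold Rminus in *. lra.
  - right. split; [lra|]. split; lra. }
destruct Hend2 as [Hend2|[Hoff2 HFx2]].
{ exists T. split; [lra|]. split; [|now left]. intros t Ht.
  destruct (Rle_lt_dec t t1); [left; apply G1; lra|apply G2; lra]. }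
destruct (Hg2 t2 ltac:(lra)) as [A1 [_ [A3 [_ A5]]]].
assert (HZ2 : Rabs (Z t2 - zp (X t2)) < k3).
{ assert (Hz2 : Rabs (zp (X t2) - zp xl) < k3 / 2).
  { apply (Heta (X t2)). change (Rabs (X t2 - xl) < eta). lra. }
  replace (Z t2 - zp (X t2)) with ((Z t2 - zs) - (zp (X t2) - zs)) by ring.
  eapply Rle_lt_trans; [apply Rabs_triang|]. rewrite Rabs_Ropp, <- Hzs. rewrite <- Hzs in A3. lra. }
destruct (Hslow e t2 T X Y Z (conj He0 Hec) ltac:(lra) (orbit_sub e a T t2 T X Y Z Ho ltac:(lra) ltac:(lra)) A5 Hoff2 HFx2 HZ2)
  as [t3 [Ht3 [Hg3 Hend3]]].
destruct Hend3 as [Hend3|[HFx3 [HX3 [HV3 HZ3]]]].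
{ exists T. split; [lra|]. split; [|now left]. intros t Ht.
  destruct (Rle_lt_dec t t1); [left; apply G1; lra|]. destruct (Rle_lt_dec t t2); [apply G2; lra|].
  right. apply Hg3. lra. }
destruct (Hjump e t3 T X Y Z (conj He0 Hed) ltac:(lra) (orbit_sub e a T t3 T X Y Z Ho ltac:(lra) ltac:(lra)) HFx3 HX3 HV3 HZ3)
  as [t4 [Ht4 [Hg4 Hend4]]].
exists t4. split; [lra|]. split; [|exact Hend4]. intros t Ht.
destruct (Rle_lt_dec t t1); [left; apply G1; lra|]. destruct (Rle_lt_dec t t2); [apply G2; lra|].
right. destruct (Rle_lt_dec t t3); [apply Hg3; lra|apply Hg4; lra].
Qed.

End Arrival.
End SlowPhase.
End FoldPassage.

(** * The passage near the plane z = z0, in the blown-up variable *)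

Definition lift (F : R -> R -> R -> R -> R) : fun5 := fun x _ z e d => F x z e d.
Definition Fx (F : R -> R -> R -> R -> R) (x z e d : R) : R := Derive (fun u => F u z e d) x.
Definition Fz (F : R -> R -> R -> R -> R) (x z e d : R) : R := Derive (fun u => F x u e d) z.

Record slow_fast (e0 d0 z0 : R) (F : R -> R -> R -> R -> R) (g1 g2 G H : fun5) : Prop := {
  sf_e0 : 0 < e0; sf_d0 : 0 < d0;
  sf_F : smooth e0 d0 (lift F); sf_g1 : smooth e0 d0 g1; sf_g2 : smooth e0 d0 g2;
  sf_G : smooth e0 d0 G; sf_H : smooth e0 d0 H;
  sf_g2_split : forall x y z e d, 0 <= e < e0 -> 0 <= d < d0 ->
    g2 x y z e d = d * G x y z e d + (z - z0) * H x y z e d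
}.

(** An attracting branch, at epsilon = delta = 0 in the plane z = z0, on which the
    reduced flow moves from the landing point [xl] to the fold [xf]. The alternative
    [rb_low] admits a landing point on a fold: the short cycle starts at L2. *)
Record rising_branch (z0 : R) (F : R -> R -> R -> R -> R) (g1 : fun5) (xl xf : R) : Prop := {
  rb_lt : xl < xf;
  rb_g1 : forall x, xl <= x <= xf -> 0 < g1 x (F x z0 0 0) z0 0 0;
  rb_Fx : forall x, xl < x < xf -> 0 < Fx F x z0 0 0;
  rb_fold : Fx F xf z0 0 0 = 0 /\ Fx (Fx F) xf z0 0 0 < 0;
  rb_low : 0 < Fx F xl z0 0 0 \/ 0 < Fx (Fx F) xl z0 0 0
}.

Lemma gronwall_two_sided (u u' : R -> R) (L K a b x0 x : R) :
  0 <= L -> 0 <= K -> a <= x0 <= b -> a <= x <= b ->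
  (forall s, a <= s <= b -> is_derive u s (u' s) /\ Rabs (u' s) <= L * Rabs (u s) + K) ->
  Rabs (u x) <= exp (L * (b - a)) * (Rabs (u x0) + K * (b - a)).
Proof.
intros HL HK Hx0 Hx Hu.
assert (Hfin : forall l, 0 <= l <= b - a ->
  exp (L * l) * (Rabs (u x0) + K * l) <= exp (L * (b - a)) * (Rabs (u x0) + K * (b - a))).
{ intros l Hl. pose proof (Rabs_pos (u x0)). apply Rmult_le_compat; [left; apply exp_pos|nra| |nra].
  destruct (Req_dec (L * l) (L * (b - a))) as [->|]; [lra|]. left. apply exp_increasing.
  assert (L * l <= L * (b - a)) by (apply Rmult_le_compat_l; lra). lra. }
destruct (Rle_lt_dec x0 x) as [Hle|Hlt].
- eapply Rle_trans; [|apply (Hfin (x - x0)); lra].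
  apply (gronwall_clock u u' (fun s => s) (fun _ => 1)); auto; try lra.
  + intros t Ht. apply Hu; lra.
  + intros t Ht. apply (is_derive_id (K := R_AbsRing) t).
  + intros. lra.
  + intros t Ht. rewrite Rmult_1_l. apply Hu; lra.
- eapply Rle_trans; [|apply (Hfin (x0 - x)); lra].
  assert (H := gronwall_clock (fun s => u (- s)) (fun s => - u' (- s)) (fun s => s) (fun _ => 1) L K (- x0) (- x)).
  cbv beta in H. rewrite !Ropp_involutive in H. replace (x0 - x) with (- x - - x0) by ring.
  apply H; auto; try lra.
  + intros t Ht. replace (- u' (- t)) with (-1 * u' (- t)) by ring.
    apply (is_derive_comp u (fun s => - s) t (u' (- t)) (-1)).
    * apply Hu; lra.
    * auto_derive; auto; ring.
  + intros t Ht. apply (is_derive_id (K := R_AbsRing) t).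
  + intros; lra.
  + intros t Ht. rewrite Rabs_Ropp, Rmult_1_l. apply Hu; lra.
Qed.

Lemma slope_lip (n n' a a' f f' c C M d1 d2 d3 : R) :
  0 < c -> c <= a -> c <= a' -> 0 <= C -> Rabs n <= M -> Rabs n' <= M -> Rabs f' <= C ->
  Rabs (n - n') <= d1 -> Rabs (a - a') <= d2 -> Rabs (f - f') <= d3 ->
  Rabs (n / a * Rmax f 0 - n' / a' * Rmax f' 0) <= C * (d1 / c + M * d2 / (c * c)) + M / c * d3.
Proof.
intros. apply prod_lip.
- unfold Rdiv. rewrite Rabs_mult, Rabs_inv. rewrite (Rabs_pos_eq a) by lra.
  apply Rmult_le_compat; auto; [apply Rabs_pos|left; apply Rinv_0_lt_compat; lra|apply Rinv_le_contravar; lra].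
- unfold Rmax. destruct Rle_dec; [rewrite Rabs_R0; lra|auto].
- apply quot_lip; auto.
- eapply Rle_trans; [apply Rmax0_lip|auto].
Qed.

Section Branch.

Variables (e0 d0 z0 : R) (F : R -> R -> R -> R -> R) (g1 g2 G H : fun5) (xl xf : R).
Hypothesis SF : slow_fast e0 d0 z0 F g1 g2 G H.
Hypothesis RB : rising_branch z0 F g1 xl xf.

Lemma smooth_Fx : smooth e0 d0 (lift (Fx F)).
Proof. exact (smooth_Dx _ _ _ (sf_F _ _ _ _ _ _ _ _ SF)). Qed.
Lemma smooth_Fz : smooth e0 d0 (lift (Fz F)).
Proof. exact (smooth_Dz _ _ _ (sf_F _ _ _ _ _ _ _ _ SF)). Qed.
Lemma smooth_Fxx : smooth e0 d0 (lift (Fx (Fx F))).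
Proof. exact (smooth_Dx _ _ _ smooth_Fx). Qed.
Lemma chain_lift (K : R -> R -> R -> R -> R) X Z t X' Z' e d :
  smooth e0 d0 (lift K) -> - e0 < e < e0 -> - d0 < d < d0 ->
  is_derive X t X' -> is_derive Z t Z' ->
  is_derive (fun s => K (X s) (Z s) e d) t (Fx K (X t) (Z t) e d * X' + Fz K (X t) (Z t) e d * Z').
Proof.
intros HK He Hd HX HZ.
assert (HC := chain5 e0 d0 (lift K) X (fun _ => 0) Z t X' 0 Z' e d HK He Hd HX
  (is_derive_const (K := R_AbsRing) (V := R_NormedModule) 0 t) HZ).
replace (Fx K (X t) (Z t) e d * X' + Fz K (X t) (Z t) e d * Z') with
 (Dx (lift K) (X t) 0 (Z t) e d * X' + Dy (lift K) (X t) 0 (Z t) e d * 0 + Dz (lift K) (X t) 0 (Z t) e d * Z').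
- exact HC.
- unfold Dx, Dz, lift, Fx, Fz. ring.
Qed.

Lemma is_derive_F_x x z e d : - e0 < e < e0 -> - d0 < d < d0 ->
  is_derive (fun x => F x z e d) x (Fx F x z e d).
Proof.
intros He Hd. apply Derive_correct.
exact (proj1 (smooth_diff5 e0 d0 (lift F) x 0 z e d (sf_F _ _ _ _ _ _ _ _ SF) He Hd)).
Qed.

Lemma is_derive_Fx_x x z e d : - e0 < e < e0 -> - d0 < d < d0 ->
  is_derive (fun x => Fx F x z e d) x (Fx (Fx F) x z e d).
Proof.
intros He Hd. apply Derive_correct.
exact (proj1 (smooth_diff5 e0 d0 (lift (Fx F)) x 0 z e d smooth_Fx He Hd)).
Qed.

Lemma continuous_on_graph (h : fun5) x z e d :
  smooth e0 d0 h -> - e0 < e < e0 -> - d0 < d < d0 ->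
  continuous (fun x => h x (F x z e d) z e d) x.
Proof.
intros Hh He Hd. apply (ex_derive_continuous (fun x => h x (F x z e d) z e d)).
eexists. apply (chain5 e0 d0 h (fun x => x) (fun x => F x z e d) (fun _ => z) x); auto.
- apply (is_derive_id (K := R_AbsRing)).
- apply is_derive_F_x; auto.
- apply (is_derive_const (K := R_AbsRing) (V := R_NormedModule)).
Qed.

Definition F_base (x : R) : R := F x z0 0 0.

(** One radius and one pair of constants for all estimates along the branch,
    which is prolonged by [eta] beyond both of its ends. *)
Record branch_tube (eta rho C c : R) : Prop := {
  bt_eta : 0 < eta; bt_rho : 0 < rho; bt_rho_e : rho < e0; bt_rho_d : rho < d0; bt_rho1 : rho <= 1;
  bt_C : 1 <= C; bt_c : 0 < c; bt_c1 : c <= 1;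
  bt_tame : forall h, In h (g1 :: g2 :: G :: H :: lift F :: lift (Fx F) :: lift (Fz F) :: nil) ->
    tame F_base z0 0 (xl - eta) (xf + eta) rho C h;
  bt_a : forall x y z e d, inbox F_base z0 0 (xl - eta) (xf + eta) rho x y z e d ->
    c <= g1 x y z e d - Fz F x z e d * g2 x y z e d;
  bt_fold : forall x z e d, xf - eta <= x <= xf + eta -> Rabs (z - z0) <= rho -> Rabs e <= rho ->
    Rabs d <= rho -> Fx (Fx F) x z e d <= - c;
  bt_low : forall x, xl - eta <= x <= xl + eta -> 0 < Fx F x z0 0 0 \/ 0 < Fx (Fx F) x z0 0 0
}.

Lemma positive_near (u : R -> R) (x : R) : continuous u x -> 0 < u x ->
  exists eta, 0 < eta /\ forall y, Rabs (y - x) <= eta -> 0 < u y.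
Proof.
intros Hc Hp. destruct (Hc (fun v => 0 < v) (open_gt 0 _ Hp)) as [eta He].
pose proof (cond_pos eta). exists (eta / 2). split; [lra|].
intros y Hy. apply He. change (Rabs (y - x) < eta). lra.
Qed.

Lemma smooth_tame_list (gam : R -> R) (a b : R) (l : list fun5) :
  (forall x, a <= x <= b -> continuous gam x) ->
  (forall h, In h l -> smooth e0 d0 h) ->
  exists r C, 0 < r /\ 1 <= C /\ forall h, In h l -> tame gam z0 0 a b r C h.
Proof.
intros Hg. assert (He0 := sf_e0 _ _ _ _ _ _ _ _ SF). assert (Hd0 := sf_d0 _ _ _ _ _ _ _ _ SF).
induction l as [|h l IH]; intros Hl.
- exists 1, 1. split; [lra|]. split; [lra|]. intros h [].
- destruct IH as [r [C [Hr [HC Ht]]]]; [intros k Hk; apply Hl; now right|].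
  destruct (smooth_tame e0 d0 gam z0 0 a b h He0 ltac:(lra) (Hl h (or_introl eq_refl)) Hg) as [r' [C' [Hr' [HC' Ht']]]].
  exists (Rmin r r'), (C + C'). split; [now apply Rmin_glb_lt|]. split; [lra|].
  intros k [<-|Hk].
  + apply (tame_mono _ _ _ a b r' C'); auto; try lra. apply Rmin_r.
  + apply (tame_mono _ _ _ a b r C); auto; try lra. apply Rmin_l.
Qed.

Lemma cont_F0' x : continuous F_base x.
Proof.
assert (He0 := sf_e0 _ _ _ _ _ _ _ _ SF). assert (Hd0 := sf_d0 _ _ _ _ _ _ _ _ SF).
apply (ex_derive_continuous F_base). eexists. apply is_derive_F_x; lra.
Qed.

Lemma cont5_minus_mult (u v w : fun5) x y z e d :
  cont5 u x y z e d -> cont5 v x y z e d -> cont5 w x y z e d ->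
  cont5 (fun x y z e d => u x y z e d - v x y z e d * w x y z e d) x y z e d.
Proof.
intros Hu Hv Hw eps Heps.
set (M := Rabs (v x y z e d) + Rabs (w x y z e d) + 1).
assert (Pv := Rabs_pos (v x y z e d)). assert (Pw := Rabs_pos (w x y z e d)).
set (eta := Rmin 1 (eps / (2 * (M + 1)))).
assert (Heta : 0 < eta) by (apply Rmin_glb_lt; [lra|apply Rdiv_lt_0_compat; unfold M; lra]).
assert (He1 : eta <= 1) by min_le.
assert (He2 : eta * (M + 1) <= eps / 2).
{ apply Rle_trans with (eps / (2 * (M + 1)) * (M + 1)); [|right; field; unfold M; lra].
  apply Rmult_le_compat_r; [unfold M; lra|apply Rmin_r]. }
destruct (Hu eta Heta) as [r1 [Hr1 H1]]. destruct (Hv eta Heta) as [r2 [Hr2 H2]].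
destruct (Hw eta Heta) as [r3 [Hr3 H3]].
exists (Rmin r1 (Rmin r2 r3)). split; [repeat apply Rmin_glb_lt; auto|].
intros x' y' z' e' d' K1 K2 K3 K4 K5.
assert (Rmin r1 (Rmin r2 r3) <= r1) by min_le.
assert (Rmin r1 (Rmin r2 r3) <= r2) by min_le.
assert (Rmin r1 (Rmin r2 r3) <= r3) by min_le.
assert (L1 := H1 x' y' z' e' d' ltac:(lra) ltac:(lra) ltac:(lra) ltac:(lra) ltac:(lra)).
assert (L2 := H2 x' y' z' e' d' ltac:(lra) ltac:(lra) ltac:(lra) ltac:(lra) ltac:(lra)).
assert (L3 := H3 x' y' z' e' d' ltac:(lra) ltac:(lra) ltac:(lra) ltac:(lra) ltac:(lra)).
assert (Hv' : Rabs (v x' y' z' e' d') <= Rabs (v x y z e d) + 1).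
{ replace (v x' y' z' e' d') with ((v x' y' z' e' d' - v x y z e d) + v x y z e d) by ring.
  eapply Rle_trans; [apply Rabs_triang|]. lra. }
assert (Hp := prod_lip _ _ _ _ _ _ _ _ Hv' (Rle_refl (Rabs (w x y z e d))) (Rlt_le _ _ L2) (Rlt_le _ _ L3)).
match goal with |- Rabs ?t < _ => replace t with
 ((u x' y' z' e' d' - u x y z e d) + - (v x' y' z' e' d' * w x' y' z' e' d' - v x y z e d * w x y z e d)) by ring end.
eapply Rle_lt_trans; [apply Rabs_triang|]. rewrite Rabs_Ropp. unfold M in He2. nra.
Qed.

Lemma exists_branch_tube : exists eta rho C c, branch_tube eta rho C c.
Proof.
destruct SF as [He0 Hd0 HF Hg1 Hg2 HG HH Hsp]. destruct RB as [Hlt Hpos HFx [Hf1 Hf2] Hlow].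
set (u := fun x => g1 x (F x z0 0 0) z0 0 0).
assert (Hu : forall x, continuous u x) by (intros x; apply continuous_on_graph; auto; lra).
assert (HFxc : forall x, continuous (fun x => Fx F x z0 0 0) x).
{ intros x. apply (ex_derive_continuous (fun x => Fx F x z0 0 0)). eexists. apply is_derive_Fx_x; lra. }
assert (HFxxc : forall x, continuous (fun x => Fx (Fx F) x z0 0 0) x).
{ intros x. apply (ex_derive_continuous (fun x => Fx (Fx F) x z0 0 0)).
  exact (proj1 (smooth_diff5 e0 d0 _ x 0 z0 0 0 smooth_Fxx ltac:(lra) ltac:(lra))). }
destruct (positive_near u xl (Hu xl) (Hpos xl ltac:(lra))) as [n1 [Hn1 P1]].
destruct (positive_near u xf (Hu xf) (Hpos xf ltac:(lra))) as [n2 [Hn2 P2]].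
destruct (positive_near (fun x => - Fx (Fx F) x z0 0 0) xf) as [n3 [Hn3 P3]].
{ apply (continuous_opp (fun x => Fx (Fx F) x z0 0 0)). auto. } { lra. }
assert (exists n4, 0 < n4 /\ forall x, Rabs (x - xl) <= n4 -> 0 < Fx F x z0 0 0 \/ 0 < Fx (Fx F) x z0 0 0) as [n4 [Hn4 P4]].
{ destruct Hlow as [Hl|Hl].
  - destruct (positive_near _ xl (HFxc xl) Hl) as [n [Hn P]]. exists n; split; auto.
  - destruct (positive_near _ xl (HFxxc xl) Hl) as [n [Hn P]]. exists n; split; auto. }
set (eta := Rmin n1 (Rmin n2 (Rmin n3 n4))).
assert (Heta : 0 < eta) by (repeat apply Rmin_glb_lt; auto).
assert (E1 : eta <= n1) by min_le.
assert (E2 : eta <= n2) by min_le.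
assert (E3 : eta <= n3) by min_le.
assert (E4 : eta <= n4) by min_le.
set (a := xl - eta). set (b := xf + eta).
destruct (smooth_tame_list F_base a b (g1 :: g2 :: G :: H :: lift F :: lift (Fx F) :: lift (Fz F) :: nil)) as [r1 [C [Hr1 [HC Ht]]]].
{ intros; apply cont_F0'. }
{ simpl. intros h Hh. repeat (destruct Hh as [<-|Hh]; [auto using smooth_Fx, smooth_Fz|]). destruct Hh. }
destruct (tube_pos F_base z0 0 a b (fun x y z e d => g1 x y z e d - lift (Fz F) x y z e d * g2 x y z e d)) as [r2 [Hr2 Ha]].
{ intros; apply cont_F0'. }
{ intros x Hx. split.
  - apply cont5_minus_mult; apply (smooth_cont5 e0 d0); auto using smooth_Fz; lra.
  - rewrite Hsp by lra. unfold lift, F_base.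
    match goal with |- 0 < ?t => replace t with (u x) by (unfold u; ring) end.
    destruct (Rle_lt_dec x xl); [apply P1; apply Rabs_le; unfold a in Hx; lra|].
    destruct (Rle_lt_dec x xf); [apply Hpos; lra|apply P2; apply Rabs_le; unfold b in Hx; lra]. }
destruct (tube_pos F_base z0 0 (xf - eta) (xf + eta) (fun x y z e d => - lift (Fx (Fx F)) x y z e d)) as [r3 [Hr3 Hfo]].
{ intros; apply cont_F0'. }
{ intros x Hx. split.
  - intros eps Heps. destruct (smooth_cont5 e0 d0 _ x (F_base x) z0 0 0 smooth_Fxx ltac:(lra) ltac:(lra) eps Heps) as [r [Hr Hh]].
    exists r. split; auto. intros. replace (- lift (Fx (Fx F)) x' y' z' e' d' - - lift (Fx (Fx F)) x (F_base x) z0 0 0) with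
     (- (lift (Fx (Fx F)) x' y' z' e' d' - lift (Fx (Fx F)) x (F_base x) z0 0 0)) by ring.
    rewrite Rabs_Ropp. now apply Hh.
  - apply P3. apply Rabs_le; lra. }
set (rho := Rmin 1 (Rmin (e0 / 2) (Rmin (d0 / 2) (Rmin r1 (Rmin r2 r3))))).
assert (Hrho : 0 < rho) by (repeat apply Rmin_glb_lt; lra).
assert (rho <= 1 /\ rho <= e0 / 2 /\ rho <= d0 / 2 /\ rho <= r1 /\ rho <= r2 /\ rho <= r3) as [L0 [L1 [L2 [L3 [L4 L5]]]]].
{ unfold rho. repeat split; repeat (first [apply Rle_refl | apply Rmin_l | eapply Rle_trans; [apply Rmin_r|]]). }
exists eta, rho, C, (Rmin 1 (Rmin r2 r3)).
assert (C1 : Rmin 1 (Rmin r2 r3) <= 1) by min_le.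
assert (C2 : Rmin 1 (Rmin r2 r3) <= r2) by min_le.
assert (C3 : Rmin 1 (Rmin r2 r3) <= r3) by min_le.
constructor; auto; try lra.
- repeat apply Rmin_glb_lt; lra.
- intros h Hh. apply (tame_mono F_base z0 0 a b r1 C); auto; unfold a, b; lra.
- intros x y z e d Hin. eapply Rle_trans; [exact C2|]. apply Ha. eapply inbox_mono; eauto; unfold a, b; lra.
- intros x z e d Hx Hz He Hd.
  assert (r3 <= - lift (Fx (Fx F)) x (F_base x) z e d).
  { apply Hfo. unfold inbox. rewrite Rminus_diag, Rabs_R0, Rminus_0_r. lra. }
  unfold lift in H0. lra.
- intros x Hx. apply P4. apply Rabs_le. lra.
Qed.

(** With [a = g1 - F_z g2], which is [F_x] times the speed of [x] in the reduced
    flow, the slope [dz/dx] of the reduced flow is [g2 / a * F_x]. It extends smoothly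
    through the folds; cutting it off where [F_x < 0] freezes [z] there. *)
Definition slow_rate (d x y z e : R) : R := g2 x y z e d / (g1 x y z e d - Fz F x z e d * g2 x y z e d).
Definition reduced_slope (d x z : R) : R := slow_rate d x (F x z 0 d) z 0 * Rmax (Fx F x z 0 d) 0.

Definition slope_const (C c M : R) : R := C * (1 / c + M * (1 + 2 * C) / (c * c)) + M / c.

Lemma speed_lip (u u' v v' w w' C del : R) :
  Rabs (u - u') <= del -> Rabs (v - v') <= del -> Rabs (w - w') <= del ->
  Rabs v <= C -> Rabs w' <= C ->
  Rabs ((u - v * w) - (u' - v' * w')) <= (1 + 2 * C) * del.
Proof.
intros K1 K2 K3 K4 K5.
assert (Hp := prod_lip v v' w w' C C del del K4 K5 K2 K3).
replace ((u - v * w) - (u' - v' * w')) with ((u - u') + - (v * w - v' * w')) by ring.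
eapply Rle_trans; [apply Rabs_triang|]. rewrite Rabs_Ropp. lra.
Qed.

Section Tube.
Variables (eta rho C c : R).
Hypothesis BT : branch_tube eta rho C c.

Let inb := inbox F_base z0 0 (xl - eta) (xf + eta) rho.

Lemma bt_lip h x y z e d y' z' e' d' :
  In h (g1 :: g2 :: G :: H :: lift F :: lift (Fx F) :: lift (Fz F) :: nil) ->
  inb x y z e d -> inb x y' z' e' d' ->
  Rabs (h x y z e d - h x y' z' e' d') <= C * (Rabs (y - y') + Rabs (z - z') + Rabs (e - e') + Rabs (d - d')).
Proof. intros Hh H1 H2. now apply (bt_tame _ _ _ _ BT h Hh x y z e d H1). Qed.

Lemma bt_bound h x y z e d :
  In h (g1 :: g2 :: G :: H :: lift F :: lift (Fx F) :: lift (Fz F) :: nil) ->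
  inb x y z e d -> Rabs (h x y z e d) <= C /\ Rabs (Dx h x y z e d) <= C /\
   Rabs (Dy h x y z e d) <= C /\ Rabs (Dz h x y z e d) <= C.
Proof. intros Hh H1. destruct (bt_tame _ _ _ _ BT h Hh x y z e d H1) as [K1 [K2 [K3 [K4 _]]]]. auto. Qed.

Lemma bt_F_lip x z e d z' e' d' :
  xl - eta <= x <= xf + eta -> Rabs (z - z0) <= rho -> Rabs e <= rho -> Rabs d <= rho ->
  Rabs (z' - z0) <= rho -> Rabs e' <= rho -> Rabs d' <= rho ->
  Rabs (F x z e d - F x z' e' d') <= C * (Rabs (z - z') + Rabs (e - e') + Rabs (d - d')).
Proof.
intros Hx Hz He Hd Hz' He' Hd'. destruct BT.
assert (K := bt_lip (lift F) x (F_base x) z e d (F_base x) z' e' d').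
rewrite (Rminus_diag (F_base x)), Rabs_R0, Rplus_0_l in K. apply K.
- simpl; tauto.
- unfold inb, inbox. rewrite Rminus_diag, Rabs_R0, Rminus_0_r. lra.
- unfold inb, inbox. rewrite Rminus_diag, Rabs_R0, Rminus_0_r. lra.
Qed.

Lemma bt_inbox x y z e d r :
  xl - eta <= x <= xf + eta -> 0 < r <= rho / (6 * C) -> Rabs (z - z0) <= r -> Rabs e <= r -> Rabs d <= r ->
  Rabs (y - F x z e d) <= rho / 2 -> inb x y z e d.
Proof.
intros Hx Hr Hz He Hd Hy. destruct BT.
assert (HrC : 6 * C * r <= rho).
{ apply Rle_trans with (6 * C * (rho / (6 * C))); [|right; field; lra]. apply Rmult_le_compat_l; lra. }
assert (r <= rho) by nra.
assert (K := bt_F_lip x z e d z0 0 0 Hx ltac:(lra) ltac:(lra) ltac:(lra)).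
rewrite (Rminus_diag z0), !Rminus_0_r, Rabs_R0 in K. specialize (K ltac:(lra) ltac:(lra) ltac:(lra)).
assert (C * (Rabs (z - z0) + Rabs e + Rabs d) <= C * (3 * r)) by (apply Rmult_le_compat_l; lra).
unfold inb, inbox. split; auto. split; [|rewrite Rminus_0_r; lra].
replace (y - F_base x) with ((y - F x z e d) + (F x z e d - F_base x)) by ring.
eapply Rle_trans; [apply Rabs_triang|]. unfold F_base. lra.
Qed.

Lemma bt_slope_lip n n' x y z e d y' z' e' d' M del d1 :
  inb x y z e d -> inb x y' z' e' d' ->
  Rabs (y - y') + Rabs (z - z') + Rabs (e - e') + Rabs (d - d') <= del ->
  Rabs n <= M -> Rabs n' <= M -> Rabs (n - n') <= d1 -> C * del <= d1 ->
  Rabs (n / (g1 x y z e d - Fz F x z e d * g2 x y z e d) * Rmax (Fx F x z e d) 0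
      - n' / (g1 x y' z' e' d' - Fz F x z' e' d' * g2 x y' z' e' d') * Rmax (Fx F x z' e' d') 0)
   <= slope_const C c M * d1.
Proof.
intros I1 I2 Hdel HM HM' Hd1 Hd2. assert (HC := bt_C _ _ _ _ BT). assert (Hc := bt_c _ _ _ _ BT).
assert (Hin : forall h, In h (g1 :: g2 :: G :: H :: lift F :: lift (Fx F) :: lift (Fz F) :: nil) ->
   Rabs (h x y z e d - h x y' z' e' d') <= d1).
{ intros h Hh. eapply Rle_trans; [apply bt_lip; auto|]. eapply Rle_trans; [|exact Hd2]. apply Rmult_le_compat_l; lra. }
assert (K1 := Hin g1 ltac:(simpl; tauto)). assert (K2 := Hin g2 ltac:(simpl; tauto)).
assert (K3 := Hin (lift (Fz F)) ltac:(simpl; tauto)). assert (K4 := Hin (lift (Fx F)) ltac:(simpl; tauto)).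
destruct (bt_bound (lift (Fz F)) x y z e d ltac:(simpl; tauto) I1) as [K5 _].
destruct (bt_bound g2 x y' z' e' d' ltac:(simpl; tauto) I2) as [K6 _].
destruct (bt_bound (lift (Fx F)) x y' z' e' d' ltac:(simpl; tauto) I2) as [K7 _].
assert (Hs := slope_lip n n' (g1 x y z e d - Fz F x z e d * g2 x y z e d)
   (g1 x y' z' e' d' - Fz F x z' e' d' * g2 x y' z' e' d') (Fx F x z e d) (Fx F x z' e' d')
   c C M d1 ((1 + 2 * C) * d1) d1 Hc (bt_a _ _ _ _ BT _ _ _ _ _ I1) (bt_a _ _ _ _ BT _ _ _ _ _ I2) ltac:(lra) HM HM' K7 Hd1
   (speed_lip _ _ _ _ _ _ C d1 K1 K3 K2 K5 K6) K4).
eapply Rle_trans; [exact Hs|]. right. unfold slope_const. field. lra.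
Qed.

Lemma slow_rate_deriv d e X Y Z t X' : let x := X t in let y := Y t in let z := Z t in
  - e0 < e < e0 -> - d0 < d < d0 -> 0 <= e -> inb x y z e d ->
  is_derive X t X' -> is_derive Y t (e * g1 x y z e d) -> is_derive Z t (e * g2 x y z e d) ->
  exists l : R, is_derive (fun t => slow_rate d (X t) (Y t) (Z t) e) t l /\
    Rabs l <= 2 * C * C * ((C + C * C) + C * (1 + 2 * C)) / (c * c) * (Rabs X' + e).
Proof.
intros x y z He Hd He0' Hin HX HY HZ. assert (HC := bt_C _ _ _ _ BT). assert (Hc := bt_c _ _ _ _ BT).
destruct SF as [_ _ HF Hg1 Hg2 HG HH Hsp].
assert (Dg1 := chain5 e0 d0 g1 X Y Z t _ _ _ e d Hg1 He Hd HX HY HZ).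
assert (Dg2 := chain5 e0 d0 g2 X Y Z t _ _ _ e d Hg2 He Hd HX HY HZ).
assert (Dfz := chain5 e0 d0 (lift (Fz F)) X Y Z t _ _ _ e d smooth_Fz He Hd HX HY HZ).
fold x y z in Dg1, Dg2, Dfz.
destruct (bt_bound g1 x y z e d ltac:(simpl; tauto) Hin) as [B1 [B1x [B1y B1z]]].
destruct (bt_bound g2 x y z e d ltac:(simpl; tauto) Hin) as [B2 [B2x [B2y B2z]]].
destruct (bt_bound (lift (Fz F)) x y z e d ltac:(simpl; tauto) Hin) as [B3 [B3x [B3y B3z]]].
assert (Ha := bt_a _ _ _ _ BT _ _ _ _ _ Hin).
set (del := 2 * C * C * (Rabs X' + e)).
assert (Hrate : forall a1 a2 a3, Rabs a1 <= C -> Rabs a2 <= C -> Rabs a3 <= C ->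
  Rabs (a1 * X' + a2 * (e * g1 x y z e d) + a3 * (e * g2 x y z e d)) <= del).
{ intros a1 a2 a3 A1 A2 A3.
  eapply Rle_trans; [apply Rabs_triang|]. eapply Rle_trans; [apply Rplus_le_compat_r, Rabs_triang|].
  rewrite !Rabs_mult, (Rabs_pos_eq e) by auto.
  assert (Rabs a1 * Rabs X' <= C * Rabs X') by (apply Rmult_le_compat_r; [apply Rabs_pos|auto]).
  assert (Rabs a2 * (e * Rabs (g1 x y z e d)) <= C * (e * C)).
  { apply Rmult_le_compat; auto; [apply Rabs_pos|apply Rmult_le_pos; [auto|apply Rabs_pos]|apply Rmult_le_compat_l; auto]. }
  assert (Rabs a3 * (e * Rabs (g2 x y z e d)) <= C * (e * C)).
  { apply Rmult_le_compat; auto; [apply Rabs_pos|apply Rmult_le_pos; [auto|apply Rabs_pos]|apply Rmult_le_compat_l; auto]. }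
  unfold del. pose proof (Rabs_pos X'). assert (C * Rabs X' <= C * C * Rabs X').
  { apply Rmult_le_compat_r; auto. nra. }
  assert (0 <= C * C * Rabs X') by (apply Rmult_le_pos; nra). lra. }
set (g1' := Dx g1 x y z e d * X' + Dy g1 x y z e d * (e * g1 x y z e d) + Dz g1 x y z e d * (e * g2 x y z e d)) in *.
set (g2' := Dx g2 x y z e d * X' + Dy g2 x y z e d * (e * g1 x y z e d) + Dz g2 x y z e d * (e * g2 x y z e d)) in *.
set (fz' := Dx (lift (Fz F)) x y z e d * X' + Dy (lift (Fz F)) x y z e d * (e * g1 x y z e d) + Dz (lift (Fz F)) x y z e d * (e * g2 x y z e d)) in *.
assert (R1 : Rabs g1' <= del) by (apply Hrate; auto).
assert (R2 : Rabs g2' <= del) by (apply Hrate; auto).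
assert (R3 : Rabs fz' <= del) by (apply Hrate; auto).
clearbody g1' g2' fz'. change (lift (Fz F) x y z e d) with (Fz F x z e d) in *.
set (a := g1 x y z e d - Fz F x z e d * g2 x y z e d) in *.
set (a' := g1' - (fz' * g2 x y z e d + Fz F x z e d * g2')).
exists ((g2' * a - g2 x y z e d * a') / (a ^ 2)). split.
{ apply (is_derive_div (fun t => g2 (X t) (Y t) (Z t) e d)
    (fun t => g1 (X t) (Y t) (Z t) e d - Fz F (X t) (Z t) e d * g2 (X t) (Y t) (Z t) e d)).
  - exact Dg2.
  - apply (is_derive_minus (fun t => g1 (X t) (Y t) (Z t) e d) (fun t => Fz F (X t) (Z t) e d * g2 (X t) (Y t) (Z t) e d)).
    + exact Dg1.
    + apply (is_derive_mult (fun t => Fz F (X t) (Z t) e d) (fun t => g2 (X t) (Y t) (Z t) e d)).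
      * exact Dfz.
      * exact Dg2.
      * intros; apply Rmult_comm.
  - fold x y z a. lra. }
assert (Hdel : 0 <= del) by (eapply Rle_trans; [apply Rabs_pos|exact R1]).
assert (Aa' : Rabs a' <= (1 + 2 * C) * del).
{ unfold a'. unfold Rminus. eapply Rle_trans; [apply Rabs_triang|]. rewrite Rabs_Ropp.
  eapply Rle_trans; [apply Rplus_le_compat_l, Rabs_triang|]. rewrite !Rabs_mult.
  assert (Rabs fz' * Rabs (g2 x y z e d) <= del * C) by (apply Rmult_le_compat; auto; apply Rabs_pos).
  assert (Rabs (Fz F x z e d) * Rabs g2' <= C * del) by (apply Rmult_le_compat; auto; apply Rabs_pos). lra. }
assert (Aa : Rabs a <= C + C * C).
{ unfold a, Rminus. eapply Rle_trans; [apply Rabs_triang|]. rewrite Rabs_Ropp, Rabs_mult.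
  apply Rplus_le_compat; auto. apply Rmult_le_compat; auto; apply Rabs_pos. }
unfold Rdiv. rewrite Rabs_mult, Rabs_inv, (Rabs_pos_eq (a ^ 2)) by nra.
replace (2 * C * C * (C + C * C + C * (1 + 2 * C)) * / (c * c) * (Rabs X' + e)) with
  ((del * (C + C * C) + C * ((1 + 2 * C) * del)) * / (c * c)) by (unfold del; ring).
apply Rmult_le_compat.
- apply Rabs_pos.
- left. apply Rinv_0_lt_compat. nra.
- unfold Rminus. eapply Rle_trans; [apply Rabs_triang|]. rewrite Rabs_Ropp, !Rabs_mult.
  apply Rplus_le_compat; apply Rmult_le_compat; auto; apply Rabs_pos.
- apply Rinv_le_contravar; nra.
Qed.

Definition fast_F (d : R) : R -> R -> R -> R := fun x z e => F x z e d.
Definition fast_g (g : fun5) (d : R) : R -> R -> R -> R -> R := fun x y z e => g x y z e d.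

(** All hypotheses of the passage hold on a fixed neighbourhood of the branch
    once the fold is left along a short arc of the repelling branch and z, epsilon and
    delta are confined to a small ball: the slow variable z is then itself slow,
    since g2 = O(r). *)
Lemma passage_exists xE : xf < xE < xf + Rmin (eta / 2) (Rmin (rho / (32 * C)) ((xf - xl) / 2)) ->
  exists c2 Cb L r1, 0 < r1 <= rho / (6 * C) /\ forall r d, 0 < r <= r1 -> 0 < d <= r ->
    fold_passage (fast_F d) (fun x z e => Fx F x z e d) (fun x z e => Fz F x z e d)
      (fun x z e => Fx (Fx F) x z e d) (fun x z e => Fz (Fx F) x z e d)
      (fast_g g1 d) (fast_g g2 d) (slow_rate d) (reduced_slope d)
      (xl - eta) (2 * xf - xE) xE z0 r (rho / 2) c c2 Cb L.
Proof.
intros HxE. destruct RB as [Hlt Hpos HFx [Hf1 Hf2] Hlow].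
assert (HSF := SF). destruct HSF as [He0 Hd0 HF Hg1 Hg2 HG HH Hsp].
assert (HBT := BT). destruct HBT as [Heta Hrho Hrhoe Hrhod Hrho1 HC Hc Hc1 _ Ha Hfold Hlowp].
assert (HxE1 : xE < xf + eta / 2) by (pose proof (Rmin_l (eta / 2) (Rmin (rho / (32 * C)) ((xf - xl) / 2))); lra).
assert (HxE2 : xE < xf + rho / (32 * C)).
{ pose proof (Rmin_r (eta / 2) (Rmin (rho / (32 * C)) ((xf - xl) / 2))).
  pose proof (Rmin_l (rho / (32 * C)) ((xf - xl) / 2)). lra. }
assert (HxE3 : xE < xf + (xf - xl) / 2).
{ pose proof (Rmin_r (eta / 2) (Rmin (rho / (32 * C)) ((xf - xl) / 2))).
  pose proof (Rmin_r (rho / (32 * C)) ((xf - xl) / 2)). lra. }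
set (xA := xl - eta). set (xM := 2 * xf - xE).
(* away from the fold, either F_x or F_xx is bounded from below *)
assert (exists c3, 0 < c3 /\ forall x z e d, xA <= x <= xM -> Rabs (z - z0) <= c3 -> Rabs e <= c3 -> Rabs d <= c3 ->
   0 < Fx F x z e d \/ c3 <= Fx (Fx F) x z e d) as [c3 [Hc3 Hlow3]].
{ destruct (compact_unif xA xM (fun x r => (forall z e d, Rabs (z - z0) <= r -> Rabs e <= r -> Rabs d <= r -> 0 < Fx F x z e d) \/
     (forall z e d, Rabs (z - z0) <= r -> Rabs e <= r -> Rabs d <= r -> r <= Fx (Fx F) x z e d))) as [c3 [Hc3 Hl]].
  - intros x r r' [K|K] Hr; [left|right]; intros z e d K1 K2 K3.
    + apply K; lra.
    + apply Rle_trans with r; [lra|]. apply K; lra.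
  - intros x Hx.
    assert (Hpt : 0 < Fx F x z0 0 0 \/ 0 < Fx (Fx F) x z0 0 0).
    { destruct (Rle_lt_dec x xl); [apply Hlowp; unfold xA in Hx; lra|].
      left. apply HFx. unfold xM in Hx. lra. }
    assert (Hgen : forall K, smooth e0 d0 (lift K) -> 0 < K x z0 0 0 -> exists r, 0 < r /\
      forall x' z e d, Rabs (x' - x) < r -> Rabs (z - z0) <= r -> Rabs e <= r -> Rabs d <= r -> r <= K x' z e d).
    { intros K HK HKp. destruct (smooth_cont5 e0 d0 (lift K) x 0 z0 0 0 HK ltac:(lra) ltac:(lra) (K x z0 0 0 / 2) ltac:(lra)) as [r [Hr HKr]].
      exists (Rmin (r / 2) (K x z0 0 0 / 2)).
      assert (M1 : Rmin (r / 2) (K x z0 0 0 / 2) <= r / 2) by min_le.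
      assert (M2 : Rmin (r / 2) (K x z0 0 0 / 2) <= K x z0 0 0 / 2) by min_le.
      split; [apply Rmin_glb_lt; lra|]. intros x' z e d K1 K2 K3 K4.
      assert (K5 := HKr x' 0 z e d ltac:(lra) ltac:(rewrite Rminus_diag, Rabs_R0; lra) ltac:(lra) ltac:(rewrite Rminus_0_r; lra) ltac:(rewrite Rminus_0_r; lra)).
      unfold lift in K5. apply Rabs_def2 in K5. lra. }
    destruct Hpt as [Hpt|Hpt].
    + destruct (Hgen (Fx F) smooth_Fx Hpt) as [r [Hr K]]. exists r. split; auto.
      intros x' _ Hx'. left. intros z e d K1 K2 K3. specialize (K x' z e d Hx' K1 K2 K3). lra.
    + destruct (Hgen (Fx (Fx F)) smooth_Fxx Hpt) as [r [Hr K]]. exists r. split; auto.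
  - exists c3. split; auto. intros x z e d Hx K1 K2 K3. destruct (Hl x Hx) as [K|K]; auto. }
(* F_x is negative at the exit *)
assert (HfE : Fx F xE z0 0 0 < 0).
{ apply Rlt_le_trans with (Fx F xf z0 0 0); [|lra]. apply Ropp_lt_cancel.
  apply (deriv_pos_lt (fun x => - Fx F x z0 0 0) (fun x => - Fx (Fx F) x z0 0 0)); [lra| |].
  - intros x Hx. apply (is_derive_opp (fun x => Fx F x z0 0 0)). apply is_derive_Fx_x; lra.
  - intros x Hx. assert (Fx (Fx F) x z0 0 0 <= - c); [|lra].
    apply Hfold; try lra; rewrite ?Rminus_diag, Rabs_R0; lra. }
set (fE := - Fx F xE z0 0 0).
set (c2 := Rmin c3 c).
assert (Hc2 : 0 < c2) by (apply Rmin_glb_lt; auto).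
assert (Hc23 : c2 <= c3) by min_le. assert (Hc2c : c2 <= c) by min_le.
set (BS := 2 * C * C * ((C + C * C) + C * (1 + 2 * C)) / (c * c)).
set (L := slope_const C c C * (C * (C + 1))).
assert (HBS : 0 <= BS). { unfold BS. apply Rdiv_le_0_compat; nra. }
assert (Hsc : 0 <= slope_const C c C).
{ unfold slope_const. assert (0 < / c) by now apply Rinv_0_lt_compat.
  assert (0 < / (c * c)) by (apply Rinv_0_lt_compat; nra). unfold Rdiv.
  assert (0 <= C * (1 + 2 * C)) by nra. assert (0 <= C * (1 + 2 * C) * / (c * c)) by nra.
  assert (0 <= C * / c) by nra. assert (0 <= C * (1 * / c + C * (1 + 2 * C) * / (c * c))) by (apply Rmult_le_pos; lra). lra. }
assert (HL : 0 <= L) by (apply Rmult_le_pos; nra).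
assert (HCc : 0 <= C / c) by (apply Rdiv_le_0_compat; lra).
set (Cb := C + C * C + C / c + BS + L).
assert (HCC : 0 <= C * C) by nra.
assert (C <= Cb /\ C + C * C <= Cb /\ C / c <= Cb /\ BS <= Cb /\ L <= Cb) as [HCb [HCb1 [HCb2 [HCb3 HCb4]]]] by (unfold Cb; lra).
clearbody Cb.
set (muv := c / (2 * Cb)). assert (Hmuv : 0 < muv) by (apply Rdiv_lt_0_compat; lra).
set (r1 := Rmin (rho / (6 * C)) (Rmin (c3) (Rmin (fE / (6 * C)) (c2 * muv / (8 * C * C))))).
assert (M1 : r1 <= rho / (6 * C)) by min_le.
assert (M2 : r1 <= c3) by min_le.
assert (M3 : r1 <= fE / (6 * C)) by min_le.
assert (M4 : r1 <= c2 * muv / (8 * C * C)) by min_le.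
exists c2, Cb, L, r1. split.
{ split; auto. repeat apply Rmin_glb_lt; auto; apply Rdiv_lt_0_compat; unfold fE; nra. }
intros r d Hr Hd.
assert (Hrr : r <= rho).
{ apply Rle_trans with (rho / (6 * C)); [lra|]. apply Rmult_le_reg_r with (6 * C); [lra|]. unfold Rdiv.
  rewrite Rmult_assoc, Rinv_l, Rmult_1_r by lra. nra. }
assert (Hxin : forall x, xA <= x <= xE -> xl - eta <= x <= xf + eta) by (unfold xA; intros; lra).
assert (HrC : 6 * C * r <= fE).
{ apply Rle_trans with (6 * C * (fE / (6 * C))); [|right; field; lra]. apply Rmult_le_compat_l; lra. }
assert (HrC2 : 8 * C * C * r <= c2 * muv).
{ apply Rle_trans with (8 * C * C * (c2 * muv / (8 * C * C))); [|right; field; lra]. apply Rmult_le_compat_l; nra. }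
assert (Hin : forall x y z e, near_S (fast_F d) xA xE z0 r (rho / 2) x y z e -> inbox F_base z0 0 (xl - eta) (xf + eta) rho x y z e d).
{ intros x y z e [K1 [K2 [K3 K4]]]. apply (bt_inbox x y z e d r); auto; try lra.
  - rewrite Rabs_pos_eq; lra. - rewrite Rabs_pos_eq; lra. }
assert (Hin0 : forall x z, xA <= x <= xE -> Rabs (z - z0) <= r -> inbox F_base z0 0 (xl - eta) (xf + eta) rho x (F x z 0 d) z 0 d).
{ intros x z K1 K2. apply (bt_inbox x _ z 0 d r); auto; try lra.
  - rewrite Rabs_R0; lra. - rewrite Rabs_pos_eq; lra. - rewrite Rminus_diag, Rabs_R0; lra. }
assert (Hg2r : forall x y z e, 0 <= e < e0 -> inbox F_base z0 0 (xl - eta) (xf + eta) rho x y z e d -> Rabs (z - z0) <= r ->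
  Rabs (g2 x y z e d) <= 2 * C * r).
{ intros x y z e Ke Kin Kz. rewrite Hsp by lra.
  destruct (bt_bound G x y z e d ltac:(simpl; tauto) Kin) as [B1 _].
  destruct (bt_bound H x y z e d ltac:(simpl; tauto) Kin) as [B2 _].
  eapply Rle_trans; [apply Rabs_triang|]. rewrite !Rabs_mult, (Rabs_pos_eq d) by lra.
  assert (d * Rabs (G x y z e d) <= r * C) by (apply Rmult_le_compat; try lra; apply Rabs_pos).
  assert (Rabs (z - z0) * Rabs (H x y z e d) <= r * C) by (apply Rmult_le_compat; try lra; apply Rabs_pos). lra. }
assert (Hdom : - d0 < d < d0) by lra.
assert (Hedom : forall e, 0 <= e <= r -> - e0 < e < e0) by (intros; lra).
assert (Hch : forall K e a b X Y Z t, smooth e0 d0 (lift K) ->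
  orbit (fast_F d) (fast_g g1 d) (fast_g g2 d) e a b X Y Z -> 0 < e <= r -> a <= t <= b ->
  is_derive (fun t => K (X t) (Z t) e d) t (Fx K (X t) (Z t) e d * (Y t - fast_F d (X t) (Z t) e) +
    Fz K (X t) (Z t) e d * (e * fast_g g2 d (X t) (Y t) (Z t) e))).
{ intros K e a b X Y Z t HK Ho He Ht. destruct (Ho t Ht) as [K1 [K2 K3]].
  apply chain_lift; auto. apply Hedom; lra. }
constructor; fold xA xM.
- unfold xA, xM. lra.
- lra.
- lra.
- auto.
- auto.
- lra.
- auto.
- intros e a b X Y Z t. apply (Hch F). exact HF.
- intros e a b X Y Z t. apply (Hch (Fx F)). exact smooth_Fx.
- intros e a b X Y Z t Ho He Ht Hn. destruct (Ho t Ht) as [K1 [K2 K3]].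
  destruct (slow_rate_deriv d e X Y Z t _ (Hedom e ltac:(lra)) Hdom ltac:(lra) (Hin _ _ _ _ Hn) K1 K2 K3) as [l [L1 L2]].
  exists l. split; [exact L1|]. fold BS in L2. eapply Rle_trans; [exact L2|].
  apply Rmult_le_compat_r; [pose proof (Rabs_pos (Y t - fast_F d (X t) (Z t) e)); lra|exact HCb3].
- intros x y z e Hn. assert (Kin := Hin _ _ _ _ Hn). destruct Hn as [K1 [K2 [K3 K4]]].
  destruct (bt_bound g1 x y z e d ltac:(simpl; tauto) Kin) as [B1 _].
  destruct (bt_bound g2 x y z e d ltac:(simpl; tauto) Kin) as [B2 _].
  destruct (bt_bound (lift (Fx F)) x y z e d ltac:(simpl; tauto) Kin) as [B3 [_ [_ B3z]]].
  destruct (bt_bound (lift (Fz F)) x y z e d ltac:(simpl; tauto) Kin) as [B4 _].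
  change (lift (Fx F) x y z e d) with (Fx F x z e d) in B3. change (lift (Fz F) x y z e d) with (Fz F x z e d) in B4.
  change (Dz (lift (Fx F)) x y z e d) with (Fz (Fx F) x z e d) in B3z.
  assert (Ka := Ha _ _ _ _ _ Kin).
  assert (Kg2 := Hg2r x y z e ltac:(lra) Kin K2).
  unfold fast_g. split; [lra|]. split; [lra|]. split; [lra|].
  set (aa := g1 x y z e d - Fz F x z e d * g2 x y z e d) in *.
  split.
  { unfold slow_rate. fold aa. unfold Rdiv. rewrite Rabs_mult, Rabs_inv, (Rabs_pos_eq aa) by lra.
    apply Rle_trans with (C * / c); [|exact HCb2].
    apply Rmult_le_compat; auto; [apply Rabs_pos|left; apply Rinv_0_lt_compat; lra|apply Rinv_le_contravar; lra]. }
  split.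
  { split; [lra|]. apply Rle_trans with (Rabs aa); [apply Rle_abs|].
    unfold aa, Rminus. eapply Rle_trans; [apply Rabs_triang|]. rewrite Rabs_Ropp, Rabs_mult.
    assert (Rabs (Fz F x z e d) * Rabs (g2 x y z e d) <= C * C) by (apply Rmult_le_compat; auto; apply Rabs_pos).
    lra. }
  split; [unfold slow_rate; fold aa; field; lra|].
  split.
  { rewrite Rabs_mult. apply Rle_trans with (C * (2 * C * r)).
    - apply Rmult_le_compat; auto; apply Rabs_pos.
    - change (mu c Cb) with muv. lra. }
  assert (Hs := bt_slope_lip (g2 x y z e d) (g2 x (F x z 0 d) z 0 d) x y z e d (F x z 0 d) z 0 d C
    ((C + 1) * (Rabs (y - F x z e d) + e)) (C * ((C + 1) * (Rabs (y - F x z e d) + e))) Kin (Hin0 x z K1 K2)).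
  assert (Hy : Rabs (y - F x z 0 d) <= Rabs (y - F x z e d) + C * e).
  { replace (y - F x z 0 d) with ((y - F x z e d) + (F x z e d - F x z 0 d)) by ring.
    eapply Rle_trans; [apply Rabs_triang|]. apply Rplus_le_compat_l.
    assert (KF := bt_F_lip x z e d z 0 d (Hxin x K1)).
    rewrite (Rminus_diag z), (Rminus_diag d), Rabs_R0, Rminus_0_r, (Rabs_pos_eq e), (Rabs_pos_eq d) in KF by lra.
    specialize (KF ltac:(lra) ltac:(lra) ltac:(lra) ltac:(lra) ltac:(lra) ltac:(lra)). lra. }
  assert (Hdel : Rabs (y - F x z 0 d) + Rabs (z - z) + Rabs (e - 0) + Rabs (d - d) <= (C + 1) * (Rabs (y - F x z e d) + e)).
  { rewrite (Rminus_diag z), (Rminus_diag d), Rabs_R0, Rminus_0_r, (Rabs_pos_eq e) by lra.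
    assert (0 <= C * Rabs (y - F x z e d)) by (apply Rmult_le_pos; [lra|apply Rabs_pos]). lra. }
  eapply Rle_trans.
  { apply (Hs Hdel B2); [apply (bt_bound g2 x _ z 0 d ltac:(simpl; tauto) (Hin0 x z K1 K2))| |lra].
    eapply Rle_trans; [apply (bt_lip g2); [simpl; tauto|exact Kin|apply Hin0; auto]|].
    apply Rmult_le_compat_l; lra. }
  replace (slope_const C c C * (C * ((C + 1) * (Rabs (y - F x z e d) + e)))) with (L * (Rabs (y - F x z e d) + e)) by (unfold L; ring).
  apply Rmult_le_compat_r; [apply Rplus_le_le_0_compat; [apply Rabs_pos|lra]|exact HCb4].
- intros x z z' K1 K2 K3.
  assert (Hy : Rabs (F x z 0 d - F x z' 0 d) <= C * Rabs (z - z')).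
  { assert (KF := bt_F_lip x z 0 d z' 0 d (Hxin x K1)).
    rewrite (Rminus_diag 0), (Rminus_diag d), Rabs_R0, (Rabs_pos_eq d), !Rplus_0_r in KF by lra. apply KF; lra. }
  eapply Rle_trans.
  { apply (bt_slope_lip (g2 x (F x z 0 d) z 0 d) (g2 x (F x z' 0 d) z' 0 d) x _ z 0 d _ z' 0 d C
     ((C + 1) * Rabs (z - z')) (C * ((C + 1) * Rabs (z - z'))) (Hin0 x z K1 K2) (Hin0 x z' K1 K3)).
    - rewrite (Rminus_diag 0), (Rminus_diag d), Rabs_R0. lra.
    - apply (bt_bound g2 x _ z 0 d ltac:(simpl; tauto) (Hin0 x z K1 K2)).
    - apply (bt_bound g2 x _ z' 0 d ltac:(simpl; tauto) (Hin0 x z' K1 K3)).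
    - eapply Rle_trans; [apply (bt_lip g2); [simpl; tauto|apply Hin0; auto|apply Hin0; auto]|].
      rewrite (Rminus_diag 0), (Rminus_diag d), Rabs_R0. apply Rmult_le_compat_l; lra.
    - lra. }
  right. unfold L. ring.
- intros x z z' e e' K1 K2 K3 K4 K5. unfold fast_F.
  assert (KF := bt_F_lip x z e d z' e' d (Hxin x K1)).
  rewrite (Rminus_diag d), Rabs_R0, (Rabs_pos_eq d), (Rabs_pos_eq e), (Rabs_pos_eq e'), Rplus_0_r in KF by lra.
  eapply Rle_trans; [apply KF; lra|]. apply Rmult_le_compat_r; auto.
  pose proof (Rabs_pos (z - z')). pose proof (Rabs_pos (e - e')). lra.
- intros x z e K1 K2 K3. destruct (Hlow3 x z e d K1 ltac:(lra)) as [K|K]; auto.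
  + rewrite Rabs_pos_eq; lra. + rewrite Rabs_pos_eq; lra. + right. lra.
- intros x z e K1 K2 K3.
  assert (Fx (Fx F) x z e d <= - c); [|lra]. apply Hfold; try lra; [unfold xM in K1; lra| |]; rewrite Rabs_pos_eq; lra.
- intros z e K1 K2.
  assert (KF := bt_lip (lift (Fx F)) xE (F_base xE) z e d (F_base xE) z0 0 0 ltac:(simpl; tauto)).
  rewrite (Rminus_diag (F_base xE)), Rabs_R0, Rplus_0_l, !Rminus_0_r, (Rabs_pos_eq e), (Rabs_pos_eq d) in KF by lra.
  assert (KF' : Rabs (lift (Fx F) xE (F_base xE) z e d - lift (Fx F) xE (F_base xE) z0 0 0) <= C * (Rabs (z - z0) + e + d)).
  { apply KF; unfold inb, inbox; rewrite ?Rminus_diag, ?Rminus_0_r, ?Rabs_R0, ?(Rabs_pos_eq e), ?(Rabs_pos_eq d) by lra; lra. }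
  assert (C * (Rabs (z - z0) + e + d) <= C * (3 * r)) by (apply Rmult_le_compat_l; lra).
  unfold lift in KF'. apply Rabs_le_between in KF'. unfold fE in *. nra.
- intros x x' z e K1 K2 K3 K4.
  assert (KM := mvt_bound (fun x => F x z e d) C x x').
  eapply Rle_trans; [apply KM|].
  + intros u Hu. assert (Hum : xM <= u <= xE).
    { unfold Rmin, Rmax in Hu. destruct Rle_dec; lra. }
    split; [eexists; apply is_derive_F_x; auto; apply Hedom; lra|].
    apply (bt_bound (lift F) u (F u z e d) z e d ltac:(simpl; tauto)).
    apply (bt_inbox u _ z e d r); auto; try lra.
    * unfold xM in Hum. lra. * rewrite Rabs_pos_eq; lra. * rewrite Rabs_pos_eq; lra. * rewrite Rminus_diag, Rabs_R0; lra.
  + apply Rle_trans with (C * (2 * (rho / (32 * C)))); [|apply Rle_trans with (rho / 16); [right; field|]; lra].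
    apply Rmult_le_compat_l; [lra|]. apply Rabs_le. unfold xM in *. lra.
- intros x x' z e K1 K2 K3 K4 K5. unfold fast_F.
  assert (Hdec : forall u v, xM <= u -> u <= v -> v <= xE -> Fx F v z e d <= Fx F u z e d).
  { intros u v Ku Kuv Kv.
    apply Ropp_le_cancel. apply (deriv_nonneg_le (fun x => - Fx F x z e d) (fun x => - Fx (Fx F) x z e d)); auto.
    - intros s Hs. apply (is_derive_opp (fun x => Fx F x z e d)). apply is_derive_Fx_x; auto.
    - intros s Hs. assert (Fx (Fx F) s z e d <= - c); [|lra].
      apply Hfold; try lra; [unfold xM in Ku; lra| |]; rewrite Rabs_pos_eq; lra. }
  destruct (Rle_lt_dec x' x).
  + apply (deriv_nonneg_le (fun x => F x z e d) (fun x => Fx F x z e d)); auto.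
    * intros s Hs. apply is_derive_F_x; auto.
    * intros s Hs. apply Rle_trans with (Fx F x z e d); [lra|]. apply Hdec; lra.
  + apply Ropp_le_cancel. apply (deriv_nonneg_le (fun x => - F x z e d) (fun x => - Fx F x z e d)); [lra| |].
    * intros s Hs. apply (is_derive_opp (fun x => F x z e d)). apply is_derive_F_x; auto.
    * intros s Hs. assert (Fx F s z e d <= Fx F x z e d) by (apply Hdec; lra). lra.
Qed.

(** The equation of the reduced slope in the blown-up variable zeta = (z - z0) / delta. The
    form of [g2] makes the division by delta exact, so that delta = 0 is allowed. *)
Definition zeta_slope (d x zeta : R) : R :=
  let z := z0 + d * zeta in let y := F x z 0 d in
  (G x y z 0 d + zeta * H x y z 0 d) / (g1 x y z 0 d - Fz F x z 0 d * g2 x y z 0 d)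
  * Rmax (Fx F x z 0 d) 0.

Let rb := rho / (6 * C).

Lemma rb_pos : 0 < rb /\ rb <= rho.
Proof.
destruct BT. unfold rb. split; [apply Rdiv_lt_0_compat; lra|].
apply Rmult_le_reg_r with (6 * C); [lra|]. unfold Rdiv. rewrite Rmult_assoc, Rinv_l, Rmult_1_r by lra. nra.
Qed.

Lemma zeta_in x zeta d N : xl - eta <= x <= xf + eta -> Rabs zeta <= N -> 0 <= d <= rb -> d * N <= rb ->
  inb x (F x (z0 + d * zeta) 0 d) (z0 + d * zeta) 0 d.
Proof.
intros Hx Hz Hd HdN. destruct rb_pos as [Hr1 Hr2]. apply (bt_inbox _ _ _ _ _ rb Hx).
- unfold rb in *. lra.
- replace (z0 + d * zeta - z0) with (d * zeta) by ring. rewrite Rabs_mult, (Rabs_pos_eq d) by lra.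
  apply Rle_trans with (d * N); auto. apply Rmult_le_compat_l; lra.
- rewrite Rabs_R0; lra.
- rewrite Rabs_pos_eq; lra.
- rewrite Rminus_diag, Rabs_R0. destruct BT. lra.
Qed.

Lemma zeta_slope_lip N : 0 <= N -> exists Lam, 0 < Lam /\
  forall x zeta zeta' d d', xl - eta <= x <= xf + eta -> Rabs zeta <= N -> Rabs zeta' <= N ->
    0 <= d <= rb -> 0 <= d' <= rb -> d * N <= rb -> d' * N <= rb ->
    Rabs (zeta_slope d x zeta - zeta_slope d' x zeta') <= Lam * (Rabs (zeta - zeta') + Rabs (d - d')).
Proof.
intros HN. assert (HC := bt_C _ _ _ _ BT). assert (Hc := bt_c _ _ _ _ BT).
assert (Hrho1 := bt_rho1 _ _ _ _ BT). destruct rb_pos as [Hr1 Hr2].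
set (M := C * (1 + N)). set (kap := C * (N + 2) * ((C + 1) * (N + 1))).
assert (HM : 0 <= M) by (unfold M; nra).
assert (Hkap : 0 <= kap). { unfold kap. apply Rmult_le_pos; nra. }
assert (Hsc : 0 <= slope_const C c M).
{ unfold slope_const, Rdiv. assert (0 < / c) by now apply Rinv_0_lt_compat.
  assert (0 < / (c * c)) by (apply Rinv_0_lt_compat; nra).
  assert (0 <= M * (1 + 2 * C)) by nra. assert (0 <= M * (1 + 2 * C) * / (c * c)) by nra.
  assert (0 <= M * / c) by nra. assert (0 <= C * (1 * / c + M * (1 + 2 * C) * / (c * c))) by (apply Rmult_le_pos; lra). lra. }
exists (slope_const C c M * kap + 1). split; [nra|].
intros x zeta zeta' d d' Hx Hz Hz' Hd Hd' HdN Hd'N.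
assert (I1 := zeta_in x zeta d N Hx Hz Hd HdN). assert (I2 := zeta_in x zeta' d' N Hx Hz' Hd' Hd'N).
unfold zeta_slope. cbv zeta.
set (z := z0 + d * zeta) in *. set (z' := z0 + d' * zeta') in *.
set (Del := Rabs (zeta - zeta') + Rabs (d - d')).
assert (HDel : 0 <= Del) by (unfold Del; pose proof (Rabs_pos (zeta - zeta')); pose proof (Rabs_pos (d - d')); lra).
assert (Hzz : Rabs (z - z') + Rabs (d - d') <= (N + 1) * Del).
{ replace (z - z') with (d * (zeta - zeta') + zeta' * (d - d')) by (unfold z, z'; ring).
  assert (Q := Rabs_triang (d * (zeta - zeta')) (zeta' * (d - d'))). rewrite !Rabs_mult, (Rabs_pos_eq d) in Q by lra.
  assert (d * Rabs (zeta - zeta') <= 1 * Rabs (zeta - zeta')) by (apply Rmult_le_compat_r; [apply Rabs_pos|lra]).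
  assert (Rabs zeta' * Rabs (d - d') <= N * Rabs (d - d')) by (apply Rmult_le_compat_r; [apply Rabs_pos|lra]).
  assert (0 <= N * Rabs (zeta - zeta')) by (apply Rmult_le_pos; [auto|apply Rabs_pos]).
  unfold Del. lra. }
assert (Hyy : Rabs (F x z 0 d - F x z' 0 d') <= C * (Rabs (z - z') + Rabs (d - d'))).
{ assert (K := bt_F_lip x z 0 d z' 0 d' Hx). rewrite (Rminus_diag 0), Rabs_R0, Rplus_0_r in K.
  destruct I1 as [_ [_ [A1 [_ A2]]]]. destruct I2 as [_ [_ [B1 [_ B2]]]]. rewrite Rminus_0_r in A2, B2.
  apply K; auto; lra. }
set (del := (C + 1) * ((N + 1) * Del)).
assert (Hdel : Rabs (F x z 0 d - F x z' 0 d') + Rabs (z - z') + Rabs (0 - 0) + Rabs (d - d') <= del).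
{ rewrite (Rminus_diag 0), Rabs_R0. unfold del.
  assert ((C + 1) * (Rabs (z - z') + Rabs (d - d')) <= (C + 1) * ((N + 1) * Del)) by (apply Rmult_le_compat_l; lra). lra. }
assert (Hdel0 : 0 <= del) by (unfold del; apply Rmult_le_pos; nra).
destruct (bt_bound G x _ z 0 d ltac:(simpl; tauto) I1) as [G1 _]. destruct (bt_bound H x _ z 0 d ltac:(simpl; tauto) I1) as [H1 _].
destruct (bt_bound G x _ z' 0 d' ltac:(simpl; tauto) I2) as [G2 _]. destruct (bt_bound H x _ z' 0 d' ltac:(simpl; tauto) I2) as [H2 _].
assert (GL := bt_lip G _ _ _ _ _ _ _ _ _ ltac:(simpl; tauto) I1 I2).
assert (HL := bt_lip H _ _ _ _ _ _ _ _ _ ltac:(simpl; tauto) I1 I2).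
assert (GL' := Rle_trans _ _ _ GL (Rmult_le_compat_l C _ _ ltac:(lra) Hdel)).
assert (HL' := Rle_trans _ _ _ HL (Rmult_le_compat_l C _ _ ltac:(lra) Hdel)).
assert (Hn : forall ze g h, Rabs ze <= N -> Rabs g <= C -> Rabs h <= C -> Rabs (g + ze * h) <= M).
{ intros ze g h A1 A2 A3. eapply Rle_trans; [apply Rabs_triang|]. rewrite Rabs_mult.
  assert (Rabs ze * Rabs h <= N * C) by (apply Rmult_le_compat; auto; apply Rabs_pos). unfold M. lra. }
eapply Rle_trans.
{ apply (bt_slope_lip _ _ x _ z 0 d _ z' 0 d' M del (kap * Del) I1 I2 Hdel).
  - apply Hn; auto.
  - apply Hn; auto.
  - replace (G x (F x z 0 d) z 0 d + zeta * H x (F x z 0 d) z 0 d - (G x (F x z' 0 d') z' 0 d' + zeta' * H x (F x z' 0 d') z' 0 d'))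
     with ((G x (F x z 0 d) z 0 d - G x (F x z' 0 d') z' 0 d') + (zeta * H x (F x z 0 d) z 0 d - zeta' * H x (F x z' 0 d') z' 0 d')) by ring.
    eapply Rle_trans; [apply Rabs_triang|].
    assert (Q := prod_lip zeta zeta' _ _ N C _ _ Hz H2 (Rle_refl (Rabs (zeta - zeta'))) HL').
    assert (C * Rabs (zeta - zeta') <= C * del).
    { apply Rmult_le_compat_l; [lra|]. unfold del. assert (Rabs (zeta - zeta') <= Del) by (unfold Del; pose proof (Rabs_pos (d - d')); lra).
      assert (Del <= (N + 1) * Del) by nra. assert ((N + 1) * Del <= (C + 1) * ((N + 1) * Del)) by nra. lra. }
    replace (kap * Del) with (C * del + (C * del + N * (C * del))) by (unfold kap, del; ring). lra.
  - replace (kap * Del) with (C * del + (C * del + N * (C * del))) by (unfold kap, del; ring).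
    assert (0 <= C * del) by nra. assert (0 <= N * (C * del)) by nra. lra. }
fold Del. rewrite <- Rmult_assoc. nra.
Qed.

(** Since [g2 = delta G + (z - z0) H], the slope grows at most linearly in zeta,
    with constants that do not depend on delta. *)
Lemma zeta_slope_growth x zeta d N : xl - eta <= x <= xf + eta -> Rabs zeta <= N -> 0 <= d <= rb -> d * N <= rb ->
  Rabs (zeta_slope d x zeta) <= C * C / c * (1 + Rabs zeta).
Proof.
intros Hx Hz Hd HdN. assert (HC := bt_C _ _ _ _ BT). assert (Hc := bt_c _ _ _ _ BT).
assert (I1 := zeta_in x zeta d N Hx Hz Hd HdN). unfold zeta_slope. cbv zeta.
set (z := z0 + d * zeta) in *. set (y := F x z 0 d) in *.
destruct (bt_bound G x _ z 0 d ltac:(simpl; tauto) I1) as [G1 _]. destruct (bt_bound H x _ z 0 d ltac:(simpl; tauto) I1) as [H1 _].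
destruct (bt_bound (lift (Fx F)) x _ z 0 d ltac:(simpl; tauto) I1) as [K1 _].
assert (Ha := bt_a _ _ _ _ BT _ _ _ _ _ I1).
assert (Rabs (Rmax (Fx F x z 0 d) 0) <= C).
{ change (lift (Fx F) x y z 0 d) with (Fx F x z 0 d) in K1. unfold Rmax. destruct Rle_dec; auto. rewrite Rabs_R0; lra. }
assert (Rabs (G x y z 0 d + zeta * H x y z 0 d) <= C * (1 + Rabs zeta)).
{ eapply Rle_trans; [apply Rabs_triang|]. rewrite Rabs_mult.
  assert (Rabs zeta * Rabs (H x y z 0 d) <= Rabs zeta * C) by (apply Rmult_le_compat_l; [apply Rabs_pos|auto]). lra. }
unfold Rdiv. rewrite !Rabs_mult, Rabs_inv, (Rabs_pos_eq (_ - _)) by lra.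
replace (C * C * / c * (1 + Rabs zeta)) with (C * (1 + Rabs zeta) * / c * C) by ring.
apply Rmult_le_compat; auto.
- apply Rmult_le_pos; [apply Rabs_pos|left; apply Rinv_0_lt_compat; lra].
- apply Rabs_pos.
- apply Rmult_le_compat; auto; [apply Rabs_pos|left; apply Rinv_0_lt_compat; lra|apply Rinv_le_contravar; lra].
Qed.

Lemma continuous_Rmax0 (u : R -> R) (x : R) : continuous u x -> continuous (fun x => Rmax (u x) 0) x.
Proof.
intros Hu. apply filterlim_locally. intros eps.
generalize (proj1 (filterlim_locally _ _) Hu eps). apply filter_imp. intros y Hy.
eapply Rle_lt_trans; [apply Rmax0_lip|exact Hy].
Qed.

Lemma zeta_slope_cont x zeta d N : xl - eta <= x <= xf + eta -> Rabs zeta <= N -> 0 <= d <= rb -> d * N <= rb ->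
  continuous (fun x => zeta_slope d x zeta) x.
Proof.
intros Hx Hz Hd HdN. assert (Hc := bt_c _ _ _ _ BT). destruct rb_pos as [Hr1 Hr2].
assert (I1 := zeta_in x zeta d N Hx Hz Hd HdN).
assert (Ha := bt_a _ _ _ _ BT _ _ _ _ _ I1).
destruct SF as [He0 Hd0 HF Hg1 Hg2 HG HH Hsp]. assert (Hrd := bt_rho_d _ _ _ _ BT).
assert (HK : forall h, smooth e0 d0 h -> continuous (fun x => h x (F x (z0 + d * zeta) 0 d) (z0 + d * zeta) 0 d) x).
{ intros h Hh. apply continuous_on_graph; auto; lra. }
unfold zeta_slope. cbv zeta. set (z := z0 + d * zeta) in *.
apply (continuous_mult (fun x => (G x (F x z 0 d) z 0 d + zeta * H x (F x z 0 d) z 0 d) / (g1 x (F x z 0 d) z 0 d - Fz F x z 0 d * g2 x (F x z 0 d) z 0 d))).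
- apply (continuous_mult (fun x => (G x (F x z 0 d) z 0 d + zeta * H x (F x z 0 d) z 0 d)) (fun x => / (g1 x (F x z 0 d) z 0 d - Fz F x z 0 d * g2 x (F x z 0 d) z 0 d))).
  + apply (continuous_plus (fun x => G x (F x z 0 d) z 0 d) (fun x => zeta * H x (F x z 0 d) z 0 d)); [auto|].
    apply (continuous_mult (fun _ => zeta) (fun x => H x (F x z 0 d) z 0 d)); [apply continuous_const|auto].
  + apply (continuous_Rinv_comp (fun x => g1 x (F x z 0 d) z 0 d - Fz F x z 0 d * g2 x (F x z 0 d) z 0 d)); [|lra].
    apply (continuous_minus (fun x => g1 x (F x z 0 d) z 0 d) (fun x => Fz F x z 0 d * g2 x (F x z 0 d) z 0 d)); [auto|].
    apply (continuous_mult (fun x => Fz F x z 0 d) (fun x => g2 x (F x z 0 d) z 0 d)); [|auto].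
    apply (HK (lift (Fz F)) smooth_Fz).
- apply (continuous_Rmax0 (fun x => Fx F x z 0 d)). apply (HK (lift (Fx F)) smooth_Fx).
Qed.

Definition zeta_bound (xE M0 : R) : R :=
  exp (C * C / c * (xE - (xl - eta))) * (M0 + C * C / c * (xE - (xl - eta))) + 1.

(** Picard's theorem is applied with both arguments of the slope clamped; linear
    growth then keeps the solution in the range where the clamps are inactive. *)
Lemma zeta_solution xE x0 u0 d M0 :
  xl - eta <= x0 <= xE -> xE <= xf + eta -> Rabs u0 <= M0 -> 0 <= d <= rb -> d * zeta_bound xE M0 <= rb ->
  exists zeta : R -> R, zeta x0 = u0 /\ forall x, xl - eta <= x <= xE ->
    Rabs (zeta x) <= zeta_bound xE M0 /\ is_derive zeta x (zeta_slope d x (zeta x)).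
Proof.
intros Hx0 HxE HM0 Hd HdN. assert (HC := bt_C _ _ _ _ BT). assert (Hc := bt_c _ _ _ _ BT).
set (N := zeta_bound xE M0) in *. set (len := xE - (xl - eta)).
assert (HK : 0 <= C * C / c) by (apply Rdiv_le_0_compat; nra).
assert (Hlen : 0 <= len) by (unfold len; lra).
pose proof (Rabs_pos u0) as Hu0.
assert (HN : 1 <= N).
{ unfold N, zeta_bound. fold len. pose proof (exp_pos (C * C / c * len)).
  assert (0 <= M0 + C * C / c * len) by nra. nra. }
destruct (zeta_slope_lip N ltac:(lra)) as [Lam [HLam HLip]].
set (cx := clamp (xl - eta) xE). set (cz := clamp (- N) N).
assert (Hcx : forall x, xl - eta <= cx x <= xf + eta).
{ intros x. unfold cx. pose proof (clamp_in (xl - eta) xE x ltac:(lra)). lra. }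
assert (Hcz : forall u, Rabs (cz u) <= N).
{ intros u. apply Rabs_le. unfold cz. apply clamp_in. lra. }
assert (Hczu : forall u, Rabs (cz u) <= Rabs u).
{ intros u. replace (cz u) with (cz u - cz 0).
  - eapply Rle_trans; [apply clamp_lip|]. rewrite Rminus_0_r. lra.
  - unfold cz. rewrite (clamp_id (- N) N 0) by lra. ring. }
destruct (picard (fun x u => zeta_slope d (cx x) (cz u)) (C * C / c * (1 + N)) Lam x0 u0 HLam) as [zeta [Hz0 Hzd]].
- intros x u. eapply Rle_trans; [apply (zeta_slope_growth _ _ _ N); auto|].
  apply Rmult_le_compat_l; auto. specialize (Hcz u). lra.
- intros x u v. eapply Rle_trans; [apply HLip; auto|].
  rewrite Rminus_diag, Rabs_R0, Rplus_0_r. apply Rmult_le_compat_l; [lra|]. apply clamp_lip.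
- intros u x. apply (continuous_clamp (fun x => zeta_slope d x (cz u))); [lra|].
  intros y Hy. apply (zeta_slope_cont _ _ _ N); auto; lra.
- exists zeta. split; auto.
  assert (Hb : forall x, xl - eta <= x <= xE -> Rabs (zeta x) <= N).
  { intros x Hx. unfold N, zeta_bound. fold len.
    assert (Hg := gronwall_two_sided zeta (fun x => zeta_slope d (cx x) (cz (zeta x))) (C * C / c) (C * C / c) (xl - eta) xE x0 x HK HK Hx0 Hx).
    assert (Rabs (zeta x) <= exp (C * C / c * len) * (Rabs (zeta x0) + C * C / c * len)).
    { apply Hg. intros s Hs. split; [apply Hzd|].
      eapply Rle_trans; [apply (zeta_slope_growth _ _ _ N); auto|].
      specialize (Hczu (zeta s)). assert (C * C / c * Rabs (cz (zeta s)) <= C * C / c * Rabs (zeta s)) by (apply Rmult_le_compat_l; auto). lra. }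
    rewrite Hz0 in H0. pose proof (exp_pos (C * C / c * len)).
    assert (exp (C * C / c * len) * (Rabs u0 + C * C / c * len) <= exp (C * C / c * len) * (M0 + C * C / c * len)) by (apply Rmult_le_compat_l; lra).
    lra. }
  intros x Hx. split; [auto|]. specialize (Hzd x). unfold cx in Hzd. rewrite clamp_id in Hzd by lra.
  unfold cz in Hzd. rewrite clamp_id in Hzd; auto. apply Rabs_le_between. auto.
Qed.

Definition lin_p (x : R) : R := H x (F_base x) z0 0 0 / g1 x (F_base x) z0 0 0 * Fx F x z0 0 0.
Definition lin_q (x : R) : R := G x (F_base x) z0 0 0 / g1 x (F_base x) z0 0 0 * Fx F x z0 0 0.

Lemma zeta_slope_0 x u : 0 <= Fx F x z0 0 0 -> zeta_slope 0 x u = lin_p x * u + lin_q x.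
Proof.
intros Hp. destruct SF as [He0 Hd0 _ _ _ _ _ Hsp]. unfold zeta_slope. cbv zeta.
replace (z0 + 0 * u) with z0 by ring. fold (F_base x). rewrite Hsp by lra. rewrite Rmax_left by auto.
replace (0 * G x (F_base x) z0 0 0 + (z0 - z0) * H x (F_base x) z0 0 0) with 0 by ring.
rewrite Rmult_0_r, Rminus_0_r. unfold lin_p, lin_q, Rdiv. ring.
Qed.

(** Beyond the fold the cut-off slope vanishes, so the value at the exit is the one
    at the fold, up to which the equation is linear. *)
Lemma zeta_limit xE zeta : xf <= xE <= xf + eta ->
  (forall x, xl <= x <= xE -> is_derive zeta x (zeta_slope 0 x (zeta x))) ->
  zeta xE = exp (RInt lin_p xl xf) * zeta xl + RInt (fun u => lin_q u * exp (RInt lin_p u xf)) xl xf.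
Proof.
intros HxE Hz. destruct RB as [Hlt Hpos HFx [Hf1 Hf2] Hlow].
destruct SF as [He0 Hd0 HF Hg1 Hg2 HG HH Hsp]. destruct BT as [Heta Hrho _ _ _ HC Hc _ _ _ Hfold _].
assert (HFxc : forall x, continuous (fun x => Fx F x z0 0 0) x).
{ intros x. apply (ex_derive_continuous (fun x => Fx F x z0 0 0)). eexists. apply is_derive_Fx_x; lra. }
assert (Hxl : 0 <= Fx F xl z0 0 0).
{ apply Rnot_lt_le. intros Hn.
  destruct (positive_near (fun x => - Fx F x z0 0 0) xl) as [n [Hn1 Hn2]].
  - apply (continuous_opp (fun x => Fx F x z0 0 0)). auto.
  - lra.
  - set (x := xl + Rmin n ((xf - xl) / 2)).
    assert (0 < Rmin n ((xf - xl) / 2)) by (apply Rmin_glb_lt; lra).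
    assert (Rmin n ((xf - xl) / 2) <= n) by min_le.
    assert (Rmin n ((xf - xl) / 2) <= (xf - xl) / 2) by min_le.
    specialize (Hn2 x ltac:(apply Rabs_le; unfold x; lra)). specialize (HFx x ltac:(unfold x; lra)). lra. }
assert (Hnn : forall x, xl <= x <= xf -> 0 <= Fx F x z0 0 0).
{ intros x Hx. destruct (Req_dec x xl) as [->|]; auto. destruct (Req_dec x xf) as [->|]; [lra|].
  left. apply HFx. lra. }
assert (Hend : zeta xE = zeta xf).
{ assert (Hzero : forall x, xf <= x <= xE -> is_derive zeta x 0).
  { intros x Hx. specialize (Hz x ltac:(lra)).
    replace 0 with (zeta_slope 0 x (zeta x)); auto.
    unfold zeta_slope. cbv zeta. replace (z0 + 0 * zeta x) with z0 by ring.
    rewrite Rmax_right; [ring|]. apply Rle_trans with (Fx F xf z0 0 0); [|lra].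
    apply Ropp_le_cancel. apply (deriv_nonneg_le (fun x => - Fx F x z0 0 0) (fun x => - Fx (Fx F) x z0 0 0)); [lra| |].
    - intros s Hs. apply (is_derive_opp (fun x => Fx F x z0 0 0)). apply is_derive_Fx_x; lra.
    - intros s Hs. assert (Fx (Fx F) s z0 0 0 <= - c); [|lra].
      apply Hfold; try lra; rewrite ?Rminus_diag, Rabs_R0; lra. }
  destruct (Req_dec xf xE) as [->|]; [reflexivity|].
  destruct (MVT_on zeta (fun _ => 0) xf xE ltac:(lra) Hzero) as [u [_ Hu]]. lra. }
rewrite Hend. apply variation_of_constants; [lra| |].
- assert (HK : forall h, smooth e0 d0 h -> forall x, continuous (fun x => h x (F x z0 0 0) z0 0 0) x).
  { intros h Hh x. apply continuous_on_graph; auto; lra. }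
  assert (HKq : forall h, smooth e0 d0 h -> forall x, xl <= x <= xf ->
    continuous (fun x => h x (F_base x) z0 0 0 / g1 x (F_base x) z0 0 0 * Fx F x z0 0 0) x).
  { intros h Hh x Hx. apply (continuous_mult (fun x => h x (F_base x) z0 0 0 / g1 x (F_base x) z0 0 0) (fun x => Fx F x z0 0 0)); auto.
    apply (continuous_mult (fun x => h x (F_base x) z0 0 0) (fun x => / g1 x (F_base x) z0 0 0)); [apply (HK h Hh)|].
    apply (continuous_Rinv_comp (fun x => g1 x (F_base x) z0 0 0)); [apply (HK g1 Hg1)|].
    apply Rgt_not_eq. apply Hpos; auto. }
  intros x Hx. split; [apply (HKq H)|apply (HKq G)]; auto.
- intros x Hx. rewrite <- zeta_slope_0 by auto. apply Hz. lra.
Qed.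

End Tube.

Lemma layer_tube (d xb xs ys zs : R) :
  - d0 < d < d0 -> xb <= xs -> (forall x, xb <= x <= xs -> ys < F x zs 0 d) ->
  exists c1 rho2 C1, 0 < c1 /\ 0 < rho2 /\ 0 <= C1 /\
    forall x y z e, xb <= x <= xs + rho2 -> Rabs (y - ys) <= rho2 -> Rabs (z - zs) <= rho2 ->
      0 < e <= rho2 ->
      y - fast_F d x z e <= - c1 /\ Rabs (fast_g g1 d x y z e) <= C1 /\ Rabs (fast_g g2 d x y z e) <= C1.
Proof.
intros Hd Hbs Hpos. destruct SF as [He0 Hd0 HF Hg1 Hg2 HG HH Hsp].
destruct (positive_near (fun x => F x zs 0 d - ys) xs) as [n [Hn Pn]].
{ apply continuous_minus_const. apply (ex_derive_continuous (fun x => F x zs 0 d)).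
  eexists. apply is_derive_F_x; lra. }
{ specialize (Hpos xs ltac:(lra)). lra. }
set (b := xs + n).
assert (Hc : forall h, smooth e0 d0 h -> forall x, cont5 h x ys zs 0 d).
{ intros h Hh x. apply (smooth_cont5 e0 d0); auto; lra. }
assert (Hgc : forall x, xb <= x <= b -> continuous (fun _ : R => ys) x) by (intros; apply continuous_const).
destruct (tube_bound (fun _ => ys) zs d xb b g1 Hgc (fun x _ => Hc g1 Hg1 x)) as [r1 [Hr1 B1]].
destruct (tube_bound (fun _ => ys) zs d xb b g2 Hgc (fun x _ => Hc g2 Hg2 x)) as [r2 [Hr2 B2]].
destruct (tube_pos (fun _ => ys) zs d xb b (fun x y z e d => lift F x y z e d - y)) as [r3 [Hr3 B3]]; auto.
{ intros x Hx. split.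
  - intros eps Heps. destruct (Hc _ HF x (eps / 2) ltac:(lra)) as [r [Hr HK]].
    exists (Rmin r (eps / 2)). split; [apply Rmin_glb_lt; lra|].
    intros x' y' z' e' d' K1 K2 K3 K4 K5.
    assert (M1 : Rmin r (eps / 2) <= r) by min_le. assert (M2 : Rmin r (eps / 2) <= eps / 2) by min_le.
    specialize (HK x' y' z' e' d' ltac:(lra) ltac:(lra) ltac:(lra) ltac:(lra) ltac:(lra)).
    replace (lift F x' y' z' e' d' - y' - (lift F x ys zs 0 d - ys)) with
     ((lift F x' y' z' e' d' - lift F x ys zs 0 d) + - (y' - ys)) by ring.
    eapply Rle_lt_trans; [apply Rabs_triang|]. rewrite Rabs_Ropp. lra.
  - unfold lift. destruct (Rle_lt_dec x xs).
    + specialize (Hpos x ltac:(lra)). lra.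
    + apply Pn. apply Rabs_le. unfold b in Hx. lra. }
exists r3, (Rmin n (Rmin r1 (Rmin r2 r3))), (/ r1 + / r2).
assert (M1 : Rmin n (Rmin r1 (Rmin r2 r3)) <= n) by min_le.
assert (M2 : Rmin n (Rmin r1 (Rmin r2 r3)) <= r1) by min_le.
assert (M3 : Rmin n (Rmin r1 (Rmin r2 r3)) <= r2) by min_le.
assert (M4 : Rmin n (Rmin r1 (Rmin r2 r3)) <= r3) by min_le.
assert (I1 : 0 < / r1) by now apply Rinv_0_lt_compat. assert (I2 : 0 < / r2) by now apply Rinv_0_lt_compat.
split; auto. split; [repeat apply Rmin_glb_lt; auto|]. split; [lra|].
intros x y z e Hx Hy Hz He.
assert (Hin : forall r, Rmin n (Rmin r1 (Rmin r2 r3)) <= r -> inbox (fun _ => ys) zs d xb b r x y z e d).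
{ intros r Hr. unfold inbox, b. rewrite Rminus_diag, Rabs_R0, (Rabs_pos_eq e) by lra. lra. }
specialize (B1 _ _ _ _ _ (Hin r1 M2)). specialize (B2 _ _ _ _ _ (Hin r2 M3)). specialize (B3 _ _ _ _ _ (Hin r3 M4)).
unfold lift in B3. unfold fast_F, fast_g. lra.
Qed.

(** In the variable zeta the reduced solution depends continuously on delta down to
    delta = 0, where the equation is linear; for each fixed delta the orbits shadow
    [z0 + delta zeta]. The initial data [zeta_s] and [xl'] vary because the landing points
    move with delta. *)
Theorem half_cycle (Zin : R) : exists eta1, 0 < eta1 /\
  forall xE, xf < xE < xf + eta1 -> forall kappa, 0 < kappa -> exists delta, 0 < delta /\
  forall d zeta_s xl', 0 < d < delta -> Rabs (zeta_s - Zin) < delta -> Rabs (xl' - xl) < delta ->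
    0 < Fx F xl' (z0 + d * zeta_s) 0 d ->
  exists zeta_e,
    Rabs (zeta_e - (exp (RInt lin_p xl xf) * Zin + RInt (fun u => lin_q u * exp (RInt lin_p u xf)) xl xf)) < kappa /\
    forall xc xs, Rabs (xc - xf) <= xE - xf -> Fx F xc (z0 + d * zeta_e) 0 d = 0 -> xl' < xs ->
      (forall x, xl' < x <= xs -> F xl' (z0 + d * zeta_s) 0 d < F x (z0 + d * zeta_s) 0 d) ->
    forall kappa', 0 < kappa' -> exists eps1 rho1, 0 < eps1 /\ 0 < rho1 /\
    forall e a T X Y Z, 0 < e < eps1 -> a <= T ->
      orbit (fast_F d) (fast_g g1 d) (fast_g g2 d) e a T X Y Z ->
      X a = xs -> Rabs (Y a - F xl' (z0 + d * zeta_s) 0 d) < rho1 -> Rabs (Z a - (z0 + d * zeta_s)) < rho1 ->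
      exists tb, a <= tb <= T /\
        (forall t, a <= t <= tb ->
          (Y t - F (X t) (Z t) e d < 0 /\ Rabs (Y t - Y a) + Rabs (Z t - Z a) <= kappa' * (xs - X t) /\
           Rabs (Y t - Y a) + Rabs (Z t - Z a) <= kappa' /\ (a < t -> X t < xs)) \/
          (0 <= Y t - F (X t) (Z t) e d /\ X t <= xE /\ Rabs (Z t - z0) <= kappa)) /\
        (tb = T \/
         (X tb = xE /\ Rabs (Z tb - (z0 + d * zeta_e)) < kappa' /\
          Rabs (Y tb - F xc (z0 + d * zeta_e) 0 d) < kappa')).
Proof.
destruct exists_branch_tube as [eta [rho [C [c BT]]]].
assert (HSF := SF). destruct HSF as [He0 Hd0 HF Hg1 Hg2 HG HH Hsp].
assert (HRB := RB). destruct HRB as [Hlt Hpos HFx [Hf1 Hf2] Hlow].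
assert (Heta := bt_eta _ _ _ _ BT). assert (Hrho := bt_rho _ _ _ _ BT). assert (HC := bt_C _ _ _ _ BT).
assert (Hc := bt_c _ _ _ _ BT). assert (Hrd := bt_rho_d _ _ _ _ BT). assert (Hre := bt_rho_e _ _ _ _ BT).
exists (Rmin (eta / 2) (Rmin (rho / (32 * C)) ((xf - xl) / 2))).
split. { repeat apply Rmin_glb_lt; try lra. apply Rdiv_lt_0_compat; lra. }
intros xE HxE kappa Hk.
destruct (passage_exists eta rho C c BT xE HxE) as [c2 [Cb [L [r1 [Hr1 Hpass]]]]].
assert (HxE1 : xE < xf + eta / 2) by (pose proof (Rmin_l (eta / 2) (Rmin (rho / (32 * C)) ((xf - xl) / 2))); lra).
assert (HxE3 : xE < xf + (xf - xl) / 2).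
{ pose proof (Rmin_r (eta / 2) (Rmin (rho / (32 * C)) ((xf - xl) / 2))).
  pose proof (Rmin_r (rho / (32 * C)) ((xf - xl) / 2)). lra. }
destruct (rb_pos eta rho C c BT) as [Hrb1 Hrb2]. set (rb := rho / (6 * C)) in *.
set (N := zeta_bound eta C c xE (Rabs Zin + 1)).
assert (HN : 1 <= N).
{ unfold N, zeta_bound. assert (0 <= C * C / c) by (apply Rdiv_le_0_compat; nra).
  pose proof (Rabs_pos Zin). pose proof (exp_pos (C * C / c * (xE - (xl - eta)))).
  assert (0 <= Rabs Zin + 1 + C * C / c * (xE - (xl - eta))) by nra. nra. }
destruct (zeta_slope_lip eta rho C c BT N ltac:(lra)) as [Lam [HLam HLip]].
destruct (zeta_solution eta rho C c BT xE xl Zin 0 (Rabs Zin + 1) ltac:(lra) ltac:(lra) ltac:(lra) ltac:(fold rb; lra) ltac:(fold rb; lra)) as [zeta0 [Hz00 Hz0]].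
fold N in Hz0.
assert (Hlim := zeta_limit eta rho C c BT xE zeta0 ltac:(lra) (fun x Hx => proj2 (Hz0 x ltac:(lra)))).
rewrite Hz00 in Hlim. rewrite <- Hlim.
set (r := Rmin r1 kappa). assert (Hr : 0 < r) by (apply Rmin_glb_lt; lra).
assert (Hr2 : r <= r1) by min_le. assert (Hr3 : r <= kappa) by min_le.
set (len := xE - (xl - eta)). set (E := exp (Lam * len)). assert (HE : 0 < E) by apply exp_pos.
assert (Hlen : 0 < len) by (unfold len; lra).
assert (Hc0 : continuous zeta0 xl).
{ apply (ex_derive_continuous zeta0). eexists. apply Hz0. lra. }
set (q := kappa / (4 * E)). assert (Hq : 0 < q) by (apply Rdiv_lt_0_compat; lra).
destruct (proj1 (filterlim_locally _ _) Hc0 (mkposreal q Hq)) as [mod0 Hmod]. pose proof (cond_pos mod0) as Hmodp.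
set (delta := Rmin (Rmin 1 (r / (2 * N))) (Rmin (Rmin q (q / (Lam * len))) (Rmin mod0 (Rmin (eta / 2) ((xf - xl) / 4))))).
assert (Hdl : 0 < delta).
{ unfold delta. repeat apply Rmin_glb_lt; try lra; apply Rdiv_lt_0_compat; nra. }
assert (D1 : delta <= 1) by min_le.
assert (D2 : delta <= r / (2 * N)) by min_le.
assert (D3 : delta <= q) by (eapply Rle_trans; [apply Rmin_r|]; eapply Rle_trans; [apply Rmin_l|apply Rmin_l]).
assert (D4 : delta <= q / (Lam * len)) by (eapply Rle_trans; [apply Rmin_r|]; eapply Rle_trans; [apply Rmin_l|apply Rmin_r]).
assert (D5 : delta <= mod0) by min_le.
assert (D6 : delta <= eta / 2) by min_le.
assert (D7 : delta <= (xf - xl) / 4) by min_le.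
exists delta. split; auto.
intros d zs xl' Hd Hzs Hxl' HFxl.
assert (HdN : d * N <= r / 2).
{ apply Rle_trans with (r / (2 * N) * N); [|right; field; lra]. apply Rmult_le_compat_r; lra. }
assert (Hdr : d <= r) by nra.
assert (Hzs1 : Rabs zs <= Rabs Zin + 1).
{ replace zs with ((zs - Zin) + Zin) by ring. eapply Rle_trans; [apply Rabs_triang|]. lra. }
assert (Hxl'b := Hxl'). apply Rabs_def2 in Hxl'b.
destruct (zeta_solution eta rho C c BT xE xl' zs d (Rabs Zin + 1) ltac:(lra) ltac:(lra) Hzs1 ltac:(fold rb; lra) ltac:(fold rb N; lra)) as [zeta [Hz1 Hz]].
fold N in Hz.
exists (zeta xE). split.
{ (* continuous dependence on delta, by Gronwall from xl' on *)
  assert (Hg := gronwall_two_sided (fun x => zeta x - zeta0 x) (fun x => zeta_slope d x (zeta x) - zeta_slope 0 x (zeta0 x))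
    Lam (Lam * d) (xl - eta) xE xl' xE ltac:(lra) ltac:(nra) ltac:(lra) ltac:(lra)).
  cbv beta in Hg. fold len E in Hg.
  assert (Hg' : Rabs (zeta xE - zeta0 xE) <= E * (Rabs (zeta xl' - zeta0 xl') + Lam * d * len)).
  { apply Hg. intros x Hx. destruct (Hz x Hx) as [A1 A2]. destruct (Hz0 x Hx) as [A3 A4]. split.
    - apply (is_derive_minus zeta zeta0); auto.
    - eapply Rle_trans; [apply HLip; fold rb; try lra; auto|]. rewrite Rminus_0_r, (Rabs_pos_eq d) by lra. lra. }
  rewrite Hz1 in Hg'.
  assert (Hm : Rabs (zeta0 xl' - zeta0 xl) < q).
  { apply (Hmod xl'). change (Rabs (xl' - xl) < mod0). lra. }
  rewrite Hz00 in Hm.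
  assert (Rabs (zs - zeta0 xl') < 2 * q).
  { replace (zs - zeta0 xl') with ((zs - Zin) + - (zeta0 xl' - Zin)) by ring.
    eapply Rle_lt_trans; [apply Rabs_triang|]. rewrite Rabs_Ropp. lra. }
  assert (Lam * d * len <= q).
  { apply Rle_trans with (Lam * len * (q / (Lam * len))); [|right; field; split; lra].
    replace (Lam * d * len) with (Lam * len * d) by ring. apply Rmult_le_compat_l; [nra|lra]. }
  assert (E * (Rabs (zs - zeta0 xl') + Lam * d * len) < E * (4 * q)) by (apply Rmult_lt_compat_l; lra).
  assert (E * (4 * q) = kappa) by (unfold q; field; lra). lra. }
intros xc xs Hxc Hcrit Hxs Hlay kappa' Hk'.
assert (HP := Hpass r d ltac:(lra) ltac:(lra)).
set (zp := fun x => z0 + d * zeta x).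
assert (Hzp : forall x, xl - eta <= x <= xE -> is_derive zp x (reduced_slope d x (zp x)) /\ Rabs (zp x - z0) <= r / 2).
{ intros x Hx. destruct (Hz x Hx) as [A1 A2]. split.
  - replace (reduced_slope d x (zp x)) with (0 + d * zeta_slope d x (zeta x)).
    + apply (is_derive_plus (fun _ => z0) (fun x => d * zeta x) x 0); [apply (is_derive_const z0)|].
      apply (is_derive_scal zeta x d). exact A2.
    + rewrite Rplus_0_l. unfold reduced_slope, slow_rate, zeta_slope. cbv zeta. fold (zp x).
      set (y := F x (zp x) 0 d). rewrite (Hsp x y (zp x) 0 d) by lra.
      replace (d * G x y (zp x) 0 d + (zp x - z0) * H x y (zp x) 0 d) with (d * (G x y (zp x) 0 d + zeta x * H x y (zp x) 0 d)) by (unfold zp; ring).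
      unfold Rdiv. ring.
  - unfold zp. replace (z0 + d * zeta x - z0) with (d * zeta x) by ring. rewrite Rabs_mult, (Rabs_pos_eq d) by lra.
    apply Rle_trans with (d * N); [apply Rmult_le_compat_l; lra|lra]. }
set (zss := z0 + d * zs) in *.
set (k2 := Rmin kappa' (kappa' / (xs - (xl - eta)))).
assert (Hk2 : 0 < k2) by (apply Rmin_glb_lt; [lra|apply Rdiv_lt_0_compat; lra]).
assert (Hk2a : k2 <= kappa') by min_le.
assert (Hk2b : k2 * (xs - (xl - eta)) <= kappa').
{ apply Rle_trans with (kappa' / (xs - (xl - eta)) * (xs - (xl - eta))); [|right; field; lra].
  apply Rmult_le_compat_r; [lra|apply Rmin_r]. }
destruct (smooth_cont5 e0 d0 _ xl' 0 zss 0 d smooth_Fx ltac:(lra) ltac:(lra) (Fx F xl' zss 0 d) HFxl) as [k0 [Hk0 HFk]].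
destruct (half_passage _ _ _ _ _ _ _ _ _ _ _ _ _ _ _ _ _ _ _ HP zp Hzp xl' zss (F xl' zss 0 d) xs (k0 / 2)
   ltac:(lra) ltac:(unfold zp, zss; rewrite Hz1; reflexivity) eq_refl ltac:(lra)) with (xc := xc) (kappa := k2) as [eps1 [rho1 [He1 [Hrho1 HT]]]].
- intros x z e K1 K2 K3.
  assert (K := HFk x 0 z e d ltac:(lra) ltac:(rewrite Rminus_diag, Rabs_R0; lra) ltac:(lra) ltac:(rewrite Rminus_0_r, Rabs_pos_eq; lra) ltac:(rewrite Rminus_diag, Rabs_R0; lra)).
  unfold lift in K. apply Rabs_def2 in K. lra.
- intros x _. apply is_derive_F_x; lra.
- apply Rabs_le_between in Hxc. lra.
- exact Hcrit.
- exact Hxs.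
- exact Hk2.
- intros xb Hxb. apply layer_tube; try lra. intros x Hx. apply Hlay. lra.
- exists eps1, rho1. split; auto. split; auto.
  intros e a T X Y Z He HaT Ho HXa HYa HZa.
  destruct (HT e a T X Y Z He HaT Ho HXa HYa HZa) as [tb [Htb [Hg Hend]]].
  exists tb. split; auto. split.
  + intros t Ht. destruct (Hg t Ht) as [[K1 [K2 [K3 K4]]]|[K1 [K2 K3]]]; [left|right].
    * assert (X t <= xs) by (destruct (Req_dec a t) as [<-|]; [lra|left; apply K3; lra]).
      split; [exact K1|].
      assert (k2 * (xs - X t) <= kappa' * (xs - X t)) by (apply Rmult_le_compat_r; lra).
      assert (k2 * (xs - X t) <= k2 * (xs - (xl - eta))) by (apply Rmult_le_compat_l; lra).
      split; [lra|]. split; [lra|exact K3].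
    * split; [exact K1|]. split; lra.
  + destruct Hend as [Hend|[K1 [K2 K3]]]; [now left|right]. split; auto. unfold zp, fast_F in K2, K3. split; lra.
Qed.

End Branch.

(** * Scalar orbits of the layer and of the reduced flow *)

(** Otherwise the speed would eventually be bounded away from 0, and the
    orbit would leave every neighbourhood of its limit. *)
Lemma limit_equilibrium (h u : R -> R) (l : R) :
  continuous h l -> (forall t, 0 <= t -> is_derive u t (h (u t))) -> is_lim u p_infty l -> h l = 0.
Proof.
intros Hh Hu Hl. apply NNPP. intros Hne.
assert (Hl' : filterlim u (Rbar_locally' p_infty) (locally l)) by exact Hl.
set (m := Rabs (h l) / 2). assert (Hm : 0 < m) by (unfold m; pose proof (Rabs_pos_lt _ Hne); lra).
assert (Hev : Rbar_locally' p_infty (fun t => Rabs (h (u t) - h l) < m /\ Rabs (u t - l) < 1)).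
{ apply filter_and.
  - apply (filterlim_comp _ _ _ u h _ _ _ Hl' Hh (fun v => Rabs (v - h l) < m)).
    exists (mkposreal m Hm). intros v Hv. exact Hv.
  - apply (Hl' (fun v => Rabs (v - l) < 1)). exists (mkposreal 1 Rlt_0_1). intros v Hv. exact Hv. }
destruct Hev as [t0 Ht0].
set (a := Rmax 0 t0 + 1). assert (Ha : 0 <= Rmax 0 t0 /\ t0 <= Rmax 0 t0) by (split; [apply Rmax_l|apply Rmax_r]).
set (b := a + 2 / m + 1). assert (0 < 2 / m) by (apply Rdiv_lt_0_compat; lra).
destruct (MVT_on u (fun t => h (u t)) a b) as [c [Hc Heq]]; [unfold b; lra|intros; apply Hu; unfold a in *; lra|].
destruct (Ht0 c ltac:(unfold a in *; lra)) as [H1 _].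
destruct (Ht0 a ltac:(unfold a in *; lra)) as [_ H2]. destruct (Ht0 b ltac:(unfold b, a in *; lra)) as [_ H3].
assert (H4 : m <= Rabs (h (u c))).
{ replace (h l) with (h (u c) + - (h (u c) - h l)) in * by ring.
  assert (Q := Rabs_triang (h (u c)) (- (h (u c) - h l))). rewrite Rabs_Ropp in Q.
  replace (h (u c) + - (h (u c) - h l)) with (h l) in * by ring. unfold m in *. lra. }
assert (H5 : Rabs (u b - u a) < 2).
{ replace (u b - u a) with ((u b - l) + - (u a - l)) by ring. eapply Rle_lt_trans; [apply Rabs_triang|]. rewrite Rabs_Ropp. lra. }
rewrite Heq, Rabs_mult, (Rabs_pos_eq (b - a)) in H5 by (unfold b; lra).
assert (m * (b - a) <= Rabs (h (u c)) * (b - a)) by (apply Rmult_le_compat_r; [unfold b; lra|auto]).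
assert (m * (b - a) = 2 + m) by (unfold b; field; lra). lra.
Qed.

Lemma equilibrium_stays (h h' u : R -> R) (t0 t c : R) :
  (forall x, is_derive h x (h' x)) -> (forall x, continuous h' x) ->
  t0 <= t -> (forall s, t0 <= s <= t -> is_derive u s (h (u s))) -> h c = 0 -> u t0 = c -> u t = c.
Proof.
intros Hd Hc Ht Hu H0 Hu0.
(* the range of the orbit is bounded, hence h is Lipschitz on it *)
destruct (continuous_bounded (fun s => u s - c) t0 t) as [Br [HBr Hb]].
{ intros s Hs. apply continuous_minus_const. apply (ex_derive_continuous u). eexists. now apply Hu. }
destruct (continuous_bounded h' (c - Br) (c + Br)) as [Lh [HLh HL]]; auto.
assert (Hg := gronwall_two_sided (fun s => u s - c) (fun s => h (u s)) Lh 0 t0 t t0 t ltac:(lra) ltac:(lra) ltac:(lra) ltac:(lra)).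
cbv beta in Hg. rewrite Hu0, Rminus_diag, Rabs_R0, Rmult_0_l, Rplus_0_l, Rmult_0_r in Hg.
assert (Rabs (u t - c) <= 0); [|pose proof (Rabs_pos (u t - c)); assert (Rabs (u t - c) = 0) by lra; apply Rabs_eq_0 in H2; lra].
apply Hg. intros s Hs. split.
- rewrite <- (Rminus_0_r (h (u s))). apply (is_derive_minus u (fun _ => c)); [now apply Hu|apply (is_derive_const c)].
- rewrite Rplus_0_r. replace (h (u s)) with (h (u s) - h c) by lra.
  apply (mvt_bound h). intros v Hv. split; [eexists; apply Hd|].
  replace (Derive h v) with (h' v) by (symmetry; apply is_derive_unique, Hd).
  apply HL. specialize (Hb s Hs). apply Rabs_le_between in Hb. unfold Rmin, Rmax in Hv. destruct Rle_dec; lra.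
Qed.

(** At the first time it reaches [x], a solution that comes from above has a
    nonpositive speed, and a zero speed would stop it there. *)
Lemma descending_orbit (h h' u : R -> R) (l : R) :
  (forall x, is_derive h x (h' x)) -> (forall x, continuous h' x) ->
  (forall t, 0 <= t -> is_derive u t (h (u t))) -> is_lim u p_infty l ->
  forall x, l < x < u 0 -> h x < 0.
Proof.
intros Hd Hc Hu Hl x Hx.
assert (Hl' : filterlim u (Rbar_locally' p_infty) (locally l)) by exact Hl.
assert (Hev : Rbar_locally' p_infty (fun t => u t < x)).
{ apply (Hl' (fun v => v < x)). apply open_lt. lra. }
destruct Hev as [t0 Ht0].
set (b := Rmax 0 t0 + 1). assert (Ha : 0 <= Rmax 0 t0 /\ t0 <= Rmax 0 t0) by (split; [apply Rmax_l|apply Rmax_r]).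
assert (Hcu : forall t, 0 <= t -> continuous u t).
{ intros t Ht. apply (ex_derive_continuous u). eexists. now apply Hu. }
destruct (first_exit (fun t => u t - x) 0 b) as [Hall|[t1 [Ht1 [Hz Hb]]]].
- unfold b; lra.
- intros t Ht. apply continuous_minus_const. apply Hcu; lra.
- lra.
- specialize (Hall b ltac:(unfold b; lra)). specialize (Ht0 b ltac:(unfold b; lra)). lra.
- assert (Hle : h x <= 0).
  { apply (is_derive_first_zero (fun t => u t - x) 0 t1); try lra; auto.
    replace (h x) with (h (u t1) - 0) by (replace (u t1) with x by lra; ring).
    apply (is_derive_minus u (fun _ => x)); [apply Hu; lra|apply (is_derive_const x)]. }
  destruct (Rle_lt_or_eq_dec _ _ Hle) as [|Heq]; auto. exfalso.
  assert (u b = x).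
  { apply (equilibrium_stays h h' u t1 b x Hd Hc ltac:(lra)); auto; [|lra]. intros s Hs. apply Hu; lra. }
  specialize (Ht0 b ltac:(unfold b; lra)). lra.
Qed.

Lemma ascending_orbit (h h' u : R -> R) (l : R) :
  (forall x, is_derive h x (h' x)) -> (forall x, continuous h' x) ->
  (forall t, 0 <= t -> is_derive u t (h (u t))) -> is_lim u p_infty l ->
  forall x, u 0 < x < l -> 0 < h x.
Proof.
intros Hd Hc Hu Hl x Hx.
assert (- h (- - x) < 0); [|rewrite Ropp_involutive in H; lra].
apply (descending_orbit (fun v => - h (- v)) (fun v => h' (- v)) (fun t => - u t) (- l)).
- intros v. replace (h' (- v)) with (- (-1 * h' (- v))) by ring.
  apply (is_derive_opp (fun v => h (- v))). apply (is_derive_comp h Ropp); auto. auto_derive; auto.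
- intros v. apply (continuous_comp Ropp h'); [apply (continuous_opp (fun x : R => x) v), (continuous_id v)|apply Hc].
- intros t Ht. rewrite Ropp_involutive. apply (is_derive_opp u). auto.
- apply (is_lim_opp u p_infty l). exact Hl.
- lra.
Qed.

Lemma continuous_derive (u : R -> R) (x l : R) : is_derive u x l -> continuous u x.
Proof. intros H. apply (ex_derive_continuous u). now exists l. Qed.

(** On an arc that the reduced flow traverses in finite time, the vector
    field cannot vanish: after its last visit to a zero [c] the solution would
    satisfy a Gronwall inequality forcing it to stay at [c]. *)
Lemma branch_speed_pos (F0 dF0 gam dgam : R -> R) (xl xf T : R) (X Y : R -> R) :
  xl < xf -> 0 < T ->
  (forall x, is_derive F0 x (dF0 x)) -> (forall x, is_derive gam x (dgam x)) ->
  (forall x, xl < x < xf -> 0 < dF0 x) -> (0 < dF0 xl \/ gam xl <> 0) -> gam xf <> 0 ->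
  (forall t, 0 <= t <= T -> continuous X t /\ continuous Y t) ->
  (forall t, 0 <= t <= T -> Y t = F0 (X t)) -> X 0 = xl -> X T = xf ->
  (forall t, 0 < t < T -> X t < xf /\ is_derive Y t (gam (X t))) ->
  forall x, xl <= x <= xf -> 0 < gam x.
Proof.
intros Hlt HT HdF Hdg Hpos Hl Hf Hcont HY HX0 HXT Hder.
assert (Hinc : forall u v, xl <= u -> u < v -> v <= xf -> F0 u < F0 v).
{ intros u v Hu Huv Hv. apply (deriv_pos_open_lt F0 dF0 u v Huv); auto. intros t Ht. apply Hpos; lra. }
assert (Hlast : forall c, xl <= c < xf -> exists ts, 0 <= ts < T /\ X ts = c /\ forall t, ts < t <= T -> c < X t).
{ intros c Hc. destruct (first_exit (fun s => X (T - s) - c) 0 T) as [Hall|[s1 [Hs1 [Hz Hb]]]].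
  - lra.
  - intros s Hs. apply continuous_minus_const. apply (continuous_comp (fun s => T - s) X).
    + apply (continuous_derive _ s (-1)). auto_derive; auto; ring.
    + apply Hcont. lra.
  - rewrite Rminus_0_r. lra.
  - specialize (Hall T ltac:(lra)). rewrite Rminus_diag in Hall. lra.
  - exists (T - s1). split; [|split; [lra|]].
    + split; [lra|]. lra.
    + intros t Ht. specialize (Hb (T - t) ltac:(lra)). replace (T - (T - t)) with t in Hb by ring. lra. }
assert (Hne : forall c, xl <= c < xf -> 0 < dF0 c -> gam c <> 0).
{ intros c Hc Hdc H0. destruct (Hlast c Hc) as [ts [Hts [HXts Haft]]].
  set (m := dF0 c / 2). assert (Hm : 0 < m) by (unfold m; lra).
  set (Lg := Rabs (dgam c) + 1). assert (HLg : 1 <= Lg) by (unfold Lg; pose proof (Rabs_pos (dgam c)); lra).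
  (* near c, |gam| <= (Lg / m) * (F0 - F0 c) to the right of c *)
  assert (Hloc : exists eta, 0 < eta /\ forall x, c <= x < c + eta -> Rabs (gam x) <= Lg / m * Rabs (F0 x - F0 c)).
  { assert (H1 := proj1 (is_derive_Reals F0 c (dF0 c)) (HdF c)). assert (H2 := proj1 (is_derive_Reals gam c (dgam c)) (Hdg c)).
    destruct (H1 m Hm) as [e1 He1]. destruct (H2 1 Rlt_0_1) as [e2 He2].
    pose proof (cond_pos e1). pose proof (cond_pos e2).
    exists (Rmin e1 e2). split; [apply Rmin_glb_lt; auto|]. intros x Hx.
    assert (Rmin e1 e2 <= e1) by min_le. assert (Rmin e1 e2 <= e2) by min_le.
    destruct (Req_dec x c) as [->|Hxc].
    { rewrite H0, Rabs_R0. apply Rmult_le_pos; [apply Rdiv_le_0_compat; lra|apply Rabs_pos]. }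
    set (k := x - c). assert (Hk : 0 < k) by (unfold k; lra).
    assert (K1 := He1 k ltac:(lra) ltac:(rewrite Rabs_pos_eq; unfold k in *; lra)).
    assert (K2 := He2 k ltac:(lra) ltac:(rewrite Rabs_pos_eq; unfold k in *; lra)).
    replace (c + k) with x in * by (unfold k; ring). rewrite H0, Rminus_0_r in K2.
    assert (K3 : m * k <= F0 x - F0 c).
    { apply Rabs_def2 in K1. assert (m < (F0 x - F0 c) / k) by (unfold m in *; lra).
      replace (F0 x - F0 c) with ((F0 x - F0 c) / k * k) by (field; lra). apply Rmult_le_compat_r; lra. }
    assert (K4 : Rabs (gam x) <= Lg * k).
    { replace (gam x) with (gam x / k * k) by (field; lra). rewrite Rabs_mult, (Rabs_pos_eq k) by lra.
      apply Rmult_le_compat_r; [lra|]. unfold Lg.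
      replace (gam x / k) with ((gam x / k - dgam c) + dgam c) by ring. eapply Rle_trans; [apply Rabs_triang|]. lra. }
    eapply Rle_trans; [exact K4|]. replace (Lg * k) with (Lg / m * (m * k)) by (field; lra).
    apply Rmult_le_compat_l; [apply Rdiv_le_0_compat; lra|]. rewrite Rabs_pos_eq; nra. }
  destruct Hloc as [eta [Heta Hloc]].
  destruct (Hcont ts ltac:(lra)) as [cX cY].
  destruct (proj1 (filterlim_locally _ _) cX (mkposreal eta Heta)) as [et Het]. pose proof (cond_pos et).
  set (tb := ts + Rmin (et / 2) ((T - ts) / 2)).
  assert (Hm1 : 0 < Rmin (et / 2) ((T - ts) / 2)) by (apply Rmin_glb_lt; lra).
  assert (Hm2 : Rmin (et / 2) ((T - ts) / 2) <= et / 2) by min_le.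
  assert (Hm3 : Rmin (et / 2) ((T - ts) / 2) <= (T - ts) / 2) by min_le.
  assert (Hnear : forall t, ts < t <= tb -> c < X t < c + eta).
  { intros t Ht. assert (HXt : Rabs (X t - X ts) < eta).
    { apply (Het t). change (Rabs (t - ts) < et). unfold tb in *. rewrite Rabs_pos_eq; lra. }
    apply Rabs_def2 in HXt. specialize (Haft t ltac:(unfold tb in *; lra)). lra. }
  set (K := Lg / m). assert (HK : 0 <= K) by (apply Rdiv_le_0_compat; lra).
  assert (Hbd : forall s, ts < s <= tb -> Rabs (Y tb - F0 c) <= exp (K * (tb - ts)) * Rabs (Y s - F0 c)).
  { intros s Hs.
    assert (Hg := gronwall_two_sided (fun t => Y t - F0 c) (fun t => gam (X t)) K 0 s tb s tb HK ltac:(lra) ltac:(lra) ltac:(lra)).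
    cbv beta in Hg. rewrite Rmult_0_l, Rplus_0_r in Hg. eapply Rle_trans.
    - apply Hg. intros t Ht. split.
      + rewrite <- (Rminus_0_r (gam (X t))). apply (is_derive_minus Y (fun _ => F0 c)); [|apply (is_derive_const (F0 c))].
        apply Hder. unfold tb in *; lra.
      + rewrite Rplus_0_r, (HY t) by (unfold tb in *; lra). apply Hloc. specialize (Hnear t ltac:(lra)). lra.
    - apply Rmult_le_compat_r; [apply Rabs_pos|].
      destruct (Req_dec (K * (tb - s)) (K * (tb - ts))) as [->|]; [lra|]. left. apply exp_increasing.
      assert (K * (tb - s) <= K * (tb - ts)) by (apply Rmult_le_compat_l; lra). lra. }
  set (E := exp (K * (tb - ts))). assert (HE : 0 < E) by apply exp_pos.
  assert (HYb : F0 c < Y tb).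
  { rewrite HY by (unfold tb; lra). specialize (Hnear tb ltac:(unfold tb; lra)).
    apply Hinc; try lra. apply Rlt_le, Hder. unfold tb; lra. }
  set (D := Y tb - F0 c). assert (HD : 0 < D) by (unfold D; lra).
  destruct (proj1 (filterlim_locally _ _) cY (mkposreal (D / E) ltac:(apply Rdiv_lt_0_compat; lra))) as [e2 He2]. pose proof (cond_pos e2).
  set (s := ts + Rmin (e2 / 2) (tb - ts)).
  assert (Hs1 : 0 < Rmin (e2 / 2) (tb - ts)) by (apply Rmin_glb_lt; unfold tb; lra).
  assert (Hs2 : Rmin (e2 / 2) (tb - ts) <= e2 / 2) by min_le.
  assert (Hs3 : Rmin (e2 / 2) (tb - ts) <= tb - ts) by min_le.
  specialize (Hbd s ltac:(unfold s; lra)). fold E D in Hbd. rewrite (Rabs_pos_eq D) in Hbd by lra.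
  assert (HYs : Rabs (Y s - Y ts) < D / E).
  { apply (He2 s). change (Rabs (s - ts) < e2). unfold s. rewrite Rabs_pos_eq; lra. }
  rewrite (HY ts), HXts in HYs by lra.
  assert (E * Rabs (Y s - F0 c) < E * (D / E)) by (apply Rmult_lt_compat_l; auto).
  replace (E * (D / E)) with D in * by (field; lra). lra. }
assert (Hnz : forall c, xl <= c <= xf -> gam c <> 0).
{ intros c Hc. destruct (Req_dec c xf) as [->|]; auto. destruct (Req_dec c xl) as [->|].
  - destruct Hl as [Hl|Hl]; auto. apply Hne; lra.
  - apply Hne; [lra|]. apply Hpos; lra. }
assert (Hex : exists y, xl <= y <= xf /\ 0 < gam y).
{ destruct (Hlast xl ltac:(lra)) as [ts [Hts [HXts Haft]]].
  destruct (MVT_gen Y ts T (fun t => gam (X t))) as [c [Hc Heq]].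
  - intros t Ht. rewrite Rmin_left, Rmax_right in Ht by lra. apply Hder; lra.
  - intros t Ht. rewrite Rmin_left, Rmax_right in Ht by lra. apply continuity_pt_filterlim. apply Hcont; lra.
  - rewrite Rmin_left, Rmax_right in Hc by lra.
    rewrite (HY T), (HY ts), HXT, HXts in Heq by lra.
    assert (F0 xl < F0 xf) by (apply Hinc; lra).
    exists (X c). split.
    + destruct (Req_dec c T) as [->|]; [lra|]. destruct (Req_dec c ts) as [->|]; [lra|].
      split; [left; apply Haft; lra|left; apply Hder; lra].
    + nra. }
destruct Hex as [y [Hy Hyp]]. intros x Hx.
destruct (Rlt_le_dec 0 (gam x)) as [|Hle]; auto. exfalso.
assert (Hcg : continuity gam) by (intros v; eapply is_derive_continuity_pt; apply Hdg).
destruct (IVT_gen gam x y 0 Hcg) as [v [Hv Hv0]].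
- rewrite Rmin_left, Rmax_right; lra.
- apply (Hnz v); auto. unfold Rmin, Rmax in Hv. destruct Rle_dec; lra.
Qed.

(** * Folds, layer orbits and the curve P(L4) *)

Definition oreflect_F (F : R -> R -> R -> R -> R) : R -> R -> R -> R -> R := fun x z e d => - F (- x) z e d.

(** The rotation [(x, y) -> (-x, -y)] maps the system to one of the same form. It
    turns the passage along S_a3 to L4, with decreasing [x], into a rising one. *)
Lemma slow_fast_reflect e0 d0 z0 F g1 g2 G H :
  slow_fast e0 d0 z0 F g1 g2 G H ->
  slow_fast e0 d0 z0 (oreflect_F F) (oreflect g1) (reflect g2) (reflect G) (reflect H).
Proof.
intros [He0 Hd0 HF Hg1 Hg2 HG HH Hsp]. constructor; auto using smooth_reflect, smooth_oreflect.
- exact (smooth_oreflect _ _ _ HF).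
- intros. unfold reflect. now apply Hsp.
Qed.

Lemma is_derive_reflect (u : R -> R) (x l : R) :
  is_derive u (- x) l -> is_derive (fun x => u (- x)) x (- l).
Proof.
intros Hu. replace (- l) with (-1 * l) by ring. apply (is_derive_comp u Ropp x l (-1)); auto.
auto_derive; auto.
Qed.

Lemma Fx_reflect e0 d0 z0 F g1 g2 G H x z e d : slow_fast e0 d0 z0 F g1 g2 G H ->
  - e0 < e < e0 -> - d0 < d < d0 ->
  Fx (oreflect_F F) x z e d = Fx F (- x) z e d.
Proof.
intros HSF He Hd. apply is_derive_unique. unfold oreflect_F.
replace (Fx F (- x) z e d) with (- - Fx F (- x) z e d) by ring.
apply (is_derive_opp (fun x => F (- x) z e d)). apply (is_derive_reflect (fun x => F x z e d)).
now apply (is_derive_F_x e0 d0 z0 F g1 g2 G H).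
Qed.

Lemma Fxx_reflect e0 d0 z0 F g1 g2 G H x z e d : slow_fast e0 d0 z0 F g1 g2 G H ->
  - e0 < e < e0 -> - d0 < d < d0 ->
  Fx (Fx (oreflect_F F)) x z e d = - Fx (Fx F) (- x) z e d.
Proof.
intros HSF He Hd. unfold Fx at 1.
rewrite (Derive_ext _ (fun u => Fx F (- u) z e d)).
- apply is_derive_unique. apply (is_derive_reflect (fun x => Fx F x z e d)).
  now apply (is_derive_Fx_x e0 d0 z0 F g1 g2 G H).
- intros t. now apply (Fx_reflect e0 d0 z0 F g1 g2 G H).
Qed.

Lemma positive_uniformly (u v : R) (h : R -> R -> R -> R -> R) (zs : R) :
  (forall y, u <= y <= v -> 0 < h y zs 0 0 /\ cont5 (fun x _ z e d => h x z e d) y 0 zs 0 0) ->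
  exists r, 0 < r /\ forall y z e d, u <= y <= v -> Rabs (z - zs) <= r -> Rabs e <= r -> Rabs d <= r ->
    r <= h y z e d.
Proof.
intros Hh. destruct (tube_pos (fun _ => 0) zs 0 u v (fun x _ z e d => h x z e d)) as [r [Hr Ht]].
- intros; apply continuous_const.
- intros x Hx. destruct (Hh x Hx). auto.
- exists r. split; auto. intros y z e d Hy Hz He Hd. apply (Ht y 0 z e d).
  unfold inbox. rewrite Rminus_diag, Rabs_R0, Rminus_0_r. lra.
Qed.

Section Geometry.

Variable s : setting.
Hypothesis Hsmooth : smooth_system s.
Hypothesis A1 : assumption1 s.
Hypothesis HDelta : section_setup s.
Hypothesis Hconv : standing_convention s.

Lemma setting_slow_fast : slow_fast (eps0 s) (delta0 s) (z0 s) (F s) (g1 s) (g2 s) (Gz s) (Hz s).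
Proof.
destruct Hsmooth as [He [Hd [HF [Hg1 Hg2]]]]. destruct Hconv as [HG [HH Hsp]].
constructor; auto.
Qed.
Let SF := setting_slow_fast.

Lemma e0_pos : 0 < eps0 s. Proof. apply Hsmooth. Qed.
Lemma d0_pos : 0 < delta0 s. Proof. apply Hsmooth. Qed.

Lemma z0_range : zmin s < zlo s < z0 s /\ z0 s < zhi s < zmax s.
Proof. destruct HDelta as [H1 [H2 _]]. auto. Qed.

Lemma derive_F x z d : small_delta s d -> is_derive (fun x => F s x z 0 d) x (Fx (F s) x z 0 d).
Proof.
intros Hd. unfold small_delta in Hd. pose proof e0_pos. apply (is_derive_F_x _ _ _ _ _ _ _ _ SF); lra.
Qed.

Lemma f_x_Fx x y z d : small_delta s d -> f_x s x y z 0 d = - Fx (F s) x z 0 d.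
Proof.
intros Hd. unfold f_x, f. apply is_derive_unique. rewrite <- (Rminus_0_l (Fx _ _ _ _ _)).
apply (is_derive_minus (fun _ => y) (fun x => F s x z 0 d)); [apply (is_derive_const y)|now apply derive_F].
Qed.

Lemma Fx_sign x z d : zmin s < z < zmax s -> small_delta s d ->
  (0 < Fx (F s) x z 0 d <-> on_branch s Sa1 x z d \/ on_branch s Sa2 x z d \/ on_branch s Sa3 x z d) /\
  (Fx (F s) x z 0 d < 0 <-> on_branch s Sr1 x z d \/ on_branch s Sr2 x z d).
Proof.
intros Hz Hd. destruct A1 as [_ HA]. destruct (HA z d Hz Hd) as [_ [_ [HS _]]].
destruct (HS x (F s x z 0 d)) as [H1 H2].
{ unfold on_S, f. ring. }
rewrite f_x_Fx in H1, H2 by auto. split.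
- rewrite <- H1. lra.
- rewrite <- H2. lra.
Qed.

Lemma nu_order z d : zmin s < z < zmax s -> small_delta s d ->
  nu s L1 z d < nu s L2 z d < nu s L3 z d /\ nu s L3 z d < nu s L4 z d.
Proof. intros Hz Hd. destruct A1 as [_ HA]. destruct (HA z d Hz Hd) as [K1 [K2 _]]. auto. Qed.

Lemma Fx_nu i z d : zmin s < z < zmax s -> small_delta s d ->
  Fx (F s) (nu s i z d) z 0 d = 0 /\ Fx (Fx (F s)) (nu s i z d) z 0 d <> 0.
Proof.
intros Hz Hd. destruct A1 as [_ HA]. destruct (HA z d Hz Hd) as [_ [_ [_ HN]]].
destruct (HN i) as [H1 H2]. rewrite f_x_Fx in H1 by auto. split; [lra|].
intros H3. apply H2. unfold f_xx. simpl.
rewrite (Derive_ext _ (fun x => - Fx (F s) x z 0 d)).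
- rewrite Derive_opp. change (- Fx (Fx (F s)) (nu s i z d) z 0 d = 0). lra.
- intros t. now rewrite <- (f_x_Fx t (fold_y s i z d) z d Hd).
Qed.

Lemma small_delta_0 : small_delta s 0.
Proof. unfold small_delta. pose proof d0_pos. lra. Qed.

Lemma z0_in : zmin s < z0 s < zmax s.
Proof. pose proof z0_range. lra. Qed.

Lemma F_increasing u v z d : small_delta s d -> u < v ->
  (forall x, u < x < v -> 0 < Fx (F s) x z 0 d) -> F s u z 0 d < F s v z 0 d.
Proof.
intros Hd Huv H. apply (deriv_pos_open_lt (fun x => F s x z 0 d) (fun x => Fx (F s) x z 0 d)); auto.
intros t _. now apply derive_F.
Qed.

Lemma cont5_lift K x z d : smooth (eps0 s) (delta0 s) (lift K) -> small_delta s d ->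
  cont5 (lift K) x 0 z 0 d.
Proof.
intros HK Hd. unfold small_delta in Hd. pose proof e0_pos. apply (smooth_cont5 _ _ _ _ _ _ _ _ HK); lra.
Qed.

Lemma lift_near K x z d (P : R -> Prop) : smooth (eps0 s) (delta0 s) (lift K) -> small_delta s d ->
  open P -> P (K x z 0 d) -> exists r, 0 < r /\ forall x' z' e' d',
    Rabs (x' - x) < r -> Rabs (z' - z) < r -> Rabs e' < r -> Rabs (d' - d) < r -> P (K x' z' e' d').
Proof.
intros HK Hd HP Hx.
destruct (cont5_imp (lift K) x 0 z 0 d P (cont5_lift K x z d HK Hd) HP Hx) as [r [Hr H]].
exists r. split; auto. intros x' z' e' d' H1 H2 H3 H4. apply (H x' 0 z' e' d'); auto.
- now rewrite Rminus_diag, Rabs_R0.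
- now rewrite Rminus_0_r.
Qed.

(** The fold curves are continuous at the singular limit: the sign pattern
    of [F_x] around each of them persists, and it can only be realised by the fold points in
    their order. *)
Lemma nu_cont kappa : 0 < kappa -> exists r, 0 < r /\ forall i z d, Rabs (z - z0 s) < r -> 0 <= d < r ->
  zmin s < z < zmax s /\ small_delta s d /\ Rabs (nu s i z d - nu s i (z0 s) 0) < kappa.
Proof.
intros Hk. pose proof z0_range as Hzr. pose proof d0_pos as Hd0.
assert (Hs0 := small_delta_0). assert (Hz0 := z0_in).
destruct (nu_order (z0 s) 0 Hz0 Hs0) as [[O1 O2] O3].
set (x1 := nu s L1 (z0 s) 0) in *. set (x2 := nu s L2 (z0 s) 0) in *.
set (x3 := nu s L3 (z0 s) 0) in *. set (x4 := nu s L4 (z0 s) 0) in *.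
set (k := Rmin (kappa / 2) (Rmin ((x2 - x1) / 3) (Rmin ((x3 - x2) / 3) ((x4 - x3) / 3)))).
assert (Hk0 : 0 < k) by (repeat apply Rmin_glb_lt; lra).
assert (K1 : k <= kappa / 2) by min_le.
assert (K2 : k <= (x2 - x1) / 3) by min_le.
assert (K3 : k <= (x3 - x2) / 3) by min_le.
assert (K4 : k <= (x4 - x3) / 3) by min_le.
assert (HF := smooth_Fx _ _ _ _ _ _ _ _ SF).
assert (Hp : forall x, 0 < Fx (F s) x (z0 s) 0 0 -> exists r, 0 < r /\ forall z d, Rabs (z - z0 s) < r -> 0 <= d < r -> 0 < Fx (F s) x z 0 d).
{ intros x Hx. destruct (lift_near _ x (z0 s) 0 (fun v => 0 < v) HF Hs0 (open_gt 0) Hx) as [r [Hr H]].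
  exists r. split; auto. intros z d Hz Hd. apply H; rewrite ?Rminus_diag, ?Rminus_0_r, ?Rabs_R0; auto. rewrite Rabs_pos_eq; lra. }
assert (Hn : forall x, Fx (F s) x (z0 s) 0 0 < 0 -> exists r, 0 < r /\ forall z d, Rabs (z - z0 s) < r -> 0 <= d < r -> Fx (F s) x z 0 d < 0).
{ intros x Hx. destruct (lift_near _ x (z0 s) 0 (fun v => v < 0) HF Hs0 (open_lt 0) Hx) as [r [Hr H]].
  exists r. split; auto. intros z d Hz Hd. apply H; rewrite ?Rminus_diag, ?Rminus_0_r, ?Rabs_R0; auto. rewrite Rabs_pos_eq; lra. }
assert (Hsg : forall x, (0 < Fx (F s) x (z0 s) 0 0 <-> x < x1 \/ x2 < x < x3 \/ x4 < x) /\
   (Fx (F s) x (z0 s) 0 0 < 0 <-> x1 < x < x2 \/ x3 < x < x4)).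
{ intros x. exact (Fx_sign x (z0 s) 0 Hz0 Hs0). }
destruct (Hp (x1 - k) ltac:(apply Hsg; lra)) as [r1 [Hr1 P1]].
destruct (Hn (x1 + k) ltac:(apply Hsg; lra)) as [r2 [Hr2 P2]].
destruct (Hn (x2 - k) ltac:(apply Hsg; lra)) as [r3 [Hr3 P3]].
destruct (Hp (x2 + k) ltac:(apply Hsg; lra)) as [r4 [Hr4 P4]].
destruct (Hp (x3 - k) ltac:(apply Hsg; lra)) as [r5 [Hr5 P5]].
destruct (Hn (x3 + k) ltac:(apply Hsg; lra)) as [r6 [Hr6 P6]].
destruct (Hn (x4 - k) ltac:(apply Hsg; lra)) as [r7 [Hr7 P7]].
destruct (Hp (x4 + k) ltac:(apply Hsg; lra)) as [r8 [Hr8 P8]].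
set (ra := Rmin (Rmin r1 r2) (Rmin r3 r4)). set (rb := Rmin (Rmin r5 r6) (Rmin r7 r8)).
set (rc := Rmin (delta0 s) (Rmin (z0 s - zmin s) (zmax s - z0 s))).
assert (ra <= r1 /\ ra <= r2 /\ ra <= r3 /\ ra <= r4) as [Q1 [Q2 [Q3 Q4]]].
{ unfold ra. repeat split; min_le. }
assert (rb <= r5 /\ rb <= r6 /\ rb <= r7 /\ rb <= r8) as [Q5 [Q6 [Q7 Q8]]].
{ unfold rb. repeat split; min_le. }
assert (rc <= delta0 s /\ rc <= z0 s - zmin s /\ rc <= zmax s - z0 s) as [Q9 [Q10 Q11]].
{ unfold rc. repeat split; min_le. }
exists (Rmin ra (Rmin rb rc)).
split. { unfold ra, rb, rc. repeat apply Rmin_glb_lt; lra. }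
intros i z d Hz Hd.
assert (M1 : Rmin ra (Rmin rb rc) <= ra) by min_le.
assert (M2 : Rmin ra (Rmin rb rc) <= rb) by min_le.
assert (M3 : Rmin ra (Rmin rb rc) <= rc) by min_le.
assert (Hz' := Hz). apply Rabs_def2 in Hz'.
assert (Hzz : zmin s < z < zmax s) by lra.
assert (Hdd : small_delta s d) by (unfold small_delta; lra).
split; auto. split; auto.
assert (Hsg' : forall x, (0 < Fx (F s) x z 0 d <-> x < nu s L1 z d \/ nu s L2 z d < x < nu s L3 z d \/ nu s L4 z d < x) /\
   (Fx (F s) x z 0 d < 0 <-> nu s L1 z d < x < nu s L2 z d \/ nu s L3 z d < x < nu s L4 z d)).
{ intros x. exact (Fx_sign x z d Hzz Hdd). }
destruct (nu_order z d Hzz Hdd) as [[N1 N2] N3].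
assert (B1 := proj1 (proj1 (Hsg' _)) (P1 z d ltac:(lra) ltac:(lra))).
assert (B2 := proj1 (proj2 (Hsg' _)) (P2 z d ltac:(lra) ltac:(lra))).
assert (B3 := proj1 (proj2 (Hsg' _)) (P3 z d ltac:(lra) ltac:(lra))).
assert (B4 := proj1 (proj1 (Hsg' _)) (P4 z d ltac:(lra) ltac:(lra))).
assert (B5 := proj1 (proj1 (Hsg' _)) (P5 z d ltac:(lra) ltac:(lra))).
assert (B6 := proj1 (proj2 (Hsg' _)) (P6 z d ltac:(lra) ltac:(lra))).
assert (B7 := proj1 (proj2 (Hsg' _)) (P7 z d ltac:(lra) ltac:(lra))).
assert (B8 := proj1 (proj1 (Hsg' _)) (P8 z d ltac:(lra) ltac:(lra))).
clear - B1 B2 B3 B4 B5 B6 B7 B8 N1 N2 N3 K1 K2 K3 K4 Hk0 O1 O2 O3.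
destruct i; apply Rabs_def1; fold x1 x2 x3 x4; lra.
Qed.

Lemma layer_continuous_Fx z d x : small_delta s d -> continuous (fun x => Fx (F s) x z 0 d) x.
Proof.
intros Hd. unfold small_delta in Hd. pose proof e0_pos.
apply (continuous_derive _ x (Fx (Fx (F s)) x z 0 d)).
apply (is_derive_Fx_x _ _ _ _ _ _ _ _ SF); lra.
Qed.

Lemma layer_field_derive (y z d x : R) : small_delta s d -> is_derive (fun x => f s x y z 0 d) x (- Fx (F s) x z 0 d).
Proof.
intros Hd. unfold f. rewrite <- (Rminus_0_l (Fx _ _ _ _ _)).
apply (is_derive_minus (fun _ => y) (fun x => F s x z 0 d)); [apply (is_derive_const y)|now apply derive_F].
Qed.

Lemma layer_field_cont (z d x : R) : small_delta s d -> continuous (fun x => - Fx (F s) x z 0 d) x.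
Proof. intros Hd. apply (continuous_opp (fun x => Fx (F s) x z 0 d)). now apply layer_continuous_Fx. Qed.

Lemma layer_limit (d y z : R) (u : R -> R) (x : R) : small_delta s d ->
  layer_orbit s (fun t => 0 <= t) d y z u -> is_lim u p_infty x -> y = F s x z 0 d.
Proof.
intros Hd Hu Hl. assert (H : f s x y z 0 d = 0).
{ apply (limit_equilibrium (fun x => f s x y z 0 d) u x); [|exact Hu|exact Hl].
  eapply continuous_derive. now apply layer_field_derive. }
unfold f in H. lra.
Qed.

Lemma layer_descends (d y z : R) (u : R -> R) (x : R) : small_delta s d ->
  layer_orbit s (fun t => 0 <= t) d y z u -> is_lim u p_infty x ->
  forall v, x < v < u 0 -> y < F s v z 0 d.
Proof.
intros Hd Hu Hl v Hv.
assert (H := descending_orbit (fun x => f s x y z 0 d) (fun x => - Fx (F s) x z 0 d) u x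
  (fun x => layer_field_derive y z d x Hd) (fun x => layer_field_cont z d x Hd) Hu Hl v Hv).
cbv beta in H. unfold f in H. lra.
Qed.

Lemma is_lim_reverse (u : R -> R) (l : R) : is_lim u m_infty l -> is_lim (fun t => u (- t)) p_infty l.
Proof.
intros H. apply (is_lim_comp u Ropp p_infty l m_infty); auto.
- apply (is_lim_opp (fun x => x) p_infty p_infty). apply is_lim_id.
- exists 0. intros; discriminate.
Qed.

(** Reversal of time together with reflection of [x] turns an orbit emanating from an
    equilibrium into one that converges to it. *)
Lemma layer_backward (d y z : R) (u : R -> R) (x : R) : small_delta s d ->
  layer_orbit s (fun t => t <= 0) d y z u -> is_lim u m_infty x ->
  y = F s x z 0 d /\ forall v, u 0 < v < x -> y < F s v z 0 d.
Proof.
intros Hd Hu Hl. assert (Hl' := is_lim_reverse _ _ Hl).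
set (h := fun x => - f s x y z 0 d). set (w := fun t => u (- t)).
assert (Hw : forall t, 0 <= t -> is_derive w t (h (w t))).
{ intros t Ht. unfold h, w. apply (is_derive_reflect u). apply Hu. lra. }
assert (Hdh : forall x, is_derive h x (- - Fx (F s) x z 0 d)).
{ intros v. apply (is_derive_opp (fun x => f s x y z 0 d)). now apply layer_field_derive. }
split.
- assert (h x = 0).
  { apply (limit_equilibrium h w x); auto. eapply continuous_derive. apply Hdh. }
  unfold h, f in H. lra.
- intros v Hv. assert (0 < h v).
  { apply (ascending_orbit h (fun x => - - Fx (F s) x z 0 d) w x); auto.
    - intros v'. apply (continuous_opp (fun x => - Fx (F s) x z 0 d)). now apply layer_field_cont.
    - unfold w. now rewrite Ropp_0. }
  unfold h, f in H. lra.
Qed.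

Lemma section_nonzero y z d : in_section s y z -> small_delta s d ->
  nu s L2 z d < xi s y z < nu s L4 z d /\ f s (xi s y z) y z 0 d <> 0.
Proof. intros Hy Hd. destruct HDelta as [_ [_ [_ [_ [H _]]]]]. now apply H. Qed.

(** The layer orbit that defines P(L4) runs monotonically from L4 to the section, and the
    point of the section is not an equilibrium. *)
Lemma PL4_below_F z d : zlo s < z < zhi s -> small_delta s d ->
  in_section s (phi4 s z d) z /\ phi4 s z d = fold_y s L4 z d /\
  forall x, xi s (phi4 s z d) z <= x < nu s L4 z d -> phi4 s z d < F s x z 0 d.
Proof.
intros Hz Hd. destruct HDelta as [_ [_ [_ [_ [_ [_ [_ HP]]]]]]].
destruct (HP (phi4 s z d) z d Hz Hd) as [_ HP4]. destruct (proj2 HP4 eq_refl) as [Hin [u [Hu [Hl H0]]]].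
destruct (layer_backward d (phi4 s z d) z u (nu s L4 z d) Hd Hu Hl) as [E1 E2].
split; auto. split; [exact E1|]. rewrite H0 in E2.
intros x Hx. destruct (Req_dec x (xi s (phi4 s z d) z)) as [->|Hne]; [|apply E2; lra].
destruct (section_nonzero _ _ d Hin Hd) as [Hxi Hf]. unfold f in Hf.
destruct (Rtotal_order (phi4 s z d) (F s (xi s (phi4 s z d) z) z 0 d)) as [H|[H|H]]; auto; [lra|].
exfalso. set (x0 := xi s (phi4 s z d) z) in *.
assert (Hc : continuous (fun x => phi4 s z d - F s x z 0 d) x0).
{ apply continuous_const_minus. eapply continuous_derive. now apply derive_F. }
destruct (positive_near _ x0 Hc ltac:(lra)) as [n [Hn Pn]].
set (v := x0 + Rmin n ((nu s L4 z d - x0) / 2)).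
assert (0 < Rmin n ((nu s L4 z d - x0) / 2)) by (apply Rmin_glb_lt; lra).
assert (Rmin n ((nu s L4 z d - x0) / 2) <= n) by min_le.
assert (Rmin n ((nu s L4 z d - x0) / 2) <= (nu s L4 z d - x0) / 2) by min_le.
specialize (Pn v ltac:(apply Rabs_le; unfold v; lra)). specialize (E2 v ltac:(unfold v; lra)). lra.
Qed.

End Geometry.

(** * Landing points on either side of the breaking point *)

Lemma smooth_two_variables (e0 d0 : R) (h : R -> R -> R) :
  smooth_on (fun _ : R * R => True) (fun p : R * R => let '(y, z) := p in h y z) ->
  smooth e0 d0 (fun x _ z _ _ => h x z).
Proof.
intros Hs k. set (A := fun p : E5 => let '(x, y, z, e, d) := p in ((x, z) : R * R)).
apply (Ck_on_ext _ _ (fun p => (fun p : R * R => let '(y, z) := p in h y z) (A p))).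
{ now intros [[[[x y] z] e] d]. }
refine (Ck_on_comp_linear (dom5 e0 d0) (fun _ : R * R => True) A _ _ _ k (fun p : R * R => let '(y, z) := p in h y z) (Hs k)); auto.
- intros [[[[x y] z] e] d] [[[[a1 a2] a3] a4] a5] t. reflexivity.
- intros [[[[x y] z] e] d]. apply filterlim_locally. intros eps. exists eps.
  intros [[[[x' y'] z'] e'] d'] [[[[Hx Hy] Hz] He] Hd]. split; auto.
Qed.

Lemma cont5_graph (F : R -> R -> R -> R -> R) (h : R -> R -> R) (y z : R) :
  (forall x, cont5 (lift F) x 0 z 0 0) -> cont5 (fun x _ z _ _ => h x z) y 0 z 0 0 ->
  cont5 (fun y _ z e d => F (h y z) z e d - y) y 0 z 0 0.
Proof.
intros HF Hh eps Heps.
destruct (HF (h y z) (eps / 2) ltac:(lra)) as [r1 [Hr1 K1]].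
destruct (Hh r1 Hr1) as [r2 [Hr2 K2]].
exists (Rmin (Rmin r1 r2) (eps / 2)).
assert (M1 : Rmin (Rmin r1 r2) (eps / 2) <= r1) by min_le.
assert (M2 : Rmin (Rmin r1 r2) (eps / 2) <= r2) by min_le.
assert (M3 : Rmin (Rmin r1 r2) (eps / 2) <= eps / 2) by min_le.
split; [repeat apply Rmin_glb_lt; lra|]. intros y' w z' e' d' Q1 Q2 Q3 Q4 Q5.
specialize (K2 y' w z' e' d' ltac:(lra) ltac:(lra) ltac:(lra) ltac:(lra) ltac:(lra)).
specialize (K1 (h y' z') w z' e' d' K2 ltac:(lra) ltac:(lra) ltac:(lra) ltac:(lra)).
unfold lift in K1.
replace (F (h y' z') z' e' d' - y' - (F (h y z) z 0 0 - y)) with ((F (h y' z') z' e' d' - F (h y z) z 0 0) + - (y' - y)) by ring.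
eapply Rle_lt_trans; [apply Rabs_triang|]. rewrite Rabs_Ropp. lra.
Qed.

Section Landing.

Variable s : setting.
Hypothesis Hsmooth : smooth_system s.
Hypothesis A1 : assumption1 s.
Hypothesis HDelta : section_setup s.
Hypothesis A4 : assumption4 s.
Hypothesis Hconv : standing_convention s.

Let SF := setting_slow_fast s Hsmooth Hconv.
Let Hs0 := small_delta_0 s Hsmooth.
Let Hz0 := z0_in s HDelta.
Let x1 := nu s L1 (z0 s) 0.
Let x2 := nu s L2 (z0 s) 0.
Let x3 := nu s L3 (z0 s) 0.
Let x4 := nu s L4 (z0 s) 0.

Lemma base_order : x1 < x2 < x3 /\ x3 < x4.
Proof. exact (nu_order s A1 (z0 s) 0 Hz0 Hs0). Qed.

Lemma base_sign x : (0 < Fx (F s) x (z0 s) 0 0 <-> x < x1 \/ x2 < x < x3 \/ x4 < x) /\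
   (Fx (F s) x (z0 s) 0 0 < 0 <-> x1 < x < x2 \/ x3 < x < x4).
Proof. exact (Fx_sign s Hsmooth A1 Hconv x (z0 s) 0 Hz0 Hs0). Qed.

(** This is the hypothesis [z0'(0) = 0]: in the blown-up variable the breaking point
    tends to 0. *)
Lemma zc_close kappa : 0 < kappa -> exists r, 0 < r <= delta0 s /\ forall d, 0 < d < r -> Rabs (zc s d - z0 s) < kappa * d.
Proof.
intros Hk. pose proof A4 as A4_; destruct A4_ as [Hz [Hl _]]. pose proof (d0_pos s Hsmooth) as Hd0.
destruct (proj1 (filterlim_locally _ _) Hl (mkposreal kappa Hk)) as [r Hr]. pose proof (cond_pos r).
exists (Rmin r (delta0 s)). split; [split; [apply Rmin_glb_lt; auto|apply Rmin_r]|].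
intros d Hd. assert (Rmin r (delta0 s) <= r) by min_le.
assert (Q : Rabs ((zc s d - zc s 0) / d - 0) < kappa).
{ apply (Hr d); [|lra]. change (Rabs (d - 0) < r). rewrite Rminus_0_r, Rabs_pos_eq; lra. }
rewrite Rminus_0_r, Hz in Q.
replace (zc s d - z0 s) with ((zc s d - z0 s) / d * d) by (field; lra).
rewrite Rabs_mult, (Rabs_pos_eq d) by lra. apply Rmult_lt_compat_r; lra.
Qed.

Lemma curve_cont phi : smooth_curve s phi -> forall eps, 0 < eps -> exists r, 0 < r /\
  forall z d, Rabs (z - z0 s) < r -> Rabs d < r -> Rabs (phi z d - phi (z0 s) 0) < eps.
Proof.
intros Hp eps Heps. pose proof (z0_range s HDelta). pose proof (d0_pos s Hsmooth).
assert (Hc := proj1 (Hp O) (z0 s, 0) ltac:(split; lra)).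
destruct (proj1 (filterlim_locally _ _) Hc (mkposreal eps Heps)) as [r Hr].
exists r. split; [apply cond_pos|]. intros z d Hz Hd.
apply (Hr (z, d)). split; [exact Hz|]. change (Rabs (d - 0) < r). now rewrite Rminus_0_r.
Qed.

Lemma phi2_fold_y z d : zlo s < z < zhi s -> small_delta s d -> phi2 s z d = fold_y s L2 z d.
Proof.
intros Hz Hd. pose proof HDelta as HD_; destruct HD_ as [_ [_ [_ [_ [_ [_ [_ HP]]]]]]].
destruct (HP (phi2 s z d) z d Hz Hd) as [HP2 _]. destruct (proj2 HP2 eq_refl) as [_ [u [Hu [H0 Hl]]]].
exact (layer_limit s Hsmooth Hconv d (phi2 s z d) z u (nu s L2 z d) Hd Hu Hl).
Qed.

(** The levels of L2 and L4 agree at the singular limit, since P(L2) and P(L4) meet at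
    [zc d] for every small positive delta. *)
Lemma level_eq : F s x2 (z0 s) 0 0 = F s x4 (z0 s) 0 0.
Proof.
pose proof (z0_range s HDelta) as Hzr. pose proof (d0_pos s Hsmooth) as Hd0.
assert (E4 := proj1 (proj2 (PL4_below_F s Hsmooth HDelta Hconv (z0 s) 0 ltac:(lra) Hs0))).
assert (E2 := phi2_fold_y (z0 s) 0 ltac:(lra) Hs0).
change (fold_y s L2 (z0 s) 0 = fold_y s L4 (z0 s) 0). rewrite <- E2, <- E4.
apply NNPP. intros Hne. set (D := Rabs (phi2 s (z0 s) 0 - phi4 s (z0 s) 0)).
assert (HD : 0 < D) by (apply Rabs_pos_lt; lra).
pose proof HDelta as HD_; destruct HD_ as [_ [_ [_ [_ [_ [S2 [S4 _]]]]]]].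
destruct (curve_cont _ S2 (D / 2) ltac:(lra)) as [r2 [Hr2 C2]].
destruct (curve_cont _ S4 (D / 2) ltac:(lra)) as [r4 [Hr4 C4]].
destruct (zc_close 1 Rlt_0_1) as [r [Hr Hz]].
set (d := Rmin (r / 2) (Rmin (r2 / 2) (r4 / 2))).
assert (Hd : 0 < d) by (repeat apply Rmin_glb_lt; lra).
assert (D1 : d <= r / 2) by min_le.
assert (D2 : d <= r2 / 2) by min_le.
assert (D3 : d <= r4 / 2) by min_le.
specialize (Hz d ltac:(lra)).
assert (Q2 := C2 (zc s d) d ltac:(lra) ltac:(rewrite Rabs_pos_eq; lra)).
assert (Q4 := C4 (zc s d) d ltac:(lra) ltac:(rewrite Rabs_pos_eq; lra)).
pose proof A4 as A4_; destruct A4_ as [_ [_ H4]]. destruct (H4 d ltac:(lra)) as [_ [Heq _]]. rewrite Heq in Q2.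
assert (D < D); [|lra]. unfold D at 1.
replace (phi2 s (z0 s) 0 - phi4 s (z0 s) 0) with (- (phi4 s (zc s d) d - phi2 s (z0 s) 0) + (phi4 s (zc s d) d - phi4 s (z0 s) 0)) by ring.
eapply Rle_lt_trans; [apply Rabs_triang|]. rewrite Rabs_Ropp. lra.
Qed.

Lemma phi4_base : phi4 s (z0 s) 0 = F s x4 (z0 s) 0 0.
Proof.
pose proof (z0_range s HDelta).
exact (proj1 (proj2 (PL4_below_F s Hsmooth HDelta Hconv (z0 s) 0 ltac:(lra) Hs0))).
Qed.

Lemma F_near x (P : R -> Prop) : open P -> P (F s x (z0 s) 0 0) -> exists r, 0 < r /\
  forall z d, Rabs (z - z0 s) < r -> 0 <= d < r -> P (F s x z 0 d).
Proof.
intros HP Hx. destruct (lift_near s Hsmooth (F s) x (z0 s) 0 P (sf_F _ _ _ _ _ _ _ _ SF) Hs0 HP Hx) as [r [Hr H]].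
exists r. split; auto. intros z d Hz Hd. apply H; rewrite ?Rminus_diag, ?Rminus_0_r, ?Rabs_R0; auto.
rewrite Rabs_pos_eq; lra.
Qed.

Lemma phi4_near (P : R -> Prop) : open P -> P (F s x4 (z0 s) 0 0) -> exists r, 0 < r /\
  forall z d, Rabs (z - z0 s) < r -> 0 <= d < r -> P (phi4 s z d).
Proof.
intros HP Hx. rewrite <- phi4_base in Hx. destruct (HP _ Hx) as [eps He].
pose proof HDelta as HD_; destruct HD_ as [_ [_ [_ [_ [_ [_ [S4 _]]]]]]].
destruct (curve_cont _ S4 eps (cond_pos eps)) as [r [Hr C4]]. exists r. split; auto.
intros z d Hz Hd. apply He. apply C4; auto. rewrite Rabs_pos_eq; lra.
Qed.

(** What the first layer passage of the return map needs to know about the fibre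
    of L4 over [z]: the landing point [xl'] and the absence of other equilibria up to the section. *)
Definition lands (z d xl' : R) : Prop :=
  F s xl' z 0 d = phi4 s z d /\ 0 < Fx (F s) xl' z 0 d /\ xl' < xi s (phi4 s z d) z /\
  forall x, xl' < x <= xi s (phi4 s z d) z -> phi4 s z d < F s x z 0 d.

(** Two orbits of the scalar layer equation that pass through the same point cannot
    have limits separated by an equilibrium, so an orbit landing in the open branches
    excludes convergence to L2. *)
Lemma lands_of_orbit z d u x : zlo s < z < zhi s -> small_delta s d ->
  layer_orbit s (fun t => 0 <= t) d (phi4 s z d) z u -> u 0 = xi s (phi4 s z d) z ->
  is_lim u p_infty (Finite x) -> (on_branch s Sa1 x z d \/ on_branch s Sa2 x z d) -> lands z d x /\ ~ PL2 s d (phi4 s z d) z.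
Proof.
intros Hz Hd Hu H0 Hl Hb. pose proof (z0_range s HDelta) as Hzr.
destruct (PL4_below_F s Hsmooth HDelta Hconv z d Hz Hd) as [Hin [_ HF]].
destruct (section_nonzero s HDelta _ _ d Hin Hd) as [Hxi Hf].
assert (HE := layer_limit s Hsmooth Hconv d _ z u x Hd Hu Hl).
assert (HD := layer_descends s Hsmooth Hconv d _ z u x Hd Hu Hl). rewrite H0 in HD.
destruct (nu_order s A1 z d ltac:(lra) Hd) as [[O1 O2] O3].
assert (Hx : x < xi s (phi4 s z d) z).
{ destruct Hb as [Hb|Hb]; simpl in Hb; [lra|].
  apply Rnot_le_lt. intros Hle. specialize (HF x ltac:(lra)). lra. }
split.
- split; [now symmetry|]. split.
  { apply (Fx_sign s Hsmooth A1 Hconv x z d ltac:(lra) Hd). tauto. }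
  split; auto. intros v Hv. destruct (Req_dec v (xi s (phi4 s z d) z)) as [->|]; [apply HF; lra|apply HD; lra].
- intros [_ [w [Hw [Hw0 Hwl]]]].
  assert (HE2 := layer_limit s Hsmooth Hconv d _ z w _ Hd Hw Hwl).
  destruct Hb as [Hb|Hb]; simpl in Hb.
  + specialize (HD (nu s L2 z d) ltac:(lra)). lra.
  + assert (HD2 := layer_descends s Hsmooth Hconv d _ z w _ Hd Hw Hwl x). rewrite Hw0 in HD2.
    specialize (HD2 ltac:(lra)). lra.
Qed.

(** As [zc d = z0 + o(d)], the point [z0 + d Z] lies on the same side of [zc d] as Z of 0.
    The landing point then solves [F x z 0 d = phi4 z d] on S_a1, where [F] increases. *)
Lemma landing_before (Z xh4 kappa : R) : Z < 0 -> xh4 < x1 -> F s xh4 (z0 s) 0 0 = F s x4 (z0 s) 0 0 -> 0 < kappa ->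
  exists r, 0 < r /\ forall d, 0 < d < r -> let z := z0 s + d * Z in
    z <> zc s d /\ ~ PL2 s d (phi4 s z d) z /\ exists xl', Rabs (xl' - xh4) < kappa /\ lands z d xl'.
Proof.
intros HZ Hx Hlev Hk. pose proof (z0_range s HDelta) as Hzr. pose proof (d0_pos s Hsmooth) as Hd0.
set (k := Rmin (kappa / 2) ((x1 - xh4) / 3)). assert (Hk0 : 0 < k) by (apply Rmin_glb_lt; lra).
assert (K1 : k <= kappa / 2) by min_le. assert (K2 : k <= (x1 - xh4) / 3) by min_le.
assert (Hdn : F s (xh4 - k) (z0 s) 0 0 < F s x4 (z0 s) 0 0).
{ rewrite <- Hlev. apply (F_increasing s Hsmooth Hconv); auto; [lra|]. intros x Hx'. apply base_sign. lra. }
assert (Hup : F s x4 (z0 s) 0 0 < F s (xh4 + k) (z0 s) 0 0).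
{ rewrite <- Hlev. apply (F_increasing s Hsmooth Hconv); auto; [lra|]. intros x Hx'. apply base_sign. lra. }
set (m1 := (F s (xh4 - k) (z0 s) 0 0 + F s x4 (z0 s) 0 0) / 2).
set (m2 := (F s (xh4 + k) (z0 s) 0 0 + F s x4 (z0 s) 0 0) / 2).
destruct (F_near (xh4 - k) (fun v => v < m1) (open_lt m1) ltac:(unfold m1; lra)) as [r1 [Hr1 B1]].
destruct (F_near (xh4 + k) (fun v => m2 < v) (open_gt m2) ltac:(unfold m2; lra)) as [r2 [Hr2 B2]].
destruct (phi4_near (fun v => m1 < v) (open_gt m1) ltac:(unfold m1; lra)) as [r3 [Hr3 B3]].
destruct (phi4_near (fun v => v < m2) (open_lt m2) ltac:(unfold m2; lra)) as [r4 [Hr4 B4]].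
destruct (nu_cont s Hsmooth A1 HDelta Hconv k Hk0) as [r5 [Hr5 B5]].
destruct (zc_close (- Z) ltac:(lra)) as [r6 [Hr6 B6]].
set (rr := Rmin (Rmin r1 r2) (Rmin (Rmin r3 r4) (Rmin r5 (z0 s - zlo s)))).
assert (Hrr : 0 < rr) by (unfold rr; repeat apply Rmin_glb_lt; lra).
assert (rr <= r1 /\ rr <= r2 /\ rr <= r3 /\ rr <= r4 /\ rr <= r5 /\ rr <= z0 s - zlo s) as [Q1 [Q2 [Q3 [Q4 [Q5 Q6]]]]].
{ unfold rr. repeat split; min_le. }
exists (Rmin r6 (Rmin rr (rr / (1 - Z)))).
split. { repeat apply Rmin_glb_lt; try lra. apply Rdiv_lt_0_compat; lra. }
intros d Hd. cbv zeta. set (z := z0 s + d * Z).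
assert (D1 : Rmin r6 (Rmin rr (rr / (1 - Z))) <= r6) by min_le.
assert (D2 : Rmin r6 (Rmin rr (rr / (1 - Z))) <= rr) by min_le.
assert (D3 : Rmin r6 (Rmin rr (rr / (1 - Z))) <= rr / (1 - Z)) by min_le.
assert (HdZ : - (d * Z) < rr).
{ assert (d * (1 - Z) < rr); [|nra]. apply Rlt_le_trans with (rr / (1 - Z) * (1 - Z)); [|right; field; lra].
  apply Rmult_lt_compat_r; lra. }
assert (HdZ0 : d * Z < 0) by nra.
assert (Hzz : Rabs (z - z0 s) < rr).
{ unfold z. replace (z0 s + d * Z - z0 s) with (d * Z) by ring. rewrite Rabs_left; lra. }
specialize (B6 d ltac:(lra)). apply Rabs_def2 in B6.
assert (Hzc : z < zc s d) by (unfold z; lra).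
assert (Hzl : zlo s < z) by (unfold z; lra).
assert (Hdd : small_delta s d) by (unfold small_delta; lra).
pose proof A4 as A4_; destruct A4_ as [_ [_ H4]]. destruct (H4 d ltac:(lra)) as [_ [_ [_ [HL _]]]].
destruct (HL z ltac:(lra)) as [u [x [Hu [Hu0 [_ [Hul Hb]]]]]].
destruct (lands_of_orbit z d u x ltac:(unfold z in *; lra) Hdd Hu Hu0 Hul (or_introl Hb)) as [Hlands HnP].
split; [lra|]. split; auto. exists x. split; auto.
destruct Hlands as [HE _].
destruct (B5 L1 z d ltac:(lra) ltac:(lra)) as [Hzin [_ Hn1]]. fold x1 in Hn1. apply Rabs_def2 in Hn1.
specialize (B1 z d ltac:(lra) ltac:(lra)). specialize (B2 z d ltac:(lra) ltac:(lra)).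
specialize (B3 z d ltac:(lra) ltac:(lra)). specialize (B4 z d ltac:(lra) ltac:(lra)). simpl in Hb.
assert (Hinc : forall p q, p < q -> q <= nu s L1 z d -> F s p z 0 d < F s q z 0 d).
{ intros p q Hpq Hq. apply (F_increasing s Hsmooth Hconv); auto. intros v Hv.
  apply (Fx_sign s Hsmooth A1 Hconv v z d Hzin Hdd). left. simpl. lra. }
apply Rabs_def1.
- assert (x < xh4 + k); [|lra]. apply Rnot_le_lt. intros Hle. destruct Hle as [Hle|<-]; [|lra].
  specialize (Hinc (xh4 + k) x Hle ltac:(lra)). lra.
- assert (xh4 - k < x); [|lra]. apply Rnot_le_lt. intros Hle. destruct Hle as [Hle| ->]; [|lra].
  specialize (Hinc x (xh4 - k) Hle ltac:(lra)). lra.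
Qed.

Lemma landing_after (Z kappa : R) : 0 < Z -> 0 < kappa ->
  exists r, 0 < r /\ forall d, 0 < d < r -> let z := z0 s + d * Z in
    z <> zc s d /\ ~ PL2 s d (phi4 s z d) z /\ exists xl', Rabs (xl' - x2) < kappa /\ lands z d xl'.
Proof.
intros HZ Hk. pose proof (z0_range s HDelta) as Hzr. pose proof (d0_pos s Hsmooth) as Hd0.
destruct base_order as [[O1 O2] O3].
set (k := Rmin (kappa / 2) ((x3 - x2) / 3)). assert (Hk0 : 0 < k) by (apply Rmin_glb_lt; lra).
assert (K1 : k <= kappa / 2) by min_le. assert (K2 : k <= (x3 - x2) / 3) by min_le.
assert (Hup : F s x4 (z0 s) 0 0 < F s (x2 + k) (z0 s) 0 0).
{ rewrite <- level_eq. apply (F_increasing s Hsmooth Hconv); auto; [lra|]. intros x Hx'. apply base_sign. lra. }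
set (m2 := (F s (x2 + k) (z0 s) 0 0 + F s x4 (z0 s) 0 0) / 2).
destruct (F_near (x2 + k) (fun v => m2 < v) (open_gt m2) ltac:(unfold m2; lra)) as [r2 [Hr2 B2]].
destruct (phi4_near (fun v => v < m2) (open_lt m2) ltac:(unfold m2; lra)) as [r4 [Hr4 B4]].
destruct (nu_cont s Hsmooth A1 HDelta Hconv k Hk0) as [r5 [Hr5 B5]].
destruct (zc_close Z ltac:(lra)) as [r6 [Hr6 B6]].
set (rr := Rmin r2 (Rmin r4 (Rmin r5 (zhi s - z0 s)))).
assert (Hrr : 0 < rr) by (unfold rr; repeat apply Rmin_glb_lt; lra).
assert (Q2 : rr <= r2) by min_le.
assert (Q4 : rr <= r4) by min_le.
assert (Q5 : rr <= r5) by min_le.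
assert (Q6 : rr <= zhi s - z0 s) by min_le.
exists (Rmin r6 (Rmin rr (rr / (1 + Z)))).
split. { repeat apply Rmin_glb_lt; try lra. apply Rdiv_lt_0_compat; lra. }
intros d Hd. cbv zeta. set (z := z0 s + d * Z).
assert (D1 : Rmin r6 (Rmin rr (rr / (1 + Z))) <= r6) by min_le.
assert (D2 : Rmin r6 (Rmin rr (rr / (1 + Z))) <= rr) by min_le.
assert (D3 : Rmin r6 (Rmin rr (rr / (1 + Z))) <= rr / (1 + Z)) by min_le.
assert (HdZ : d * Z < rr).
{ assert (d * (1 + Z) < rr); [|nra]. apply Rlt_le_trans with (rr / (1 + Z) * (1 + Z)); [|right; field; lra].
  apply Rmult_lt_compat_r; lra. }
assert (HdZ0 : 0 < d * Z) by nra.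
assert (Hzz : Rabs (z - z0 s) < rr).
{ unfold z. replace (z0 s + d * Z - z0 s) with (d * Z) by ring. rewrite Rabs_pos_eq; lra. }
specialize (B6 d ltac:(lra)). apply Rabs_def2 in B6.
assert (Hzc : zc s d < z) by (unfold z; lra).
assert (Hzl : z < zhi s) by (unfold z; lra).
assert (Hdd : small_delta s d) by (unfold small_delta; lra).
pose proof A4 as A4_; destruct A4_ as [_ [_ H4]]. destruct (H4 d ltac:(lra)) as [_ [_ [_ [_ HR]]]].
destruct (HR z ltac:(lra)) as [u [x [Hu [Hu0 [Hul Hb]]]]].
destruct (lands_of_orbit z d u x ltac:(unfold z in *; lra) Hdd Hu Hu0 Hul (or_intror Hb)) as [Hlands HnP].
split; [lra|]. split; auto. exists x. split; auto.
destruct Hlands as [HE _].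
destruct (B5 L2 z d ltac:(lra) ltac:(lra)) as [Hzin [_ Hn2]]. fold x2 in Hn2. apply Rabs_def2 in Hn2.
specialize (B2 z d ltac:(lra) ltac:(lra)). specialize (B4 z d ltac:(lra) ltac:(lra)). simpl in Hb.
apply Rabs_def1; [|lra].
assert (x < x2 + k); [|lra]. apply Rnot_le_lt. intros Hle. destruct Hle as [Hle|<-]; [|lra].
assert (F s (x2 + k) z 0 d < F s x z 0 d); [|lra].
apply (F_increasing s Hsmooth Hconv); auto. intros v Hv.
apply (Fx_sign s Hsmooth A1 Hconv v z d Hzin Hdd). right; left. simpl. lra.
Qed.

End Landing.

(** * The two singular cycles and the section *)

Section Arcs.

Variable s : setting.
Hypothesis Hsmooth : smooth_system s.
Hypothesis A1 : assumption1 s.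
Hypothesis A2 : assumption2 s.
Hypothesis HDelta : section_setup s.
Hypothesis A4 : assumption4 s.
Hypothesis A5 : assumption5 s.
Hypothesis Hconv : standing_convention s.

Let SF := setting_slow_fast s Hsmooth Hconv.
Let Hs0 := small_delta_0 s Hsmooth.
Let Hz0 := z0_in s HDelta.
Let x1 := nu s L1 (z0 s) 0.
Let x2 := nu s L2 (z0 s) 0.
Let x3 := nu s L3 (z0 s) 0.
Let x4 := nu s L4 (z0 s) 0.
Let Hord : x1 < x2 < x3 /\ x3 < x4 := base_order s Hsmooth A1 HDelta.
Let Hsign x := base_sign s Hsmooth A1 HDelta Hconv x.

Definition base_speed (x : R) : R := g1 s x (F s x (z0 s) 0 0) (z0 s) 0 0.

Lemma base_speed_derive x : is_derive base_speed x (Derive base_speed x).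
Proof.
pose proof (e0_pos s Hsmooth). pose proof (d0_pos s Hsmooth).
apply Derive_correct. eexists.
apply (chain5 (eps0 s) (delta0 s) (g1 s) (fun x => x) (fun x => F s x (z0 s) 0 0) (fun _ => z0 s) x); try lra.
- apply (sf_g1 _ _ _ _ _ _ _ _ SF).
- apply (is_derive_id (K := R_AbsRing)).
- apply (derive_F s Hsmooth Hconv); auto.
- apply (is_derive_const (K := R_AbsRing) (V := R_NormedModule)).
Qed.

Lemma base_speed_fold i : base_speed (nu s i (z0 s) 0) <> 0.
Proof.
destruct (A2 (z0 s) 0 Hz0 Hs0) as [H _]. specialize (H i). cbv zeta in H.
intros H0. apply H. pose proof Hconv as Hc_; destruct Hc_ as [_ [_ Hsp]]. pose proof (e0_pos s Hsmooth).
rewrite Hsp by (auto; lra). unfold base_speed in H0. unfold fold_y. rewrite H0. ring.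
Qed.

Lemma Fxx_base x : is_derive (fun x => Fx (F s) x (z0 s) 0 0) x (Fx (Fx (F s)) x (z0 s) 0 0).
Proof.
pose proof (e0_pos s Hsmooth). pose proof (d0_pos s Hsmooth).
apply (is_derive_Fx_x _ _ _ _ _ _ _ _ SF); lra.
Qed.

(** The derivative [F_x] is positive before the fold and vanishes there, so [F_xx] is
    nonpositive, and it is nonzero by assumption. *)
Lemma fold_max i a : a < nu s i (z0 s) 0 ->
  (forall x, a <= x < nu s i (z0 s) 0 -> 0 < Fx (F s) x (z0 s) 0 0) ->
  Fx (F s) (nu s i (z0 s) 0) (z0 s) 0 0 = 0 /\ Fx (Fx (F s)) (nu s i (z0 s) 0) (z0 s) 0 0 < 0.
Proof.
intros Ha Hp. destruct (Fx_nu s Hsmooth A1 Hconv i (z0 s) 0 Hz0 Hs0) as [H1 H2]. split; auto.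
assert (Fx (Fx (F s)) (nu s i (z0 s) 0) (z0 s) 0 0 <= 0); [|lra].
apply (is_derive_first_zero (fun x => Fx (F s) x (z0 s) 0 0) a (nu s i (z0 s) 0)); auto; [apply Fxx_base|lra].
Qed.

Lemma fold_min i b : nu s i (z0 s) 0 < b ->
  (forall x, nu s i (z0 s) 0 < x <= b -> 0 < Fx (F s) x (z0 s) 0 0) ->
  Fx (F s) (nu s i (z0 s) 0) (z0 s) 0 0 = 0 /\ 0 < Fx (Fx (F s)) (nu s i (z0 s) 0) (z0 s) 0 0.
Proof.
intros Ha Hp. destruct (Fx_nu s Hsmooth A1 Hconv i (z0 s) 0 Hz0 Hs0) as [H1 H2]. split; auto.
assert (- Fx (Fx (F s)) (nu s i (z0 s) 0) (z0 s) 0 0 <= 0); [|lra].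
apply (is_derive_first_zero (fun x => Fx (F s) (- x) (z0 s) 0 0) (- b) (- nu s i (z0 s) 0)); try lra.
- apply (is_derive_reflect (fun x => Fx (F s) x (z0 s) 0 0)). rewrite Ropp_involutive. apply Fxx_base.
- rewrite Ropp_involutive. lra.
- intros t Ht. apply Hp. lra.
Qed.

(** The singular closed orbit traverses the branch in finite time, which is impossible
    if [g1] has a zero on it; its sign is that of the direction of motion. *)
Lemma arc_speed_up b xl xf X Y T : xl < xf ->
  (forall x, xl < x < xf -> 0 < Fx (F s) x (z0 s) 0 0) ->
  (0 < Fx (F s) xl (z0 s) 0 0 \/ base_speed xl <> 0) -> base_speed xf <> 0 ->
  (forall x, on_branch s b x (z0 s) 0 -> x < xf) ->
  reduced_segment s b 0 X Y (fun _ => z0 s) T -> X 0 = xl -> X T = xf ->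
  forall x, xl <= x <= xf -> 0 < base_speed x.
Proof.
intros Hlt HFx Hl Hf Hb [HT [Hc [HS Hd]]] HX0 HXT.
apply (branch_speed_pos (fun x => F s x (z0 s) 0 0) (fun x => Fx (F s) x (z0 s) 0 0) base_speed (Derive base_speed) xl xf T X Y); auto.
- intros x. apply (derive_F s Hsmooth Hconv); auto.
- apply base_speed_derive.
- intros t Ht. destruct (Hc t Ht) as [H1 [H2 _]]. auto.
- intros t Ht. specialize (HS t Ht). unfold on_S, f in HS. lra.
- intros t Ht. destruct (Hd t Ht) as [H1 [H2 _]]. split; [now apply Hb|].
  specialize (HS t ltac:(lra)). unfold on_S, f in HS. unfold base_speed.
  replace (F s (X t) (z0 s) 0 0) with (Y t) by lra. exact H2.
Qed.

(** The same on S_a3, in reflected coordinates. *)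
Lemma arc_speed_down xr X Y T : x4 < xr ->
  reduced_segment s Sa3 0 X Y (fun _ => z0 s) T -> X 0 = xr -> X T = x4 ->
  forall x, x4 <= x <= xr -> base_speed x < 0.
Proof.
intros Hlt [HT [Hc [HS Hd]]] HX0 HXT x Hx.
assert (H : 0 < - base_speed (- - x)); [|rewrite Ropp_involutive in H; lra].
apply (branch_speed_pos (fun x => - F s (- x) (z0 s) 0 0) (fun x => Fx (F s) (- x) (z0 s) 0 0)
  (fun x => - base_speed (- x)) (fun x => Derive base_speed (- x)) (- xr) (- x4) T (fun t => - X t) (fun t => - Y t)); try lra; auto.
- intros v. replace (Fx (F s) (- v) (z0 s) 0 0) with (- - Fx (F s) (- v) (z0 s) 0 0) by ring.
  apply (is_derive_opp (fun x => F s (- x) (z0 s) 0 0)). apply (is_derive_reflect (fun x => F s x (z0 s) 0 0)).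
  apply (derive_F s Hsmooth Hconv); auto.
- intros v. replace (Derive base_speed (- v)) with (- - Derive base_speed (- v)) by ring.
  apply (is_derive_opp (fun x => base_speed (- x))). apply (is_derive_reflect base_speed). apply base_speed_derive.
- intros v Hv. apply Hsign. right; right. fold x4. lra.
- left. rewrite Ropp_involutive. apply Hsign. right; right. exact Hlt.
- rewrite Ropp_involutive. pose proof (base_speed_fold L4). fold x4 in H. lra.
- intros t Ht. destruct (Hc t Ht) as [H1 [H2 _]]. split; [apply (continuous_opp X)|apply (continuous_opp Y)]; auto.
- intros t Ht. rewrite Ropp_involutive. specialize (HS t Ht). unfold on_S, f in HS. lra.
- intros t Ht. destruct (Hd t Ht) as [H1 [H2 _]]. simpl in H1. fold x4 in H1. split; [lra|].
  rewrite Ropp_involutive. apply (is_derive_opp Y).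
  specialize (HS t ltac:(lra)). unfold on_S, f in HS. unfold base_speed.
  replace (F s (X t) (z0 s) 0 0) with (Y t) by lra. exact H2.
Qed.

Lemma layer_path_end d y z a b : small_delta s d -> layer_path s d y z a b -> y = F s b z 0 d.
Proof.
intros Hd H. assert (HE : exists c, layer_connection s d y z c b).
{ induction H as [a b H|a b c _ _ _ IH]; [now exists a|exact IH]. }
destruct HE as [c [u [Hu [_ Hl]]]]. apply (layer_limit s Hsmooth Hconv d y z u b Hd); auto.
intros t _. now apply Hu.
Qed.

Lemma layer_connection_above d y z a b : small_delta s d -> a < b -> layer_connection s d y z a b ->
  y = F s b z 0 d /\ forall x, a < x < b -> F s x z 0 d < y.
Proof.
intros Hd Hab [u [Hu [Hm Hp]]]. split.
{ apply (layer_limit s Hsmooth Hconv d y z u b Hd); auto. intros t _. now apply Hu. }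
intros x Hx.
assert (Hev : Rbar_locally' m_infty (fun t => u t < x)).
{ assert (Hm' : filterlim u (Rbar_locally' m_infty) (locally a)) by exact Hm.
  apply (Hm' (fun v => v < x)). apply open_lt. lra. }
destruct Hev as [t0 Ht0]. set (t1 := t0 - 1).
assert (H := ascending_orbit (fun x => f s x y z 0 d) (fun x => - Fx (F s) x z 0 d) (fun t => u (t1 + t)) b
  (fun x => layer_field_derive s Hsmooth Hconv y z d x Hd) (fun x => layer_field_cont s Hsmooth Hconv z d x Hd)).
assert (0 < f s x y z 0 d); [|unfold f in H0; lra].
apply H.
- intros t _. rewrite <- (Rmult_1_l (f s (u (t1 + t)) y z 0 d)).
  apply (is_derive_comp u (fun t => t1 + t) t (f s (u (t1 + t)) y z 0 d) 1); [now apply Hu|].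
  auto_derive; auto.
- apply (is_lim_comp u (fun t => t1 + t) p_infty b p_infty); auto.
  + apply (is_lim_plus (fun _ => t1) (fun t => t) p_infty t1 p_infty); [apply is_lim_const|apply is_lim_id|reflexivity].
  + exists 0. intros; discriminate.
- rewrite Rplus_0_r. specialize (Ht0 t1 ltac:(unfold t1; lra)). lra.
Qed.

Lemma F0_injective_right u v : x4 <= u -> x4 <= v -> F s u (z0 s) 0 0 = F s v (z0 s) 0 0 -> u = v.
Proof.
intros Hu Hv HE. destruct (Rtotal_order u v) as [H|[H|H]]; auto; exfalso.
- assert (F s u (z0 s) 0 0 < F s v (z0 s) 0 0); [|lra].
  apply (F_increasing s Hsmooth Hconv); auto. intros x Hx. apply Hsign. right; right. fold x4. lra.
- assert (F s v (z0 s) 0 0 < F s u (z0 s) 0 0); [|lra].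
  apply (F_increasing s Hsmooth Hconv); auto. intros x Hx. apply Hsign. right; right. fold x4. lra.
Qed.

(** What the two singular closed orbits have in common: the slow passage
    from [xl] to the fold [xf], the jump to [xr], and the slow passage from [xr] to L4. *)
Definition singular_cycle (i : fold) (xl xr : R) : Prop :=
  let xf := nu s i (z0 s) 0 in
  (i = L1 \/ i = L3) /\ xf < x4 < xr /\
  rising_branch (z0 s) (F s) (g1 s) xl xf /\
  rising_branch (z0 s) (oreflect_F (F s)) (oreflect (g1 s)) (- xr) (- x4) /\
  F s xr (z0 s) 0 0 = F s xf (z0 s) 0 0 /\
  (forall x, xf < x < xr -> F s x (z0 s) 0 0 < F s xf (z0 s) 0 0).

Lemma right_branch xr : x4 < xr -> (forall x, x4 <= x <= xr -> base_speed x < 0) ->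
  rising_branch (z0 s) (oreflect_F (F s)) (oreflect (g1 s)) (- xr) (- x4).
Proof.
intros Hlt Hsp. pose proof (e0_pos s Hsmooth). pose proof (d0_pos s Hsmooth).
assert (HFx : forall x, Fx (oreflect_F (F s)) x (z0 s) 0 0 = Fx (F s) (- x) (z0 s) 0 0).
{ intros x. apply (Fx_reflect _ _ _ _ _ _ _ _ _ _ _ _ SF); lra. }
assert (HFxx : forall x, Fx (Fx (oreflect_F (F s))) x (z0 s) 0 0 = - Fx (Fx (F s)) (- x) (z0 s) 0 0).
{ intros x. apply (Fxx_reflect _ _ _ _ _ _ _ _ _ _ _ _ SF); lra. }
constructor.
- lra.
- intros x Hx. unfold oreflect, oreflect_F. rewrite Ropp_involutive.
  specialize (Hsp (- x) ltac:(lra)). unfold base_speed in Hsp. lra.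
- intros x Hx. rewrite HFx. apply Hsign. right; right. fold x4. lra.
- rewrite HFx, HFxx, Ropp_involutive.
  destruct (fold_min L4 xr Hlt) as [K1 K2]; [|unfold x4; lra].
  intros x Hx. apply Hsign. right; right. fold x4 in Hx |- *. lra.
- left. rewrite HFx, Ropp_involutive. apply Hsign. right; right. exact Hlt.
Qed.

(** On each attracting branch [F] is increasing, so a landing or jump point
    of the closed orbit is determined by its level. *)
Lemma cycle_L (xh1 xh4 : R) : xh4 < x1 -> F s xh4 (z0 s) 0 0 = F s x4 (z0 s) 0 0 ->
  x4 < xh1 -> F s xh1 (z0 s) 0 0 = F s x1 (z0 s) 0 0 -> singular_cycle L1 xh4 xh1.
Proof.
intros H4 E4 H1 E1. pose proof A5 as A5_; destruct A5_ as [HL _].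
destruct HL as [xl [xr [X [Y [X' [Y' [T [T' HL]]]]]]]]. cbv zeta in HL.
destruct HL as [Hland [Hseg [HX0 [HXT [Hbr [Hconn [Hseg' [HX0' [HXT' [Hpath _]]]]]]]]]]. simpl in Hbr. fold x4 in Hbr.
assert (Hxl := layer_path_end _ _ _ _ _ Hs0 Hpath). change (F s x4 (z0 s) 0 0 = F s xl (z0 s) 0 0) in Hxl.
fold x1 in Hland, HXT. destruct Hord as [[O1 O2] O3].
assert (xl = xh4) as ->.
{ destruct (Rtotal_order xl xh4) as [H|[H|H]]; auto; exfalso.
  - assert (F s xl (z0 s) 0 0 < F s xh4 (z0 s) 0 0); [|lra].
    apply (F_increasing s Hsmooth Hconv); auto. intros x Hx. apply Hsign. left. fold x1. lra.
  - assert (F s xh4 (z0 s) 0 0 < F s xl (z0 s) 0 0); [|lra].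
    apply (F_increasing s Hsmooth Hconv); auto. intros x Hx. apply Hsign. left. fold x1. lra. }
assert (Hlr : nu s L1 (z0 s) 0 < xr) by (simpl in Hbr; unfold x1, x4 in *; lra).
destruct (layer_connection_above _ _ _ _ _ Hs0 Hlr Hconn) as [Exr Hab].
change (F s x1 (z0 s) 0 0 = F s xr (z0 s) 0 0) in Exr. change (forall x, x1 < x < xr -> F s x (z0 s) 0 0 < F s x1 (z0 s) 0 0) in Hab.
assert (xr = xh1) as -> by (apply F0_injective_right; lra).
unfold singular_cycle. cbv zeta. fold x1 x4.
split; [auto|]. split; [lra|]. split; [|split; [|split; [exact E1|exact Hab]]].
- assert (Hp : forall x, x < x1 -> 0 < Fx (F s) x (z0 s) 0 0) by (intros; apply Hsign; left; fold x1; lra).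
  constructor; auto.
  + intros x Hx. apply (arc_speed_up Sa1 xh4 x1 X Y T H4); auto.
    * intros v Hv. apply Hp; lra.
    * apply base_speed_fold.
  + intros x Hx. apply Hp; lra.
  + apply (fold_max L1 xh4); auto. intros x Hx. apply Hp. apply Hx.
- apply right_branch; auto. apply (arc_speed_down xh1 X' Y' T'); auto.
Qed.

Lemma cycle_S (xh3 : R) : x4 < xh3 -> F s xh3 (z0 s) 0 0 = F s x3 (z0 s) 0 0 -> singular_cycle L3 x2 xh3.
Proof.
intros H3 E3. pose proof A5 as A5_; destruct A5_ as [_ HL].
destruct HL as [xl [xr [X [Y [X' [Y' [T [T' HL]]]]]]]]. cbv zeta in HL.
destruct HL as [Hland [Hseg [HX0 [HXT [Hbr [Hconn [Hseg' [HX0' [HXT' [Hpath _]]]]]]]]]]. simpl in Hbr. fold x4 in Hbr.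
assert (Hxl := layer_path_end _ _ _ _ _ Hs0 Hpath). change (F s x4 (z0 s) 0 0 = F s xl (z0 s) 0 0) in Hxl.
fold x2 x3 in Hland, HXT. destruct Hord as [[O1 O2] O3].
assert (Hlev := level_eq s Hsmooth HDelta A4 Hconv). fold x2 x4 in Hlev.
assert (xl = x2) as ->.
{ destruct (Rle_lt_or_eq_dec x2 xl ltac:(lra)) as [H|H]; auto; exfalso.
  assert (F s x2 (z0 s) 0 0 < F s xl (z0 s) 0 0); [|lra].
  apply (F_increasing s Hsmooth Hconv); auto. intros x Hx. apply Hsign. right; left. fold x2 x3. lra. }
assert (Hlr : nu s L3 (z0 s) 0 < xr) by (simpl in Hbr; unfold x3, x4 in *; lra).
destruct (layer_connection_above _ _ _ _ _ Hs0 Hlr Hconn) as [Exr Hab].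
change (F s x3 (z0 s) 0 0 = F s xr (z0 s) 0 0) in Exr. change (forall x, x3 < x < xr -> F s x (z0 s) 0 0 < F s x3 (z0 s) 0 0) in Hab.
assert (xr = xh3) as -> by (apply F0_injective_right; lra).
unfold singular_cycle. cbv zeta. fold x3 x4.
split; [auto|]. split; [lra|]. split; [|split; [|split; [exact E3|exact Hab]]].
- assert (Hp : forall x, x2 < x < x3 -> 0 < Fx (F s) x (z0 s) 0 0) by (intros; apply Hsign; right; left; fold x2 x3; lra).
  constructor; auto.
  + intros x Hx. apply (arc_speed_up Sa2 x2 x3 X Y T); auto.
    * right. apply base_speed_fold.
    * apply base_speed_fold.
    * intros v [_ Hv]. exact Hv.
  + apply (fold_max L3 ((x2 + x3) / 2)); [fold x3; lra|]. fold x3. intros x Hx. apply Hp. lra.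
  + right. apply (fold_min L2 ((x2 + x3) / 2)); [fold x2; lra|]. fold x2. intros x Hx. apply Hp. lra.
- apply right_branch; auto. apply (arc_speed_down xh3 X' Y' T'); auto.
Qed.

(** At the singular limit [F] stays below the level of the fold on [xE, xr) and crosses
    it transversely at [xr]; both facts persist, so the intermediate value theorem gives
    the landing point and no equilibrium precedes it. *)
Lemma right_landing i xl xr xE kappa : singular_cycle i xl xr -> nu s i (z0 s) 0 < xE < xr -> 0 < kappa ->
  exists r, 0 < r /\ forall z d, Rabs (z - z0 s) < r -> 0 <= d < r -> exists xl',
    Rabs (xl' - xr) < kappa /\ xE < xl' /\ F s xl' z 0 d = fold_y s i z d /\ 0 < Fx (F s) xl' z 0 d /\
    forall x, xE <= x < xl' -> F s x z 0 d < F s xl' z 0 d.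
Proof.
intros [Hi [Hxr [_ [_ [EF Hbelow]]]]] HxE Hk. cbv zeta in *. set (xf := nu s i (z0 s) 0) in *.
set (k := Rmin (kappa / 2) (Rmin ((xr - x4) / 3) ((xr - xE) / 2))).
assert (Hk0 : 0 < k) by (repeat apply Rmin_glb_lt; lra).
assert (K1 : k <= kappa / 2) by min_le.
assert (K2 : k <= (xr - x4) / 3) by min_le.
assert (K3 : k <= (xr - xE) / 2) by min_le.
assert (Hup : F s xf (z0 s) 0 0 < F s (xr + k) (z0 s) 0 0).
{ rewrite <- EF. apply (F_increasing s Hsmooth Hconv); auto; [lra|]. intros x Hx. apply Hsign. right; right. fold x4. lra. }
pose proof (e0_pos s Hsmooth) as He0. pose proof (d0_pos s Hsmooth) as Hd0.
destruct (positive_uniformly xE (xr - k) (fun x z e d => F s xf (z0 s) 0 0 - F s x z e d) (z0 s)) as [m1 [Hm1 B1]].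
{ intros x Hx. split; [specialize (Hbelow x ltac:(lra)); lra|].
  intros eps Heps. destruct (cont5_lift s Hsmooth (F s) x (z0 s) 0 (sf_F _ _ _ _ _ _ _ _ SF) Hs0 eps Heps) as [r [Hr H]].
  exists r. split; auto. intros x' y' z' e' d' Q1 Q2 Q3 Q4 Q5. specialize (H x' y' z' e' d' Q1 Q2 Q3 Q4 Q5). unfold lift in H.
  rewrite <- Rabs_Ropp. match goal with |- Rabs ?t < _ => replace t with (F s x' z' e' d' - F s x (z0 s) 0 0) by ring end. exact H. }
set (m2 := F s (xr + k) (z0 s) 0 0 - F s xf (z0 s) 0 0).
set (m := Rmin (m1 / 2) (m2 / 4)). assert (Hm : 0 < m) by (apply Rmin_glb_lt; unfold m2; lra).
assert (M1 : m <= m1 / 2) by min_le. assert (M2 : m <= m2 / 4) by min_le.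
(* the level of the fold is continuous *)
destruct (lift_near s Hsmooth (F s) xf (z0 s) 0 (fun v => Rabs (v - F s xf (z0 s) 0 0) < m) (sf_F _ _ _ _ _ _ _ _ SF) Hs0) as [r1 [Hr1 B2]].
{ intros v Hv. exists (mkposreal (m - Rabs (v - F s xf (z0 s) 0 0)) ltac:(lra)). intros w Hw.
  change (Rabs (w - v) < m - Rabs (v - F s xf (z0 s) 0 0)) in Hw.
  replace (w - F s xf (z0 s) 0 0) with ((w - v) + (v - F s xf (z0 s) 0 0)) by ring.
  eapply Rle_lt_trans; [apply Rabs_triang|]. lra. }
{ rewrite Rminus_diag, Rabs_R0; lra. }
destruct (F_near s Hsmooth Hconv (xr + k) (fun v => F s xf (z0 s) 0 0 + m2 / 2 < v) (open_gt _) ltac:(unfold m2; lra)) as [r2 [Hr2 B3]].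
destruct (nu_cont s Hsmooth A1 HDelta Hconv (Rmin r1 k) ltac:(apply Rmin_glb_lt; auto)) as [r3 [Hr3 B4]].
set (r := Rmin (Rmin m1 r1) (Rmin r2 r3)).
assert (Hr : 0 < r) by (repeat apply Rmin_glb_lt; auto).
assert (Q1 : r <= m1) by min_le.
assert (Q2 : r <= r1) by min_le.
assert (Q3 : r <= r2) by min_le.
assert (Q4 : r <= r3) by min_le.
exists r. split; auto. intros z d Hz Hd.
destruct (B4 i z d ltac:(lra) ltac:(lra)) as [Hzin [Hdd Hni]].
assert (L1' := Rmin_l r1 k). assert (L2' := Rmin_r r1 k).
assert (HY : Rabs (fold_y s i z d - F s xf (z0 s) 0 0) < m).
{ apply B2; [fold xf in Hni; lra|lra|rewrite Rabs_R0; lra|rewrite Rminus_0_r, Rabs_pos_eq; lra]. }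
destruct (B4 L4 z d ltac:(lra) ltac:(lra)) as [_ [_ Hn4]]. fold x4 in Hn4.
apply Rabs_def2 in HY, Hn4.
assert (B1' : forall x, xE <= x <= xr - k -> F s x z 0 d <= F s xf (z0 s) 0 0 - m1).
{ intros x Hx. specialize (B1 x z 0 d Hx ltac:(lra) ltac:(rewrite Rabs_R0; lra) ltac:(rewrite Rabs_pos_eq; lra)). lra. }
specialize (B3 z d ltac:(lra) ltac:(lra)).
assert (Hinc : forall p q, xr - k <= p -> p < q -> F s p z 0 d < F s q z 0 d).
{ intros p q Hp Hpq. apply (F_increasing s Hsmooth Hconv); auto. intros v Hv.
  apply (Fx_sign s Hsmooth A1 Hconv v z d Hzin Hdd). right; right. simpl. lra. }
destruct (IVT_gen (fun x => F s x z 0 d) (xr - k) (xr + k) (fold_y s i z d)) as [xl' [Hx1 Hx2]].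
{ intros x. apply (is_derive_continuity_pt _ x (Fx (F s) x z 0 d)). now apply (derive_F s Hsmooth Hconv). }
{ specialize (B1' (xr - k) ltac:(lra)). rewrite Rmin_left, Rmax_right by lra. unfold m2 in *. lra. }
rewrite Rmin_left, Rmax_right in Hx1 by lra.
assert (Hxne : xr - k < xl').
{ destruct (Rle_lt_or_eq_dec (xr - k) xl' ltac:(lra)) as [|<-]; auto. specialize (B1' (xr - k) ltac:(lra)). lra. }
exists xl'. split; [apply Rabs_def1; lra|]. split; [lra|]. split; auto. split.
- apply (Fx_sign s Hsmooth A1 Hconv xl' z d Hzin Hdd). right; right. simpl. lra.
- intros x Hx. destruct (Rle_lt_dec x (xr - k)) as [Hle|Hlt].
  + specialize (B1' x ltac:(lra)). rewrite Hx2. lra.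
  + apply Hinc; lra.
Qed.

Definition xi5 : fun5 := fun x _ z _ _ => xi s x z.

Lemma smooth_xi : smooth (eps0 s) (delta0 s) xi5.
Proof. apply smooth_two_variables. pose proof HDelta as HD_; destruct HD_ as [_ [_ [_ [H _]]]]. exact H. Qed.

Lemma xi_cont5 y : cont5 xi5 y 0 (z0 s) 0 0.
Proof.
pose proof (e0_pos s Hsmooth). pose proof (d0_pos s Hsmooth).
apply (smooth_cont5 _ _ _ _ _ _ _ _ smooth_xi); lra.
Qed.

(** The vector field is nonzero on the section, hence of constant sign along it, and the
    sign is known on P(L4). *)
Lemma section_below y : ylo s <= y <= yhi s -> 0 < F s (xi s y (z0 s)) (z0 s) 0 0 - y.
Proof.
intros Hy. pose proof (z0_range s HDelta) as Hzr.
set (psi := fun y => F s (xi s y (z0 s)) (z0 s) 0 0 - y).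
assert (Hne : forall y, ylo s <= y <= yhi s -> psi y <> 0).
{ intros v Hv. destruct (section_nonzero s HDelta v (z0 s) 0) as [_ H]; auto; [split; lra|].
  unfold f in H. unfold psi. lra. }
destruct (PL4_below_F s Hsmooth HDelta Hconv (z0 s) 0 ltac:(lra) Hs0) as [Hin [_ HF]].
destruct (section_nonzero s HDelta _ _ 0 Hin Hs0) as [Hxi _].
specialize (HF (xi s (phi4 s (z0 s) 0) (z0 s)) ltac:(lra)). destruct Hin as [Hin _].
assert (Hcont : continuity psi).
{ intros v. apply (is_derive_continuity_pt psi v (Dx xi5 v 0 (z0 s) 0 0 * Fx (F s) (xi s v (z0 s)) (z0 s) 0 0 - 1)).
  apply (is_derive_minus (fun y => F s (xi s y (z0 s)) (z0 s) 0 0) (fun y => y)).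
  - apply (is_derive_comp (fun x => F s x (z0 s) 0 0) (fun y => xi s y (z0 s))).
    + apply (derive_F s Hsmooth Hconv); auto.
    + apply Derive_correct. pose proof (e0_pos s Hsmooth). pose proof (d0_pos s Hsmooth).
      apply (smooth_diff5 _ _ xi5 v 0 (z0 s) 0 0 smooth_xi); lra.
  - apply (is_derive_id (K := R_AbsRing)). }
change (0 < psi y). destruct (Rlt_le_dec 0 (psi y)) as [|Hle]; auto. exfalso.
destruct (IVT_gen psi y (phi4 s (z0 s) 0) 0 Hcont) as [v [Hv Hv0]].
{ unfold psi at 2 4. unfold Rmin, Rmax. repeat destruct Rle_dec; lra. }
apply (Hne v); auto. unfold Rmin, Rmax in Hv. destruct Rle_dec; lra.
Qed.

(** The section is compact in y, so what holds on it in the plane z = z0 for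
    epsilon = delta = 0 persists nearby. *)
Lemma section_near_base : exists rho h Lip, 0 < rho /\ 0 < h /\ 0 < Lip /\
  (forall y z e d, in_section s y z -> Rabs (z - z0 s) <= rho -> Rabs e <= rho -> Rabs d <= rho ->
     y - F s (xi s y z) z e d < 0) /\
  (forall y z, in_section s y z -> Rabs (z - z0 s) <= rho -> xi s y z < x4 - h) /\
  (forall y z y' z', in_section s y z -> in_section s y' z' -> Rabs (z - z0 s) <= rho -> Rabs (z' - z0 s) <= rho ->
     Rabs (xi s y z - xi s y' z') <= Lip * (Rabs (y - y') + Rabs (z - z'))).
Proof.
pose proof (e0_pos s Hsmooth) as He0. pose proof (d0_pos s Hsmooth) as Hd0. pose proof (z0_range s HDelta) as Hzr.
destruct (positive_uniformly (ylo s) (yhi s) (fun y z e d => F s (xi s y z) z e d - y) (z0 s)) as [r1 [Hr1 B1]].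
{ intros y Hy. split; [now apply section_below|].
  apply cont5_graph; [|apply xi_cont5].
  intros x. apply (cont5_lift s Hsmooth); auto. apply (sf_F _ _ _ _ _ _ _ _ SF). }
destruct (positive_uniformly (ylo s) (yhi s) (fun y z e d => x4 - xi s y z) (z0 s)) as [r2 [Hr2 B2]].
{ intros y Hy. split.
  - destruct (section_nonzero s HDelta y (z0 s) 0) as [H _]; auto; [split; lra|]. fold x4 in H. lra.
  - intros eps Heps. destruct (xi_cont5 y eps Heps) as [r [Hr H]]. exists r. split; auto.
    intros x' y' z' e' d' Q1 Q2 Q3 Q4 Q5. specialize (H x' y' z' e' d' Q1 Q2 Q3 Q4 Q5). unfold xi5 in H.
    rewrite <- Rabs_Ropp. match goal with |- Rabs ?t < _ => replace t with (xi s x' z' - xi s y (z0 s)) by ring end. exact H. }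
destruct (smooth_tame (eps0 s) (delta0 s) (fun _ => 0) (z0 s) 0 (ylo s) (yhi s) xi5 He0 ltac:(lra) smooth_xi) as [r3 [C [Hr3 [HC Ht]]]].
{ intros; apply continuous_const. }
set (rho := Rmin r1 (Rmin r2 r3)).
assert (Q1 : rho <= r1) by min_le.
assert (Q2 : rho <= r2) by min_le.
assert (Q3 : rho <= r3) by min_le.
exists rho, (r2 / 2), C. split; [unfold rho; repeat apply Rmin_glb_lt; auto|]. split; [lra|]. split; [auto|].
split; [|split].
- intros y z e d [Hy _] Hz He Hd. specialize (B1 y z e d Hy ltac:(lra) ltac:(lra) ltac:(lra)). lra.
- intros y z [Hy _] Hz. specialize (B2 y z 0 0 Hy ltac:(lra) ltac:(rewrite Rabs_R0; lra) ltac:(rewrite Rabs_R0; lra)). lra.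
- intros y z y' z' [Hy _] [Hy' _] Hz Hz'.
  assert (Hin : forall v w, ylo s <= v <= yhi s -> Rabs (w - z0 s) <= rho -> inbox (fun _ => 0) (z0 s) 0 (ylo s) (yhi s) r3 v 0 w 0 0).
  { intros v w Hv Hw. unfold inbox. rewrite !Rminus_diag, Rabs_R0. lra. }
  assert (K1 : Rabs (xi s y z - xi s y' z) <= C * Rabs (y - y')).
  { apply (mvt_bound (fun y => xi s y z)). intros u Hu.
    assert (Hu' : ylo s <= u <= yhi s) by (unfold Rmin, Rmax in Hu; destruct Rle_dec; lra).
    split; [apply (smooth_diff5 _ _ xi5 u 0 z 0 0 smooth_xi); lra|].
    apply (Ht u 0 z 0 0 (Hin u z Hu' Hz)). }
  assert (K2 : Rabs (xi s y' z - xi s y' z') <= C * Rabs (z - z')).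
  { destruct (Ht y' 0 z 0 0 (Hin y' z Hy' Hz)) as [_ [_ [_ [_ K]]]].
    specialize (K 0 z' 0 0 (Hin y' z' Hy' Hz')). rewrite Rminus_diag, Rabs_R0 in K. unfold xi5 in K. lra. }
  replace (xi s y z - xi s y' z') with ((xi s y z - xi s y' z) + (xi s y' z - xi s y' z')) by ring.
  eapply Rle_trans; [apply Rabs_triang|]. lra.
Qed.

End Arcs.

(** * The return map and its singular limit *)

Lemma rescaled_small (d zeta w r : R) : 0 < d -> Rabs (zeta - w) < 1 -> d * (Rabs w + 1) < r -> Rabs (d * zeta) < r.
Proof.
intros Hd Hz Hr. rewrite Rabs_mult, (Rabs_pos_eq d) by lra.
replace zeta with ((zeta - w) + w) by ring.
pose proof (Rabs_triang (zeta - w) w). nra.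
Qed.

Lemma rescaled_radius (w r : R) : 0 < r -> exists delta, 0 < delta /\ forall d, 0 < d < delta -> d * (Rabs w + 1) < r.
Proof.
intros Hr. pose proof (Rabs_pos w). exists (r / (Rabs w + 1)). split; [apply Rdiv_lt_0_compat; lra|].
intros d [_ Hd]. apply Rlt_div_r in Hd; lra.
Qed.

Lemma Rmin_lt_both a b c : c < Rmin a b -> c < a /\ c < b.
Proof. intros H. pose proof (Rmin_l a b). pose proof (Rmin_r a b). lra. Qed.

Ltac split_min H :=
  match type of H with
  | _ < Rmin _ _ => let H1 := fresh H in let H2 := fresh H in
      apply Rmin_lt_both in H; destruct H as [H1 H2]; split_min H1; split_min H2
  | _ => idtac
  end.

Section Return.

Variable s : setting.
Hypothesis Hsmooth : smooth_system s.
Hypothesis A1 : assumption1 s.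
Hypothesis HDelta : section_setup s.
Hypothesis Hconv : standing_convention s.

Let SF := setting_slow_fast s Hsmooth Hconv.
Let x4 := nu s L4 (z0 s) 0.

Definition orbit_of (d : R) := orbit (fast_F (F s) d) (fast_g (g1 s) d) (fast_g (g2 s) d).

(** For Z < 0 this holds with [xl] the point of S_a1 at the level of L4; for Z > 0
    the orbits land on S_a2 next to L2, and [xl] is the abscissa of L2. *)
Definition lands_near (Z xl : R) : Prop :=
  forall kappa, 0 < kappa -> exists r, 0 < r /\ forall d, 0 < d < r -> let z := z0 s + d * Z in
    z <> zc s d /\ ~ PL2 s d (phi4 s z d) z /\ exists xl', Rabs (xl' - xl) < kappa /\ lands s z d xl'.

Definition left_map (Z xl xf : R) : R :=
  exp (RInt (lin_p (z0 s) (F s) (g1 s) (Hz s)) xl xf) * Z +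
  RInt (fun u => lin_q (z0 s) (F s) (g1 s) (Gz s) u * exp (RInt (lin_p (z0 s) (F s) (g1 s) (Hz s)) u xf)) xl xf.

(** The value at L4 of the linear equation on S_a3, written in reflected coordinates. *)
Definition right_map (Z xl xf : R) : R :=
  let P := lin_p (z0 s) (oreflect_F (F s)) (oreflect (g1 s)) (reflect (Hz s)) in
  exp (RInt P (- xl) (- xf)) * Z +
  RInt (fun u => lin_q (z0 s) (oreflect_F (F s)) (oreflect (g1 s)) (reflect (Gz s)) u *
                 exp (RInt P u (- xf))) (- xl) (- xf).

(** A falling orbit moves much less in [(y, z)] than in [x], so it cannot meet the Lipschitz
    graph from which it started. *)
Lemma on_Delta_close Lip rho y z x y' z' k :
  (forall y z y' z', in_section s y z -> in_section s y' z' -> Rabs (z - z0 s) <= rho -> Rabs (z' - z0 s) <= rho ->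
     Rabs (xi s y z - xi s y' z') <= Lip * (Rabs (y - y') + Rabs (z - z'))) ->
  0 < Lip -> Lip * k < 1 -> in_section s y z -> Rabs (z - z0 s) <= rho -> Rabs (z' - z0 s) <= rho ->
  on_Delta s x y' z' -> Rabs (y - y') + Rabs (z - z') <= k * (xi s y z - x) -> x < xi s y z -> False.
Proof.
intros HL HLip Hk Hin Hz Hz' [Hin' ->] Hc Hlt.
specialize (HL y z y' z' Hin Hin' Hz Hz'). apply Rabs_le_between in HL.
assert (Lip * (Rabs (y - y') + Rabs (z - z')) <= Lip * (k * (xi s y z - xi s y' z'))) by (apply Rmult_le_compat_l; lra).
nra.
Qed.

(** The passage cannot last until the return time: a falling orbit has left the section for
    good, and on the slow part the layer field points to the right, whereas it points to the
    left on the section. *)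
Lemma left_leg i xl xr Z : singular_cycle s i xl xr -> lands_near Z xl ->
  let xf := nu s i (z0 s) 0 in exists eta, 0 < eta /\ forall xE, xf < xE < xf + eta ->
  forall kappa, 0 < kappa -> exists delta, 0 < delta /\ forall d, 0 < d < delta ->
  let z := z0 s + d * Z in let y := phi4 s z d in exists zeta, Rabs (zeta - left_map Z xl xf) < kappa /\
  forall kappa', 0 < kappa' -> exists eps1, 0 < eps1 /\ forall e T X Y Zt, 0 < e < eps1 -> 0 < T ->
    orbit_of d e 0 T X Y Zt -> on_Delta s (X 0) (Y 0) (Zt 0) -> Y 0 = y -> Zt 0 = z -> on_Delta s (X T) (Y T) (Zt T) ->
    exists tb, 0 <= tb < T /\ X tb = xE /\ Rabs (Zt tb - (z0 s + d * zeta)) < kappa' /\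
      Rabs (Y tb - fold_y s i (z0 s + d * zeta) d) < kappa'.
Proof.
intros [Hi [Hord [RB _]]] Hland xf. fold xf in RB.
destruct (half_cycle _ _ _ _ _ _ _ _ _ _ SF RB Z) as [eta [Heta HC]].
exists eta. split; auto. intros xE HxE kappa Hk.
destruct (section_near_base s Hsmooth HDelta Hconv) as [rho [h [Lip [Hrho [Hh [HLip [Sec1 [Sec2 Sec3]]]]]]]].
destruct (HC xE HxE (Rmin (Rmin kappa 1) rho)) as [del1 [Hdel1 HC1]]; [repeat apply Rmin_glb_lt; lra|]. clear HC.
fold (left_map Z xl xf) in HC1.
assert (k1 : Rmin (Rmin kappa 1) rho <= kappa) by min_le.
assert (k2 : Rmin (Rmin kappa 1) rho <= 1) by min_le.
assert (k3 : Rmin (Rmin kappa 1) rho <= rho) by min_le.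
set (k := Rmin (Rmin kappa 1) rho) in *.
destruct (nu_cont s Hsmooth A1 HDelta Hconv (xE - xf) ltac:(lra)) as [r1 [Hr1 Hnu]].
destruct (Hland del1 Hdel1) as [r2 [Hr2 Hl]].
pose proof (z0_range s HDelta) as Hzr. pose proof (e0_pos s Hsmooth) as He0. pose proof (d0_pos s Hsmooth) as Hd0.
set (r3 := Rmin (Rmin (z0 s - zlo s) (zhi s - z0 s)) (Rmin r1 (rho / 2))).
assert (Hr3 : 0 < r3) by (repeat apply Rmin_glb_lt; lra).
assert (M1 : r3 <= z0 s - zlo s) by min_le.
assert (M2 : r3 <= zhi s - z0 s) by min_le.
assert (M3 : r3 <= r1) by min_le.
assert (M4 : r3 <= rho / 2) by min_le.
destruct (rescaled_radius Z r3 Hr3) as [r4 [Hr4 Hsc]].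
destruct (rescaled_radius (left_map Z xl xf) r3 Hr3) as [r5 [Hr5 Hsc1]].
exists (Rmin (Rmin (Rmin del1 r1) (Rmin r2 (delta0 s))) (Rmin (Rmin r4 r5) rho)).
split; [repeat apply Rmin_glb_lt; auto|].
intros d [Hdp Hd]. split_min Hd.
intros z y.
assert (Hz : Rabs (z - z0 s) < r3).
{ unfold z. replace (z0 s + d * Z - z0 s) with (d * Z) by ring.
  apply (rescaled_small d Z Z r3 Hdp); [rewrite Rminus_diag, Rabs_R0; lra|]. apply Hsc; lra. }
destruct (Hl d ltac:(lra)) as [_ [_ [xl' [Hxl' [La1 [La2 [La3 La4]]]]]]]. fold z in La1, La2, La3, La4. fold y in La1, La3, La4.
destruct (HC1 d Z xl' ltac:(lra) ltac:(rewrite Rminus_diag, Rabs_R0; lra) Hxl' La2) as [zeta [Hzeta HC2]].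
exists zeta. split; [lra|]. intros kappa' Hk'.
assert (Hze : Rabs (z0 s + d * zeta - z0 s) < r3).
{ replace (z0 s + d * zeta - z0 s) with (d * zeta) by ring.
  apply (rescaled_small d zeta (left_map Z xl xf)); [lra|lra|]. apply Hsc1; lra. }
destruct (Hnu i (z0 s + d * zeta) d ltac:(lra) ltac:(lra)) as [Hzin [Hds Hni]]. fold xf in Hni.
assert (Hzb := Rabs_def2 _ _ Hz).
assert (Hin : in_section s y z).
{ apply (PL4_below_F s Hsmooth HDelta Hconv z d); auto. lra. }
set (kk := Rmin (Rmin kappa' (1 / (2 * Lip))) (rho / 2)).
assert (Hkk : 0 < kk).
{ repeat apply Rmin_glb_lt; try lra. apply Rdiv_lt_0_compat; lra. }
assert (N1 : kk <= kappa') by min_le.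
assert (N2 : kk <= 1 / (2 * Lip)) by min_le.
assert (N3 : kk <= rho / 2) by min_le.
assert (N4 : Lip * kk < 1).
{ assert (Lip * kk <= Lip * (1 / (2 * Lip))) by (apply Rmult_le_compat_l; lra).
  replace (Lip * (1 / (2 * Lip))) with (1 / 2) in H by (field; lra). lra. }
destruct (HC2 (nu s i (z0 s + d * zeta) d) (xi s y z) ltac:(lra)) with (kappa' := kk) as [eps1 [rho1 [Heps1 [Hrho1 HO]]]]; auto.
{ apply (Fx_nu s Hsmooth A1 Hconv); auto. }
{ intros x Hx. fold z. rewrite La1. apply La4; auto. }
exists (Rmin eps1 rho). split; [apply Rmin_glb_lt; auto|].
intros e T X Y Zt [Hep He] HT Ho HD0 HY0 HZ0 HDT. split_min He.
destruct (HO e 0 T X Y Zt ltac:(lra) ltac:(lra) Ho) as [tb [Htb [Hgood Hend]]].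
{ destruct HD0 as [_ ->]. now rewrite HY0, HZ0. }
{ fold z. rewrite La1, HY0, Rminus_diag, Rabs_R0. auto. }
{ fold z. rewrite HZ0, Rminus_diag, Rabs_R0. auto. }
exists tb.
assert (HtbT : tb < T).
{ destruct (Rle_lt_or_eq_dec tb T (proj2 Htb)) as [|E]; auto. exfalso.
  destruct (Hgood T ltac:(lra)) as [[_ [G1 [G2 G3]]]|[G1 [_ G2]]].
  - rewrite HY0, HZ0, <- Rabs_Ropp, (Ropp_minus_distr (Y T)), <- (Rabs_Ropp (Zt T - z)), (Ropp_minus_distr (Zt T)) in G1.
    apply (on_Delta_close Lip rho y z (X T) (Y T) (Zt T) kk); auto; [lra|].
    rewrite HZ0 in G2. pose proof (Rabs_pos (Y T - Y 0)).
    replace (Zt T - z0 s) with ((Zt T - z) + (z - z0 s)) by ring. eapply Rle_trans; [apply Rabs_triang|]. lra.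
  - destruct HDT as [HinT HXT]. rewrite HXT in G1.
    specialize (Sec1 (Y T) (Zt T) e d HinT ltac:(lra)). rewrite !Rabs_pos_eq in Sec1 by lra. lra. }
split; [lra|]. destruct Hend as [E|[E1 [E2 E3]]]; [lra|].
split; auto. unfold fold_y. lra.
Qed.

Lemma orbit_mirror d e a b X Y Z : orbit_of d e a b X Y Z ->
  orbit (fast_F (oreflect_F (F s)) d) (fast_g (oreflect (g1 s)) d) (fast_g (reflect (g2 s)) d) e a b
    (fun t => - X t) (fun t => - Y t) Z.
Proof.
intros Ho t Ht. destruct (Ho t Ht) as [HX [HY HZ]].
unfold fast_F, fast_g, oreflect_F, oreflect, reflect in *. rewrite !Ropp_involutive.
split; [|split; auto].
- replace (- Y t - - F s (X t) (Z t) e d) with (- (Y t - F s (X t) (Z t) e d)) by ring. now apply (is_derive_opp X).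
- replace (e * - g1 s (X t) (Y t) (Z t) e d) with (- (e * g1 s (X t) (Y t) (Z t) e d)) by ring. now apply (is_derive_opp Y).
Qed.

(** The half cycle in reflected coordinates. Rising orbits do not meet the section, where the
    layer field points to the left, and on the slow part the orbit stays to the right of it. *)
Lemma right_leg i xl xr Zin : singular_cycle s i xl xr -> exists eta, 0 < eta /\
  forall xE xm, nu s i (z0 s) 0 < xE < xr -> x4 - eta < xm < x4 ->
  forall kappa, 0 < kappa -> exists delta, 0 < delta /\ forall d zeta1, 0 < d < delta -> Rabs (zeta1 - Zin) < delta ->
  exists zeta, Rabs (zeta - right_map Zin xr x4) < kappa /\
  forall kappa', 0 < kappa' -> exists eps1 rho1, 0 < eps1 /\ 0 < rho1 /\ forall e a T X Y Zt, 0 < e < eps1 -> a <= T ->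
    orbit_of d e a T X Y Zt -> X a = xE -> Rabs (Y a - fold_y s i (z0 s + d * zeta1) d) < rho1 ->
    Rabs (Zt a - (z0 s + d * zeta1)) < rho1 -> on_Delta s (X T) (Y T) (Zt T) ->
    exists tb, a <= tb < T /\ X tb = xm /\ Rabs (Zt tb - (z0 s + d * zeta)) < kappa' /\
      Rabs (Y tb - fold_y s L4 (z0 s + d * zeta) d) < kappa'.
Proof.
intros Hcyc. assert (RB : rising_branch (z0 s) (oreflect_F (F s)) (oreflect (g1 s)) (- xr) (- x4)) by apply Hcyc.
destruct (half_cycle _ _ _ _ _ _ _ _ _ _ (slow_fast_reflect _ _ _ _ _ _ _ _ SF) RB Zin) as [eta [Heta HC]].
destruct (section_near_base s Hsmooth HDelta Hconv) as [rho [h [Lip [Hrho [Hh [_ [Sec1 [Sec2 _]]]]]]]]. fold x4 in Sec2.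
exists (Rmin eta h). split; [apply Rmin_glb_lt; auto|]. intros xE xm HxE Hxm kappa Hk.
assert (Hxm1 : - x4 < - xm < - x4 + eta) by (pose proof (Rmin_l eta h); lra).
assert (Hxm2 : x4 - h < xm) by (pose proof (Rmin_r eta h); lra).
destruct (HC (- xm) Hxm1 (Rmin (Rmin kappa 1) rho)) as [del1 [Hdel1 HC1]]; [repeat apply Rmin_glb_lt; lra|]. clear HC.
fold (right_map Zin xr x4) in HC1.
assert (k1 : Rmin (Rmin kappa 1) rho <= kappa) by min_le.
assert (k2 : Rmin (Rmin kappa 1) rho <= 1) by min_le.
assert (k3 : Rmin (Rmin kappa 1) rho <= rho) by min_le.
set (k := Rmin (Rmin kappa 1) rho) in *.
destruct (nu_cont s Hsmooth A1 HDelta Hconv (x4 - xm) ltac:(lra)) as [r1 [Hr1 Hnu]].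
destruct (right_landing s Hsmooth A1 HDelta Hconv i xl xr xE del1 Hcyc HxE Hdel1) as [r2 [Hr2 Hl]].
pose proof (e0_pos s Hsmooth) as He0. pose proof (d0_pos s Hsmooth) as Hd0.
set (r3 := Rmin (Rmin r2 r1) (rho / 3)).
assert (Hr3 : 0 < r3) by (repeat apply Rmin_glb_lt; lra).
assert (M2 : r3 <= r2) by min_le.
assert (M3 : r3 <= r1) by min_le.
assert (M4 : r3 <= rho / 3) by min_le.
destruct (rescaled_radius Zin r3 Hr3) as [r4 [Hr4 Hsc]].
destruct (rescaled_radius (right_map Zin xr x4) r3 Hr3) as [r5 [Hr5 Hsc1]].
exists (Rmin (Rmin (Rmin del1 r1) (Rmin r2 1)) (Rmin (Rmin r4 r5) (Rmin (delta0 s) rho))).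
split; [repeat apply Rmin_glb_lt; lra|].
intros d zeta1 [Hdp Hd] Hz1. split_min Hd. split_min Hz1.
set (z := z0 s + d * zeta1).
assert (Hz : Rabs (z - z0 s) < r3).
{ unfold z. replace (z0 s + d * zeta1 - z0 s) with (d * zeta1) by ring.
  apply (rescaled_small d zeta1 Zin r3 Hdp); [lra|]. apply Hsc; lra. }
destruct (Hl z d ltac:(lra) ltac:(lra)) as [xl' [La1 [La2 [La3 [La4 La5]]]]].
assert (HFx : forall x z, Fx (oreflect_F (F s)) x z 0 d = Fx (F s) (- x) z 0 d).
{ intros x z'. apply (Fx_reflect _ _ _ _ _ _ _ _ _ _ _ _ SF); lra. }
destruct (HC1 d zeta1 (- xl') ltac:(lra) ltac:(lra)) as [zeta [Hzeta HC2]].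
{ rewrite <- Rabs_Ropp. replace (- (- xl' - - xr)) with (xl' - xr) by ring. auto. }
{ rewrite HFx, Ropp_involutive. exact La4. }
exists zeta. split; [lra|]. intros kappa' Hk'.
assert (Hze : Rabs (z0 s + d * zeta - z0 s) < r3).
{ replace (z0 s + d * zeta - z0 s) with (d * zeta) by ring.
  apply (rescaled_small d zeta (right_map Zin xr x4)); [lra|lra|]. apply Hsc1; lra. }
destruct (Hnu L4 (z0 s + d * zeta) d ltac:(lra) ltac:(lra)) as [Hzin [Hds Hni]]. fold x4 in Hni.
destruct (HC2 (- nu s L4 (z0 s + d * zeta) d) (- xE)) with (kappa' := Rmin kappa' (rho / 3)) as [eps1 [rho1 [Heps1 [Hrho1 HO]]]].
{ rewrite <- Rabs_Ropp. replace (- (- nu s L4 (z0 s + d * zeta) d - - x4)) with (nu s L4 (z0 s + d * zeta) d - x4) by ring. lra. }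
{ rewrite HFx, Ropp_involutive. apply (Fx_nu s Hsmooth A1 Hconv); auto. }
{ lra. }
{ intros x Hx. unfold oreflect_F. rewrite Ropp_involutive. fold z. specialize (La5 (- x) ltac:(lra)). lra. }
{ apply Rmin_glb_lt; lra. }
assert (N1 := Rmin_l kappa' (rho / 3)). assert (N2 := Rmin_r kappa' (rho / 3)).
set (kk := Rmin kappa' (rho / 3)) in *.
exists (Rmin eps1 rho), (Rmin rho1 (rho / 3)). split; [apply Rmin_glb_lt; auto|]. split; [apply Rmin_glb_lt; lra|].
intros e a T X Y Zt [Hep He] HaT Ho HXa HYa HZa HDT. split_min He. split_min HYa. split_min HZa. fold z in HYa0, HZa0, HZa1.
destruct (HO e a T _ _ Zt ltac:(lra) HaT (orbit_mirror d e a T X Y Zt Ho)) as [tb [Htb [Hgood Hend]]].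
{ now rewrite HXa. }
{ unfold oreflect_F. rewrite Ropp_involutive. fold z. rewrite La3, <- Rabs_Ropp.
  replace (- (- Y a - - fold_y s i z d)) with (Y a - fold_y s i z d) by ring. auto. }
{ auto. }
exists tb.
assert (HtbT : tb < T).
{ destruct (Rle_lt_or_eq_dec tb T (proj2 Htb)) as [|E]; auto. exfalso. destruct HDT as [HinT HXT].
  destruct (Hgood T ltac:(lra)) as [[G0 [_ [G1 _]]]|[_ [G1 G2]]].
  - unfold oreflect_F in G0. rewrite Ropp_involutive, HXT in G0.
    assert (HzT : Rabs (Zt T - z0 s) <= rho).
    { pose proof (Rabs_pos (- Y T - - Y a)).
      replace (Zt T - z0 s) with ((Zt T - Zt a) + (Zt a - z) + (z - z0 s)) by ring.
      eapply Rle_trans; [apply Rabs_triang|]. pose proof (Rabs_triang (Zt T - Zt a) (Zt a - z)). lra. }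
    specialize (Sec1 (Y T) (Zt T) e d HinT HzT). rewrite !Rabs_pos_eq in Sec1 by lra.
    lra.
  - specialize (Sec2 (Y T) (Zt T) HinT ltac:(lra)). lra. }
split; [lra|]. destruct Hend as [E|[E1 [E2 E3]]]; [lra|].
split; [lra|]. split; [lra|]. unfold oreflect_F in E3. rewrite Ropp_involutive, <- Rabs_Ropp in E3.
unfold fold_y. match type of E3 with Rabs ?u < _ => replace u with (Y tb - F s (nu s L4 (z0 s + d * zeta) d) (z0 s + d * zeta) 0 d) in E3 by ring end. lra.
Qed.

(** The orbit is followed slightly beyond the section. It crosses the section on the way, so
    the first return occurs before the end of the descent, hence close to its start in z. *)
Lemma final_descent : exists h, 0 < h /\ forall xm, x4 - h < xm < x4 ->
  exists r, 0 < r /\ forall z d, Rabs (z - z0 s) < r -> 0 <= d < r ->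
  forall kappa, 0 < kappa -> exists eps1 rho1, 0 < eps1 /\ 0 < rho1 /\ forall e a T X Y Zt, 0 < e < eps1 -> a <= T ->
    orbit_of d e a T X Y Zt -> X a = xm -> Rabs (Y a - fold_y s L4 z d) < rho1 -> Rabs (Zt a - z) < rho1 ->
    (forall t, a < t < T -> ~ on_Delta s (X t) (Y t) (Zt t)) -> Rabs (Zt T - z) < kappa.
Proof.
destruct (section_near_base s Hsmooth HDelta Hconv) as [rho [h [Lip [Hrho [Hh [HLip [_ [Sec2 Sec3]]]]]]]]. fold x4 in Sec2.
exists h. split; auto. intros xm Hxm.
pose proof (z0_range s HDelta) as Hzr. pose proof (e0_pos s Hsmooth) as He0. pose proof (d0_pos s Hsmooth) as Hd0.
assert (Hy : ylo s < phi4 s (z0 s) 0 < yhi s) by apply HDelta.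
destruct (nu_cont s Hsmooth A1 HDelta Hconv (x4 - xm) ltac:(lra)) as [r1 [Hr1 Hnu]].
set (w := Rmin (phi4 s (z0 s) 0 - ylo s) (yhi s - phi4 s (z0 s) 0) / 2).
assert (Hw : 0 < w /\ w <= (phi4 s (z0 s) 0 - ylo s) / 2 /\ w <= (yhi s - phi4 s (z0 s) 0) / 2).
{ unfold w. pose proof (Rmin_l (phi4 s (z0 s) 0 - ylo s) (yhi s - phi4 s (z0 s) 0)).
  pose proof (Rmin_r (phi4 s (z0 s) 0 - ylo s) (yhi s - phi4 s (z0 s) 0)).
  assert (0 < Rmin (phi4 s (z0 s) 0 - ylo s) (yhi s - phi4 s (z0 s) 0)) by (apply Rmin_glb_lt; lra). lra. }
assert (Hphi : smooth_curve s (phi4 s)) by apply HDelta.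
destruct (curve_cont s Hsmooth HDelta (phi4 s) Hphi w ltac:(lra)) as [r2 [Hr2 Hc]].
set (wz := Rmin (Rmin (z0 s - zlo s) (zhi s - z0 s)) rho).
assert (Hwz : 0 < wz) by (repeat apply Rmin_glb_lt; lra).
assert (W1 : wz <= z0 s - zlo s) by min_le.
assert (W2 : wz <= zhi s - z0 s) by min_le.
assert (W3 : wz <= rho) by min_le.
exists (Rmin (Rmin r1 r2) (wz / 2)). split; [repeat apply Rmin_glb_lt; lra|].
intros z d Hz [Hd1 Hd]. split_min Hz. split_min Hd. intros kappa Hk.
destruct (Hnu L4 z d ltac:(lra) ltac:(lra)) as [Hzin [Hds Hn4]]. fold x4 in Hn4. unfold small_delta in Hds. apply Rabs_def2 in Hn4.
destruct (PL4_below_F s Hsmooth HDelta Hconv z d) as [Hin [Hfy Hpos]]; auto; [apply Rabs_def2 in Hz1; lra|].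
assert (Hxi := Sec2 _ _ Hin ltac:(lra)).
set (y := phi4 s z d) in *. set (x0 := xi s y z) in *.
specialize (Hc z d ltac:(lra) ltac:(rewrite Rabs_pos_eq; lra)). fold y in Hc. apply Rabs_def2 in Hc.
assert (Hz1' := Rabs_def2 _ _ Hz1).
destruct (positive_near (fun x => F s x z 0 d - y) x0) as [n [Hn Pn]].
{ apply continuous_minus_const. apply (ex_derive_continuous (fun x => F s x z 0 d)).
  eexists. apply (derive_F s Hsmooth Hconv). exact Hds. }
{ specialize (Hpos x0 ltac:(lra)). lra. }
(* the descent is followed slightly beyond the section *)
set (xb := x0 - n).
destruct (layer_tube _ _ _ _ _ _ _ _ SF d xb xm y z) as [c1 [rho2 [C1 [Hc1 [Hrho2 [HC1 Htube]]]]]].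
{ lra. } { unfold xb. lra. }
{ intros x Hx. destruct (Rle_lt_dec x0 x); [apply Hpos; lra|].
  specialize (Pn x ltac:(apply Rabs_le; unfold xb in Hx; lra)). simpl in Pn. lra. }
set (m := Rmin (Rmin w (wz / 2)) (Rmin (n / (2 * Lip)) kappa)).
assert (Hm : 0 < m).
{ repeat apply Rmin_glb_lt; try lra. apply Rdiv_lt_0_compat; lra. }
assert (m1 : m <= w) by min_le.
assert (m2 : m <= wz / 2) by min_le.
assert (m3 : m <= n / (2 * Lip)) by min_le.
assert (m4 : m <= kappa) by min_le.
assert (m5 : Lip * m < n).
{ assert (Lip * m <= Lip * (n / (2 * Lip))) by (apply Rmult_le_compat_l; lra).
  replace (Lip * (n / (2 * Lip))) with (n / 2) in H by (field; lra). lra. }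
assert (Hlen : 0 < xm - xb) by (unfold xb; lra).
set (kk := m / (3 * (xm - xb))). assert (Hkk : 0 < kk) by (apply Rdiv_lt_0_compat; lra).
assert (Hkk' : kk * (xm - xb) = m / 3) by (unfold kk; field; lra).
destruct (layer_descent _ _ _ xb xm y z c1 rho2 C1 kk ltac:(lra) Hc1 Hrho2 HC1 Hkk Htube) as [eps1 [rho1 [Heps1 [Hrho1 HO]]]].
exists eps1, (Rmin rho1 (m / 3)). split; auto. split; [apply Rmin_glb_lt; lra|].
intros e a T X Y Zt He HaT Ho HXa HYa HZa HnD. rewrite <- Hfy in HYa. split_min HYa. split_min HZa.
destruct (HO e a T X Y Zt He HaT Ho HXa HYa0 HZa0) as [t1 [Ht1 [Hst Hend]]].
assert (Hclose : forall t, a <= t <= t1 -> Rabs (Y t - y) + Rabs (Zt t - z) < m).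
{ intros t Ht. destruct (Hst t Ht) as [_ [K1 [_ K2]]].
  assert (kk * (xm - X t) <= kk * (xm - xb)) by (apply Rmult_le_compat_l; lra).
  replace (Y t - y) with ((Y t - Y a) + (Y a - y)) by ring. replace (Zt t - z) with ((Zt t - Zt a) + (Zt a - z)) by ring.
  pose proof (Rabs_triang (Y t - Y a) (Y a - y)). pose proof (Rabs_triang (Zt t - Zt a) (Zt a - z)). lra. }
assert (HT1 : t1 = T); [|rewrite <- HT1; specialize (Hclose t1 ltac:(lra)); pose proof (Rabs_pos (Y t1 - y)); lra].
destruct Hend as [|Hxb]; auto. destruct (Rle_lt_or_eq_dec t1 T (proj2 Ht1)) as [HtT|]; auto. exfalso.
assert (Hsec : forall t, a <= t <= t1 -> in_section s (Y t) (Zt t) /\ Rabs (Zt t - z0 s) <= rho /\ Rabs (xi s (Y t) (Zt t) - x0) < n).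
{ intros t Ht. specialize (Hclose t Ht).
  assert (KY : Rabs (Y t - y) < m) by (pose proof (Rabs_pos (Zt t - z)); lra).
  assert (KZ : Rabs (Zt t - z) < m) by (pose proof (Rabs_pos (Y t - y)); lra).
  apply Rabs_def2 in KY, KZ.
  assert (Hi : in_section s (Y t) (Zt t)) by (split; lra).
  assert (Hr : Rabs (Zt t - z0 s) <= rho) by (apply Rabs_le; lra).
  split; auto. split; auto. eapply Rle_lt_trans; [apply (Sec3 (Y t) (Zt t) y z); auto; lra|].
  eapply Rle_lt_trans; [apply Rmult_le_compat_l; [lra|left; exact Hclose]|]. exact m5. }
assert (Hat1 : a < t1).
{ destruct (Rle_lt_or_eq_dec a t1 (proj1 Ht1)) as [|E]; auto. exfalso. rewrite <- E in Hxb. unfold xb in Hxb. lra. }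
assert (Hcont : forall t, a <= t <= t1 -> continuous (fun t => X t - xi s (Y t) (Zt t)) t).
{ intros t Ht. destruct (orbit_cont _ _ _ _ _ _ _ _ _ t Ho ltac:(lra)) as [cX [cY cZ]].
  apply (continuous_minus X (fun t => xi s (Y t) (Zt t))); auto.
  apply (continuous_comp_2 Y Zt (xi s) t cY cZ).
  assert (Hsx := smooth_xi s HDelta).
  assert (HS : smooth_on (fun _ : R * R => True) (fun p : R * R => let '(y, z) := p in xi s y z)) by apply HDelta.
  destruct (HS 0%nat) as [Hcx _]. specialize (Hcx (Y t, Zt t) I).
  eapply filterlim_ext; [|exact Hcx]. now intros [u v]. }
destruct (Hsec a ltac:(lra)) as [Ia [Ra _]]. assert (Ka := Sec2 _ _ Ia Ra).
destruct (Hsec t1 ltac:(lra)) as [_ [_ Kb]]. apply Rabs_def2 in Kb.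
destruct (first_exit (fun t => X t - xi s (Y t) (Zt t)) a t1) as [Hall|[t [Ht [E _]]]]; auto; try lra.
- specialize (Hall t1 ltac:(lra)). simpl in Hall. unfold xb in Hxb. lra.
- destruct (Rle_lt_or_eq_dec t t1 (proj2 Ht)) as [Htt|Htt].
  + apply (HnD t); [lra|]. split; [apply Hsec; lra|]. lra.
  + rewrite Htt in E. unfold xb in Hxb. lra.
Qed.

(** The three legs are composed; each tolerance is chosen from the leg that follows, and epsilon
    last, after delta has fixed the point reached on each fold curve. *)
Lemma cycle_return i xl xr Z : singular_cycle s i xl xr -> lands_near Z xl ->
  forall kappa, 0 < kappa -> exists delta, 0 < delta /\ forall d, 0 < d < delta -> let z := z0 s + d * Z in
  exists zeta, Rabs (zeta - right_map (left_map Z xl (nu s i (z0 s) 0)) xr x4) < kappa /\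
  forall kappa', 0 < kappa' -> exists e1, 0 < e1 /\ forall e y' z', 0 < e < e1 ->
    first_return s e d (phi4 s z d) z y' z' -> Rabs (z' - (z0 s + d * zeta)) < kappa'.
Proof.
intros Hcyc Hland kappa Hk.
destruct (left_leg i xl xr Z Hcyc Hland) as [eta1 [Heta1 HA]].
set (xf := nu s i (z0 s) 0) in *. set (W1 := left_map Z xl xf) in *.
destruct (right_leg i xl xr W1 Hcyc) as [eta2 [Heta2 HB]].
destruct final_descent as [h [Hh HC]].
assert (Hord : xf < x4 < xr) by apply Hcyc.
set (xE := xf + Rmin eta1 (xr - xf) / 2). set (xm := x4 - Rmin eta2 h / 2).
assert (HxE : xf < xE < xf + eta1 /\ xE < xr).
{ assert (0 < Rmin eta1 (xr - xf)) by (apply Rmin_glb_lt; lra).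
  pose proof (Rmin_l eta1 (xr - xf)). pose proof (Rmin_r eta1 (xr - xf)). unfold xE. lra. }
assert (Hxm : x4 - eta2 < xm < x4 /\ x4 - h < xm).
{ assert (0 < Rmin eta2 h) by (apply Rmin_glb_lt; lra).
  pose proof (Rmin_l eta2 h). pose proof (Rmin_r eta2 h). unfold xm. lra. }
destruct (HC xm ltac:(lra)) as [r [Hr HC1]].
destruct (HB xE xm ltac:(fold xf; lra) ltac:(lra) (Rmin kappa 1)) as [del2 [Hdel2 HB1]]; [apply Rmin_glb_lt; lra|].
destruct (HA xE ltac:(lra) del2 Hdel2) as [del1 [Hdel1 HA1]].
set (W := right_map W1 xr x4) in *.
destruct (rescaled_radius W r Hr) as [r4 [Hr4 Hsc]].
exists (Rmin (Rmin del1 del2) (Rmin r r4)). split; [repeat apply Rmin_glb_lt; auto|].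
intros d [Hdp Hd] z. split_min Hd.
destruct (HA1 d ltac:(lra)) as [zeta1 [Hz1 HA2]]. fold z in HA2. clear HA1.
destruct (HB1 d zeta1 ltac:(lra) Hz1) as [zeta [Hz2 HB2]]. clear HB1. split_min Hz2.
exists zeta. split; auto. intros kappa' Hk'.
destruct (HC1 (z0 s + d * zeta) d) with (kappa := kappa') as [e3 [rho3 [He3 [Hrho3 HC2]]]]; auto; try lra.
{ replace (z0 s + d * zeta - z0 s) with (d * zeta) by ring. apply (rescaled_small d zeta W); [auto|lra|]. apply Hsc; lra. }
destruct (HB2 rho3 Hrho3) as [e2 [rho2 [He2 [Hrho2 HB3]]]].
destruct (HA2 rho2 Hrho2) as [e1 [He1 HA3]].
exists (Rmin e1 (Rmin e2 e3)). split; [repeat apply Rmin_glb_lt; auto|].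
intros e y' z' [Hep He] [T [X [Y [Zt [HT [Hsol [H0 [HY0 [HZ0 [H1 [_ [HZT HnD]]]]]]]]]]]]. split_min He. rewrite <- HZT.
destruct (HA3 e T X Y Zt ltac:(lra) HT Hsol H0 HY0 HZ0 H1) as [t1 [Ht1 [X1 [Z1 Y1]]]].
assert (Hsub : forall a, 0 <= a <= T -> orbit_of d e a T X Y Zt).
{ intros a Ha t Ht. apply (Hsol t); lra. }
destruct (HB3 e t1 T X Y Zt ltac:(lra) ltac:(lra) (Hsub t1 ltac:(lra)) X1 Y1 Z1 H1) as [t2 [Ht2 [X2 [Z2 Y2]]]].
apply (HC2 e t2 T X Y Zt); auto; try lra.
- apply Hsub; lra.
- intros t Ht. apply HnD. lra.
Qed.

Lemma at_right_pos (P : R -> Prop) : (exists r, 0 < r /\ forall t, 0 < t < r -> P t) -> at_right 0 P.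
Proof.
intros [r [Hr H]]. exists (mkposreal r Hr). intros t Ht Hp. apply H. split; auto.
change (Rabs (t - 0) < r) in Ht. apply Rabs_def2 in Ht. lra.
Qed.

Lemma filterlim_at_right_0 (u : R -> R) (l : R) :
  (forall kappa, 0 < kappa -> exists r, 0 < r /\ forall t, 0 < t < r -> Rabs (u t - l) < kappa) ->
  filterlim u (at_right 0) (locally l).
Proof.
intros H. apply filterlim_locally. intros eps. apply at_right_pos.
destruct (H eps (cond_pos eps)) as [r Hr]. exists r. exact Hr.
Qed.

(** The operator [lim] returns the limit of a Cauchy filter, and convergence makes the image
    filter Cauchy. *)
Lemma Zsing_unique Zmap y z d l :
  filterlim (fun e => Zmap y z e d) (at_right 0) (locally l) -> Zsing Zmap y z d = l.
Proof.
intros Hl. set (Fl := filtermap (fun e => Zmap y z e d) (at_right 0)).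
assert (HP : ProperFilter (at_right 0)) by apply at_right_proper_filter.
assert (HPF : ProperFilter Fl) by (apply filtermap_proper_filter; exact HP).
assert (Hcau : cauchy Fl).
{ intros eps. exists l. apply Hl. now exists eps. }
apply (filterlim_locally_unique (fun e => Zmap y z e d) (F := at_right 0) (V := R_NormedModule)); auto.
apply filterlim_locally. intros eps. exact (complete_cauchy (T := R_CompleteSpace) Fl HPF Hcau eps).
Qed.

(** The point of return depends on epsilon, but its distance to [z0 + d zeta] tends to 0
    for fixed [d], so the singular limit is [z0 + d zeta] and the rescaled map takes the value zeta. *)
Lemma cycle_limit U Ymap Zmap (HPi : return_map s U Ymap Zmap) i xl xr Z :
  singular_cycle s i xl xr -> lands_near Z xl ->
  at_right 0 (fun d => Pi0_defined s U Ymap Zmap d Z) /\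
  filterlim (fun d => Pi0 s Zmap d Z) (at_right 0)
    (locally (right_map (left_map Z xl (nu s i (z0 s) 0)) xr x4)).
Proof.
intros Hcyc Hland. set (W := right_map _ xr x4).
destruct HPi as [HU [HUc [HUin [d1 [r1 [Hd1 [Hr1 HPi']]]]]]].
pose proof (z0_range s HDelta) as Hzr. pose proof (d0_pos s Hsmooth) as Hd0.
assert (Hphi : smooth_curve s (phi4 s)) by apply HDelta.
destruct (HU _ HUc) as [eps Heps].
destruct (curve_cont s Hsmooth HDelta (phi4 s) Hphi eps (cond_pos eps)) as [r2 [Hr2 Hc]].
destruct (Hland 1 ltac:(lra)) as [r3 [Hr3 Hl]].
pose proof (cond_pos eps) as Hpe.
set (rz := Rmin (Rmin (z0 s - zlo s) (zhi s - z0 s)) (Rmin eps r2)).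
assert (Hrz : 0 < rz) by (repeat apply Rmin_glb_lt; lra).
destruct (rescaled_radius Z rz Hrz) as [r4 [Hr4 Hsc]].
set (delta := Rmin (Rmin (Rmin d1 r2) (Rmin r3 r4)) (delta0 s)).
assert (Hdelta : 0 < delta) by (repeat apply Rmin_glb_lt; auto).
(* in this range the return map is defined for all small epsilon *)
assert (Hdom : forall d, 0 < d < delta -> let z := z0 s + d * Z in let y := phi4 s z d in
  z <> zc s d /\ U (y, z) /\ ~ PL2 s d y z /\
  exists e1, 0 < e1 /\ forall e, 0 < e < e1 -> first_return s e d y z (Ymap y z e d) (Zmap y z e d)).
{ intros d [Hdp Hd] z y. unfold delta in Hd. split_min Hd.
  destruct (Hl d ltac:(lra)) as [Hzc [HnP _]]. fold z in Hzc, HnP. fold y in HnP.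
  assert (Hz : Rabs (z - z0 s) < rz).
  { unfold z. replace (z0 s + d * Z - z0 s) with (d * Z) by ring.
    apply (rescaled_small d Z Z rz Hdp); [rewrite Rminus_diag, Rabs_R0; lra|]. apply Hsc; lra. }
  assert (Hzb := Rabs_def2 _ _ Hz). unfold rz in Hz, Hzb. split_min Hz.
  assert (Hzin : zlo s < z < zhi s).
  { pose proof (Rmin_l (z0 s - zlo s) (zhi s - z0 s)). pose proof (Rmin_r (z0 s - zlo s) (zhi s - z0 s)).
    pose proof (Rmin_l (Rmin (z0 s - zlo s) (zhi s - z0 s)) (Rmin eps r2)). lra. }
  assert (Hzeps : Rabs (z - z0 s) < eps) by lra.
  split; auto.
  assert (HUy : U (y, z)).
  { apply Heps. split; [|exact Hzeps]. apply Hc; [lra|]. rewrite Rabs_pos_eq; lra. }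
  split; auto. split; auto.
  assert (Hne : 0 < Rabs (y - phi2 s z d)).
  { apply Rabs_pos_lt. intros E. apply HnP. destruct HDelta as [_ [_ [_ [_ [_ [_ [_ HP]]]]]]].
    destruct (HP y z d Hzin) as [HP2 _]; [split; lra|]. apply HP2. lra. }
  destruct (HPi' d (Rmin (r1 / 2) (Rabs (y - phi2 s z d)))) as [e1 [He1 HR]]; [lra|split; [apply Rmin_glb_lt; lra|]|].
  { eapply Rle_lt_trans; [apply Rmin_l|]. lra. }
  exists e1. split; auto. intros e He. apply HR; auto. intros [_ HB]. split_min HB. lra. }
assert (Hret := cycle_return i xl xr Z Hcyc Hland). fold x4 W in Hret.
(* the singular limit exists at every small delta, and is close to the limit map *)
assert (Hlim : forall kappa, 0 < kappa -> exists del, 0 < del /\ forall d, 0 < d < del -> let z := z0 s + d * Z in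
  let y := phi4 s z d in exists zeta, Rabs (zeta - W) < kappa /\
  filterlim (fun e => Zmap y z e d) (at_right 0) (locally (z0 s + d * zeta))).
{ intros kappa Hk. destruct (Hret kappa Hk) as [del [Hdel HR]]. exists (Rmin del delta). split; [apply Rmin_glb_lt; auto|].
  intros d [Hdp Hd] z y. split_min Hd. destruct (HR d ltac:(lra)) as [zeta [Hz HR1]]. fold z in HR1. fold y in HR1.
  exists zeta. split; auto. destruct (Hdom d ltac:(lra)) as [_ [_ [_ [e1 [He1 Hfr]]]]]. fold z in Hfr. fold y in Hfr.
  apply filterlim_at_right_0. intros k' Hk'. destruct (HR1 k' Hk') as [e2 [He2 HR2]].
  exists (Rmin e1 e2). split; [apply Rmin_glb_lt; auto|]. intros e [Hep He]. split_min He.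
  apply (HR2 e (Ymap y z e d)); [lra|]. apply Hfr. lra. }
split.
- apply at_right_pos. destruct (Hlim 1 ltac:(lra)) as [del [Hdel HL]].
  exists (Rmin del delta). split; [apply Rmin_glb_lt; auto|]. intros d [Hdp Hd]. split_min Hd.
  destruct (Hdom d ltac:(lra)) as [K1 [K2 [K3 [e1 [He1 K4]]]]]. destruct (HL d ltac:(lra)) as [zeta [_ K5]].
  unfold Pi0_defined. cbv zeta in *. split; auto. split; auto. split; auto. split.
  + apply at_right_pos. now exists e1.
  + now rewrite (Zsing_unique _ _ _ _ _ K5).
- apply filterlim_at_right_0. intros kappa Hk. destruct (Hlim kappa Hk) as [del [Hdel HL]].
  exists del. split; auto. intros d Hd. destruct (HL d Hd) as [zeta [Hz K]]. cbv zeta in K.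
  assert (E : Pi0 s Zmap d Z = zeta); [|now rewrite E].
  unfold Pi0, Z1. apply Zsing_unique in K. rewrite K.
  destruct (Req_EM_T d 0) as [|_]; [lra|]. destruct (Req_EM_T _ _); field; lra.
Qed.

Lemma left_map_Zsol Z xl xf : left_map Z xl xf = Zsol s xf xl Z.
Proof. reflexivity. Qed.

(** Both sides select a value of the same predicate, so integrability is not an issue. *)
Lemma RInt_opp_reflect (u : R -> R) (a b : R) : RInt (fun y => - u (- y)) a b = RInt u (- a) (- b).
Proof.
unfold RInt. f_equal. apply functional_extensionality. intros l. apply propositional_extensionality. split; intros H.
- assert (H' : is_RInt (fun y => - u (- y)) (- - a) (- - b) l) by now rewrite !Ropp_involutive.
  apply (is_RInt_comp_opp (V := R_NormedModule) (fun y => - u (- y)) (- a) (- b)) in H'.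
  eapply is_RInt_ext; [|exact H']. intros x _. change (- - u (- - x) = u x). now rewrite !Ropp_involutive.
- exact (is_RInt_comp_opp (V := R_NormedModule) u a b l H).
Qed.

Lemma right_map_Zsol Z xl xf : right_map Z xl xf = Zsol s xf xl Z.
Proof.
pose proof (e0_pos s Hsmooth). pose proof (d0_pos s Hsmooth).
set (P := lin_p (z0 s) (oreflect_F (F s)) (oreflect (g1 s)) (reflect (Hz s))).
set (Q := lin_q (z0 s) (oreflect_F (F s)) (oreflect (g1 s)) (reflect (Gz s))).
assert (Hdiv : forall a b c, a / - b * c = - (a / b * c)).
{ intros a b c. unfold Rdiv. rewrite Rinv_opp. ring. }
assert (HP : P = fun x => - p s (- x)).
{ apply functional_extensionality. intros x. unfold P, lin_p, reflect, oreflect, F_base, oreflect_F.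
  rewrite !Ropp_involutive, Hdiv. change (fun x z e d => - F s (- x) z e d) with (oreflect_F (F s)).
  rewrite (Fx_reflect _ _ _ _ _ _ _ _ _ _ _ _ SF) by lra. reflexivity. }
assert (HQ : Q = fun x => - q s (- x)).
{ apply functional_extensionality. intros x. unfold Q, lin_q, reflect, oreflect, F_base, oreflect_F.
  rewrite !Ropp_involutive, Hdiv. change (fun x z e d => - F s (- x) z e d) with (oreflect_F (F s)).
  rewrite (Fx_reflect _ _ _ _ _ _ _ _ _ _ _ _ SF) by lra. reflexivity. }
assert (HI : forall a b, RInt P (- a) (- b) = RInt (p s) a b).
{ intros a b. rewrite HP, RInt_opp_reflect. now rewrite !Ropp_involutive. }
unfold right_map, Zsol. cbv zeta. fold P Q. rewrite HI. f_equal.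
transitivity (RInt (fun u => - ((fun v => q s v * exp (RInt (p s) v xf)) (- u))) (- xl) (- xf)).
- apply RInt_ext. intros u _. rewrite HQ. rewrite <- (HI (- u)), Ropp_involutive.
  match goal with |- ?a = ?b => change (@eq R a b) end. ring.
- rewrite (RInt_opp_reflect (fun v => q s v * exp (RInt (p s) v xf))). now rewrite !Ropp_involutive.
Qed.

End Return.

Theorem proposition1 (s : setting)
    (Hsmooth : smooth_system s)
    (A1 : assumption1 s) (A2 : assumption2 s) (A3 : assumption3 s)
    (HDelta : section_setup s)
    (A4 : assumption4 s) (A5 : assumption5 s)
    (Hconv : standing_convention s)
    (U : R * R -> Prop) (Ymap Zmap : R -> R -> R -> R -> R)
    (HPi : return_map s U Ymap Zmap)
    (xh1 xh3 xh4 : R)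
    (Hxh4 : xh4 < nu s L1 (z0 s) 0 /\ F0 s xh4 = F0 s (nu s L4 (z0 s) 0))
    (Hxh3 : nu s L4 (z0 s) 0 < xh3 /\ F0 s xh3 = F0 s (nu s L3 (z0 s) 0))
    (Hxh1 : nu s L4 (z0 s) 0 < xh1 /\ F0 s xh1 = F0 s (nu s L1 (z0 s) 0)) :
  forall Z : R, Z <> 0 ->
    at_right 0 (fun d => Pi0_defined s U Ymap Zmap d Z) /\
    filterlim (fun d => Pi0 s Zmap d Z) (at_right 0)
      (locally (M s xh1 xh3 xh4 Z)).
Proof.
intros Z HZ. unfold M. destruct Hxh4 as [H4 E4], Hxh3 as [H3 E3], Hxh1 as [H1 E1].
destruct (Rlt_dec Z 0) as [Hneg|Hpos].
- rewrite <- (right_map_Zsol s Hsmooth Hconv), <- left_map_Zsol.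
  apply (cycle_limit s Hsmooth A1 HDelta Hconv U Ymap Zmap HPi L1).
  + now apply cycle_L.
  + intros kappa Hk. now apply landing_before.
- rewrite <- (right_map_Zsol s Hsmooth Hconv), <- left_map_Zsol.
  apply (cycle_limit s Hsmooth A1 HDelta Hconv U Ymap Zmap HPi L3).
  + now apply cycle_S.
  + intros kappa Hk. apply landing_after; auto. lra.
Qed.
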